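(* (i) Let $a\in L^{n-1}(\partial\Omega)$ be positive. For every $\varepsilon>0$ there exists $b\in C^0(\overline{\Omega})$ with $\|b\|_{C^0}<\varepsilon$ such that all the eigenvalues $\lambda$ of the problem $$-\Delta u=0\ \text{ in }\Omega,\qquad \partial_\nu u+(a+b)u=\lambda\, d\, u\ \text{ on }\partial\Omega$$ are simple. (ii) Let $a\in L^{n/2}(\Omega)$ be positive. For every $\varepsilon>0$ there exists $b\in C^0(\overline{\Omega})$ with $\|b\|_{C^0}<\varepsilon$ such that all the eigenvalues $\lambda$ of the problem $$-\Delta u+(a+b)u=0\ \text{ in }\Omega,\qquad \partial_\nu u=\lambda\, d\, u\ \text{ on }\partial\Omega$$ are simple.
   Context: $\Omega\subset\mathbb{R}^n$ is an open bounded domain whose boundary $\partial\Omega$ is of class $C^{1,1}$ and is composed of two connected parts, $\partial\Omega=S\cup W$, with nonempty (relative) interiors $S^{\mathrm{o}}$, $W^{\mathrm{o}}$ satisfying $S^{\mathrm{o}}\cap W^{\mathrm{o}}=\emptyset$. The function $d=\mathbbm{1}_S$ on $\partial\Omega$ equals $1$ on $S$ and $0$ on $W$. $\nu$ is the outward unit normal. Eigenvalues are understood weakly: $\lambda$ is an eigenvalue with eigenfunction $0\neq e\in H^1(\Omega)$ if for all $\varphi\in H^1(\Omega)$, in case (i), $\int_\Omega\nabla e\cdot\nabla\varphi\,dx+\int_{\partial\Omega}(a+b)e\varphi\,d\sigma=\lambda\int_{\partial\Omega}d\,e\varphi\,d\sigma$, and in case (ii), $\int_\Omega\nabla e\cdot\nabla\varphi\,dx+\int_{\Omega}(a+b)e\varphi\,dx=\lambda\int_{\partial\Omega}d\,e\varphi\,d\sigma$.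 An eigenvalue is simple if its eigenspace is one-dimensional. *)

(* Defs.v *)
(* MathComp-Analysis; points of R^n are row vectors 'rV[R]_n, whose topology
   (but not the Euclidean norm) is the one of the library. *)
From HB Require Import structures.
From mathcomp Require Import all_boot all_order all_algebra.
From mathcomp Require Import all_classical all_reals all_analysis.

Set Implicit Arguments.
Unset Strict Implicit.
Unset Printing Implicit Defensive.

Import Order.TTheory GRing.Theory Num.Theory.
Import numFieldNormedType.Exports.

Local Open Scope classical_set_scope.
Local Open Scope ring_scope.

Section gauge_outer.
Local Open Scope ereal_scope.
Context {R : realType} {T : pointedType}.

(* Least total weight of a countable cover by arbitrary sets; inadmissible
   covering sets are excluded by giving them the weight +oo. *)
Definition gauge_outer (w : set T -> \bar R) (X : set T) : \bar R :=
  ereal_inf [set \sum_(k <oo) w (A k) |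
             A in [set A : (set T)^nat | X `<=` \bigcup_k A k]].

Variable w : set T -> \bar R.
Hypotheses (w0 : w set0 = 0) (w_ge0 : forall A, 0 <= w A).

Let TT := g_sigma_algebraType [set: set T].

Lemma gauge_outerE : gauge_outer w = mu_ext (w : set TT -> \bar R).
Proof.
apply/funext => X; congr ereal_inf; apply/seteqP; split => _ [A XA <-];
  exists A => //; last by case: XA.
by split=> // i; apply: sub_sigma_algebra.
Qed.

Lemma gauge_outer0 : gauge_outer w set0 = 0.
Proof. by rewrite gauge_outerE; exact: (@mu_ext0 _ TT). Qed.

Lemma gauge_outer_ge0 X : 0 <= gauge_outer w X.
Proof. by rewrite gauge_outerE; exact: (@mu_ext_ge0 _ TT). Qed.

Lemma le_gauge_outer : {homo gauge_outer w : A B / A `<=` B >-> A <= B}.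
Proof. by rewrite gauge_outerE; exact: (@le_mu_ext _ TT). Qed.

Lemma gauge_outer_sigma_subadditive : sigma_subadditive (gauge_outer w).
Proof. by rewrite gauge_outerE; exact: (@mu_ext_sigma_subadditive _ TT). Qed.

End gauge_outer.

Section lebesgue_rV.
Local Open Scope ereal_scope.
Variables (R : realType) (n : nat).

(* The volume of A if A is a half-open box, 0 if A is empty, +oo otherwise. *)
Definition box_gauge (A : set 'rV[R]_n) : \bar R :=
  if `[< A = set0 >] then 0 else
  ereal_inf [set v | exists a b : 'rV[R]_n,
    [/\ forall i, (a ord0 i < b ord0 i)%R,
        A = [set x : 'rV_n | forall i, (a ord0 i < x ord0 i <= b ord0 i)%R] &
        v = (\prod_i (b ord0 i - a ord0 i))%R%:E]].

Lemma box_gauge0 : box_gauge set0 = 0.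
Proof. by rewrite /box_gauge; case: asboolP. Qed.

Lemma box_gauge_ge0 A : 0 <= box_gauge A.
Proof.
rewrite /box_gauge; case: asboolP => // _; apply: le_ereal_inf_tmp.
move=> _ [a [b [ab _ ->]]]; rewrite lee_fin prodr_ge0// => i _.
by rewrite subr_ge0 ltW.
Qed.

Definition lebesgue_outer : set 'rV[R]_n -> \bar R := gauge_outer box_gauge.

HB.instance Definition _ := isOuterMeasure.Build R 'rV[R]_n lebesgue_outer
  (gauge_outer0 box_gauge0 box_gauge_ge0)
  (gauge_outer_ge0 box_gauge_ge0)
  (@le_gauge_outer _ _ box_gauge)
  (gauge_outer_sigma_subadditive box_gauge_ge0).

Let mu : {outer_measure set 'rV[R]_n -> \bar R} := lebesgue_outer.

Definition lebesgue_rV :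
    {measure set (caratheodory_type lebesgue_outer) -> \bar R} :=
  mu : set (caratheodory_type mu) -> \bar R.

End lebesgue_rV.
Arguments lebesgue_rV {R n}.

(* Volume of the Euclidean unit ball of R^k. *)
Fixpoint ball_volume (R : realType) (k : nat) : R :=
  match k with
  | 0 => 1
  | 1 => 2
  | k'.+2 => 2 * pi / k%:R * ball_volume R k'
  end.

Section hausdorff_rV.
Local Open Scope ereal_scope.
Variables (R : realType) (n k : nat).

Definition enorm (x : 'rV[R]_n) : R := Num.sqrt (\sum_i x ord0 i ^+ 2).

(* -oo if A is empty. *)
Definition diam (A : set 'rV[R]_n) : \bar R :=
  ereal_sup [set (enorm (x - y)%R)%:E | x in A & y in A].

Definition hausdorff_gauge (delta : R) (A : set 'rV[R]_n) : \bar R :=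
  if `[< A = set0 >] then 0 else
  if diam A <= delta%:E then (ball_volume R k * (fine (diam A) / 2) ^+ k)%R%:E
  else +oo.

Lemma hausdorff_gauge0 delta : hausdorff_gauge delta set0 = 0.
Proof. by rewrite /hausdorff_gauge; case: asboolP. Qed.

Lemma ball_volume_ge0 j : (0 <= ball_volume R j)%R.
Proof.
suff: ((0 <= ball_volume R j) && (0 <= ball_volume R j.+1))%R by case/andP.
elim: j => [|j /andP[j0 j1]]; first by rewrite ler01 ler0n.
by rewrite j1 /= mulr_ge0// divr_ge0// mulr_ge0// pi_ge0.
Qed.

Lemma hausdorff_gauge_ge0 delta A : 0 <= hausdorff_gauge delta A.
Proof.
rewrite /hausdorff_gauge; case: asboolP => // /eqP/set0P[x Ax].
case: ifPn => // _; rewrite lee_fin mulr_ge0 ?ball_volume_ge0// exprn_ge0//.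
rewrite divr_ge0// fine_ge0//; apply: ereal_sup_ubound.
exists x => //; exists x => //; rewrite subrr /enorm big1 ?sqrtr0// => i _.
by rewrite mxE expr0n.
Qed.

Definition hausdorff_outer (A : set 'rV[R]_n) : \bar R :=
  ereal_sup [set gauge_outer (hausdorff_gauge delta) A |
             delta in [set delta : R | (0 < delta)%R]].

Let H_delta delta := gauge_outer (hausdorff_gauge delta).

Let le_hausdorff_outer_delta delta A :
  (0 < delta)%R -> H_delta delta A <= hausdorff_outer A.
Proof. by move=> d0; apply: ereal_sup_ubound; exists delta. Qed.

Lemma hausdorff_outer_ge0 A : 0 <= hausdorff_outer A.
Proof.
apply: (le_trans _ (le_hausdorff_outer_delta A ltr01)).
exact/gauge_outer_ge0/hausdorff_gauge_ge0.
Qed.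

Lemma hausdorff_outer0 : hausdorff_outer set0 = 0.
Proof.
apply/eqP; rewrite eq_le hausdorff_outer_ge0 andbT; apply: ge_ereal_sup.
move=> _ [delta d0 <-]; rewrite gauge_outer0//.
- exact: hausdorff_gauge0.
- exact: hausdorff_gauge_ge0.
Qed.

Lemma le_hausdorff_outer : {homo hausdorff_outer : A B / A `<=` B >-> A <= B}.
Proof.
move=> A B AB; apply: ge_ereal_sup => _ [delta d0 <-].
apply: (le_trans (le_gauge_outer (hausdorff_gauge delta) AB)).
exact: le_hausdorff_outer_delta.
Qed.

Lemma hausdorff_outer_sigma_subadditive : sigma_subadditive hausdorff_outer.
Proof.
move=> F; apply: ge_ereal_sup => _ [delta d0 <-].
apply: (le_trans (gauge_outer_sigma_subadditive (hausdorff_gauge_ge0 _) F)).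
apply: lee_nneseries => i _; last exact: le_hausdorff_outer_delta.
by move=> _; exact/gauge_outer_ge0/hausdorff_gauge_ge0.
Qed.

HB.instance Definition _ := isOuterMeasure.Build R 'rV[R]_n hausdorff_outer
  hausdorff_outer0 hausdorff_outer_ge0 le_hausdorff_outer
  hausdorff_outer_sigma_subadditive.

Let mu : {outer_measure set 'rV[R]_n -> \bar R} := hausdorff_outer.

Definition hausdorff_measure :
    {measure set (caratheodory_type hausdorff_outer) -> \bar R} :=
  mu : set (caratheodory_type mu) -> \bar R.

End hausdorff_rV.
Arguments hausdorff_measure {R n} k.

Section calculus.
Variables (R : realType) (n : nat).

Definition partial (i : 'I_n) (f : 'rV[R]_n -> R) : 'rV[R]_n -> R :=
  'D_(delta_mx ord0 i) f.

Fixpoint Ck (k : nat) (f : 'rV[R]_n -> R) : Prop :=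
  continuous f /\
  match k with
  | 0 => True
  | k'.+1 => forall i,
      (forall x, derivable f x (delta_mx ord0 i)) /\ Ck k' (partial i f)
  end.

Definition C11 (f : 'rV[R]_n -> R) : Prop :=
  Ck 1 f /\ exists L : R, forall (i : 'I_n) x y,
    `|partial i f x - partial i f y| <= L * enorm (x - y).

Definition test_function (Omega : set 'rV[R]_n) (phi : 'rV[R]_n -> R) : Prop :=
  [/\ forall k, Ck k phi,
      compact (closure [set x | phi x != 0]) &
      closure [set x | phi x != 0] `<=` Omega].

End calculus.

Section domains.
Variables (R : realType) (n : nat).

Definition boundary (A : set 'rV[R]_n) : set 'rV[R]_n :=
  closure A `\` interior A.

(* The interior of X relative to A. *)
Definition relint (A X : set 'rV[R]_n) : set 'rV[R]_n :=
  [set x | A x /\ \forall y \near x, A y -> X y].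

(* Near each boundary point, and up to relabelling and reorienting the axes,
   Omega is the region strictly above the graph of a C^{1,1} function. *)
Definition C11_boundary (Omega : set 'rV[R]_n) : Prop :=
  forall x0, boundary Omega x0 ->
  exists (r : R) (i : 'I_n) (s : bool) (g : 'rV[R]_n.-1 -> R),
    [/\ 0 < r, C11 g & forall x, enorm (x - x0) < r ->
          (Omega x <-> g (col' i x) < (-1) ^+ s * x ord0 i)].

Definition surface_measure := @hausdorff_measure R n n.-1.

End domains.
Arguments surface_measure {R n}.

Section sobolev.
Variables (R : realType) (n : nat).
Implicit Types (Omega S D : set 'rV[R]_n) (u g e a b : 'rV[R]_n -> R).

Definition Lp_on d (T : measurableType d)
    (mu : {measure set T -> \bar R}) (D : set T) (p : R) (f : T -> R) : Prop :=
  measurable_fun D f /\ finite_norm mu p%:E (f \_ D).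

Definition weak_partial Omega (i : 'I_n) u g : Prop :=
  Lp_on lebesgue_rV Omega 2 g /\
  forall phi, test_function Omega phi ->
    \int[lebesgue_rV]_(x in Omega) (u x * partial i phi x) =
    - \int[lebesgue_rV]_(x in Omega) (g x * phi x).

Definition H1 Omega : set ('rV[R]_n -> R) :=
  [set u | Lp_on lebesgue_rV Omega 2 u /\
           forall i, exists g, weak_partial Omega i u g].

(* Junk value 0 when u is not in H^1(Omega). *)
Definition wpartial Omega (i : 'I_n) u : 'rV[R]_n -> R :=
  xget (cst 0) (weak_partial Omega i u).

Definition L2_cvg d (T : measurableType d) (mu : {measure set T -> \bar R})
    (D : set T) (v : nat -> T -> R) (f : T -> R) : Prop :=
  (\int[mu]_(x in D) ((v k x - f x) ^+ 2)%:E)%E @[k --> \oo] --> 0%E.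

(* The trace operator is the continuous extension to H^1(Omega) of the
   restriction map u |-> u|_(boundary Omega) on C^1 functions. *)
Definition is_trace Omega u g : Prop :=
  Lp_on surface_measure (boundary Omega) 2 g /\
  exists v : nat -> 'rV[R]_n -> R,
    [/\ forall k, Ck 1 (v k),
        L2_cvg lebesgue_rV Omega v u,
        forall i, L2_cvg lebesgue_rV Omega
                    (fun k => partial i (v k)) (wpartial Omega i u) &
        L2_cvg surface_measure (boundary Omega) v g].

Definition trace Omega u : 'rV[R]_n -> R := xget (cst 0) (is_trace Omega u).

Definition dirichlet_form Omega u v : R :=
  \int[lebesgue_rV]_(x in Omega)
    (\sum_(i < n) wpartial Omega i u x * wpartial Omega i v x).

(* The eigenspace of lambda, as a set of functions of which only the classes
   modulo equality almost everywhere in Omega matter.  The existence of the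
   zero-order integrals, automatic for n >= 3 by the Sobolev and trace
   embeddings when a has the critical integrability, is part of the equation. *)
Definition robin_eigenspace Omega S a b (lambda : R) : set ('rV[R]_n -> R) :=
  [set e | H1 Omega e /\ forall phi, H1 Omega phi ->
    let q x := (a x + b x) * trace Omega e x * trace Omega phi x in
    let r x := \1_S x * trace Omega e x * trace Omega phi x in
    [/\ surface_measure.-integrable (boundary Omega) (EFin \o q),
        surface_measure.-integrable (boundary Omega) (EFin \o r) &
        dirichlet_form Omega e phi +
          \int[surface_measure]_(x in boundary Omega) q x =
        lambda * \int[surface_measure]_(x in boundary Omega) r x]].

Definition steklov_eigenspace Omega S a b (lambda : R) : set ('rV[R]_n -> R) :=
  [set e | H1 Omega e /\ forall phi, H1 Omega phi ->
    let q x := (a x + b x) * e x * phi x in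
    let r x := \1_S x * trace Omega e x * trace Omega phi x in
    [/\ lebesgue_rV.-integrable Omega (EFin \o q),
        surface_measure.-integrable (boundary Omega) (EFin \o r) &
        dirichlet_form Omega e phi + \int[lebesgue_rV]_(x in Omega) q x =
        lambda * \int[surface_measure]_(x in boundary Omega) r x]].

Definition eq_on Omega u v : Prop :=
  {ae lebesgue_rV, forall x, Omega x -> u x = v x}.

Definition is_eigenvalue Omega (V : R -> set ('rV[R]_n -> R)) (lambda : R) :
    Prop :=
  exists2 e, V lambda e & ~ eq_on Omega e (cst 0).

Definition is_simple_eigenvalue Omega (V : R -> set ('rV[R]_n -> R))
    (lambda : R) : Prop :=
  exists e, [/\ V lambda e, ~ eq_on Omega e (cst 0) &
    forall u, V lambda u -> exists c : R, eq_on Omega u (fun x => c * e x)].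

(* The norm of C^0(closure Omega), for Omega nonempty and bounded. *)
Definition C0_norm Omega b : R := sup [set `|b x| | x in closure Omega].

End sobolev.

(* Main.v *)
Require Import Defs.
From HB Require Import structures.
From mathcomp Require Import all_boot all_order all_algebra.
From mathcomp Require Import all_classical all_reals all_analysis.
From mathcomp Require Import measurable_realfun ring lra zify.

(** Let r(u, v) be the integral of u v over S and Q_b(u, v) the Dirichlet form plus
the zero-order term with coefficient a + b; lambda is an eigenvalue when the
form Q_b - lambda r has a nonzero kernel.  The two problems differ only in
where the zero-order term is integrated, and they are solved together in
simple_eigenvalues, for a measure m on a set E and an operator tau from H^1 to
L^2(E): the surface measure and the trace, or the Lebesgue measure and the
identity.

Why a generic b separates eigenvalues.  Let Lambda_k(b) be the min-max values of
Q_b relative to r; they are Lipschitz in b for the uniform norm, as soon as b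
stays above a positive constant.  Suppose that e1 and e2 are r-orthonormal in
the kernel of Q_b - lambda r, and let k - 1 be the dimension of a maximal
negative space of this form.  Adding e1, or e2, to the negative space gives a
space that realizes Lambda_k(b) = lambda, whence
Lambda_k(b + t beta) <= lambda + t B_i + O(t^2) with B_i the integral of
beta (tau e_i)^2, for i = 1, 2 (minmax_at_eigenvector, minmax_ge_eigenvalue).
If B_1 and B_2 differ, then Lambda_k has a concave corner at b in the direction
beta: its second differences at scale h are below - c h.  But on a segment a
Lipschitz function has points without concave corner, by telescoping
(second_difference_step), and nested balls give one b without concave corners
for all k and countably many beta (generic_second_difference).  For that b the
integrals of beta (tau e1)^2 and beta (tau e2)^2 agree, and, by rotating the
pair, the integral of beta (tau e1)(tau e2) vanishes (generic_splitting).  When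
the beta separate integrable functions on E, this gives (tau e1)^2 = (tau e2)^2
and (tau e1)(tau e2) = 0, so that tau e1 = 0, which contradicts r(e1, e1) = 1
(separating_potential).

Why there is a maximal negative space of finite dimension.  It suffices that
r(u, u) <= delta D(u, u) when finitely many linear functionals of u vanish, for
every delta > 0, where D is the Dirichlet form.  This is the form in which
compactness of the trace enters, and the functionals are integrals over boxes
(trace_inequality).  For functions of class C^1 one integrates along the
vertical segments of a graph patch of the boundary, to bound the trace by values
in the interior and a small multiple of the energy (layer_inequality), and then
one applies Poincare's inequality on small cubes (interior_estimate).  Of the
Hausdorff measure this uses that Borel sets are measurable for it, and an upper
bound for the area of a Lipschitz graph (hausdorff_graph).

From there to simple eigenvalues.  If e is an eigenfunction with r(e, e) > 0 and
u is another one, then w = u - c e with r(w, e) = 0 satisfies r(w, w) = 0 by the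
choice of b.  As a + b is bounded below by a positive constant, an
eigenfunction w with r(w, w) = 0 has no energy: its gradient and tau w vanish,
so that w is a constant (zero_gradient_constant) with zero trace, and w = 0
since the boundary is not negligible when r(e, e) > 0.  If r vanishes on the
whole eigenspace, then all its elements are constants (eigenvalue_simple). *)

Set Implicit Arguments.
Unset Strict Implicit.
Unset Printing Implicit Defensive.

Import Order.TTheory GRing.Theory Num.Theory.
Import numFieldNormedType.Exports.

Local Open Scope classical_set_scope.
Local Open Scope ring_scope.

(** * Continuous potentials without concave corners *)

Section generic_perturbation.
Context {R : realType} {E : topologicalType}.
Implicit Types (b beta : E -> R).

Definition uclose (rho : R) b b' := forall x, `|b x - b' x| <= rho.

Lemma uclose_weaken rho rho' b b' : rho <= rho' -> uclose rho b b' -> uclose rho' b b'.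
Proof. by move=> le_rho bb' x; exact: le_trans (bb' x) le_rho. Qed.

Lemma uclose_trans rho rho' b1 b2 b3 :
  uclose rho b1 b2 -> uclose rho' b2 b3 -> uclose (rho + rho') b1 b3.
Proof.
by move=> h12 h23 x; apply: le_trans (ler_distD (b2 x) _ _) _; rewrite lerD.
Qed.

Definition perturb b (t : R) beta : E -> R := fun x => b x + t * beta x.

Lemma continuous_perturb b t beta :
  continuous b -> continuous beta -> continuous (perturb b t beta).
Proof.
move=> cb cbeta x; apply: cvgD; first exact: cb.
by apply: cvgM; [exact: cvg_cst | exact: cbeta].
Qed.

Lemma uclose_perturb b t beta :
  (forall x, `|beta x| <= 1) -> uclose `|t| b (perturb b t beta).
Proof.
move=> beta1 x; rewrite /perturb opprD addrA subrr add0r normrN normrM.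
by rewrite ler_piMr.
Qed.

Lemma uclose_perturbl rho b b' t beta :
  uclose rho b b' -> uclose rho (perturb b t beta) (perturb b' t beta).
Proof. by move=> bb' x; rewrite /perturb opprD addrACA subrr addr0. Qed.

Lemma perturb_perturb b s t beta :
  perturb (perturb b s beta) t beta = perturb b (s + t) beta.
Proof. by apply/funext => x; rewrite /perturb mulrDl addrA. Qed.

(** If all second differences at scale h on [0, rho / 2] were below - h eta / 2, the
    increments over N consecutive steps would decrease by N h eta / 2, which exceeds
    the 2 L h that the Lipschitz bound leaves when N is large. *)
Lemma second_difference_step (phi : R -> R) (L rho eta : R) :
  0 < rho -> 0 < eta ->
  (forall s t, `|s| <= rho -> `|t| <= rho ->
     `|phi s - phi t| <= L * `|s - t|) ->
  exists s h : R, [/\ 0 < h, h <= eta, h <= rho / 4, 0 <= s <= rho / 2 &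
    - (h * eta / 2) <= phi (s + h) + phi (s - h) - 2 * phi s].
Proof.
move=> rho0 eta0 phiL.
have L0 : 0 <= L.
  have := phiL rho 0; rewrite normr0 subr0 gtr0_norm// lexx ltW// => /(_ isT isT).
  by move=> /(le_trans (normr_ge0 _)); rewrite pmulr_lge0.
(* The first term forces (N - 1) h eta / 2 > 2 L h, the second one h <= eta. *)
pose N := (Num.truncn (4 * L / eta) + Num.truncn (rho / (2 * eta)) + 3)%N.
have N1 : 4 * L / eta < N%:R - 1.
  have /andP[_ +] := truncn_itv (divr_ge0 (mulr_ge0 (ler0n R 4) L0) (ltW eta0)).
  move=> /lt_le_trans; apply; rewrite /N !natrD -natr1 lerBrDr.
  have := ler0n R (Num.truncn (rho / (2 * eta))); lra.
have N2 : rho / (2 * eta) < N%:R.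
  have /andP[_ +] := truncn_itv (divr_ge0 (ltW rho0) (mulr_ge0 (ler0n R 2) (ltW eta0))).
  move=> /lt_le_trans; apply; rewrite ler_nat /N; move: (Num.truncn _) (Num.truncn _) => u v; lia.
have N3 : 2 <= N%:R :> R by rewrite (ler_nat R 2) /N; move: (Num.truncn _) (Num.truncn _) => u v; lia.
have N0 : 0 < N%:R :> R by lra.
pose h := rho / 2 / N%:R.
have h0 : 0 < h by rewrite divr_gt0 // divr_gt0.
have Nh : N%:R * h = rho / 2 by rewrite /h; field; rewrite gt_eqF.
have heta : h <= eta.
  rewrite /h ler_pdivrMr// ltW//; move: N2.
  rewrite ltr_pdivrMr ?mulr_gt0//; lra.
have hrho : h <= rho / 4 by nra.
pose d (i : nat) := phi (i.+1%:R * h) - phi (i%:R * h).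
apply: contrapT => nex.
have dec i : (i.+2 <= N)%N -> d i.+1 <= d i - h * eta / 2.
  move=> iN; rewrite leNgt; apply/negP => di; apply: nex.
  exists (i.+1%:R * h), h; split=> //.
  - apply/andP; split; first by apply: mulr_ge0; [exact: ler0n|exact: ltW].
    by rewrite -Nh ler_pM2r// ler_nat ltnW.
  - rewrite -[X in _ * h + X]mul1r -[X in _ * h - X]mul1r -mulrDl natr1 -mulrBl.
    rewrite -[X in _ <= _ + phi ((X - 1) * h) - _]natr1 addrK.
    move: di; rewrite /d; lra.
have decn i : (i.+1 <= N)%N -> d i <= d 0 - i%:R * (h * eta / 2).
  elim: i => [|i IH] iN; first by rewrite mul0r subr0.
  apply: le_trans (dec _ iN) _; have := IH (ltnW iN).
  rewrite -[i.+1%:R]natr1; lra.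
have in01 i : (i <= N)%N -> `|i%:R * h| <= rho.
  move=> iN; rewrite ger0_norm; last by apply: mulr_ge0; [exact: ler0n|exact: ltW].
  have : i%:R * h <= N%:R * h by rewrite ler_pM2r// ler_nat.
  by move=> /le_trans; apply; rewrite Nh; lra.
have dL i : (i.+1 <= N)%N -> `|d i| <= L * h.
  move=> iN; apply: le_trans (phiL _ _ (in01 _ iN) (in01 _ (ltnW iN))) _.
  by rewrite -mulrBl -natr1 addrAC subrr add0r mul1r gtr0_norm.
have Npos : (0 < N)%N by rewrite /N addn3.
have := decn N.-1; rewrite prednK // leqnn => /(_ isT).
have := dL N.-1; rewrite prednK // leqnn => /(_ isT).
have := dL 0%N Npos; rewrite !ler_norml => /andP[_ u0] /andP[l1 _] u1.
have N1E : N.-1%:R = N%:R - 1 :> R by rewrite -[in RHS](prednK Npos) -natr1 addrK.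
rewrite N1E in u1.
have : 4 * L < (N%:R - 1) * eta by rewrite -ltr_pdivrMr.
move=> key.
have : (N%:R - 1) * (h * eta / 2) <= 2 * L * h by lra.
have -> : (N%:R - 1) * (h * eta / 2) = ((N%:R - 1) * eta / 2) * h by ring.
rewrite ler_pM2r// => ?; lra.
Qed.

Lemma halving_small (r : nat -> R) :
  (forall k, r k.+1 <= r k / 2) -> forall e, 0 < e -> exists k, r k < e.
Proof.
move=> halve e e0.
have pow k : r k * 2 ^+ k <= r 0%N.
  elim: k => [|k IH]; first by rewrite expr0 mulr1.
  apply: le_trans IH; rewrite exprS mulrA ler_pM2r ?exprn_gt0//.
  by have := halve k; lra.
have [r0|r0] := ltP (r 0%N) 0; first by exists 0%N; exact: lt_trans e0.
pose k := Num.truncn (r 0%N / e); exists k.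
have /andP[_ kE] := truncn_itv (divr_ge0 r0 (ltW e0)).
have k2 : k.+1%:R <= 2 ^+ k :> R by rewrite -natrX ler_nat; exact: ltn_expl.
have ke : r 0%N < 2 ^+ k * e by rewrite -ltr_pdivrMr// (lt_le_trans kE).
rewrite -(@ltr_pM2r _ (2 ^+ k)) ?exprn_gt0//.
by rewrite (le_lt_trans (pow k))// mulrC.
Qed.

(** Density of one condition (second_difference_step) and its openness, which the
    Lipschitz bound gives, produce a sequence of nested uniform balls that meets the
    countably many conditions one after the other. *)
Lemma generic_second_difference (Lam : nat -> (E -> R) -> R)
    (beta : nat -> E -> R) b0 (kappa : R) :
  0 < kappa -> continuous b0 ->
  (forall j, continuous (beta j)) -> (forall j x, `|beta j x| <= 1) ->
  (forall m, exists L, forall b b' rho,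
     continuous b -> continuous b' ->
     uclose kappa b0 b -> uclose kappa b0 b' -> uclose rho b b' ->
     `|Lam m b - Lam m b'| <= L * rho) ->
  exists b, [/\ continuous b, uclose (kappa / 2) b0 b &
    forall m j p, exists h : R, [/\ 0 < h, h <= p.+1%:R^-1 &
      - (h / p.+1%:R) <= Lam m (perturb b h (beta j)) +
                         Lam m (perturb b (- h) (beta j)) - 2 * Lam m b]].
Proof.
move=> kappa0 cb0 cbeta beta1 LamL.
(* The triple is (m, j, p). *)
pose good (t : nat * nat * nat) b := exists h : R,
  [/\ 0 < h, h <= t.2.+1%:R^-1 &
  - (h / t.2.+1%:R) <= Lam t.1.1 (perturb b h (beta t.1.2)) +
     Lam t.1.1 (perturb b (- h) (beta t.1.2)) - 2 * Lam t.1.1 b].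
pose P (s : (E -> R) * R) := [/\ continuous s.1, 0 < s.2 &
  forall b', uclose s.2 s.1 b' -> uclose kappa b0 b'].
pose Rel t (s s' : (E -> R) * R) := [/\ s'.2 <= s.2 / 2,
  uclose (s.2 / 2) s.1 s'.1 & forall b', continuous b' -> uclose s'.2 s'.1 b' -> good t b'].
have step t s : exists s', P s -> P s' /\ Rel t s s'.
  have [Ps|nPs] := pselect (P s); last by exists s => /nPs.
  case: s t Ps => [b rho] [[m j] p] [/= cb rho0 inb].
  have [L HL] := LamL m; pose eta : R := p.+1%:R^-1.
  have eta0 : 0 < eta by rewrite invr_gt0.
  have [|||s [h [h0 heta hrho /andP[s0 srho] sdiff]]] :=
    @second_difference_step (fun t => Lam m (perturb b t (beta j))) L rho eta => //.
    move=> s t sr tr; apply: HL => //.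
    - exact: continuous_perturb.
    - exact: continuous_perturb.
    - by apply/inb/(uclose_weaken sr); exact: uclose_perturb.
    - by apply/inb/(uclose_weaken tr); exact: uclose_perturb.
    - move=> x; rewrite /perturb opprD addrACA subrr add0r -mulrBl normrM.
      by rewrite ler_piMr.
  pose L' := `|L| + 1.
  have L'0 : 0 < L' by rewrite ltr_wpDl.
  have LL' : L <= L' by rewrite (le_trans (ler_norm _))// lerDl.
  (* Within rho' the second difference changes by at most 4 (h eta / 8). *)
  pose rho' := Num.min (rho / 4) (h * eta / (8 * L')).
  have rho'0 : 0 < rho'.
    by rewrite lt_min !divr_gt0 ?mulr_gt0.
  have rho'1 : rho' <= rho / 4 by rewrite ge_min lexx.
  have rho'2 : L' * rho' <= h * eta / 8.
    have : rho' <= h * eta / (8 * L') by rewrite ge_min lexx orbT.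
    rewrite ler_pdivlMr ?mulr_gt0// => ?; lra.
  exists (perturb b s (beta j), rho') => _ /=; split; split => /=.
  - exact: continuous_perturb.
  - exact: rho'0.
  - move=> b' bb'; apply: inb.
    apply: (@uclose_weaken (`|s| + rho')); first by rewrite ger0_norm//; lra.
    by apply: uclose_trans bb'; exact: uclose_perturb.
  - lra.
  - apply: (@uclose_weaken `|s|); first by rewrite ger0_norm.
    exact: uclose_perturb.
  - move=> b' cb' bb'; exists h; split => //=.
    have tri t : `|t| <= rho / 4 ->
        `|Lam m (perturb b (s + t) (beta j)) - Lam m (perturb b' t (beta j))| <= L' * rho'.
      move=> tr; apply: (@le_trans _ _ (L * rho')); last first.
        by rewrite ler_wpM2r// ltW.
      have c1 : uclose rho' (perturb b (s + t) (beta j)) (perturb b' t (beta j)).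
        by rewrite -perturb_perturb; exact: uclose_perturbl.
      have c2 : uclose (`|s| + `|t|) b (perturb b (s + t) (beta j)).
        rewrite -perturb_perturb; apply: uclose_trans; first exact: uclose_perturb.
        exact: uclose_perturb.
      apply: HL => //.
      + exact: continuous_perturb.
      + exact: continuous_perturb.
      + by apply/inb/(uclose_weaken _ c2); rewrite (ger0_norm s0); lra.
      + apply: inb.
        have := uclose_trans c2 c1; apply: uclose_weaken; rewrite (ger0_norm s0); lra.
    have t1 := tri h; have t2 := tri (- h); have t3 := tri 0.
    rewrite normrN gtr0_norm// in t2; rewrite gtr0_norm// in t1.
    rewrite normr0 in t3.
    have s0E : perturb b' 0 (beta j) = b'.
      by apply/funext => x; rewrite /perturb mul0r addr0.
    move: (t1 hrho) (t2 hrho) t3; rewrite s0E addr0 => {}t1 {}t2 t3.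
    have {}t3 := t3 (divr_ge0 (ltW rho0) (ler0n _ _)).
    move: t1 t2 t3; rewrite !ler_norml => /andP[_ t1] /andP[_ t2] /andP[t3 _].
    rewrite -/eta; lra.
have [F HF] := choice (fun ts : (nat * nat * nat) * ((E -> R) * R) => step ts.1 ts.2).
pose task k := odflt (0%N, 0%N, 0%N) (unpickle k).
have [S [S0 SS]] : exists S : nat -> (E -> R) * R,
    S 0%N = (b0, kappa / 2) /\ forall k, S k.+1 = F (task k, S k).
  by exists (fix S k := if k is k'.+1 then F (task k', S k') else (b0, kappa / 2)).
have PS k : P (S k).
  elim: k => [|k IH]; last by rewrite SS; have [] := HF (task k, S k) IH.
  rewrite S0; split => //=; first by rewrite divr_gt0.
  by move=> b'; apply: uclose_weaken; lra.
have RS k : Rel (task k) (S k) (S k.+1) by rewrite SS; have [] := HF (task k, S k) (PS k).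
have rho0 k : 0 < (S k).2 by have [] := PS k.
have halve k : (S k.+1).2 <= (S k).2 / 2 by have [] := RS k.
have stepS k : uclose ((S k).2 - (S k.+1).2) (S k).1 (S k.+1).1.
  by have [? + _] := RS k; apply: uclose_weaken; have := rho0 k; lra.
have nest k i : uclose ((S k).2 - (S (k + i)%N).2) (S k).1 (S (k + i)%N).1.
  elim: i => [|i IH]; first by rewrite addn0 => x; rewrite !subrr normr0.
  have := uclose_trans IH (stepS (k + i)%N); rewrite addnS.
  by apply: uclose_weaken; lra.
have meet k l x : (S k).1 x - (S k).2 <= (S l).1 x + (S l).2.
  have [kl|lk] := leqP k l.
    have := nest k (l - k)%N x; rewrite subnKC// ler_norml => /andP[_].
    have := rho0 l; lra.
  have := nest l (k - l)%N x; rewrite subnKC ?(ltnW lk)// ler_norml => /andP[+ _].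
  have := rho0 k; lra.
(* The limit of the centers of the balls; as a supremum it needs no completeness of
   the uniform norm. *)
pose b x := sup [set (S k).1 x - (S k).2 | k in [set: nat]].
have bin k : uclose (S k).2 (S k).1 b.
  move=> x; rewrite distrC ler_distl; apply/andP; split.
    apply: ub_le_sup; last by exists k.
    by exists ((S 0%N).1 x + (S 0%N).2) => _ [l _ <-]; exact: (meet l 0%N x).
  apply: ge_sup; first by exists ((S 0%N).1 x - (S 0%N).2); exists 0%N.
  move=> _ [l _ <-].
  exact: (meet l k x).
have small := halving_small halve.
have cb : continuous b.
  move=> x; apply/cvgrPdist_le => e e0.
  have [k ke] := small (e / 4) (divr_gt0 e0 (ltr0n _ 4)).
  have [ck _ _] := PS k.
  have e2 : 0 < e / 2 by rewrite divr_gt0.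
  have /cvgrPdist_le/(_ _ e2) := ck x.
  apply: filterS => y xy.
  have := bin k x; have := bin k y; move: xy; rewrite !ler_norml.
  move=> /andP[? ?] /andP[? ?] /andP[? ?]; apply/andP; split; lra.
exists b; split => //; first by have := bin 0%N; rewrite S0.
move=> m j p.
have [_ _] := RS (pickle (m, j, p)); rewrite /task pickleK /=; apply => //.
Qed.

End generic_perturbation.

(** * Symmetric forms and min-max values *)

Section forms.
Context {R : realType} {V : lmodType R}.
Implicit Types (X : set V) (f : V -> V -> R) (u v w : V).

Definition linear_subspace X := X 0 /\ forall a u v, X u -> X v -> X (a *: u + v).

Definition linear_on X (l : V -> R) :=
  forall a u v, X u -> X v -> l (a *: u + v) = a * l u + l v.

Definition form_on X f :=
  (forall u v, X u -> X v -> f u v = f v u) /\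
  forall w, X w -> linear_on X (f ^~ w).

Definition comb k (c : 'rV[R]_k) (u : 'I_k -> V) : V :=
  \sum_(i < k) c ord0 i *: u i.

Lemma subspace_add X u v : linear_subspace X -> X u -> X v -> X (u + v).
Proof. by case=> _ h hu hv; have := h 1 _ _ hu hv; rewrite scale1r. Qed.

Lemma subspace_scale X a u : linear_subspace X -> X u -> X (a *: u).
Proof. by case=> h0 h hu; have := h a _ _ hu h0; rewrite addr0. Qed.

Lemma subspace_comb X k (c : 'rV[R]_k) (u : 'I_k -> V) :
  linear_subspace X -> (forall i, X (u i)) -> X (comb c u).
Proof.
move=> hX hu; rewrite /comb; elim/big_ind : _ => [|x y|i _].
- by case: hX.
- exact: subspace_add.
- exact: subspace_scale.
Qed.

Lemma linear_on0 X l : linear_subspace X -> linear_on X l -> l 0 = 0.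
Proof.
move=> [h0 _] /(_ 1 _ _ h0 h0); rewrite scale1r addr0 mul1r => /eqP.
by rewrite -subr_eq subrr => /eqP <-.
Qed.

Lemma linear_on_comb X l k (c : 'rV[R]_k) (u : 'I_k -> V) :
  linear_subspace X -> linear_on X l -> (forall i, X (u i)) ->
  l (comb c u) = \sum_(i < k) c ord0 i * l (u i).
Proof.
move=> hX hl hu; rewrite /comb.
suff : X (\sum_(i < k) c ord0 i *: u i) /\
  l (\sum_(i < k) c ord0 i *: u i) = \sum_(i < k) c ord0 i * l (u i) by case.
elim/big_ind2 : _ => [|x1 x2 y1 y2 [hx <-] [hy <-]|i _].
- by split; [case: hX | exact: linear_on0 hl].
- split; first exact: subspace_add.
  by have := hl 1 _ _ hx hy; rewrite scale1r mul1r.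
- split; first exact: subspace_scale.
  have [h0 _] := hX; have := hl (c ord0 i) _ _ (hu i) h0.
  by rewrite addr0 => ->; rewrite (linear_on0 hX hl) addr0.
Qed.

Section form.
Variables (X : set V) (f : V -> V -> R).
Hypotheses (hX : linear_subspace X) (hf : form_on X f).

Lemma form_sym u v : X u -> X v -> f u v = f v u. Proof. by case: hf => + _; apply. Qed.

Lemma form_combll a u v w : X u -> X v -> X w ->
  f (a *: u + v) w = a * f u w + f v w.
Proof. by move=> hu hv hw; case: hf => _ /(_ _ hw); apply. Qed.

Lemma form_addl u v w : X u -> X v -> X w -> f (u + v) w = f u w + f v w.
Proof. by move=> hu hv hw; have := form_combll 1 hu hv hw; rewrite scale1r mul1r. Qed.

Lemma form_zerol w : X w -> f 0 w = 0.
Proof. by move=> hw; case: hf => _ /(_ _ hw)/(linear_on0 hX). Qed.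

Lemma form_scalel a u w : X u -> X w -> f (a *: u) w = a * f u w.
Proof.
move=> hu hw; have [h0 _] := hX; have := form_combll a hu h0 hw.
by rewrite addr0 form_zerol// addr0.
Qed.

Lemma form_addr u v w : X u -> X v -> X w -> f w (u + v) = f w u + f w v.
Proof.
move=> hu hv hw; rewrite form_sym ?form_addl//; last exact: subspace_add.
by rewrite (form_sym hu hw) (form_sym hv hw).
Qed.

Lemma form_scaler a u w : X u -> X w -> f w (a *: u) = a * f w u.
Proof.
move=> hu hw; rewrite form_sym ?form_scalel//; last exact: subspace_scale.
by rewrite (form_sym hu hw).
Qed.

Lemma form_addZ a u v : X u -> X v ->
  f (u + a *: v) (u + a *: v) = f u u + 2 * a * f u v + a ^+ 2 * f v v.
Proof.
move=> hu hv; have hav := subspace_scale a hX hv.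
rewrite form_addl ?form_addr// ?(form_scalel, form_scaler)//; last exact: subspace_add.
rewrite (form_sym hv hu); ring.
Qed.

Lemma form_combl k (c : 'rV[R]_k) (u : 'I_k -> V) w : (forall i, X (u i)) -> X w ->
  f (comb c u) w = \sum_(i < k) c ord0 i * f (u i) w.
Proof.
by move=> hu hw; case: hf => _ /(_ _ hw) hl; exact: (linear_on_comb _ hX hl hu).
Qed.

Lemma form_combr k (c : 'rV[R]_k) (u : 'I_k -> V) w : (forall i, X (u i)) -> X w ->
  f w (comb c u) = \sum_(i < k) c ord0 i * f w (u i).
Proof.
move=> hu hw; rewrite form_sym ?form_combl//; last exact: subspace_comb.
by apply: eq_bigr => i _; rewrite form_sym.
Qed.

Lemma form_comb2 k (c : 'rV[R]_k) (u : 'I_k -> V) : (forall i, X (u i)) ->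
  f (comb c u) (comb c u) =
  \sum_(i < k) \sum_(j < k) c ord0 i * c ord0 j * f (u i) (u j).
Proof.
move=> hu; rewrite form_combl//; last exact: subspace_comb.
apply: eq_bigr => i _; rewrite form_combr// mulr_sumr.
by apply: eq_bigr => j _; rewrite mulrA.
Qed.

Lemma form_comb_bound k (u : 'I_k -> V) : (forall i, X (u i)) ->
  exists2 M, 0 <= M & forall c : 'rV[R]_k,
    `|f (comb c u) (comb c u)| <= M * \sum_(i < k) c ord0 i ^+ 2.
Proof.
move=> hu; exists (\sum_(i < k) \sum_(j < k) `|f (u i) (u j)|).
  by apply: sumr_ge0 => i _; apply: sumr_ge0.
move=> c; rewrite form_comb2// mulr_suml.
apply: le_trans (ler_norm_sum _ _ _) _; apply: ler_sum => i _.
apply: le_trans (ler_norm_sum _ _ _) _; rewrite mulr_suml; apply: ler_sum => j _.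
rewrite normrM mulrC ler_wpM2l//.
have le1 l : `|c ord0 l| ^+ 2 <= \sum_(i < k) c ord0 i ^+ 2.
  rewrite (bigD1 l)//= real_normK ?num_real// lerDl sumr_ge0// => ? _.
  exact: sqr_ge0.
rewrite normrM.
have := le1 i; have := le1 j; move: (\sum_(_ < _) _) `|_| `|_| => S x y; nra.
Qed.

End form.

Lemma form_on_comb X f g (a : R) : form_on X f -> form_on X g ->
  form_on X (fun u v => f u v + a * g u v).
Proof.
move=> [fC fl] [gC gl]; split=> [u v hu hv|w hw b u v hu hv].
  by rewrite fC// gC.
by rewrite fl// gl//; ring.
Qed.

Lemma nonzero_kernel k m (A : 'M[R]_(k, m)) : (m < k)%N ->
  exists2 c : 'rV[R]_k, c != 0 & c *m A = 0.
Proof.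
move=> mk; have : kermx A != 0.
  rewrite -mxrank_eq0 mxrank_ker -lt0n subn_gt0.
  exact: leq_ltn_trans (rank_leq_col A) mk.
by case/rowV0Pn => c /sub_kermxP cA c0; exists c.
Qed.

Lemma sum_sqr_gt0 k (c : 'rV[R]_k) : c != 0 -> 0 < \sum_(i < k) c ord0 i ^+ 2.
Proof.
move=> c0; rewrite lt_neqAle sumr_ge0 ?andbT; last by move=> i _; exact: sqr_ge0.
apply: contra c0 => /eqP/esym; move=> /psumr_eq0P h; apply/eqP/rowP => i.
by rewrite mxE; apply/eqP; rewrite -sqrf_eq0 h// => j _; exact: sqr_ge0.
Qed.

Definition snoc m (n : 'I_m -> V) e (i : 'I_m.+1) : V :=
  if unlift ord_max i is Some j then n j else e.

Lemma snoc_lift m (n : 'I_m -> V) e i : snoc n e (lift ord_max i) = n i.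
Proof. by rewrite /snoc liftK. Qed.

Lemma snoc_max m (n : 'I_m -> V) e : snoc n e ord_max = e.
Proof. by rewrite /snoc unlift_none. Qed.

Lemma ord_max_ind m (P : 'I_m.+1 -> Prop) :
  P ord_max -> (forall i, P (lift ord_max i)) -> forall i, P i.
Proof. by move=> Pm Pl i; case: (unliftP ord_max i) => [j|] ->. Qed.

Definition front m (c : 'rV[R]_m.+1) : 'rV[R]_m := \row_j c ord0 (lift ord_max j).

Lemma comb_snoc m (c : 'rV[R]_m.+1) n e :
  comb c (snoc n e) = comb (front c) n + c ord0 ord_max *: e.
Proof.
rewrite /comb (bigD1_ord ord_max)//= snoc_max addrC; congr (_ + _).
by apply: eq_bigr => i _; rewrite snoc_lift mxE.
Qed.

End forms.

Section minmax.
Context {R : realType} {V : lmodType R}.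
Variables (X : set V) (r : V -> V -> R).
Hypotheses (hX : linear_subspace X) (hr : form_on X r).

(** Positivity of r makes the family linearly independent, so that its span has
    dimension m. *)
Definition frame m (u : 'I_m -> V) := (forall i, X (u i)) /\
  forall c : 'rV[R]_m, c != 0 -> 0 < r (comb c u) (comb c u).

Definition frame_bounds m (Q : V -> V -> R) : set R := [set s |
  exists2 u : 'I_m.+1 -> V, frame u &
    forall c, Q (comb c u) (comb c u) <= s * r (comb c u) (comb c u)].

(** The Courant-Fischer value over the spaces of dimension m + 1.  It is an infimum
    of upper bounds of Q / r, so that it makes sense without an eigenfunction; it
    has the junk value 0 when no frame has m + 1 members. *)
Definition minmax m Q : R := inf (frame_bounds m Q).

Definition nonneg_on (Q : V -> V -> R) := forall u, X u -> 0 <= Q u u.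

Lemma frame_bounds_ge0 m Q s : nonneg_on Q -> frame_bounds m Q s -> 0 <= s.
Proof.
move=> Q0 [u [hu ru] Qu].
have c0 : delta_mx ord0 ord0 != 0 :> 'rV[R]_m.+1.
  by apply/eqP => /rowP/(_ ord0); rewrite !mxE !eqxx; apply/eqP/oner_neq0.
have := le_trans (Q0 _ (subspace_comb _ hX hu)) (Qu (delta_mx ord0 ord0)).
by rewrite pmulr_lge0// ru.
Qed.

Lemma minmax_le m Q s : nonneg_on Q -> frame_bounds m Q s -> minmax m Q <= s.
Proof.
move=> Q0 hs; apply: ge_inf => //; exists 0 => s'; exact: frame_bounds_ge0.
Qed.

(** Equivalent forms have the same frames with finite bounds, so that the junk
    value 0 does not spoil the comparison. *)
Lemma minmax_scale m Q Q' theta : nonneg_on Q -> nonneg_on Q' ->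
  0 <= theta ->
  (forall u, X u -> Q' u u <= (1 + theta) * Q u u) ->
  (exists2 T, 0 < T & forall u, X u -> Q u u <= T * Q' u u) ->
  minmax m Q' <= (1 + theta) * minmax m Q.
Proof.
move=> Q0 Q'0 t0 QQ' [T T0 Q'Q].
have t1 : 0 < 1 + theta by rewrite ltr_pwDl.
have [h|/set0P/negP/negPn/eqP h] := pselect (frame_bounds m Q !=set0); last first.
  suff h' : frame_bounds m Q' = set0 by rewrite /minmax h h' inf0 mulr0.
  apply/eqP/negPn/negP => /set0P[s [u hu us]].
  have : frame_bounds m Q (T * s).
    exists u => // c; apply: le_trans (Q'Q _ _) _; last by rewrite -mulrA ler_pM2l.
    by apply: subspace_comb => //; case: hu.
  by rewrite h.
rewrite -ler_pdivrMl//; apply: lb_le_inf => // s [u hu us].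
rewrite ler_pdivrMl//; apply: minmax_le => //; exists u => // c.
rewrite -mulrA; apply: le_trans (QQ' _ _) _; last by rewrite ler_pM2l.
by apply: subspace_comb => //; case: hu.
Qed.

End minmax.

(** * Perturbation of a multiple eigenvalue *)

Section splitting.
Context {R : realType} {V : lmodType R}.
Variables (X : set V) (r : V -> V -> R).
Hypotheses (hX : linear_subspace X) (hr : form_on X r).

Definition negative_family (q : V -> V -> R) m (n : 'I_m -> V) :=
  (forall i, X (n i)) /\ forall i j, q (n i) (n j) = - (i == j)%:R.

Lemma negative_comb (q : V -> V -> R) m (n : 'I_m -> V) (c : 'rV[R]_m) :
  form_on X q -> negative_family q n ->
  q (comb c n) (comb c n) = - \sum_(i < m) c ord0 i ^+ 2.
Proof.
move=> hq [hn qn]; rewrite (form_comb2 hX hq)// -sumrN; apply: eq_bigr => i _.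
rewrite (bigD1 i)//= big1 ?addr0 => [|j /negPf ji]; rewrite qn.
  by rewrite eqxx mulrN1 -expr2.
by rewrite eq_sym ji oppr0 mulr0.
Qed.

(** A negative family with more than N members would have a nonzero combination
    annihilated by the N functionals, on which q is both nonnegative and negative. *)
Lemma maximal_negative (q : V -> V -> R) N (l : 'I_N -> V -> R) :
  form_on X q -> (forall j, linear_on X (l j)) ->
  (forall u, X u -> (forall j, l j u = 0) -> 0 <= q u u) ->
  exists m, exists2 n : 'I_m -> V, negative_family q n &
    forall u, X u -> (forall i, q (n i) u = 0) -> 0 <= q u u.
Proof.
move=> hq hl qpos.
pose P m := `[< exists n : 'I_m -> V, negative_family q n >].
have exP : exists m, P m.
  by exists 0%N; apply/asboolP; exists (fun=> 0); split=> -[].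
have leN m : P m -> (m <= N)%N.
  move=> /asboolP[n hn]; rewrite leqNgt; apply/negP => Nm.
  have [c c0 cA] := nonzero_kernel (\matrix_(i < m, j < N) l j (n i)) Nm.
  have [hn1 _] := hn.
  have := qpos (comb c n) (subspace_comb c hX hn1).
  rewrite (negative_comb c hq hn) oppr_ge0 leNgt sum_sqr_gt0//=.
  suff : forall j, l j (comb c n) = 0 by move=> h /(_ h).
  move=> j; rewrite (linear_on_comb c hX (hl j) hn1).
  have /matrixP/(_ ord0 j) := cA; rewrite !mxE => h; rewrite -[RHS]h.
  by apply: eq_bigr => i _; rewrite mxE.
case: (ex_maxnP exP leN) => m /asboolP[n hn] maxm.
exists m, n => // u hu qu; rewrite leNgt; apply/negP => quu.
have [hn1 hn2] := hn.
pose a := (Num.sqrt (- q u u))^-1.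
have a2 : a * (a * q u u) = -1.
  have := @sqr_sqrtr _ (- q u u); rewrite oppr_ge0 => /(_ (ltW quu)) e.
  rewrite mulrA -expr2 /a exprVn e invrN mulNr mulVf// lt_eqF//.
have hau : X (a *: u) by exact: subspace_scale.
have /maxm : P m.+1; last by rewrite ltnn.
apply/asboolP; exists (snoc n (a *: u)); split.
  by apply: ord_max_ind => [|i]; rewrite ?snoc_max ?snoc_lift.
have e1 i : q (n i) (a *: u) = 0 by rewrite (form_scaler hX hq)// qu mulr0.
apply: ord_max_ind => [|i]; apply: ord_max_ind => [|j];
  rewrite ?snoc_max ?snoc_lift.
- by rewrite eqxx (form_scalel hX hq)// (form_scaler hX hq).
- by rewrite (negPf (neq_lift _ _)) oppr0 (form_sym hq).
- by rewrite eq_sym (negPf (neq_lift _ _)) oppr0.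
- by rewrite hn2 (inj_eq lift_inj).
Qed.

Section at_eigenvalue.
Variables (Q : V -> V -> R) (lambda : R) (e1 e2 : V).
Hypotheses (hQ : form_on X Q) (he1 : X e1) (he2 : X e2).
Hypotheses (r11 : r e1 e1 = 1) (r22 : r e2 e2 = 1) (r12 : r e1 e2 = 0).
Let q u v := Q u v + (- lambda) * r u v.
Hypotheses (q1 : forall u, X u -> q e1 u = 0) (q2 : forall u, X u -> q e2 u = 0).
Hypothesis (lambda0 : 0 < lambda).

Let hq : form_on X q. Proof. exact: form_on_comb. Qed.

(** Adding elements of the kernel of q to the members of the family changes none of
    the values of q. *)
Lemma negative_orthogonal m (n : 'I_m -> V) : negative_family q n ->
  (forall u, X u -> (forall i, q (n i) u = 0) -> 0 <= q u u) ->
  exists2 n' : 'I_m -> V, negative_family q n' &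
  [/\ forall u, X u -> (forall i, q (n' i) u = 0) -> 0 <= q u u,
      forall i, r (n' i) e1 = 0 & forall i, r (n' i) e2 = 0].
Proof.
move=> [hn qn] nmax.
pose n' i := (- r (n i) e1) *: e1 + ((- r (n i) e2) *: e2 + n i).
have hn2 i : X ((- r (n i) e2) *: e2 + n i) by case: hX => _; apply.
have hn' i : X (n' i) by case: hX => _; apply.
have ql i u : X u -> q (n' i) u = q (n i) u.
  by move=> hu; rewrite /n' !(form_combll hq)// q1// q2// !mulr0 !add0r.
exists n'; split=> //.
- move=> i j; rewrite ql// (form_sym hq)// ql// (form_sym hq)//.
- by move=> u hu h; apply: nmax => // i; rewrite -ql.
- move=> i; rewrite /n' !(form_combll hr)// r11 (form_sym hr he2 he1) r12; ring.
- move=> i; rewrite /n' !(form_combll hr)// r22 r12; ring.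
Qed.

(** The space spanned by a maximal negative family and one eigenvector realizes the
    min-max value, and a perturbation t * beta moves its bound by t * beta e e up to
    an error of second order: the terms that mix the eigenvector with the negative
    part are absorbed there, since Q - lambda r is minus a square sum on it. *)
Lemma minmax_at_eigenvector m (n : 'I_m -> V) e beta :
  negative_family q n -> X e -> r e e = 1 -> (forall u, X u -> q e u = 0) ->
  (forall i, r (n i) e = 0) -> nonneg_on X Q -> form_on X beta ->
  exists t0 C, [/\ 0 < t0, 0 <= C & forall t, `|t| <= t0 ->
    frame_bounds X r m (fun u v => Q u v + t * beta u v)
      (lambda + t * beta e e + C * t ^+ 2)].
Proof.
move=> nneg he ree qe rn Q0 hb; have [hn _] := nneg.
have [M M0 bM] := form_comb_bound hX hb hn.
have [M' M'0 rM] := form_comb_bound hX hr hn.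
(* Mb bounds the mixed terms, and K the terms on the negative part: for K t <= 1/2
   they are absorbed by half of the square sum. *)
pose Mb := \sum_(i < m) beta (n i) e ^+ 2.
have Mb0 : 0 <= Mb by apply: sumr_ge0 => i _; exact: sqr_ge0.
pose K := M + `|beta e e| * M' + 1.
have K0 : 0 < K by rewrite ltr_wpDl// addr_ge0// mulr_ge0.
exists (2 * K)^-1, (2 * Mb); split; rewrite ?mulr_ge0 ?invr_gt0 ?mulr_gt0//.
move=> t tK.
have tK2 : `|t| * K <= 2^-1.
  by rewrite -ler_pdivlMr// -invfM.
have hw (c : 'rV[R]_m) : X (comb c n) by exact: subspace_comb.
have rne (c : 'rV[R]_m) : r (comb c n) e = 0.
  by rewrite (form_combl hX hr)// big1// => i _; rewrite rn mulr0.
have rw (c : 'rV[R]_m.+1) : r (comb c (snoc n e)) (comb c (snoc n e)) =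
    r (comb (front c) n) (comb (front c) n) + c ord0 ord_max ^+ 2.
  by rewrite comb_snoc (form_addZ hX hr)// rne ree mulr0 addr0 mulr1.
have qS (c : 'rV[R]_m) : Q (comb c n) (comb c n) =
    lambda * r (comb c n) (comb c n) - \sum_(i < m) c ord0 i ^+ 2.
  by rewrite -(negative_comb c hq nneg) /q; ring.
have lr (c : 'rV[R]_m) : \sum_(i < m) c ord0 i ^+ 2 <= lambda * r (comb c n) (comb c n).
  by have := Q0 _ (hw c); rewrite qS subr_ge0.
exists (snoc n e).
  split; first by apply: ord_max_ind => [|i]; rewrite ?snoc_max ?snoc_lift.
  move=> c c0; rewrite rw -(pmulr_rgt0 _ lambda0) mulrDr.
  apply: lt_le_trans (lerD (lr (front c)) (lexx _)).
  have [f0|f0] := eqVneq (front c) 0.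
    rewrite f0 big1 ?add0r => [|i _]; last by rewrite mxE expr0n.
    rewrite pmulr_rgt0// exprn_even_gt0//=; apply: contra c0 => /eqP cm.
    apply/eqP/rowP; apply: ord_max_ind => [|i]; first by rewrite cm mxE.
    by have /rowP/(_ i) := f0; rewrite !mxE.
  by rewrite ltr_pwDl// ?sum_sqr_gt0// mulr_ge0 ?sqr_ge0// ltW.
move=> c; rewrite rw comb_snoc (form_addZ hX hQ)// (form_addZ hX hb)//.
set f := front c; set a := c ord0 ord_max.
have Qe u : X u -> Q e u = lambda * r e u.
  by move=> hu; have := qe _ hu; rewrite /q; lra.
have Qne : Q (comb f n) e = 0 by rewrite (form_sym hQ)// Qe// (form_sym hr)// rne mulr0.
rewrite Qne Qe// ree qS.
have := bM f; have := rM f; have := lr f.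
(* Young's inequality in each coordinate. *)
have cross : 2 * (t * a * beta (comb f n) e) <=
    (\sum_(i < m) f ord0 i ^+ 2) / 2 + 2 * t ^+ 2 * a ^+ 2 * Mb.
  rewrite (form_combl hX hb)// !mulr_sumr mulr_suml -big_split /=.
  apply: ler_sum => i _.
  have := sqr_ge0 (f ord0 i / 2 - t * a * beta (n i) e).
  move: (f ord0 i) (beta _ _) => x y; lra.
have S0 : 0 <= \sum_(i < m) f ord0 i ^+ 2 by apply: sumr_ge0 => i _; exact: sqr_ge0.
move: cross S0; rewrite !ler_norml.
set S := \sum_(i < m) _; set B := beta (comb f n) (comb f n).
set rr := r (comb f n) (comb f n); set be := beta e e; set bne := beta _ e.
move=> cross S0 lrS /andP[_ rU] /andP[bL bU].
have r0 : 0 <= rr by rewrite -(pmulr_rge0 _ lambda0); exact: le_trans lrS.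
have tB : t * B <= `|t| * (M * S).
  apply: le_trans (ler_norm _) _; rewrite normrM ler_wpM2l// ler_norml.
  by rewrite bL bU.
have tr : - (t * be * rr) <= `|t| * (`|be| * (M' * S)).
  apply: le_trans (ler_norm _) _; rewrite normrN !normrM (ger0_norm r0) -mulrA.
  by rewrite ler_wpM2l// ler_wpM2l.
have tS : `|t| * K * S <= 2^-1 * S by rewrite ler_wpM2r.
have e3 : `|t| * K * S = `|t| * (M * S) + `|t| * (`|be| * (M' * S)) + `|t| * S.
  by rewrite /K; ring.
have tS0 : 0 <= `|t| * S by rewrite mulr_ge0.
have Cr : 0 <= 2 * Mb * t ^+ 2 * rr.
  by rewrite mulr_ge0// mulr_ge0 ?sqr_ge0// mulr_ge0.
lra.
Qed.

(** A space of dimension m + 1 contains a nonzero element that is q-orthogonal to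
    the m members of the family. *)
Lemma minmax_ge_eigenvalue m (n : 'I_m -> V) :
  (forall i, X (n i)) ->
  (forall u, X u -> (forall i, q (n i) u = 0) -> 0 <= q u u) ->
  frame_bounds X r m Q !=set0 -> lambda <= minmax X r m Q.
Proof.
move=> hn npos fne; apply: lb_le_inf => // s [u [hu ru] us].
have [c c0 cA] := nonzero_kernel (\matrix_(i < m.+1, j < m) q (u i) (n j)) (ltnSn m).
have hw : X (comb c u) by exact: subspace_comb.
have : 0 <= q (comb c u) (comb c u).
  apply: npos => // j; rewrite (form_sym hq)// (form_combl hX hq)//.
  have /matrixP/(_ ord0 j) := cA; rewrite !mxE => h; rewrite -[RHS]h.
  by apply: eq_bigr => i _; rewrite mxE.
have := us c; have := ru _ c0; rewrite /q => rw0 Qs q0.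
have : lambda * r (comb c u) (comb c u) <= s * r (comb c u) (comb c u) by lra.
by rewrite ler_pM2r.
Qed.

End at_eigenvalue.

End splitting.

Section generic_splitting.
Context {R : realType} {V : lmodType R} {E : topologicalType}.
Variables (X : set V) (r A : V -> V -> R) (B : (E -> R) -> V -> V -> R).
Variables (N : V -> R) (beta : nat -> E -> R) (kappa : R) (x0 : E).

Definition tame (b : E -> R) := continuous b /\ exists M, forall x, `|b x| <= M.

Hypotheses (hX : linear_subspace X) (hr : form_on X r).
Hypotheses (hA : form_on X A) (A0 : nonneg_on X A).
Hypothesis hB : forall b, tame b -> form_on X (B b).
Hypothesis BD : forall b b' (t : R) u v, tame b -> tame b' -> X u -> X v ->
  B (perturb b t b') u v = B b u v + t * B b' u v.
Hypothesis N0 : forall u, X u -> 0 <= N u.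
Hypothesis BN : forall b (rho : R) u, tame b -> (forall x, `|b x| <= rho) -> X u ->
  `|B b u u| <= rho * N u.
Hypothesis Bcst : forall (c : R) u, X u -> B (cst c) u u = c * N u.
Hypothesis definite : forall u, X u -> A u u = 0 -> N u = 0 -> r u u = 0.
Hypothesis compact_form : forall delta : R, 0 < delta ->
  exists k, exists2 l : 'I_k -> V -> R, forall j, linear_on X (l j) &
    forall u, X u -> (forall j, l j u = 0) -> r u u <= delta * A u u.
Hypotheses (cbeta : forall j, continuous (beta j)).
Hypotheses (beta1 : forall j x, `|beta j x| <= 1).
Hypothesis kappa0 : 0 < kappa.

Let b0 : E -> R := cst (2 * kappa).
Let Q b u v := A u v + B b u v.

Let tame_close (rho : R) (b : E -> R) : continuous b -> uclose rho b0 b -> tame b.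
Proof.
move=> cb bb; split=> //; exists (2 * kappa + rho) => x.
have := bb x; have := le_trans (normr_ge0 _) (bb x).
rewrite /b0 /= !ler_norml => h0 /andP[h1 h2]; apply/andP; split; last by lra.
have := kappa0; lra.
Qed.

Let tame_beta j : tame (beta j). Proof. by split=> //; exists 1. Qed.

Let tame_b0 : tame b0.
Proof. by split; [move=> x; exact: cvg_cst|exists `|2 * kappa| => x /=]. Qed.

Let tame_perturb b (t : R) b' : tame b -> tame b' -> tame (perturb b t b').
Proof.
move=> [cb [M bM]] [cb' [M' bM']]; split; first exact: continuous_perturb.
exists (M + `|t| * M') => x; apply: le_trans (ler_normD _ _) _.
by rewrite lerD// normrM ler_wpM2l.
Qed.

Let form_Q b : tame b -> form_on X (Q b).
Proof.
move=> tb; have := form_on_comb 1 hA (hB tb); rewrite /Q.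
by under [X in form_on _ X -> _]eq_fun do under eq_fun do rewrite mul1r.
Qed.

Let B_close b b' (rho : R) u : tame b -> tame b' -> uclose rho b b' -> X u ->
  `|B b u u - B b' u u| <= rho * N u.
Proof.
move=> tb tb' bb' hu; have -> : b = perturb b' 1 (perturb b (-1) b').
  by apply/funext => x; rewrite /perturb; ring.
have td := tame_perturb (-1) tb tb'.
rewrite BD// mul1r addrAC subrr add0r; apply: BN => // x.
by rewrite /perturb mulN1r.
Qed.

Let Q_ge b u : tame b -> uclose kappa b0 b -> X u -> kappa * N u <= Q b u u.
Proof.
move=> tb bb hu; have := B_close tame_b0 tb bb hu; rewrite Bcst// ler_norml.
by rewrite /Q; have := A0 hu => ? /andP[? ?]; lra.
Qed.

Let Q_ge0 b : tame b -> uclose kappa b0 b -> nonneg_on X (Q b).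
Proof.
move=> tb bb u hu; apply: le_trans (Q_ge tb bb hu).
by rewrite mulr_ge0 ?N0// ltW.
Qed.

Let Q_lip b b' (rho : R) u : tame b -> tame b' -> uclose kappa b0 b -> uclose rho b b' ->
  X u -> Q b' u u <= (1 + rho / kappa) * Q b u u.
Proof.
move=> tb tb' bb bb' hu.
have rho0 : 0 <= rho by exact: le_trans (bb' x0).
have := Q_ge tb bb hu; have := B_close tb tb' bb' hu; rewrite ler_norml.
move=> /andP[h1 _] h2; rewrite mulrDl mul1r.
have : rho * N u <= rho / kappa * Q b u u.
  by rewrite -mulrA ler_wpM2l// ler_pdivlMl.
rewrite /Q in h2 *; lra.
Qed.

Let minmax_lip m b b' (rho : R) : tame b -> tame b' ->
  uclose kappa b0 b -> uclose kappa b0 b' -> uclose rho b b' ->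
  minmax X r m (Q b') <= (1 + rho / kappa) * minmax X r m (Q b).
Proof.
move=> tb tb' bb bb' cbb.
have rho0 : 0 <= rho by exact: le_trans (cbb x0).
have rk : 0 <= rho / kappa by rewrite divr_ge0// ltW.
apply: minmax_scale => //; first exact: Q_ge0.
- exact: Q_ge0.
- by move=> u hu; exact: Q_lip.
- exists (1 + rho / kappa); first by rewrite ltr_pwDl.
  by move=> u hu; apply: Q_lip => // x; rewrite distrC.
Qed.

Let minmax_lipschitz m : exists L : R, forall b b' (rho : R),
  continuous b -> continuous b' -> uclose kappa b0 b -> uclose kappa b0 b' ->
  uclose rho b b' -> `|minmax X r m (Q b) - minmax X r m (Q b')| <= L * rho.
Proof.
have b00 : uclose kappa b0 b0 by move=> x; rewrite subrr normr0 ltW.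
exists (2 * minmax X r m (Q b0) / kappa) => b b' rho cb cb' bb bb' cbb.
have tb := tame_close cb bb; have tb' := tame_close cb' bb'.
have cb'b : uclose rho b' b by move=> x; rewrite distrC.
have rho0 : 0 <= rho by exact: le_trans (cbb x0).
have rk : 0 <= rho / kappa by rewrite divr_ge0// ltW.
have h1 := minmax_lip m tb tb' bb bb' cbb.
have h2 := minmax_lip m tb' tb bb' bb cb'b.
have h3 := minmax_lip m tame_b0 tb b00 bb bb.
have h4 := minmax_lip m tame_b0 tb' b00 bb' bb'.
rewrite divff ?gt_eqF// in h3 h4.
rewrite -[X in _ <= X]mulrA [kappa^-1 * _]mulrC.
have h5 : rho / kappa * minmax X r m (Q b) <= rho / kappa * (2 * minmax X r m (Q b0)).
  by rewrite ler_wpM2l.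
have h6 : rho / kappa * minmax X r m (Q b') <= rho / kappa * (2 * minmax X r m (Q b0)).
  by rewrite ler_wpM2l.
rewrite ler_norml; apply/andP; split; lra.
Qed.

Definition second_differences_small b := forall m j p, exists h : R,
  [/\ 0 < h, h <= p.+1%:R^-1 & - (h / p.+1%:R) <=
    minmax X r m (Q (perturb b h (beta j))) +
    minmax X r m (Q (perturb b (- h) (beta j))) - 2 * minmax X r m (Q b)].

Definition eigenvector b (lambda : R) e :=
  X e /\ forall u, X u -> Q b e u = lambda * r e u.

Let eigenvector_comb b (lambda : R) (a a' : R) e e' : tame b ->
  eigenvector b lambda e -> eigenvector b lambda e' ->
  eigenvector b lambda (a *: e + a' *: e').
Proof.
move=> tb [he qe] [he' qe']; have hae' := subspace_scale a' hX he'.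
split=> [|u hu]; first by case: hX => _; apply.
have hQ := form_Q tb.
rewrite (form_combll hQ)// (form_scalel hX hQ)// (form_combll hr)// (form_scalel hX hr)// qe// qe'//.
ring.
Qed.

Let eigenvalue_gt0 b (lambda : R) e : tame b -> uclose kappa b0 b ->
  eigenvector b lambda e -> r e e = 1 -> 0 < lambda.
Proof.
move=> tb bb [he qe] re; have := qe _ he; rewrite re mulr1 => Ql.
rewrite lt_neqAle -Ql Q_ge0// andbT; apply/eqP => Qe0.
have := Q_ge tb bb he; rewrite -Qe0 pmulr_rle0// => Ne.
have Ne0 : N e = 0 by apply/eqP; rewrite eq_le Ne N0.
have Be0 : B b e e = 0.
  have [_ [M bM]] := tb; have := BN tb bM he; rewrite Ne0 mulr0 normr_le0.
  by move/eqP.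
have Ae0 : A e e = 0 by move: Qe0; rewrite /Q Be0 addr0 => <-.
have := definite he Ae0 Ne0; rewrite re; lra.
Qed.

(** The upper bounds at b + h beta, from e1, and at b - h beta, from e2, add up to
    2 lambda + h (B(e1, e1) - B(e2, e2)) + O(h^2); a second difference that is not
    very negative forces the middle term to be nonnegative in the limit. *)
Let split_le b (lambda : R) e1 e2 j : tame b -> uclose (kappa / 2) b0 b ->
  second_differences_small b ->
  eigenvector b lambda e1 -> eigenvector b lambda e2 ->
  r e1 e1 = 1 -> r e2 e2 = 1 -> r e1 e2 = 0 ->
  B (beta j) e2 e2 <= B (beta j) e1 e1.
Proof.
move=> tb bb2 small ev1 ev2 r11 r22 r12.
have bb : uclose kappa b0 b by apply: uclose_weaken bb2; have := kappa0; lra.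
have lambda0 := eigenvalue_gt0 tb bb ev1 r11.
have [he1 qe1] := ev1; have [he2 qe2] := ev2.
have hQ := form_Q tb.
pose q u v := Q b u v + (- lambda) * r u v.
have hq : form_on X q by exact: form_on_comb.
have q1 u : X u -> q e1 u = 0 by move=> hu; rewrite /q qe1//; lra.
have q2 u : X u -> q e2 u = 0 by move=> hu; rewrite /q qe2//; lra.
have [k [l hl cl]] := compact_form (divr_gt0 ltr01 (mulr_gt0 (ltr0n R 2) lambda0)).
have [u hu lu|m [n0 n0neg n0max]] := maximal_negative hX hq hl.
  have Bb0 : 0 <= B b u u.
    apply: (@le_trans _ _ (kappa * N u)); first by rewrite mulr_ge0 ?N0// ltW.
    have := B_close tame_b0 tb bb hu; rewrite Bcst// ler_norml => /andP[_ ?].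
    have := kappa0; lra.
  have := cl u hu lu; rewrite mul1r ler_pdivlMl ?mulr_gt0// => rA.
  by rewrite /q /Q; have := A0 hu; lra.
have [n nneg [nmax n1 n2]] :=
  negative_orthogonal hX hr hQ he1 he2 r11 r22 r12 q1 q2 n0neg n0max.
have Q0 := Q_ge0 tb bb.
have hbj := hB (tame_beta j).
have [t1 [C1 [t10 C10 F1]]] :=
  minmax_at_eigenvector hX hr hQ lambda0 nneg he1 r11 q1 n1 Q0 hbj.
have [t2 [C2 [t20 C20 F2]]] :=
  minmax_at_eigenvector hX hr hQ lambda0 nneg he2 r22 q2 n2 Q0 hbj.
have lb : lambda <= minmax X r m (Q b).
  apply: (minmax_ge_eigenvalue hX hr hQ _ nmax); first by case: nneg.
  exists (lambda + 0 * B (beta j) e1 e1 + C1 * 0 ^+ 2).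
  have := F1 0; rewrite normr0 => /(_ (ltW t10)).
  by under [X in frame_bounds _ _ _ X _ -> _]eq_fun do under eq_fun do
    rewrite mul0r addr0.
apply/ler_addgt0Pl => eps eps0.
(* Scales at which both expansions hold, b remains above a positive constant, and
   the quadratic errors are below eps h. *)
pose T := Num.min (Num.min t1 t2) (Num.min (kappa / 2) (eps / (1 + C1 + C2))).
have T0 : 0 < T.
  have C0 : 0 < 1 + C1 + C2 by rewrite ltr_wpDr// ltr_wpDr.
  by rewrite !lt_min t10 t20 !divr_gt0.
pose p := Num.truncn T^-1.
have pT : p.+1%:R^-1 <= T.
  have /andP[_ h] := truncn_itv (ltW (eqbRL (invr_gt0 T) T0)).
  by rewrite -[leRHS]invrK lef_pV2 ?posrE ?invr_gt0// ltW.
have [h [h0 hp hd]] := small m j p.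
have hT : h <= T by exact: le_trans pT.
have /andP[/andP[ht1 ht2] /andP[hk he]] :
    ((h <= t1) && (h <= t2)) && ((h <= kappa / 2) && (h <= eps / (1 + C1 + C2))).
  by move: hT; rewrite !le_min.
have ub (t : R) e C : `|t| = h ->
   frame_bounds X r m (fun u v => Q b u v + t * B (beta j) u v)
      (lambda + t * B (beta j) e e + C * t ^+ 2) ->
   minmax X r m (Q (perturb b t (beta j))) <= lambda + t * B (beta j) e e + C * h ^+ 2.
  move=> th fb.
  have tb' := tame_perturb t tb (tame_beta j).
  apply: minmax_le => //.
    apply: Q_ge0 => //; apply: (@uclose_weaken _ _ (kappa / 2 + h)).
      by have := kappa0; lra.
    by apply: uclose_trans bb2 _; rewrite -th; exact: uclose_perturb.
  rewrite -th real_normK ?num_real//.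
  have [u [hu ru] uQ] := fb; exists u => // c; apply: le_trans (uQ c).
  have hc := subspace_comb c hX hu.
  by rewrite /Q BD// addrA.
have u1 := ub h e1 C1 (gtr0_norm h0) (F1 h _).
have u2 := ub (- h) e2 C2 _ (F2 (- h) _).
rewrite normrN (gtr0_norm h0) in u1 u2.
have {}u1 := u1 ht1; have {}u2 := u2 erefl ht2.
have ph : h / p.+1%:R <= h * (eps / (1 + C1 + C2)).
  rewrite ler_pM2l//; apply: le_trans pT _; rewrite /T ge_min; apply/orP; right.
  by rewrite ge_min lexx orbT.
have e3 : h * (B (beta j) e2 e2) <= h * (eps / (1 + C1 + C2) + B (beta j) e1 e1 + (C1 + C2) * h).
  move: hd u1 u2 ph lb; rewrite [h ^+ 2]expr2; move: (eps / _) (h / _) => y z.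
  rewrite mulrDr mulrDr.
  move: (B _ e1 e1) (B _ e2 e2) (minmax _ _ _ _) (minmax _ _ _ _) (minmax _ _ _ _).
  by move=> B1 B2 L1 L2 L3 *; lra.
rewrite ler_pM2l// in e3; apply: le_trans e3 _.
have C0 : 0 < 1 + C1 + C2 by rewrite ltr_wpDr// ltr_wpDr.
have : (C1 + C2) * h <= (C1 + C2) * (eps / (1 + C1 + C2)).
  by rewrite ler_wpM2l// addr_ge0.
have : (1 + C1 + C2) * (eps / (1 + C1 + C2)) = eps.
  by rewrite mulrCA divff ?mulr1// gt_eqF.
lra.
Qed.

(** The form Q_b is the sum of A, which stands for the fixed part of the energy, and
    of B b, which is linear in the potential b; N is the form of the potential 1.
    The off-diagonal identity is the diagonal one for the rotated pair
    (e1 + e2) / sqrt 2 and (e1 - e2) / sqrt 2. *)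
Lemma generic_splitting : exists b, [/\ continuous b, uclose (kappa / 2) b0 b &
  forall (lambda : R) e1 e2, eigenvector b lambda e1 -> eigenvector b lambda e2 ->
    r e1 e1 = 1 -> r e2 e2 = 1 -> r e1 e2 = 0 ->
    forall j, B (beta j) e1 e1 = B (beta j) e2 e2 /\ B (beta j) e1 e2 = 0].
Proof.
have cb0 : continuous b0 by case: tame_b0.
have [b [cb bb small]] :=
  generic_second_difference kappa0 cb0 cbeta beta1 minmax_lipschitz.
have tb := tame_close cb bb.
exists b; split=> // lambda e1 e2 ev1 ev2 r11 r22 r12 j.
have [he1 _] := ev1; have [he2 _] := ev2.
have hbj := hB (tame_beta j).
have r21 : r e2 e1 = 0 by rewrite (form_sym hr).
have eqB f1 f2 : eigenvector b lambda f1 -> eigenvector b lambda f2 ->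
    r f1 f1 = 1 -> r f2 f2 = 1 -> r f1 f2 = 0 ->
    B (beta j) f1 f1 = B (beta j) f2 f2.
  move=> ev1' ev2' r11' r22' r12'; apply/eqP; rewrite eq_le.
  rewrite (split_le j tb bb small ev1' ev2')// (split_le j tb bb small ev2' ev1')//.
  by case: ev1' => h1 _; case: ev2' => h2 _; rewrite (form_sym hr).
split; first exact: eqB.
(* The rotated pair is also r-orthonormal. *)
pose s : R := (Num.sqrt 2)^-1.
have s2 : s * s = 2^-1.
  by rewrite -expr2 /s exprVn sqr_sqrtr.
have hse1 := subspace_scale s hX he1.
have hse2 (a : R) := subspace_scale a hX he2.
have expand f a a' : form_on X f -> f (s *: e1 + a *: e2) (s *: e1 + a' *: e2) =
    s * s * f e1 e1 + s * (a + a') * f e1 e2 + a * a' * f e2 e2.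
  move=> hf; have hw := subspace_add hX hse1 (hse2 a').
  rewrite (form_combll hf)// (form_scalel hX hf)// !(form_addr hX hf)// !(form_scaler hX hf)//.
  by rewrite (form_sym hf he2 he1); ring.
have := eqB (s *: e1 + s *: e2) (s *: e1 + (- s) *: e2).
rewrite !(expand r)// !(expand (B (beta j)))// r11 r22 r12 mulrNN !mulr0 !mulrN s2.
move=> h; have {}h : s * (s + s) * B (beta j) e1 e2 = s * (- s - s) * B (beta j) e1 e2.
  have : 2^-1 + 2^-1 = 1 :> R by lra.
  move=> e; have := h (eigenvector_comb _ _ tb ev1 ev2) (eigenvector_comb _ _ tb ev1 ev2).
  rewrite !mulr1 !addr0 e subrr => /(_ erefl erefl erefl); lra.
have e4 : s * (s + s) = 1 by rewrite mulrDr s2; lra.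
have e5 : s * (- s - s) = -1 by rewrite mulrBr mulrN s2; lra.
by move: h; rewrite e4 e5; lra.
Qed.

End generic_splitting.

(** * Borel sets are measurable for both outer measures *)

Section borel_rV.
Context {R : realType} {n : nat}.

Definition halfspace (i : 'I_n) (c : R) : set 'rV[R]_n := [set x | x ord0 i <= c].

(** Generators of the Borel sets that suit both outer measures: a half-space cuts a
    box into boxes, and separates sets by one coordinate. *)
Definition halfspaces : set (set 'rV[R]_n) :=
  [set A | exists i c, A = halfspace i c].

Local Notation Bo := (g_sigma_algebraType halfspaces).

Lemma measurable_halfspace i c : measurable (halfspace i c : set Bo).
Proof. by apply: sub_sigma_algebra; exists i, c. Qed.

Lemma measurable_coord i : measurable_fun [set: Bo] (fun x : Bo => x ord0 i).
Proof.
apply: (measurability _ (RGenOInfty.measurableE R)) => _ [_ [c ->] <-].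
have -> : [set: Bo] `&` (fun x : Bo => x ord0 i) @^-1` `]c, +oo[%classic =
    ~` halfspace i c.
  apply/seteqP; split => x /=; first by
    rewrite in_itv/= andbT => -[_ h]; apply/negP; rewrite -ltNge.
  by move=> /negP; rewrite -ltNge => h; split => //; rewrite in_itv/= h.
by apply: measurableC; exact: measurable_halfspace.
Qed.

Definition rect (p q : 'rV[R]_n) : set 'rV[R]_n :=
  [set x | forall i, p ord0 i < x ord0 i < q ord0 i].

Lemma measurable_coord_lt i c : measurable [set x : Bo | c < x ord0 i].
Proof.
have -> : [set x : Bo | c < x ord0 i] = ~` halfspace i c.
  apply/seteqP; split => x /=; first by move=> h; apply/negP; rewrite -ltNge.
  by move=> /negP; rewrite -ltNge.
by apply: measurableC; exact: measurable_halfspace.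
Qed.

Lemma measurable_coord_gt i c : measurable [set x : Bo | x ord0 i < c].
Proof.
have -> : [set x : Bo | x ord0 i < c] =
    [set: Bo] `&` (fun x : Bo => x ord0 i) @^-1` `]-oo, c[%classic.
  by rewrite setTI; apply/seteqP; split => x /=; rewrite in_itv.
by apply: measurable_coord => //; exact: measurable_itv.
Qed.

Lemma measurable_forall_coord (P : 'I_n -> R -> Prop) :
  (forall i, measurable [set x : Bo | P i (x ord0 i)]) ->
  measurable [set x : Bo | forall i, P i (x ord0 i)].
Proof.
move=> mP; have -> : [set x : Bo | forall i, P i (x ord0 i)] =
    \bigcap_(i in [set: 'I_n]) [set x | P i (x ord0 i)].
  by apply/seteqP; split => x /= h i; [move=> _; exact: h|exact: h].
by apply: fin_bigcap_measurable => // i _; exact: mP.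
Qed.

Lemma measurable_rect p q : measurable (rect p q : set Bo).
Proof.
apply: (@measurable_forall_coord (fun i t => p ord0 i < t < q ord0 i)) => i.
have -> : [set x : Bo | p ord0 i < x ord0 i < q ord0 i] =
    [set x | p ord0 i < x ord0 i] `&` [set x | x ord0 i < q ord0 i].
  by apply/seteqP; split => x /=; [move/andP | move/andP].
by apply: measurableI; [exact: measurable_coord_lt|exact: measurable_coord_gt].
Qed.

Definition rat_rect (pq : 'rV[rat]_n * 'rV[rat]_n) : set 'rV[R]_n :=
  rect (map_mx ratr pq.1) (map_mx ratr pq.2).

Lemma nbhs_rV (x : 'rV[R]_n) (U : set 'rV[R]_n) : nbhs x U ->
  exists2 e : R, 0 < e & forall y : 'rV[R]_n, (forall i, `|x ord0 i - y ord0 i| < e) -> U y.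
Proof.
move=> /nbhs_ballP[e /= e0 eU]; exists e => // y xy; apply: eU; split=> // i j.
by rewrite (ord1 i); exact: xy.
Qed.

Lemma open_rat_rect (U : set 'rV[R]_n) : open U ->
  U = \bigcup_(pq in [set pq | rat_rect pq `<=` U]) rat_rect pq.
Proof.
move=> oU; apply/seteqP; split => [x Ux|x [pq /=]]; last exact.
have [e e0 eU] := nbhs_rV (open_nbhs_nbhs (conj oU Ux)).
have lt1 i : x ord0 i - e < x ord0 i by rewrite ltrBlDr ltrDl.
have lt2 i : x ord0 i < x ord0 i + e by rewrite ltrDl.
have [p Hp] := choice (fun i => rat_in_itvoo (lt1 i)).
have [q Hq] := choice (fun i => rat_in_itvoo (lt2 i)).
exists (\row_i p i, \row_i q i) => /=.
  move=> y yrect; apply: eU => i; have := yrect i; rewrite !mxE.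
  have := Hp i; have := Hq i; rewrite !in_itv/= => /andP[? ?] /andP[? ?] /andP[? ?].
  by rewrite ltr_distl; apply/andP; split; lra.
move=> i; rewrite !mxE; have := Hp i; have := Hq i.
by rewrite !in_itv/= => /andP[-> _] /andP[_ ->].
Qed.

Lemma open_borel (U : set 'rV[R]_n) : open U -> measurable (U : set Bo).
Proof.
move=> /open_rat_rect ->; rewrite bigcup_mkcond.
apply: countable_bigcupT_measurable => [|pq]; first exact: countableP.
by case: ifP => _; [exact: measurable_rect | exact: measurable0].
Qed.

Lemma closed_borel (C : set 'rV[R]_n) : closed C -> measurable (C : set Bo).
Proof. by move=> /closed_openC/open_borel/measurableC; rewrite setCK. Qed.

Lemma continuous_borel (f : 'rV[R]_n -> R) : continuous f ->
  measurable_fun setT (f : Bo -> R).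
Proof.
move=> /continuousP cf; apply: (measurability _ (RGenOpens.measurableE R)).
move=> _ [_ [a [b ->] <-]]; rewrite setTI; apply: open_borel.
exact/cf/interval_open.
Qed.

Section outer_measure.
Variable mu : {outer_measure set 'rV[R]_n -> \bar R}.
Hypothesis mu_halfspace : forall i c, mu.-caratheodory (halfspace i c).

Lemma borel_caratheodory (A : set Bo) :
  measurable A -> mu.-caratheodory (A : set 'rV[R]_n).
Proof.
move: A; apply: smallest_sub; last by move=> _ [i [c ->]]; exact: mu_halfspace.
split.
- exact: caratheodory_measurable_set0.
- by move=> A hA; rewrite setTD; exact: caratheodory_measurable_setC.
- exact: caratheodory_measurable_bigcup.
Qed.

End outer_measure.

End borel_rV.
Notation borel_rV R n := (g_sigma_algebraType (@halfspaces R n)).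

Section gauge_split.
Context {R : realType} {T : pointedType}.
Local Open Scope ereal_scope.

Lemma gauge_outer_split (w : set T -> \bar R) (P Q X : set T) :
  (forall A, 0 <= w A) -> (forall A, w (A `&` P) + w (A `&` Q) <= w A) ->
  gauge_outer w (X `&` P) + gauge_outer w (X `&` Q) <= gauge_outer w X.
Proof.
move=> w0 wPQ; apply: le_ereal_inf_tmp => _ [A XA <-].
apply: (@le_trans _ _ (\sum_(k <oo) w (A k `&` P) + \sum_(k <oo) w (A k `&` Q))).
  apply: leeD; apply: ereal_inf_lbound.
    exists (fun k => A k `&` P) => // x [/XA[k _ Akx] Px].
    by exists k.
  exists (fun k => A k `&` Q) => // x [/XA[k _ Akx] Qx].
  by exists k.
rewrite -nneseriesD//; apply: lee_nneseries => //.
by move=> i _ _; exact: adde_ge0.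
Qed.

End gauge_split.

Section lebesgue_borel.
Context {R : realType} {n : nat}.
Local Open Scope ereal_scope.

Definition obox (a b : 'rV[R]_n) : set 'rV[R]_n :=
  [set x | forall i, (a ord0 i < x ord0 i <= b ord0 i)%R].

Definition volume (a b : 'rV[R]_n) : R := (\prod_i (b ord0 i - a ord0 i))%R.

Lemma box_gauge_obox (a b : 'rV[R]_n) : (forall i, (a ord0 i < b ord0 i)%R) ->
  box_gauge (obox a b) <= (volume a b)%:E.
Proof.
move=> ab; rewrite /box_gauge; case: asboolP => _; last first.
  by apply: ereal_inf_lbound; exists a, b.
by rewrite lee_fin; apply: prodr_ge0 => i _; rewrite subr_ge0 ltW.
Qed.

Definition set_coord (a : 'rV[R]_n) i c : 'rV[R]_n :=
  (\row_j if j == i then c else a ord0 j)%R.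

Lemma set_coord_eq a i c : set_coord a i c ord0 i = c.
Proof. by rewrite mxE eqxx. Qed.

Lemma set_coord_neq a i c j : j != i -> set_coord a i c ord0 j = a ord0 j.
Proof. by rewrite mxE => /negPf ->. Qed.

Lemma volume_split (a b : 'rV[R]_n) i c :
  volume a b = (volume a (set_coord b i c) + volume (set_coord a i c) b)%R.
Proof.
have vD1 (a' b' : 'rV[R]_n) : volume a' b' =
    ((b' ord0 i - a' ord0 i) * \prod_(j < n | j != i) (b' ord0 j - a' ord0 j))%R.
  by rewrite /volume (bigD1 i).
rewrite !vD1 !set_coord_eq.
have -> : (\prod_(j < n | j != i) (set_coord b i c ord0 j - a ord0 j) =
    \prod_(j < n | j != i) (b ord0 j - a ord0 j))%R.
  by apply: eq_bigr => j ji; rewrite set_coord_neq.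
have -> : (\prod_(j < n | j != i) (b ord0 j - set_coord a i c ord0 j) =
    \prod_(j < n | j != i) (b ord0 j - a ord0 j))%R.
  by apply: eq_bigr => j ji; rewrite set_coord_neq.
by rewrite -mulrDl; congr (_ * _)%R; ring.
Qed.

Lemma box_gauge_halfspace i c (A : set 'rV[R]_n) :
  box_gauge (A `&` halfspace i c) + box_gauge (A `&` ~` halfspace i c)
  <= box_gauge A.
Proof.
rewrite [leRHS]/box_gauge; case: asboolP => [->|A0].
  by rewrite !set0I box_gauge0 adde0.
apply: le_ereal_inf_tmp => _ [a [b [ab -> ->]]]; rewrite -/(obox a b) -/(volume a b).
have vE : box_gauge (obox a b) <= (volume a b)%:E by exact: box_gauge_obox.
have [ca|ac] := leP c (a ord0 i).
  have -> : obox a b `&` halfspace i c = set0.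
    rewrite -subset0 => x [/(_ i)/andP[ax _]]; rewrite /halfspace/= => /(lt_le_trans ax).
    by rewrite ltNge ca.
  rewrite box_gauge0 add0e; apply: le_trans vE.
  have -> // : obox a b `&` ~` halfspace i c = obox a b.
  apply/setIidl => x /(_ i)/andP[ax _]; rewrite /halfspace/=; apply/negP.
  by rewrite -ltNge (le_lt_trans ca).
have [bc|cb] := leP (b ord0 i) c.
  have -> : obox a b `&` ~` halfspace i c = set0.
    rewrite -subset0 => x [/(_ i)/andP[_ xb]]; apply; rewrite /halfspace/=.
    exact: le_trans bc.
  rewrite box_gauge0 adde0; apply: le_trans vE.
  have -> // : obox a b `&` halfspace i c = obox a b.
  by apply/setIidl => x /(_ i)/andP[_ xb]; exact: le_trans bc.
have -> : obox a b `&` halfspace i c = obox a (set_coord b i c).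
  apply/seteqP; split => x /=.
    move=> [xab xc] j; have [->|ji] := eqVneq j i.
      by rewrite set_coord_eq; have /andP[-> _] := xab i.
    by rewrite set_coord_neq.
  move=> xab; split.
    move=> j; have := xab j; have [->|ji] := eqVneq j i; last by rewrite set_coord_neq.
    by rewrite set_coord_eq => /andP[-> /le_trans ->]//; exact: ltW.
  by have := xab i; rewrite set_coord_eq => /andP[].
have -> : obox a b `&` ~` halfspace i c = obox (set_coord a i c) b.
  apply/seteqP; split => x /=.
    move=> [xab /negP]; rewrite /halfspace/= -ltNge => xc j.
    have [->|ji] := eqVneq j i; last by rewrite set_coord_neq.
    by rewrite set_coord_eq xc; have /andP[_ ->] := xab i.
  move=> xab; split.
    move=> j; have := xab j; have [->|ji] := eqVneq j i; last by rewrite set_coord_neq.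
    by rewrite set_coord_eq => /andP[/(lt_trans ac) -> ->].
  have := xab i; rewrite set_coord_eq => /andP[cx _]; apply/negP.
  by rewrite /halfspace/= -ltNge.
rewrite (volume_split a b i c) EFinD; apply: leeD; apply: box_gauge_obox => j.
  by have [->|ji] := eqVneq j i; rewrite ?set_coord_eq ?set_coord_neq.
by have [->|ji] := eqVneq j i; rewrite ?set_coord_eq ?set_coord_neq.
Qed.

Lemma lebesgue_halfspace i c :
  (@lebesgue_outer R n).-caratheodory (halfspace i c).
Proof.
apply: le_caratheodory_measurable => X; apply: gauge_outer_split.
  exact: box_gauge_ge0.
exact: box_gauge_halfspace.
Qed.

Lemma le_lebesgue_obox (a b : 'rV[R]_n) : (forall i, (a ord0 i < b ord0 i)%R) ->
  lebesgue_outer (obox a b) <= (volume a b)%:E.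
Proof.
move=> ab; apply: le_trans (box_gauge_obox ab).
apply: (@ereal_inf_lbound); exists (fun k => if k == 0%N then obox a b else set0).
  by move=> x abx; exists 0%N.
rewrite (@nneseriesD1 R _ 0%N xpredT)//=; last by move=> k _; exact: box_gauge_ge0.
rewrite eseries0 ?adde0// => k _ /= k0; by rewrite (negPf k0) box_gauge0.
Qed.

End lebesgue_borel.

Section hausdorff_borel.
Context {R : realType} {n k : nat}.
Local Open Scope ereal_scope.
Implicit Types (A X P Q : set 'rV[R]_n) (delta eta : R).

Local Notation w delta := (@hausdorff_gauge R n k delta).
Local Notation H := (@hausdorff_outer R n k).

Lemma le_coord_enorm (x : 'rV[R]_n) i : (`|x ord0 i| <= enorm x)%R.
Proof.
rewrite /enorm -(sqrtr_sqr (x ord0 i)); apply: ler_wsqrtr.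
by rewrite (bigD1 i)//= lerDl sumr_ge0// => j _; exact: sqr_ge0.
Qed.

Lemma diam_le A (c : \bar R) :
  (forall x y, A x -> A y -> (enorm (x - y))%:E <= c) -> diam A <= c.
Proof. by move=> h; apply: ge_ereal_sup => _ [x Ax] [y Ay <-]; exact: h. Qed.

Lemma le_diam A x y : A x -> A y -> (enorm (x - y))%:E <= diam A.
Proof. by move=> Ax Ay; apply: ereal_sup_ubound; exists x => //; exists y. Qed.

Lemma enorm0 : enorm (0 : 'rV[R]_n) = 0%R.
Proof. by rewrite /enorm big1 ?sqrtr0// => i _; rewrite mxE expr0n. Qed.

Lemma diam_ge0 A : A !=set0 -> 0 <= diam A.
Proof. by move=> [x Ax]; have := le_diam Ax Ax; rewrite subrr enorm0. Qed.

Lemma diamS A P : A `<=` P -> diam A <= diam P.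
Proof. by move=> AP; apply: diam_le => x y /AP Px /AP Py; exact: le_diam. Qed.

Lemma gauge_nonempty delta A : A !=set0 -> diam A <= delta%:E ->
  w delta A = (ball_volume R k * (fine (diam A) / 2) ^+ k)%R%:E.
Proof.
move=> /set0P/eqP A0 dA; rewrite /hausdorff_gauge; case: asboolP => // _.
by rewrite dA.
Qed.

Lemma gauge_big delta A : A !=set0 -> ~~ (diam A <= delta%:E) -> w delta A = +oo.
Proof.
move=> /set0P/eqP A0 /negPf dA; rewrite /hausdorff_gauge; case: asboolP => // _.
by rewrite dA.
Qed.

Lemma le_hausdorff_gauge delta A P : A `<=` P -> w delta A <= w delta P.
Proof.
move=> AP; have [A0|/set0P/negP/negPn/eqP ->] := pselect (A !=set0); last first.
  by rewrite hausdorff_gauge0 hausdorff_gauge_ge0.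
have P0 : P !=set0 by case: A0 => x /AP Px; exists x.
have [dP|dP] := boolP (diam P <= delta%:E); last by rewrite (gauge_big P0 dP) leey.
have dA : diam A <= delta%:E by exact: le_trans (diamS AP) dP.
rewrite !gauge_nonempty// lee_fin ler_wpM2l// ?ball_volume_ge0//.
have fA : diam A \is a fin_num by rewrite ge0_fin_numE ?diam_ge0// (le_lt_trans dA)// ltry.
have fP : diam P \is a fin_num by rewrite ge0_fin_numE ?diam_ge0// (le_lt_trans dP)// ltry.
apply: lerXn2r; rewrite ?nnegrE ?divr_ge0 ?fine_ge0 ?diam_ge0//.
by rewrite ler_pM2r ?invr_gt0// fine_le// diamS.
Qed.

Lemma hausdorff_gauge_anti delta delta' A : (delta <= delta')%R ->
  w delta' A <= w delta A.
Proof.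
move=> dd; have [A0|/set0P/negP/negPn/eqP ->] := pselect (A !=set0); last first.
  by rewrite !hausdorff_gauge0.
have [dA|dA] := boolP (diam A <= delta%:E); last by rewrite (gauge_big A0 dA) leey.
by rewrite !gauge_nonempty// (le_trans dA)// lee_fin.
Qed.

Lemma gauge_outer_mono (w1 w2 : set 'rV[R]_n -> \bar R) A :
  (forall B, 0 <= w1 B) -> (forall B, w1 B <= w2 B) ->
  gauge_outer w1 A <= gauge_outer w2 A.
Proof.
move=> w0 w12; apply: le_ereal_inf_tmp => _ [F AF <-].
apply: (@le_trans _ _ (\sum_(j <oo) w1 (F j))).
  by apply: ereal_inf_lbound; exists F.
exact: lee_nneseries.
Qed.

Lemma gauge_outer_le_hausdorff delta A : (0 < delta)%R ->
  gauge_outer (w delta) A <= H A.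
Proof. by move=> d0; apply: ereal_sup_ubound; exists delta. Qed.

Lemma gauge_separated delta eta A P Q i : (delta < eta)%R ->
  (forall x y, P x -> Q y -> (eta <= `|x ord0 i - y ord0 i|)%R) ->
  w delta (A `&` P) + w delta (A `&` Q) <= w delta A.
Proof.
move=> de PQ.
have [A0|/set0P/negP/negPn/eqP ->] := pselect (A !=set0); last first.
  by rewrite !set0I !hausdorff_gauge0 adde0.
have [dA|dA] := boolP (diam A <= delta%:E); last by rewrite (gauge_big A0 dA) leey.
have [[x [Ax Px]]|/set0P/negP/negPn/eqP ->] := pselect (A `&` P !=set0); last first.
  by rewrite hausdorff_gauge0 add0e; apply: le_hausdorff_gauge => y [].
suff -> : A `&` Q = set0.
  by rewrite hausdorff_gauge0 adde0; apply: le_hausdorff_gauge => y [].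
rewrite -subset0 => y [Ay Qy].
have := le_trans (le_diam Ax Ay) dA; rewrite lee_fin.
have := le_coord_enorm (x - y) i; rewrite !mxE.
by have := PQ _ _ Px Qy; move=> h1 h2 h3; move: (le_lt_trans (le_trans h1 (le_trans h2 h3)) de); rewrite ltxx.
Qed.

(** Covering sets of small diameter meet at most one of two sets at positive
    distance, so that a cover of X splits into covers of the two parts.  The two
    suprema over the scale of the cover are taken one at a time. *)
Lemma hausdorff_separated eta X P Q i : (0 < eta)%R ->
  (forall x y, P x -> Q y -> (eta <= `|x ord0 i - y ord0 i|)%R) ->
  H (X `&` P) + H (X `&` Q) <= H X.
Proof.
move=> eta0 PQ.
have key (d1 d2 : R) : (0 < d1)%R -> (0 < d2)%R ->
    gauge_outer (w d1) (X `&` P) + gauge_outer (w d2) (X `&` Q) <= H X.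
  move=> d10 d20; pose d := Num.min (Num.min d1 d2) (eta / 2)%R.
  have d0 : (0 < d)%R by rewrite !lt_min d10 d20 divr_gt0.
  apply: (@le_trans _ _ (gauge_outer (w d) (X `&` P) + gauge_outer (w d) (X `&` Q))).
    apply: leeD; apply: gauge_outer_mono => B; rewrite ?hausdorff_gauge_ge0//.
      by apply: hausdorff_gauge_anti; rewrite !ge_min lexx.
    by apply: hausdorff_gauge_anti; rewrite !ge_min lexx orbT.
  apply: le_trans (gauge_outer_le_hausdorff _ d0).
  apply: gauge_outer_split => [A|A]; first exact: hausdorff_gauge_ge0.
  apply: (@gauge_separated _ eta) PQ.
  by rewrite gt_min; apply/orP; right; rewrite ltr_pdivrMr// ltr_pMr// ltr1n.
have [->|Xoo] := eqVneq (H X) +oo; first exact: leey.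
have Xfin : H X \is a fin_num.
  by rewrite ge0_fin_numE ?ltey// hausdorff_outer_ge0.
have fin A : A `<=` X -> H A \is a fin_num.
  move=> AX; rewrite ge0_fin_numE ?hausdorff_outer_ge0//.
  by rewrite (le_lt_trans (le_hausdorff_outer k AX))// ltey.
have gfin d A : (0 < d)%R -> A `<=` X -> gauge_outer (w d) A \is a fin_num.
  move=> d0 AX; rewrite ge0_fin_numE ?gauge_outer_ge0//; last exact: hausdorff_gauge_ge0.
  rewrite (le_lt_trans (gauge_outer_le_hausdorff _ d0))// ltey_eq fin//.
have fP : H (X `&` P) \is a fin_num by apply: fin => x [].
rewrite addeC -leeBrDr//; apply: ge_ereal_sup => _ [d2 d20 <-].
rewrite leeBrDr// addeC -leeBrDr; last by apply: gfin => // x [].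
apply: ge_ereal_sup => _ [d1 d10 <-].
rewrite leeBrDr; first exact: key.
by apply: gfin => // x [].
Qed.

(** Caratheodory's argument: the complement of the half-space is exhausted by the sets
    G j at distance 1 / (j + 1), and the slices D j between consecutive ones are
    summable, because every second slice is at positive distance from the others. *)
Lemma hausdorff_halfspace i (c : R) : H.-caratheodory (halfspace i c).
Proof.
apply: le_caratheodory_measurable => X.
change (H (X `&` halfspace i c) + H (X `&` ~` halfspace i c) <= H X).
have [->|Xoo] := eqVneq (H X) +oo; first exact: leey.
have fin A : A `<=` X -> H A \is a fin_num.
  move=> AX; rewrite ge0_fin_numE ?hausdorff_outer_ge0//.
  by rewrite (le_lt_trans (le_hausdorff_outer k AX))// ltey.
(* Levels that decrease to c. *)
pose a (j : nat) : R := (c + j.+1%:R^-1)%R.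
have a_dec j : (a j.+1 < a j)%R by rewrite ltrD2l ltf_pV2 ?posrE// ltr_nat.
pose gt t : set 'rV[R]_n := [set x | (t < x ord0 i)%R].
pose G j := X `&` gt (a j).
pose D j := X `&` (gt (a j.+1) `&` halfspace i (a j)).
have GX j : G j `<=` X by move=> x [].
have DX j : D j `<=` X by move=> x [].
pose g j : R := fine (H (G j)).
have gE j : H (G j) = (g j)%:E by rewrite fineK// fin.
pose d j : R := fine (H (D j)).
have dE j : H (D j) = (d j)%:E by rewrite fineK// fin.
(* One slice is skipped between G j and D j.+1, which leaves a gap. *)
have gd j : (g j + d j.+1 <= g j.+2)%R.
  rewrite -lee_fin EFinD -gE -dE -gE.
  have -> : G j = G j.+2 `&` gt (a j).
    apply/seteqP; split => x /=; last by move=> [[]].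
    move=> [Xx h]; do 2?split => //.
    by apply: lt_trans h; apply: lt_trans (a_dec _) (a_dec _).
  have -> : D j.+1 = G j.+2 `&` halfspace i (a j.+1).
    by apply/seteqP; split => x /=; [move=> [? []]|move=> [[? ?] ?]].
  apply: (@hausdorff_separated (a j - a j.+1) _ _ _ i); first by rewrite subr_gt0.
  move=> x y /= ax ya; apply: le_trans (ler_norm _); move: ax ya; rewrite /gt/halfspace/=; lra.
pose h : R := fine (H X).
have hE : H X = h%:E by rewrite fineK// fin.
have low j : (fine (H (X `&` halfspace i c)) + g j <= h)%R.
  rewrite -lee_fin EFinD -gE -hE fineK; last by apply: fin => x [].
  rewrite addeC; apply: (@hausdorff_separated (j.+1%:R^-1) _ _ _ i); first by rewrite invr_gt0.
  move=> x y /= ax yc; apply: le_trans (ler_norm _); move: ax yc; rewrite /gt/a/halfspace/=.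
  by move: (_^-1)%R => q; lra.
have g_inc j : (g j <= g j.+1)%R.
  rewrite -lee_fin -!gE; apply: le_hausdorff_outer => x [Xx xa]; split => //.
  by apply: lt_trans xa; exact: a_dec.
pose L : R := sup (range g).
have g_le j : (g j <= h)%R.
  by rewrite -lee_fin -gE -hE; apply: le_hausdorff_outer.
have hsup : has_sup (range g) by split; [exists (g 0%N); exists 0%N|exists h => _ [j _ <-]].
have gL j : (g j <= L)%R by apply: ub_le_sup; [case: hsup|exists j].
have sumd N M : (\sum_(0 <= j < M) d (N + j).+1 <= g (N + M)%N + g (N + M).+1%N - g N - g N.+1)%R.
  elim: M => [|M IH]; first by rewrite addn0 big_geq//; lra.
  rewrite addnS big_nat_recr//=.
  by have := gd (N + M)%N; move: IH; lra.
have cover N : ~` halfspace i c `&` X `<=` G N.+1 `|` \bigcup_j D (N + j).+1.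
  move=> x [/negP]; rewrite -ltNge => cx Xx.
  have [|xa] := ltP (a N.+1) (x ord0 i); first by left.
  right; have : exists j, (a (N + j).+2 < x ord0 i)%R.
    have xc : (0 < x ord0 i - c)%R by rewrite subr_gt0.
    have [q qx] : exists q : nat, ((x ord0 i - c)^-1 < q.+1%:R)%R.
      exists (Num.truncn (x ord0 i - c)^-1).
      by have /andP[] := truncn_itv (ltW (eqbRL (invr_gt0 (x ord0 i - c)) xc)).
    exists q; rewrite /a -ltrBrDl -[X in (_ < X)%R]invrK ltf_pV2 ?posrE ?invr_gt0//.
    by apply: lt_le_trans qx _; rewrite ler_nat ltnS !leqW// leq_addl.
  move=> /ex_minnP [[|j] aj minj].
    exists 0%N => //; rewrite addn0 in aj *; split => //.
  exists j.+1 => //; split => //; split => //.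
  rewrite /halfspace/= leNgt; apply/negP => ajx.
  by have := minj j; rewrite -addnS ltnn => /(_ ajx).
have up eps : (0 < eps)%R -> H (X `&` ~` halfspace i c) <= (L + 2 * eps)%:E.
  move=> eps0; have [N hN] : exists N, (L - eps < g N)%R.
    by have [_ [N _ <-] ?] := sup_adherent eps0 hsup; exists N.
  rewrite setIC; apply: le_trans (le_hausdorff_outer k (@cover N)) _.
  apply: (@le_trans _ _ (H (G N.+1) + H (\bigcup_j D (N + j).+1))).
    exact: outer_measureU2.
  rewrite (_ : L + 2 * eps = g N.+1 + (L + 2 * eps - g N.+1))%R; last by ring.
  rewrite EFinD gE leeD2l//.
  apply: le_trans (hausdorff_outer_sigma_subadditive _ _) _.
  apply: lime_le; first by apply: is_cvg_nneseries => *; exact: hausdorff_outer_ge0.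
  apply: nearW => M.
  have -> : \sum_(0 <= j < M) H (D (N + j).+1) = (\sum_(0 <= j < M) d (N + j).+1)%:E.
    by rewrite -sumEFin; apply: eq_bigr => j _; rewrite dE.
  rewrite lee_fin; apply: le_trans (sumd N M) _.
  have := gL (N + M)%N; have := gL (N + M).+1; have := hN; lra.
have {up} up : H (X `&` ~` halfspace i c) <= L%:E.
  apply/lee_addgt0Pr => eps eps0; rewrite -EFinD.
  have -> : (eps = 2 * (eps / 2))%R by rewrite mulrC divfK.
  by apply: up; rewrite divr_gt0.
have f1 : H (X `&` halfspace i c) \is a fin_num by apply: fin => x [].
rewrite -(fineK f1) hE; apply: (@le_trans _ _ ((fine (H (X `&` halfspace i c)))%:E + L%:E)).
  by rewrite leeD2l.
rewrite -EFinD lee_fin addrC -lerBrDr; apply: ge_sup; first by exists (g 0%N); exists 0%N.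
by move=> _ [j _ <-]; rewrite lerBrDr addrC; exact: low.
Qed.

End hausdorff_borel.

Section borel_regularity.
Context {R : realType} {n : nat}.
Local Open Scope ereal_scope.
Implicit Types (A X : set 'rV[R]_n).
Local Notation Bo := (borel_rV R n).

Lemma gauge_outer_regular (w : set 'rV[R]_n -> \bar R) X :
  (forall A, 0 <= w A) ->
  (forall A, exists A', [/\ measurable (A' : set Bo), A `<=` A' & w A' <= w A]) ->
  exists B, [/\ measurable (B : set Bo), X `<=` B &
    gauge_outer w B <= gauge_outer w X].
Proof.
move=> w0 wA.
have [->|Xoo] := eqVneq (gauge_outer w X) +oo.
  by exists setT; split => //; exact: leey.
have Xfin : gauge_outer w X \is a fin_num.
  by rewrite ge0_fin_numE ?ltey// gauge_outer_ge0.
have [hull hullP] := choice wA.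
have cover (m : nat) : exists F : (set 'rV[R]_n)^nat, X `<=` \bigcup_j F j /\
    \sum_(j <oo) w (F j) <= gauge_outer w X + (m.+1%:R^-1)%:E.
  have m0 : (0 < m.+1%:R^-1 :> R)%R by rewrite invr_gt0.
  by have [_ [F XF <-] h] := lb_ereal_inf_adherent m0 Xfin; exists F; split => //; exact: ltW.
have [F FP] := choice cover.
exists (\bigcap_m \bigcup_j hull (F m j)); split.
- apply: bigcapT_measurable => m; apply: bigcupT_measurable => j.
  by have [] := hullP (F m j).
- move=> x Xx m _; have [/(_ _ Xx)[j _ Fx] _] := FP m; exists j => //.
  by have [_ + _] := hullP (F m j); apply.
- apply/lee_addgt0Pr => eps eps0.
  have [m hm] : exists m : nat, (m.+1%:R^-1 <= eps)%R.
    exists (Num.truncn eps^-1).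
    have /andP[_ h] := truncn_itv (ltW (eqbRL (invr_gt0 eps) eps0)).
    by rewrite -[leRHS]invrK lef_pV2 ?posrE ?invr_gt0// ltW.
  have [_ h] := FP m.
  apply: (@le_trans _ _ (gauge_outer w X + (m.+1%:R^-1)%:E)); last by rewrite leeD2l// lee_fin.
  apply: le_trans h.
  apply: (@le_trans _ _ (\sum_(j <oo) w (hull (F m j)))).
    apply: ereal_inf_lbound; exists (fun j => hull (F m j)) => // x; exact.
  by apply: lee_nneseries => // j _; have [] := hullP (F m j).
Qed.

Lemma measurable_obox (a b : 'rV[R]_n) : measurable (obox a b : set Bo).
Proof.
apply: (@measurable_forall_coord _ _ (fun i t => (a ord0 i < t <= b ord0 i)%R)) => i.
have -> : [set x : Bo | (a ord0 i < x ord0 i <= b ord0 i)%R] =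
    [set x : Bo | (a ord0 i < x ord0 i)%R] `&` halfspace i (b ord0 i).
  by apply/seteqP; split => x /=; [move/andP | move/andP].
by apply: measurableI; [exact: measurable_coord_lt|exact: measurable_halfspace].
Qed.

Lemma lebesgue_regular X : exists B, [/\ measurable (B : set Bo), X `<=` B &
  lebesgue_outer B <= lebesgue_outer X].
Proof.
apply: gauge_outer_regular => [A|A]; first exact: box_gauge_ge0.
have [->|Aoo] := eqVneq (box_gauge A) +oo.
  by exists setT; split => //; exact: leey.
exists A; split => //; move: Aoo; rewrite /box_gauge; case: asboolP => [->|_].
  by move=> _; exact: measurable0.
move=> Aoo; suff [v [a [b [_ -> _]]]] : [set v | exists a b : 'rV[R]_n,
    [/\ forall i, (a ord0 i < b ord0 i)%R,
        A = [set x : 'rV_n | forall i, (a ord0 i < x ord0 i <= b ord0 i)%R] &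
        v = (\prod_i (b ord0 i - a ord0 i))%R%:E]] !=set0 by exact: measurable_obox.
by apply/set0P/negP => /eqP h; move: Aoo; rewrite h ereal_inf0 eqxx.
Qed.

Lemma continuous_coord (i : 'I_n) : continuous (fun x : 'rV[R]_n => x ord0 i).
Proof. exact: coord_continuous. Qed.

Lemma continuous_sum_fun (I : finType) (f : I -> 'rV[R]_n -> R) :
  (forall i, continuous (f i)) -> continuous (fun x => \sum_i f i x)%R.
Proof.
move=> cf x; rewrite (_ : (fun x => _) = \sum_i f i)%R; last first.
  by apply/funext => y; rewrite fct_sumE.
have : continuous (\sum_i f i)%R; last exact.
elim/big_ind : _ => [|g h cg ch|i _]; first exact: cst_continuous.
  by move=> y; apply: continuousD; [exact: cg|exact: ch].
exact: cf.
Qed.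

Lemma continuous_enorm_sub (y : 'rV[R]_n) : continuous (fun x : 'rV[R]_n => enorm (x - y)).
Proof.
move=> x; rewrite /enorm.
apply: (@continuous_comp _ _ _ (fun x : 'rV[R]_n => \sum_i (x - y) ord0 i ^+ 2)%R Num.sqrt);
  last exact: sqrt_continuous.
apply: continuous_sum_fun => i {}x.
rewrite (_ : (fun x : 'rV[R]_n => _) =
    (fun x : 'rV[R]_n => (x ord0 i - y ord0 i) * (x ord0 i - y ord0 i))%R); last first.
  by apply/funext => z; rewrite !mxE expr2.
have c : continuous (fun x : 'rV[R]_n => x ord0 i - y ord0 i)%R.
  by move=> z; apply: continuousB; [exact: continuous_coord|exact: cst_continuous].
exact: (continuousM (c x) (c x)).
Qed.

Lemma enormN (x : 'rV[R]_n) : enorm (- x) = enorm x.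
Proof. by congr (Num.sqrt _); apply: eq_bigr => i _; rewrite mxE sqrrN. Qed.

Lemma enorm_subC (x y : 'rV[R]_n) : enorm (x - y) = enorm (y - x).
Proof. by rewrite -enormN opprB. Qed.

Lemma closure_enorm_le A (y : 'rV[R]_n) (c : R) :
  (forall x, A x -> enorm (x - y) <= c)%R -> forall x, closure A x -> (enorm (x - y) <= c)%R.
Proof.
move=> h; have cl : closed ((fun x => enorm (x - y)) @^-1` [set t | t <= c])%R.
  apply: preimage_closed => [x _|]; last exact: closed_le.
  exact: continuous_enorm_sub.
have := @closureS _ A _ h; move/closure_id : cl => <-; exact.
Qed.

Lemma diam_closure A : diam (closure A) <= diam A.
Proof.
have [->|/set0P A0] := eqVneq A set0; first by rewrite closure0.
have [->|Aoo] := eqVneq (diam A) +oo; first exact: leey.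
have dfin : diam A \is a fin_num by rewrite ge0_fin_numE ?ltey// diam_ge0.
have dA x y : A x -> A y -> (enorm (x - y) <= fine (diam A))%R.
  by move=> Ax Ay; rewrite -lee_fin fineK// le_diam.
apply: diam_le => x y Ax Ay; rewrite -(fineK dfin) lee_fin.
apply: (closure_enorm_le _ Ax) => {Ax}x Ax; rewrite enorm_subC.
by apply: (closure_enorm_le _ Ay) => {Ay}y Ay; rewrite enorm_subC; exact: dA.
Qed.

(** Closures have the same diameters as the sets, so that covers may be taken
    closed. *)
Lemma hausdorff_regular k X : exists B, [/\ measurable (B : set Bo), X `<=` B &
  hausdorff_outer k B <= hausdorff_outer k X].
Proof.
have reg (m : nat) : exists B, [/\ measurable (B : set Bo), X `<=` B &
    gauge_outer (hausdorff_gauge k (m.+1%:R^-1)) B <=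
    gauge_outer (hausdorff_gauge k (m.+1%:R^-1)) X].
  apply: gauge_outer_regular => [A|A]; first exact: hausdorff_gauge_ge0.
  exists (closure A); split; [by apply: closed_borel; exact: closed_closure|exact: subset_closure|].
  have [->|/set0P A0] := eqVneq A set0; first by rewrite closure0.
  have cA0 : closure A !=set0 by case: A0 => x Ax; exists x; exact: subset_closure.
  have dE : diam (closure A) = diam A.
    by apply/eqP; rewrite eq_le diam_closure (diamS (@subset_closure _ A)).
  have [dA|dA] := boolP (diam A <= (m.+1%:R^-1)%:E); last by rewrite (gauge_big A0 dA) leey.
  by rewrite !gauge_nonempty ?dE.
have [B BP] := choice reg.
exists (\bigcap_m B m); split.
- by apply: bigcapT_measurable => m; have [] := BP m.
- by move=> x Xx m _; have [_ + _] := BP m; apply.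
- apply: ge_ereal_sup => _ [delta d0 <-].
  have [m hm] : exists m : nat, (m.+1%:R^-1 <= delta)%R.
    exists (Num.truncn delta^-1).
    have /andP[_ h] := truncn_itv (ltW (eqbRL (invr_gt0 delta) d0)).
    by rewrite -[leRHS]invrK lef_pV2 ?posrE ?invr_gt0// ltW.
  have m0 : (0 < m.+1%:R^-1 :> R)%R by rewrite invr_gt0.
  apply: (@le_trans _ _ (gauge_outer (hausdorff_gauge k m.+1%:R^-1) (\bigcap_m B m))).
    apply: gauge_outer_mono => A; first exact: hausdorff_gauge_ge0.
    exact: hausdorff_gauge_anti.
  apply: (@le_trans _ _ (gauge_outer (hausdorff_gauge k m.+1%:R^-1) (B m))).
    by apply: le_gauge_outer => x; exact.
  have [_ _ h] := BP m; apply: le_trans h _.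
  exact: gauge_outer_le_hausdorff.
Qed.

End borel_regularity.

(** * The area of a Lipschitz graph *)

Section graph_measure.
Context {R : realType} {n : nat}.
Local Open Scope ereal_scope.
Implicit Types (A X : set 'rV[R]_n) (a b x y : 'rV[R]_n) (rho delta L : R).

(** A subset of the graph of an L-Lipschitz function of the coordinates other than i,
    described without that function. *)
Definition lipschitz_over (i : 'I_n) L A := forall x y rho, A x -> A y ->
  (forall j, j != i -> (`|x ord0 j - y ord0 j| <= rho)%R) ->
  (`|x ord0 i - y ord0 i| <= L * rho)%R.

Definition cylinder (i : 'I_n) a b : set 'rV[R]_n :=
  [set x | forall j, j != i -> (a ord0 j < x ord0 j <= b ord0 j)%R].

Definition base_volume (i : 'I_n) a b : R :=
  (\prod_(j < n | j != i) (b ord0 j - a ord0 j))%R.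

Lemma enorm_le_sum x : (enorm x <= \sum_j `|x ord0 j|)%R.
Proof.
rewrite /enorm -[leRHS]ger0_norm ?sumr_ge0// -sqrtr_sqr; apply: ler_wsqrtr.
rewrite expr2 mulr_suml; apply: ler_sum => j _.
rewrite -real_normK ?num_real// expr2 ler_wpM2l// (bigD1 j)//= lerDl.
exact: sumr_ge0.
Qed.

Lemma gauge_outerU (w : set 'rV[R]_n -> \bar R) A X :
  w set0 = 0 -> (forall B, 0 <= w B) ->
  gauge_outer w (A `|` X) <= gauge_outer w A + gauge_outer w X.
Proof.
move=> w0 wge.
pose mixin := isOuterMeasure.Build R 'rV[R]_n (gauge_outer w) (gauge_outer0 w0 wge)
  (gauge_outer_ge0 wge) (@le_gauge_outer _ _ w) (gauge_outer_sigma_subadditive wge).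
pose mu : {outer_measure set 'rV[R]_n -> \bar R} := HB.pack (gauge_outer w) mixin.
exact: (outer_measureU2 mu).
Qed.

Lemma gauge_outer_le (w : set 'rV[R]_n -> \bar R) A :
  w set0 = 0 -> (forall B, 0 <= w B) -> gauge_outer w A <= w A.
Proof.
move=> w0 wge; apply: ereal_inf_lbound.
exists (fun k => if k == 0%N then A else set0).
  by move=> x Ax; exists 0%N.
rewrite (@nneseriesD1 R _ 0%N xpredT)//= eseries0 ?adde0// => k _ /= k0.
by rewrite (negPf k0).
Qed.

Let K L : R := (n%:R + L)%R.
Let C L : R := (ball_volume R n.-1 * K L ^+ n.-1)%R.

Lemma graph_gauge_cell i L A a b rho delta :
  lipschitz_over i L A -> (0 <= L)%R -> (0 < rho)%R -> (2 * K L * rho <= delta)%R ->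
  (forall j, j != i -> (b ord0 j - a ord0 j <= 2 * rho)%R) ->
  hausdorff_gauge n.-1 delta (A `&` cylinder i a b) <= (C L * rho ^+ n.-1)%:E.
Proof.
move=> lipA L0 rho0 Kd ab.
have K0 : (0 <= K L)%R by rewrite addr_ge0.
have C0 : (0 <= C L * rho ^+ n.-1)%R.
  by rewrite !mulr_ge0 ?ball_volume_ge0 ?exprn_ge0// ltW.
have [->|/set0P Y0] := eqVneq (A `&` cylinder i a b) set0.
  by rewrite hausdorff_gauge0 lee_fin.
have dY : diam (A `&` cylinder i a b) <= (2 * K L * rho)%:E.
  apply: diam_le => x y [Ax cx] [Ay cy]; rewrite lee_fin.
  have bd j : j != i -> (`|x ord0 j - y ord0 j| <= 2 * rho)%R.
    move=> ji; have := ab j ji; have := cx j ji; have := cy j ji.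
    by move=> /andP[? ?] /andP[? ?] ?; rewrite ler_norml; apply/andP; split; lra.
  apply: le_trans (enorm_le_sum _) _; rewrite (bigD1 i)//= !mxE.
  have := lipA x y (2 * rho)%R Ax Ay bd.
  have : (\sum_(j < n | j != i) `|(x - y) ord0 j| <= n%:R * (2 * rho))%R.
    apply: (@le_trans _ _ (\sum_(j < n) (2 * rho))%R); last first.
      by rewrite sumr_const card_ord -[leLHS]mulr_natl.
    rewrite [leRHS](bigD1 i)//= -[leLHS]add0r lerD ?mulr_ge0// ?(ltW rho0)//.
    by apply: ler_sum => j ji; rewrite !mxE; exact: bd.
  by rewrite /K; move: (\sum_(_ | _) _)%R => S h1 h2; nra.
rewrite gauge_nonempty//; last by apply: le_trans dY _; rewrite lee_fin.
rewrite lee_fin /C -mulrA ler_wpM2l ?ball_volume_ge0// -exprMn.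
have dfin : diam (A `&` cylinder i a b) \is a fin_num.
  by rewrite ge0_fin_numE ?diam_ge0// (le_lt_trans dY)// ltry.
apply: lerXn2r; rewrite ?nnegrE ?divr_ge0 ?mulr_ge0 ?fine_ge0 ?diam_ge0// ?(ltW rho0)//.
rewrite ler_pdivrMr//; move: dY; rewrite -(fineK dfin) lee_fin; nra.
Qed.

(** Halve the sides of the base as long as they exceed 2 rho: the cells that remain
    are almost cubes, of sides between rho and 2 rho, over which the graph has
    diameter at most a multiple of rho, and their base volumes add up. *)
Lemma graph_gauge_cylinder i L A a b rho delta :
  lipschitz_over i L A -> (0 <= L)%R -> (0 < rho)%R -> (2 * K L * rho <= delta)%R ->
  (forall j, j != i -> (rho <= b ord0 j - a ord0 j)%R) ->
  gauge_outer (hausdorff_gauge n.-1 delta) (A `&` cylinder i a b) <=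
  (C L * base_volume i a b)%:E.
Proof.
move=> lipA L0 rho0 Kd.
have K0 : (0 <= K L)%R by rewrite addr_ge0.
have C0 : (0 <= C L)%R by rewrite mulr_ge0 ?ball_volume_ge0 ?exprn_ge0.
pose size a b := (\sum_(j < n | j != i) Num.truncn ((b ord0 j - a ord0 j) / rho))%N.
move: {2}(size a b).+1 (ltnSn (size a b)) => m.
elim: m a b => // m IH a b; rewrite ltnS => sm rab.
have [small|] := pselect (forall j, j != i -> (b ord0 j - a ord0 j <= 2 * rho)%R).
  apply: le_trans (gauge_outer_le _ _ _) _.
  - exact: hausdorff_gauge0.
  - exact: hausdorff_gauge_ge0.
  apply: le_trans (graph_gauge_cell lipA L0 rho0 Kd small) _.
  rewrite lee_fin ler_wpM2l// /base_volume.
  have <- : (\prod_(j < n | j != i) rho = rho ^+ n.-1)%R.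
    by rewrite prodr_const cardC1 card_ord.
  by apply: ler_prod => j ji; rewrite ltW//= rab.
move=> /existsNP[j /not_implyP[ji /negP]]; rewrite -ltNge => jbig.
pose c := ((a ord0 j + b ord0 j) / 2)%R.
have cyl : A `&` cylinder i a b `<=`
    (A `&` cylinder i a (set_coord b j c)) `|` (A `&` cylinder i (set_coord a j c) b).
  move=> x [Ax cx]; have [xc|cx'] := leP (x ord0 j) c; [left|right]; split=> // l li.
    have := cx l li; have [->|lj] := eqVneq l j; last by rewrite set_coord_neq.
    by rewrite set_coord_eq xc => /andP[->].
  have := cx l li; have [->|lj] := eqVneq l j; last by rewrite set_coord_neq.
  by rewrite set_coord_eq cx' => /andP[_ ->].
apply: le_trans (le_gauge_outer _ cyl) _.
apply: le_trans (gauge_outerU _ _ _ _) _.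
- exact: hausdorff_gauge0.
- exact: hausdorff_gauge_ge0.
have half1 : (set_coord b j c ord0 j - a ord0 j = (b ord0 j - a ord0 j) / 2)%R.
  by rewrite set_coord_eq /c; field.
have half2 : (b ord0 j - set_coord a j c ord0 j = (b ord0 j - a ord0 j) / 2)%R.
  by rewrite set_coord_eq /c; field.
have vol1 : base_volume i a (set_coord b j c) = (base_volume i a b / 2)%R.
  rewrite /base_volume !(bigD1 (P := fun l => l != i) j)//= half1 mulrAC.
  congr (_ * _ / _)%R; apply: eq_bigr => l /andP[_ lj]; by rewrite set_coord_neq.
have vol2 : base_volume i (set_coord a j c) b = (base_volume i a b / 2)%R.
  rewrite /base_volume !(bigD1 (P := fun l => l != i) j)//= half2 mulrAC.
  congr (_ * _ / _)%R; apply: eq_bigr => l /andP[_ lj]; by rewrite set_coord_neq.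
have tr : (Num.truncn ((b ord0 j - a ord0 j) / 2 / rho) <
    Num.truncn ((b ord0 j - a ord0 j) / rho))%N.
  have sp : (0 < b ord0 j - a ord0 j)%R by apply: lt_trans jbig; rewrite mulr_gt0.
  have t0 : (0 <= (b ord0 j - a ord0 j) / 2 / rho)%R by rewrite ltW// !divr_gt0.
  have [t1 _] := andP (truncn_itv t0).
  have s0 : (0 <= (b ord0 j - a ord0 j) / rho)%R by rewrite ltW// divr_gt0.
  have [_ s1] := andP (truncn_itv s0).
  rewrite -ltnS -(ltr_nat R); apply: le_lt_trans s1.
  rewrite -natr1; apply: (@le_trans _ _ ((b ord0 j - a ord0 j) / 2 / rho + 1)%R).
    by rewrite lerD2r.
  have : (1 <= (b ord0 j - a ord0 j) / 2 / rho)%R.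
    by rewrite ler_pdivlMr// mul1r ler_pdivlMr// mulrC ltW.
  have -> : ((b ord0 j - a ord0 j) / rho = (b ord0 j - a ord0 j) / 2 / rho + (b ord0 j - a ord0 j) / 2 / rho)%R.
    by field; rewrite gt_eqF.
  by move=> h; rewrite lerD2l.
have size1 : (size a (set_coord b j c) < size a b)%N.
  rewrite /size !(bigD1 (P := fun l => l != i) j)//= half1 -addSn leq_add//.
  by apply: leq_sum => l /andP[_ lj]; rewrite set_coord_neq.
have size2 : (size (set_coord a j c) b < size a b)%N.
  rewrite /size !(bigD1 (P := fun l => l != i) j)//= half2 -addSn leq_add//.
  by apply: leq_sum => l /andP[_ lj]; rewrite set_coord_neq.
have -> : (C L * base_volume i a b = C L * (base_volume i a b / 2) + C L * (base_volume i a b / 2))%R.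
  by field.
have side l : l != i -> l = j -> (rho <= (b ord0 l - a ord0 l) / 2)%R.
  by move=> _ ->; rewrite ler_pdivlMr// mulrC ltW.
rewrite EFinD; apply: leeD.
  rewrite -vol1; apply: IH => [|l li]; first exact: leq_trans size1 sm.
  have [lj|lj] := eqVneq l j; last by rewrite set_coord_neq// rab.
  by rewrite lj half1 -lj side.
rewrite -vol2; apply: IH => [|l li]; first exact: leq_trans size2 sm.
have [lj|lj] := eqVneq l j; last by rewrite set_coord_neq// rab.
by rewrite lj half2 -lj side.
Qed.

(** An upper bound for the area of a Lipschitz graph takes no area formula, only
    covers by the parts of the graph over almost cubic cells. *)
Lemma hausdorff_graph i L A : lipschitz_over i L A -> (0 <= L)%R ->
  exists2 M, (0 < M)%R & forall a b,
    (forall j, j != i -> (a ord0 j < b ord0 j)%R) ->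
    hausdorff_outer n.-1 (A `&` cylinder i a b) <= (M * base_volume i a b)%:E.
Proof.
move=> lipA L0; exists (C L + 1)%R.
  by rewrite ltr_wpDl// mulr_ge0 ?ball_volume_ge0 ?exprn_ge0// addr_ge0.
move=> a b ab; apply: ge_ereal_sup => _ [delta d0 <-].
have K0 : (0 < 2 * K L + 1)%R by rewrite ltr_wpDl// mulr_ge0// addr_ge0.
(* Small enough for covers at scale delta, and for the base to contain a cell. *)
pose rho := Num.min (delta / (2 * K L + 1))%R
  (\big[Num.min/1%R]_(j < n | j != i) (b ord0 j - a ord0 j))%R.
have rho0 : (0 < rho)%R.
  rewrite lt_min divr_gt0//=; apply/bigmin_gtP; split => // j ji.
  by rewrite subr_gt0 ab.
have v0 : (0 <= base_volume i a b)%R.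
  by apply: prodr_ge0 => j ji; rewrite subr_ge0 ltW// ab.
apply: le_trans (graph_gauge_cylinder lipA L0 rho0 _ _) _.
- have : (rho <= delta / (2 * K L + 1))%R by rewrite ge_min lexx.
  rewrite ler_pdivlMr// mulrDr mulr1 [(rho * _)%R]mulrC => h.
  by apply: le_trans h; rewrite lerDl ltW.
- by move=> j ji; rewrite ge_min; apply/orP; right; exact: bigmin_le_cond.
- by rewrite lee_fin ler_wpM2r// lerDl.
Qed.

End graph_measure.

(** * Comparison of measures by their values on boxes *)

Section transport.
Context {R : realType} {n : nat}.
Local Open Scope ereal_scope.
Local Notation Bo := (borel_rV R n).

Lemma le_box_gauge_hull (m : {measure set Bo -> \bar R}) (C : R) (A : set 'rV[R]_n) :
  (0 < C)%R ->
  (forall a b : 'rV[R]_n, (forall i, a ord0 i < b ord0 i)%R ->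
    m (obox a b) <= (C * volume a b)%:E) ->
  exists A', [/\ measurable (A' : set Bo), A `<=` A' & m A' <= C%:E * box_gauge A].
Proof.
move=> C0 mbox; have [Aoo|Aoo] := eqVneq (box_gauge A) +oo.
  by exists setT; split => //; rewrite Aoo gt0_muley ?leey// lte_fin.
have boxA : A = set0 \/ exists a b : 'rV[R]_n, (forall i, a ord0 i < b ord0 i)%R /\ A = obox a b.
  have [->|/eqP A0] := eqVneq A set0; [by left|right].
  move: Aoo; rewrite /box_gauge; case: asboolP => // _ Aoo.
  suff [v [a [b [ab Aab _]]]] : [set v | exists a b : 'rV[R]_n,
      [/\ forall i, (a ord0 i < b ord0 i)%R,
        A = [set x : 'rV_n | forall i, (a ord0 i < x ord0 i <= b ord0 i)%R] &
        v = (\prod_i (b ord0 i - a ord0 i))%R%:E]] !=set0 by exists a, b.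
  by apply/set0P/negP => /eqP h; move: Aoo; rewrite h ereal_inf0 eqxx.
exists A; split => //.
  by case: boxA => [->|[a [b [_ ->]]]]; [exact: measurable0|exact: measurable_obox].
have [->|/eqP A0] := eqVneq A set0; first by rewrite measure0 mule_ge0 ?box_gauge_ge0// lee_fin ltW.
rewrite -lee_pdivrMl// /box_gauge; case: asboolP => // _.
apply: le_ereal_inf_tmp => _ [a [b [ab Aab ->]]].
rewrite lee_pdivrMl// -EFinM Aab; exact: mbox.
Qed.

(** The Lebesgue measure is an infimum over covers by boxes, so that a measure is
    compared with it as soon as it is on boxes. *)
Lemma le_lebesgue_boxes (m : {measure set Bo -> \bar R}) (C : R) (A : set Bo) :
  (0 < C)%R ->
  (forall a b : 'rV[R]_n, (forall i, a ord0 i < b ord0 i)%R ->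
    m (obox a b) <= (C * volume a b)%:E) ->
  measurable A -> m A <= C%:E * lebesgue_outer (A : set 'rV[R]_n).
Proof.
move=> C0 mbox mA; rewrite -lee_pdivrMl//.
apply: le_ereal_inf_tmp => _ [F AF <-].
have [G GP] := choice (fun k => le_box_gauge_hull (F k) C0 mbox).
rewrite lee_pdivrMl// -nneseriesZl; last by move=> k _; exact: box_gauge_ge0.
apply: (@le_trans _ _ (\sum_(k <oo) m (G k))).
  apply: (@measure_sigma_subadditive _ _ _ m) => //; first by move=> k; have [] := GP k.
  by move=> x /AF[k _ Fkx]; exists k => //; have [_ + _] := GP k; apply.
apply: lee_nneseries => k _; first by move=> _; apply: measure_ge0.
by have [] := GP k.
Qed.

Import HBNNSimple.

Lemma le_measure_integral d (T : measurableType d) (m1 m2 : {measure set T -> \bar R})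
    (f : T -> \bar R) :
  (forall A, measurable A -> m1 A <= m2 A) -> (forall x, 0 <= f x) ->
  \int[m1]_x f x <= \int[m2]_x f x.
Proof.
move=> m12 f0; rewrite !ge0_integralTE//; apply: ge_ereal_sup => _ [h hf <-].
apply: (le_trans (le_measure_sintegral m12 h)).
by apply: ereal_sup_ubound; exists h.
Qed.

Lemma le_integral_mrestr d (T : measurableType d) (m : {measure set T -> \bar R})
    (E : set T) (mE : measurable E) (f : T -> \bar R) : (forall x, 0 <= f x) ->
  \int[m]_(x in E) f x <= \int[mrestr m mE]_x f x.
Proof.
move=> f0; rewrite ge0_integralE// ge0_integralTE//.
apply: ge_ereal_sup => _ [h hf <-].
apply: (@le_trans _ _ (sintegral (mrestr m mE) h)).
  rewrite !sintegralE; apply: lee_fsum => // r [t _ <-].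
  have [->|h0] := eqVneq (h t) 0%R; first by rewrite !mul0e.
  suff hE : h @^-1` [set h t] `<=` E.
    have e : mrestr m mE (h @^-1` [set h t]) = m (h @^-1` [set h t]).
      by rewrite /mrestr setIidl.
    by rewrite -e; exact: lexx.
  move=> x /= hx.
  have := hf x; rewrite /patch; case: ifPn => [|_]; first by rewrite inE.
  rewrite hx => ht; exfalso; have : (h t <= 0)%R by exact: ht.
  have : (0 <= h t)%R by exact: fun_ge0.
  by move: h0; case: ltgtP.
apply: ereal_sup_ubound; exists h => //= x; apply: le_trans (hf x) _.
by rewrite /patch; case: ifP.
Qed.

Lemma borel_lebesgue (A : set 'rV[R]_n) : measurable (A : set Bo) ->
  measurable (A : set (caratheodory_type (@lebesgue_outer R n))).
Proof. by move=> mA; apply: borel_caratheodory => //; exact: lebesgue_halfspace. Qed.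

Lemma borel_hausdorff k (A : set 'rV[R]_n) : measurable (A : set Bo) ->
  measurable (A : set (caratheodory_type (@hausdorff_outer R n k))).
Proof. by move=> mA; apply: borel_caratheodory => //; exact: hausdorff_halfspace. Qed.

Lemma borel_fun_lebesgue d (T : measurableType d) (f : 'rV[R]_n -> T) :
  measurable_fun setT (f : Bo -> T) ->
  measurable_fun setT (f : caratheodory_type (@lebesgue_outer R n) -> T).
Proof.
move=> mf _ A mA; rewrite setTI; apply: borel_lebesgue.
by rewrite -[X in measurable X]setTI; exact: mf.
Qed.

Lemma borel_fun_hausdorff k d (T : measurableType d) (f : 'rV[R]_n -> T) :
  measurable_fun setT (f : Bo -> T) ->
  measurable_fun setT (f : caratheodory_type (@hausdorff_outer R n k) -> T).
Proof.
move=> mf _ A mA; rewrite setTI; apply: borel_hausdorff.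
by rewrite -[X in measurable X]setTI; exact: mf.
Qed.

Lemma measurable_id_lebesgue :
  measurable_fun setT (id : caratheodory_type (@lebesgue_outer R n) -> Bo).
Proof. by move=> _ A mA; rewrite setTI; exact: borel_lebesgue. Qed.

(** By le_lebesgue_boxes it is enough to bound the image of m under phi on boxes. *)
Lemma transport_integral d (T : measurableType d) (m : {measure set T -> \bar R})
    (phi : T -> Bo) (E : set T) (D : set Bo) (C : R) (f : Bo -> \bar R) :
  measurable_fun setT phi -> measurable E -> measurable D -> (0 < C)%R ->
  (forall a b : 'rV[R]_n, (forall i, a ord0 i < b ord0 i)%R ->
    m (phi @^-1` (obox a b : set Bo) `&` E) <= (C * volume a b)%:E) ->
  measurable_fun setT f -> (forall x, 0 <= f x) -> (forall x, E x -> D (phi x)) ->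
  \int[m]_(x in E) f (phi x) <= C%:E * \int[lebesgue_rV]_(x in D) f x.
Proof.
move=> mphi mE mD C0 mbox mf f0 ED.
pose g := f \_ D.
have mg : measurable_fun setT g by apply/(measurable_restrictT _ mD); exact: measurable_funTS.
have g0 x : 0 <= g x by rewrite /g /patch; case: ifP.
have -> : \int[m]_(x in E) f (phi x) = \int[m]_(x in E) (g \o phi) x.
  apply: eq_integral => x /[!inE] Ex; rewrite /g /= patchE mem_set//; exact: ED.
apply: (le_trans (le_integral_mrestr m mE (fun x => g0 (phi x)))).
have -> : \int[mrestr m mE]_x (g \o phi) x = \int[pushforward (mrestr m mE) phi]_x g x.
  by rewrite ge0_integral_pushforward// => *; exact: g0.
pose nu : {measure set Bo -> \bar R} := pushforward (mrestr m mE) phi.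
pose leb : {measure set Bo -> \bar R} := pushforward (@lebesgue_rV R n)
  (id : caratheodory_type (@lebesgue_outer R n) -> Bo).
pose leb' := leb measurable_id_lebesgue.
pose Cn : {nonneg R} := NngNum (ltW C0).
apply: (@le_trans _ _ (\int[mscale Cn leb']_x g x)).
  apply: (@le_measure_integral _ _ (nu mphi)) => // A mA.
  rewrite /mscale /=; exact: le_lebesgue_boxes.
rewrite ge0_integral_mscale// lee_wpmul2l ?lee_fin ?(ltW C0)//.
have -> : \int[leb']_x g x = \int[@lebesgue_rV R n]_x g x.
  by rewrite (ge0_integral_pushforward measurable_id_lebesgue).
by rewrite [leRHS]integral_mkcond.
Qed.

End transport.

Section vertical.
Context {R : realType} {n : nat}.
Local Open Scope ereal_scope.
Local Notation Bo := (borel_rV R n).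
Local Notation CH := (caratheodory_type (@hausdorff_outer R n n.-1)).

Definition shift_coord (i : 'I_n) (x : 'rV[R]_n) (t : R) : 'rV[R]_n :=
  set_coord x i (x ord0 i + t).

Lemma shift_coord_eq i x t : shift_coord i x t ord0 i = (x ord0 i + t)%R.
Proof. exact: set_coord_eq. Qed.

Lemma shift_coord_neq i x t j : j != i -> shift_coord i x t ord0 j = x ord0 j.
Proof. exact: set_coord_neq. Qed.

Lemma measurable_rV_fun d (T : measurableType d) (phi : T -> 'rV[R]_n) :
  (forall i, measurable_fun setT (fun x => phi x ord0 i)) ->
  measurable_fun setT (phi : T -> Bo).
Proof.
move=> mphi; apply: (@measurability _ _ T Bo setT phi (@halfspaces R n) erefl) => _ [_ [i [c ->]] <-].
rewrite setTI; have -> : phi @^-1` halfspace i c =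
    setT `&` (fun x => phi x ord0 i) @^-1` `]-oo, c]%classic.
  by rewrite setTI; apply/seteqP; split => x /=; rewrite in_itv.
by apply: mphi => //; exact: measurable_itv.
Qed.

Lemma measurable_coord_hausdorff i :
  measurable_fun setT (fun x : CH => (x : 'rV[R]_n) ord0 i).
Proof.
exact: (borel_fun_hausdorff (f := fun x : 'rV[R]_n => x ord0 i) (measurable_coord i)).
Qed.

(** The image of the product of the surface measure and the length under
    (x, t) |-> x + s t e_i has bounded density: over a box it is at most the area of
    a piece of the graph times the height of the box. *)
Lemma vertical_transport (i : 'I_n) (s M : R) (S : set 'rV[R]_n) (D : set 'rV[R]_n)
    (t0 t1 : R) (f : 'rV[R]_n -> \bar R) :
  `|s|%R = 1%R -> (0 < M)%R ->
  (forall a b : 'rV[R]_n, (forall j, j != i -> a ord0 j < b ord0 j)%R ->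
    hausdorff_outer n.-1 (S `&` cylinder i a b) <= (M * base_volume i a b)%:E) ->
  hausdorff_outer n.-1 S < +oo ->
  measurable (S : set Bo) -> measurable (D : set Bo) ->
  measurable_fun setT (f : Bo -> \bar R) -> (forall x, 0 <= f x) ->
  (forall x t, S x -> (t0 <= t <= t1)%R -> D (shift_coord i x (s * t))) ->
  \int[surface_measure]_(x in S) \int[lebesgue_measure]_(t in `[t0, t1])
     f (shift_coord i x (s * t)) <= M%:E * \int[lebesgue_rV]_(x in D) f x.
Proof.
move=> s1 M0 HS Soo mS mD mf f0 SD.
have mSH : measurable (S : set CH).
  exact: borel_hausdorff.
pose phi (z : CH * R) : Bo := shift_coord i z.1 (s * z.2).
have mphi : measurable_fun setT phi.
  apply: measurable_rV_fun => j; have [->|ji] := eqVneq j i.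
    rewrite (_ : (fun z => _) = (fun z : CH * R => (z.1 : 'rV[R]_n) ord0 i + s * z.2)%R); last first.
      by apply/funext => z; rewrite /phi shift_coord_eq.
    apply: measurable_funD; last by apply: measurable_funM => //; exact: measurable_snd.
    exact: (measurableT_comp (measurable_coord_hausdorff i) measurable_fst).
  rewrite (_ : (fun z => _) = (fun z : CH * R => (z.1 : 'rV[R]_n) ord0 j)); last first.
    by apply/funext => z; rewrite /phi shift_coord_neq.
  exact: (measurableT_comp (measurable_coord_hausdorff j) measurable_fst).
pose E : set (CH * R) := (S : set CH) `*` `[t0, t1]%classic.
have mE : measurable E by exact: measurableX.
have mfphi : measurable_fun setT (f \o phi) by exact: (measurableT_comp mf mphi).
have f1 z : 0 <= ((f \o phi) \_ E) z.
  by rewrite patchE; case: ifP => _; [exact: f0|exact: lexx].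
have mf1 : measurable_fun setT ((f \o phi) \_ E).
  by apply/(measurable_restrictT _ mE); exact: measurable_funTS.
pose sm : {measure set CH -> \bar R} := surface_measure.
have Soo' : sm (S : set CH) < +oo by exact: Soo.
pose m1 : {finite_measure set CH -> \bar R} := mfrestr mSH Soo'.
pose g := (f \o phi) \_ E.
have -> : \int[surface_measure]_(x in S) \int[lebesgue_measure]_(t in `[t0, t1])
     f (shift_coord i x (s * t)) =
    \int[surface_measure]_(x in (S : set CH)) fubini_F (@lebesgue_measure R) g x.
  apply: eq_integral => x Sx; rewrite /fubini_F [LHS]integral_mkcond.
  apply: eq_integral => t _.
  by rewrite /g !patchE /E in_setX /= Sx.
have F0 x : 0 <= fubini_F (@lebesgue_measure R) g x by exact: integral_ge0.
apply: (le_trans (le_integral_mrestr _ mSH F0)).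
apply: (@le_trans _ _ (\int[m1 \x (@lebesgue_measure R)]_(z in E) f (phi z))).
  rewrite [leRHS]integral_mkcond; have := fubini_tonelli1 (m1 := m1) (m2 := @lebesgue_measure R) _ mf1 f1.
  by move=> e; rewrite -[leLHS]e.
pose m12 := (m1 \x (@lebesgue_measure R) : {measure set _ -> \bar R})%E.
apply: (@transport_integral _ _ _ _ m12 phi E D M f) => //; last first.
  by move=> [x t] [/= Sx]; rewrite in_itv/=; exact: SD.
move=> a b ab.
pose Y : set CH := S `&` cylinder i a b.
have mY : measurable Y.
  apply: measurableI => //; apply: borel_hausdorff.
  apply: (@measurable_forall_coord _ _ (fun j t => j != i -> (a ord0 j < t <= b ord0 j)%R)) => j.
  have [->|ji] := eqVneq j i.
    rewrite (_ : [set _ | _] = setT) ?measurableT//.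
    by apply/seteqP; split => // x _ /=; rewrite ?eqxx.
  rewrite (_ : [set _ | _] = [set x : Bo | (a ord0 j < x ord0 j)%R] `&` halfspace j (b ord0 j)).
    by apply: measurableI; [exact: measurable_coord_lt|exact: measurable_halfspace].
  by apply/seteqP; split => x /= => [/(_ isT)/andP|/andP ? _].
have v0 : (0 <= M * base_volume i a b)%R.
  rewrite mulr_ge0 ?(ltW M0)//; apply: prodr_ge0 => j _; by rewrite subr_ge0 ltW.
have -> : (M * volume a b = (b ord0 i - a ord0 i) * (M * base_volume i a b))%R.
  by rewrite /volume (bigD1 i)//= mulrCA.
have bi0 : (0 <= b ord0 i - a ord0 i)%R by rewrite subr_ge0 ltW.
apply: (@le_trans _ _ (\int[m1]_(x in Y) (b ord0 i - a ord0 i)%:E)); last first.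
  rewrite integral_cst//= EFinM lee_wpmul2l ?lee_fin//.
  have -> : m1 Y = hausdorff_outer n.-1 Y by rewrite /m1 /= /mfrestr /mrestr setIidl// => x [].
  by apply: HS => j _; exact: ab.
pose A : set (CH * R) := phi @^-1` (obox a b : set Bo) `&` E.
have mA : measurable A.
  apply: measurableI => //; rewrite -[X in measurable X]setTI.
  by apply: mphi => //; exact: measurable_obox.
change (\int[m1]_x (@lebesgue_measure R) (xsection A x) <=
  \int[m1]_(x in Y) (b ord0 i - a ord0 i)%:E).
rewrite [leRHS]integral_mkcond; apply: ge0_le_integral.
- exact: measurableT.
- by move=> x _; exact: measure_ge0.
- exact: measurable_fun_xsection.
- by apply/(measurable_restrictT _ mY); exact: measurable_cst.
move=> x _ /=; rewrite patchE; case: ifPn => [Yx|nYx]; last first.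
  rewrite (_ : xsection _ _ = set0) ?measure0//.
  rewrite -subset0 => t; rewrite /xsection/= inE => -[/= h [/= Sx _]].
  move/negP: nYx; apply; rewrite inE; split => // j ji; have := h j.
  by rewrite /phi shift_coord_neq.
have [s1' | s1'] : s = 1%R \/ s = (-1)%R.
  by have := eqr_norml s 1; rewrite s1 eqxx ler01 andbT => /esym/orP[/eqP|/eqP]; [left|right].
  apply: (@le_trans _ _ (@lebesgue_measure R `](a ord0 i - x ord0 i)%R, (b ord0 i - x ord0 i)%R]%classic)).
    apply: le_measure; rewrite ?inE//.
      exact: measurable_xsection.
    move=> t; rewrite /xsection/= inE => -[/= /(_ i) + _].
    rewrite /phi shift_coord_eq /= s1' mul1r in_itv/= => /andP[h1 h2]; apply/andP; split; lra.
  rewrite lebesgue_measure_itv/=; case: ifP => // _; rewrite lee_fin; lra.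
apply: (@le_trans _ _ (@lebesgue_measure R `[(x ord0 i - b ord0 i)%R, (x ord0 i - a ord0 i)%R[%classic)).
  apply: le_measure; rewrite ?inE//.
    exact: measurable_xsection.
  move=> t; rewrite /xsection/= inE => -[/= /(_ i) + _].
  rewrite /phi shift_coord_eq /= s1' mulN1r in_itv/= => /andP[h1 h2]; apply/andP; split; lra.
rewrite lebesgue_measure_itv/=; case: ifP => // _; rewrite lee_fin; lra.
Qed.

End vertical.

(** * Integrals and functions of class C^1 *)

Lemma integral_scale {R : realType} d (T : measurableType d)
    (m : {measure set T -> \bar R}) (D : set T) (c : R) (g : T -> R) :
  measurable D -> (0 <= c)%R -> (forall x, (0 <= g x)%R) -> measurable_fun D g ->
  (c%:E * \int[m]_(x in D) (g x)%:E = \int[m]_(x in D) (c * g x)%:E)%E.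
Proof.
move=> mD c0 g0 mg; rewrite -ge0_integralZl_EFin//.
  by move=> x _; rewrite lee_fin.
exact/measurable_EFinP.
Qed.

Lemma integral_addf {R : realType} d (T : measurableType d)
    (m : {measure set T -> \bar R}) (D : set T) (f g : T -> R) :
  measurable D -> (forall x, (0 <= f x)%R) -> measurable_fun D f ->
  (forall x, (0 <= g x)%R) -> measurable_fun D g ->
  (\int[m]_(x in D) (f x + g x)%:E =
   \int[m]_(x in D) (f x)%:E + \int[m]_(x in D) (g x)%:E)%E.
Proof.
move=> mD f0 mf g0 mg; under eq_integral do rewrite EFinD.
rewrite ge0_integralD//; first [exact/measurable_EFinP | by move=> x _; rewrite lee_fin].
Qed.

Lemma layer_arithmetic {R : realType} (h M : R) (x y z : \bar R) :
  (0 < h)%R -> (0 < M)%R -> (0 <= y)%E -> (0 <= z)%E ->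
  (h%:E * x <= M%:E * (2%:E * y + (4 * h ^+ 2)%:E * z))%E ->
  (x <= (2 * M / h)%:E * y + (4 * M * h)%:E * z)%E.
Proof.
move=> h0 M0 y0 z0 H; have hn : h != 0%R by rewrite gt_eqF.
rewrite -(@lee_pmul2l _ h%:E)// ?lte_fin//; apply: le_trans H _.
have c0 : (0 <= 4 * h ^+ 2 :> R)%R by rewrite mulr_ge0// sqr_ge0.
have d0 : (0 <= 2 * M / h :> R)%R by rewrite divr_ge0// ?mulr_ge0// ltW.
have e0 : (0 <= 4 * M * h :> R)%R by rewrite !mulr_ge0// ltW.
rewrite ge0_muleDr; [|by rewrite mule_ge0// lee_fin|by rewrite mule_ge0// lee_fin].
rewrite [leRHS]ge0_muleDr; [|by rewrite mule_ge0// lee_fin|by rewrite mule_ge0// lee_fin].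
rewrite !muleA -!EFinM; apply: leeD; apply: lee_wpmul2r => //; rewrite lee_fin.
  by rewrite le_eqVlt; apply/orP; left; apply/eqP; field.
by rewrite le_eqVlt; apply/orP; left; apply/eqP; ring.
Qed.

Lemma integral_sqr_ge0 {R : realType} d (T : measurableType d)
    (m : {measure set T -> \bar R}) (D : set T) (f : T -> R) :
  (0 <= \int[m]_(x in D) (f x ^+ 2)%:E)%E.
Proof. by apply: integral_ge0 => x _; rewrite lee_fin sqr_ge0. Qed.

Lemma continuous_addf {R : realType} {n : nat} (f g : 'rV[R]_n -> R) :
  continuous f -> continuous g -> continuous (fun x => f x + g x).
Proof. by move=> cf cg x; apply: continuousD; [exact: cf|exact: cg]. Qed.

Lemma continuous_mulf {R : realType} {n : nat} (f g : 'rV[R]_n -> R) :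
  continuous f -> continuous g -> continuous (fun x => f x * g x).
Proof. by move=> cf cg x; apply: continuousM; [exact: cf|exact: cg]. Qed.

Lemma continuous_scalef {R : realType} {n : nat} (c : R) (f : 'rV[R]_n -> R) :
  continuous f -> continuous (fun x => c * f x).
Proof. by move=> cf; apply: continuous_mulf => //; exact: cst_continuous. Qed.

Lemma continuous_shiftf {R : realType} {n : nat} (c : R) (f : 'rV[R]_n -> R) :
  continuous f -> continuous (fun x => f x + c).
Proof. by move=> cf; apply: continuous_addf => //; exact: cst_continuous. Qed.

Lemma integral_cst_fin {R : realType} d (T : measurableType d)
    (mu : {measure set T -> \bar R}) (D : set T) (c r : R) :
  measurable D -> mu D = r%:E -> (\int[mu]_(x in D) c%:E = (c * r)%:E)%E.
Proof. by move=> mD Dr; rewrite integral_cst// Dr. Qed.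

Lemma integral_affine {R : realType} d (T : measurableType d)
    (mu : {measure set T -> \bar R}) (D : set T) (A : T -> \bar R) (k r s : R) :
  measurable D -> (forall x, (0 <= A x)%E) -> measurable_fun setT A -> 0 <= k -> 0 <= r ->
  mu D = s%:E ->
  (\int[mu]_(x in D) (k%:E * A x + r%:E) = k%:E * \int[mu]_(x in D) A x + (r * s)%:E)%E.
Proof.
move=> mD A0 mA k0 r0 Ds.
have mAD : measurable_fun D A by exact: measurable_funTS.
rewrite ge0_integralD//.
- rewrite ge0_integralZl// integral_cst//.
  by rewrite Ds.
- by move=> x _; exact: mule_ge0.
- exact: measurable_funeM.
Qed.

Section C1_functions.
Context {R : realType} {n : nat}.
Implicit Types (f : 'rV[R]_n -> R) (x y d : 'rV[R]_n).

Lemma Ck1_continuous f : Ck 1 f -> continuous f. Proof. by case. Qed.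

Lemma Ck1_derivable f i x : Ck 1 f -> derivable f x (delta_mx ord0 i).
Proof. by case=> _ /(_ i)[]. Qed.

Lemma Ck1_partial f i : Ck 1 f -> continuous (partial i f).
Proof. by case=> _ /(_ i)[_ []]. Qed.

Lemma is_derive_line f y e (t : R) : derivable f (y + t *: e) e ->
  is_derive t 1 (fun s : R => f (y + s *: e)) ('D_e f (y + t *: e)).
Proof.
move=> df; have E : (fun h : R => h^-1 *: (f (y + (h *: 1 + t) *: e) - f (y + t *: e))) =
    (fun h : R => h^-1 *: (f (h *: e + (y + t *: e)) - f (y + t *: e))).
  apply/funext => h; congr (_ *: (f _ - _)).
  by rewrite [h *: 1]mulr1 scalerDl addrCA.
split; first by rewrite /derivable /= E; exact: df.
by rewrite /derive /= E.
Qed.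

Lemma MVT_signed (c dc : R -> R) (a : R) :
  (forall t : R, is_derive t (1 : R) c (dc t)) ->
  exists2 xi : R, `|xi| <= `|a| & c a - c 0 = a * dc xi.
Proof.
move=> dcE.
have cc : continuous c.
  by move=> t; apply: differentiable_continuous; apply/derivable1_diffP; have [] := dcE t.
have wc (A : set R) : {within A, continuous c} by exact: continuous_subspaceT.
have [a0|a0|->] := ltgtP a 0.
- have [xi] := MVT a0 (fun t _ => dcE t) (wc _).
  rewrite in_itv/= => /andP[x1 x2] E; exists xi.
    by rewrite !ltr0_norm// lerN2 ltW.
  by rewrite -[LHS]opprB E sub0r mulrN opprK mulrC.
- have [xi] := MVT a0 (fun t _ => dcE t) (wc _).
  rewrite in_itv/= => /andP[x1 x2] E; exists xi.
    by rewrite !gtr0_norm// ltW.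
  by rewrite E subr0 mulrC.
- by exists 0; rewrite ?normr0// subrr mul0r.
Qed.

(** Change the coordinates one at a time; the mean value theorem applies to each
    step. *)
Lemma C1_increment f y d : Ck 1 f -> exists2 xi : 'I_n -> 'rV[R]_n,
  forall k j, `|xi k ord0 j - y ord0 j| <= `|d ord0 j| &
  f (y + d) - f y = \sum_k d ord0 k * partial k f (xi k).
Proof.
move=> C1f.
pose p (k : nat) : 'rV[R]_n := \row_j (if (j < k)%N then y ord0 j + d ord0 j else y ord0 j).
have p0 : p 0%N = y by apply/rowP => j; rewrite mxE.
have pn : p n = y + d by apply/rowP => j; rewrite !mxE ltn_ord.
have pS (k : 'I_n) : p k.+1 = p k + d ord0 k *: delta_mx ord0 k.
  apply/rowP => j; rewrite !mxE ltnS leq_eqVlt eqxx /=.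
  have [->|jk] := eqVneq j k; first by rewrite eqxx ltnn mulr1.
  by rewrite (inj_eq val_inj) (negPf jk) mulr0 addr0.
have step (k : 'I_n) : exists xi : 'rV[R]_n,
    (forall j, `|xi ord0 j - y ord0 j| <= `|d ord0 j|) /\
    f (p k.+1) - f (p k) = d ord0 k * partial k f xi.
  have [t tk E] := @MVT_signed (fun s : R => f (p k + s *: delta_mx ord0 k))
    (fun s : R => partial k f (p k + s *: delta_mx ord0 k)) (d ord0 k)
    (fun t => is_derive_line (Ck1_derivable C1f)).
  exists (p k + t *: delta_mx ord0 k); split; last first.
    by rewrite pS -E scale0r addr0.
  move=> j; rewrite !mxE eqxx /=.
  have [->|jk] := eqVneq j k.
    by rewrite ltnn mulr1 addrAC subrr add0r.
  by rewrite mulr0 addr0; case: ifP => _; rewrite ?subrr ?normr0// addrAC subrr add0r.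
have [xi xiP] := choice step.
exists xi; first by move=> k j; have [] := xiP k.
rewrite -pn -[in LHS]p0 -(telescope_sumr (fun k => f (p k)) (leq0n n)) big_mkord.
by apply: eq_bigr => k _; have [_ ->] := xiP k.
Qed.

Lemma nbhs_forall_coord (P : 'I_n -> set 'rV[R]_n) y : (forall i, nbhs y (P i)) ->
  exists2 r : R, 0 < r & forall z : 'rV[R]_n, (forall j, `|y ord0 j - z ord0 j| < r) ->
    forall i, P i z.
Proof.
move=> nP; have [|r r0 hr] := @nbhs_rV _ _ y [set z | forall i, P i z].
  exact: (@filter_forall _ _ P (nbhs y) _ nP).
by exists r => // z /hr.
Qed.

(** The chain rule for a line in an arbitrary direction, from continuous partial
    derivatives. *)
Lemma C1_line f x d (t : R) : Ck 1 f ->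
  is_derive t 1 (fun s : R => f (x + s *: d))
    (\sum_k d ord0 k * partial k f (x + t *: d)).
Proof.
move=> C1f; set L := \sum_k _.
pose q (h : R) := h^-1 *: (f (x + (h *: 1 + t) *: d) - f (x + t *: d)).
suff qL : q h @[h --> 0^'] --> L.
  split; first by apply/cvg_ex; exists L.
  by apply: cvg_lim qL.
apply/cvgrPdist_le => eps eps0.
pose y := x + t *: d.
pose K := 1 + \sum_j `|d ord0 j|.
have K0 : 0 < K by rewrite ltr_pwDl// sumr_ge0.
have dK j : `|d ord0 j| <= K.
  by rewrite /K (bigD1 j)//= addrCA lerDl addr_ge0// sumr_ge0.
have e0 : 0 < eps / K by rewrite divr_gt0.
have near_partial i : nbhs y [set z | `|partial i f y - partial i f z| <= eps / K].
  have c : continuous (partial i f) by exact: Ck1_partial.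
  by have /cvgrPdist_le := c y; apply.
have [r r0 hr] := @nbhs_forall_coord (fun i => [set z | `|partial i f y - partial i f z| <= eps / K]) y
  (fun i => near_partial i).
have rK : 0 < r / K by rewrite divr_gt0.
near=> h.
have h0 : h != 0 by near: h; exact: nbhs_dnbhs_neq.
have hr' : `|h| < r / K.
  near: h; apply: dnbhs0_lt; exact: rK.
have [xi xiP E] := C1_increment y (h *: d) C1f.
have -> : q h = \sum_k d ord0 k * partial k f (xi k).
  rewrite /q; have -> : x + (h *: 1 + t) *: d = y + h *: d.
    by rewrite [h *: 1]mulr1 scalerDl addrCA addrC.
  rewrite -/y E [_ *: _]mulr_sumr; apply: eq_bigr => k _.
  by rewrite mxE -mulrA mulKf.
rewrite /L -sumrB; apply: le_trans (ler_norm_sum _ _ _) _.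
apply: (@le_trans _ _ (\sum_k `|d ord0 k| * (eps / K))).
  apply: ler_sum => k _; rewrite -mulrBr normrM ler_wpM2l//.
  apply: (hr (xi k)) => j; rewrite distrC.
  apply: le_lt_trans (xiP k j) _; rewrite mxE normrM.
  apply: le_lt_trans (ler_wpM2l (normr_ge0 _) (dK j)) _.
  by rewrite -ltr_pdivlMr.
rewrite -mulr_suml mulrCA -[leRHS]mulr1 ler_wpM2l ?(ltW eps0)//.
by rewrite ler_pdivrMr// mul1r /K lerDr.
Unshelve. all: by end_near. Qed.

Lemma continuous_line x d : continuous (fun s : R => x + s *: d).
Proof.
move=> s; apply: cvgD; first exact: cvg_cst.
by apply: cvgZr_tmp; exact: cvg_id.
Qed.

End C1_functions.

(** * The trace and a layer of the domain *)

Section one_dimensional.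
Context {R : realType}.
Local Open Scope ereal_scope.
Local Notation mu := (@lebesgue_measure R).

Lemma derive_continuous (phi dphi : R -> R) :
  (forall t : R, is_derive t (1%R : R) phi (dphi t)) -> continuous phi.
Proof.
by move=> h t; apply: differentiable_continuous; apply/derivable1_diffP; have [] := h t.
Qed.

Lemma FTC_itv (phi dphi : R -> R) (t : R) : (0 < t)%R ->
  (forall t : R, is_derive t (1%R : R) phi (dphi t)) -> continuous dphi ->
  \int[mu]_(s in `[0%R, t]) (dphi s)%:E = (phi t - phi 0)%R%:E.
Proof.
move=> t0 dE cd; rewrite EFinB; have cphi := derive_continuous dE.
apply: continuous_FTC2 => //.
- exact: continuous_subspaceT.
- split.
  + by move=> x _; have [] := dE x.
  + apply: cvg_at_right_filter; exact: cphi.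
  + apply: cvg_at_left_filter; exact: cphi.
- by move=> x _; rewrite derive1E; have [_ ->] := dE x.
Qed.

(** Expanding the square of dphi - c, with c the mean slope, gives this case of the
    Cauchy-Schwarz inequality. *)
Lemma sqr_increment (phi dphi : R -> R) (t : R) : (0 <= t)%R ->
  (forall t : R, is_derive t (1%R : R) phi (dphi t)) -> continuous dphi ->
  ((phi t - phi 0) ^+ 2)%R%:E <= t%:E * \int[mu]_(s in `[0%R, t]) ((dphi s) ^+ 2)%R%:E.
Proof.
move=> t0 dE cd.
have [->|tn0] := eqVneq t 0%R.
  by rewrite subrr expr0n mul0e.
have tp : (0 < t)%R by rewrite lt_neqAle eq_sym tn0.
pose c := ((phi t - phi 0) / t)%R.
have cphi := derive_continuous dE.
have csq : continuous (fun s => (dphi s) ^+ 2)%R.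
  by move=> s; apply: (@continuous_comp _ _ _ dphi (fun x => x ^+ 2)%R); [exact: cd|exact: exprn_continuous].
pose G s := (2 * c * phi s - c ^+ 2 * s)%R.
have dG s : is_derive s (1%R : R) G (2 * c * dphi s - c ^+ 2)%R.
  have := is_deriveB (is_deriveZ (2 * c)%R (dE s)) (is_deriveZ (c ^+ 2)%R (is_derive_id s (1%R : R))).
  by move=> h; apply: is_derive_eq h _; rewrite /GRing.scale/= mulr1.
have cG : continuous (fun s => 2 * c * dphi s - c ^+ 2)%R.
  move=> s; apply: cvgB; last exact: cvg_cst.
  by apply: cvgM; [exact: cvg_cst|exact: cd].
have key : \int[mu]_(s in `[0%R, t]) (2 * c * dphi s - c ^+ 2)%R%:E <=
    \int[mu]_(s in `[0%R, t]) ((dphi s) ^+ 2)%R%:E.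
  apply: le_integral => //.
  - apply: continuous_compact_integrable; first exact: segment_compact.
    exact: continuous_subspaceT.
  - apply: continuous_compact_integrable; first exact: segment_compact.
    exact: continuous_subspaceT.
  - move=> s _; rewrite lee_fin; have := sqr_ge0 (dphi s - c); lra.
rewrite (FTC_itv tp dG cG) in key.
rewrite -lee_pdivrMl//; apply: le_trans key; rewrite -EFinM lee_fin /G /c.
by rewrite le_eqVlt; apply/orP; left; apply/eqP; field.
Qed.

Lemma le_integral_nonneg d (T : measurableType d) (m : {measure set T -> \bar R})
    (D : set T) (f g : T -> \bar R) :
  (forall x, D x -> 0 <= f x) -> (forall x, D x -> f x <= g x) ->
  \int[m]_(x in D) f x <= \int[m]_(x in D) g x.
Proof.
move=> f0 fg; rewrite !ge0_integralE//; last by move=> x Dx; apply: le_trans (f0 x Dx) (fg x Dx).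
apply: ge_ereal_sup => _ [h hf <-]; apply: ereal_sup_ubound; exists h => //= x.
apply: le_trans (hf x) _; rewrite !patchE; case: ifPn => [|//].
by rewrite inE => /fg.
Qed.

(** Bound phi 0 ^ 2 by 2 phi t ^ 2 + 2 (phi t - phi 0) ^ 2, and integrate over t in
    [h, 2h]. *)
Lemma value_from_layer (phi dphi : R -> R) (h : R) : (0 < h)%R ->
  (forall t : R, is_derive t (1%R : R) phi (dphi t)) -> continuous dphi ->
  (h * phi 0 ^+ 2)%:E <= \int[mu]_(t in `[0%R, (2 * h)%R])
    (2 * (\1_`[h, (2 * h)%R]%classic t * phi t ^+ 2) + 4 * h ^+ 2 * dphi t ^+ 2)%R%:E.
Proof.
move=> h0 dE cd.
have h20 : (0 <= 2 * h)%R by rewrite mulr_ge0// ltW.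
have cphi := derive_continuous dE.
have sqr_cont (f : R -> R) : continuous f -> continuous (fun s => f s ^+ 2)%R.
  by move=> cf s; apply: (@continuous_comp _ _ _ f (fun x => x ^+ 2)%R); [exact: cf|exact: exprn_continuous].
have mphi : measurable_fun setT (fun s => phi s ^+ 2)%R by apply: continuous_measurable_fun; exact: sqr_cont.
have mdphi : measurable_fun setT (fun s => dphi s ^+ 2)%R by apply: continuous_measurable_fun; exact: sqr_cont.
pose I := \int[mu]_(s in `[0%R, (2 * h)%R]) ((dphi s) ^+ 2)%R%:E.
have m1 : measurable_fun setT (fun t => (2 * (\1_`[h, (2 * h)%R]%classic t * phi t ^+ 2))%R%:E).
  by apply/measurable_EFinP; apply: measurable_funM => //; apply: measurable_funM => //; exact: measurable_indic.
have m2 : measurable_fun setT (fun t => (4 * h ^+ 2 * dphi t ^+ 2)%R%:E).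
  by apply/measurable_EFinP; apply: measurable_funM.
under eq_integral do rewrite EFinD.
rewrite ge0_integralD//; last 4 first.
- by move=> t _; rewrite lee_fin mulr_ge0// mulr_ge0 ?sqr_ge0// indicE.
- exact: measurable_funTS.
- by move=> t _; rewrite lee_fin mulr_ge0 ?sqr_ge0// mulr_ge0 ?sqr_ge0.
- exact: measurable_funTS.
have I2 : \int[mu]_(t in `[0%R, (2 * h)%R]) (4 * h ^+ 2 * dphi t ^+ 2)%R%:E = (4 * h ^+ 2)%:E * I.
  under eq_integral do rewrite EFinM.
  rewrite ge0_integralZl//; last 3 first.
  - by apply/measurable_EFinP; exact: measurable_funTS.
  - by move=> t _; rewrite lee_fin sqr_ge0.
  - by rewrite lee_fin mulr_ge0// sqr_ge0.
rewrite I2.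
have I0 : 0 <= I by apply: integral_ge0 => t _; rewrite lee_fin sqr_ge0.
have [Ioo|Ifin] := eqVneq I +oo.
  rewrite Ioo gt0_muley; last by rewrite lte_fin mulr_gt0// exprn_gt0.
  rewrite addey ?leey//.
  suff : 0 <= \int[mu]_(t in `[0%R, (2 * h)%R]) (2 * (\1_`[h, (2 * h)%R]%classic t * phi t ^+ 2))%:E by case: integral.
  by apply: integral_ge0 => t _; rewrite lee_fin mulr_ge0// mulr_ge0 ?sqr_ge0// indicE.
have Ifn : I \is a fin_num by rewrite ge0_fin_numE// ltey.
have point t : (h <= t <= 2 * h)%R -> (phi 0 ^+ 2 - 4 * h * fine I <= 2 * phi t ^+ 2)%R.
  move=> /andP[ht t2h]; have t0 : (0 <= t)%R by lra.
  have : ((phi t - phi 0) ^+ 2)%R%:E <= (2 * h * fine I)%:E.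
    apply: le_trans (sqr_increment t0 dE cd) _.
    rewrite EFinM fineK//; apply: lee_pmul => //.
    - by apply: integral_ge0 => s _; rewrite lee_fin sqr_ge0.
    - apply: ge0_subset_integral => //.
      + by apply/measurable_EFinP; exact: measurable_funTS.
      + by move=> s _; rewrite lee_fin sqr_ge0.
      + by move=> s /=; rewrite !in_itv/= => /andP[-> /le_trans]; apply.
  rewrite lee_fin; have := sqr_ge0 (2 * phi t - phi 0)%R; lra.
have lower : (h * (phi 0 ^+ 2 - 4 * h * fine I))%:E <=
    \int[mu]_(t in `[0%R, (2 * h)%R]) (2 * (\1_`[h, (2 * h)%R]%classic t * phi t ^+ 2))%:E.
  have [neg|pos] := leP (phi 0 ^+ 2 - 4 * h * fine I)%R 0%R.
    apply: (@le_trans _ _ 0); first by rewrite lee_fin mulr_ge0_le0// ltW.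
    by apply: integral_ge0 => t _; rewrite lee_fin mulr_ge0// mulr_ge0 ?sqr_ge0// indicE.
  apply: (@le_trans _ _ (\int[mu]_(t in `[h, (2 * h)%R]) (phi 0 ^+ 2 - 4 * h * fine I)%:E)).
    rewrite integral_cst//= lebesgue_measure_itv/= lte_fin ifT; last by move: h0; lra.
    by rewrite -EFinD -EFinM lee_fin; rewrite le_eqVlt; apply/orP; left; apply/eqP; ring.
  rewrite integral_mkcond [leRHS]integral_mkcond; apply: le_integral_nonneg => t _.
    by rewrite patchE; case: ifPn => // _; rewrite lee_fin ltW.
  rewrite !patchE; case: ifPn => [|_]; last first.
    by case: ifP => // _; rewrite lee_fin mulr_ge0// mulr_ge0 ?sqr_ge0// indicE.
  rewrite inE/= in_itv/= => /andP[ht t2h].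
  rewrite ifT; last by rewrite inE/= in_itv/= t2h andbT; lra.
  rewrite indicE mem_set/= ?in_itv/= ?ht ?t2h// mul1r lee_fin; apply: point.
  by rewrite ht.
apply: (@le_trans _ _ ((h * (phi 0 ^+ 2 - 4 * h * fine I))%:E + (4 * h ^+ 2)%:E * I)).
  by rewrite -(fineK Ifn) -EFinM -EFinD lee_fin /=; rewrite le_eqVlt; apply/orP; left; apply/eqP; ring.
by rewrite leeD2r.
Qed.

End one_dimensional.

Lemma le_integral_but0 {R : realType} (a : R) (f g : R -> \bar R) :
  (forall t, (0 <= f t)%E) -> measurable_fun setT f ->
  (forall t, (0 < t <= a)%R -> (f t <= g t)%E) ->
  (forall t, (0 <= g t)%E) ->
  (\int[@lebesgue_measure R]_(t in `[0%R, a]) f t <=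
   \int[@lebesgue_measure R]_(t in `[0%R, a]) g t)%E.
Proof.
move=> f0 mf fg g0; rewrite -(@integral_setD1 _ _ 0%R); last 2 first.
- by apply: measurableD => //; exact: measurable_itv.
- exact: measurable_funTS.
rewrite integral_mkcond [leRHS]integral_mkcond; apply: le_integral_nonneg => t _.
  by rewrite patchE; case: ifP.
rewrite !patchE; case: ifPn => [|_]; last by case: ifP.
rewrite inE => -[/= tI t0]; rewrite mem_set//; apply: fg.
move: tI; rewrite in_itv/= => /andP[t0' ->]; rewrite andbT lt_neqAle t0' andbT eq_sym.
exact/eqP.
Qed.

Section layer.
Context {R : realType} {n : nat}.
Local Open Scope ereal_scope.
Local Notation Bo := (borel_rV R n).
Local Notation leb := (@lebesgue_rV R n).

Lemma shift_coordE (i : 'I_n) (s : R) (x : 'rV[R]_n) (t : R) :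
  shift_coord i x (s * t) = (x + t *: (s *: delta_mx ord0 i))%R.
Proof.
apply/rowP => j; rewrite /shift_coord /set_coord !mxE eqxx /=.
have [->|_] := eqVneq j i; first by rewrite mulr1 mulrC.
by rewrite !mulr0 addr0.
Qed.

Lemma continuous_sqr_borel (v : 'rV[R]_n -> R) : continuous v ->
  measurable_fun setT ((fun x => v x ^+ 2)%R : Bo -> R).
Proof.
move=> cv; apply: continuous_borel => x.
by apply: (@continuous_comp _ _ _ v (fun t => t ^+ 2)%R); [exact: cv|exact: exprn_continuous].
Qed.

(** The value on the graph piece S is compared, along the vertical segments that start
    there, with the values on the slab U at height [h, 2h].  The factor h in front of the
    derivative is what makes the trace compact. *)
Lemma layer_inequality (i : 'I_n) (s M h : R) (S U Omega : set 'rV[R]_n)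
    (v : 'rV[R]_n -> R) :
  `|s|%R = 1%R -> (0 < M)%R -> (0 < h)%R ->
  (forall a b : 'rV[R]_n, (forall j, j != i -> a ord0 j < b ord0 j)%R ->
    hausdorff_outer n.-1 (S `&` cylinder i a b) <= (M * base_volume i a b)%:E) ->
  hausdorff_outer n.-1 S < +oo ->
  measurable (S : set Bo) -> measurable (U : set Bo) -> measurable (Omega : set Bo) ->
  (forall x t, S x -> (0 < t <= 2 * h)%R -> Omega (shift_coord i x (s * t))) ->
  (forall x t, S x -> (h <= t <= 2 * h)%R -> U (shift_coord i x (s * t))) ->
  U `<=` Omega -> S `&` Omega = set0 -> Ck 1 v ->
  \int[surface_measure]_(x in S) (v x ^+ 2)%:E <=
    (2 * M / h)%:E * \int[leb]_(x in U) (v x ^+ 2)%:E +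
    (4 * M * h)%:E * \int[leb]_(x in Omega) (partial i v x ^+ 2)%:E.
Proof.
move=> s1 M0 h0 HS Soo mS mU mOm SOm SU UOm SOm0 C1v.
pose f x := (2 * (\1_U x * v x ^+ 2) + 4 * h ^+ 2 * (\1_Omega x * partial i v x ^+ 2))%R.
have cv := Ck1_continuous C1v.
have cp : continuous (partial i v) by exact: Ck1_partial.
have mf1 : measurable_fun setT ((fun x => 2 * (\1_U x * v x ^+ 2))%R : Bo -> R).
  apply: measurable_funM => //; apply: measurable_funM; first exact: measurable_indic.
  exact: continuous_sqr_borel.
have mf2 : measurable_fun setT ((fun x => 4 * h ^+ 2 * (\1_Omega x * partial i v x ^+ 2))%R : Bo -> R).
  apply: measurable_funM => //; apply: measurable_funM; first exact: measurable_indic.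
  exact: continuous_sqr_borel.
have mf : measurable_fun setT (f : Bo -> R) by exact: measurable_funD.
have i0 (A : set 'rV[R]_n) x : (0 <= \1_A x :> R)%R by rewrite indicE.
have f10 x : (0 <= 2 * (\1_U x * v x ^+ 2))%R.
  by apply: mulr_ge0 => //; apply: mulr_ge0 => //; exact: sqr_ge0.
have f20 x : (0 <= 4 * h ^+ 2 * (\1_Omega x * partial i v x ^+ 2))%R.
  by apply: mulr_ge0; [rewrite mulr_ge0 ?sqr_ge0//|apply: mulr_ge0 => //; exact: sqr_ge0].
have f0 x : (0 <= f x)%R by rewrite addr_ge0.
have mSH : measurable (S : set (caratheodory_type (@hausdorff_outer R n n.-1))) by exact: borel_hausdorff.
have mfE : measurable_fun setT ((fun x => (f x)%:E) : Bo -> \bar R) by exact/measurable_EFinP.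
have f0E x : 0 <= (f x)%:E by rewrite lee_fin.
have transport := @vertical_transport R n i s M S setT 0%R (2 * h)%R _
  s1 M0 HS Soo mS measurableT mfE f0E (fun _ _ _ _ => Logic.I).
have lower : h%:E * \int[surface_measure]_(x in S) (v x ^+ 2)%:E <= M%:E * \int[leb]_x (f x)%:E.
  apply: le_trans transport.
  rewrite (integral_scale _ mSH (ltW h0) (fun x => sqr_ge0 (v x)));
    last by apply: measurable_funTS; apply: borel_fun_hausdorff; exact: continuous_sqr_borel.
  apply: le_integral_nonneg => x Sx.
    by rewrite lee_fin; apply: mulr_ge0; [exact: ltW|exact: sqr_ge0].
  pose phi t := v (x + t *: (s *: delta_mx ord0 i))%R.
  pose dphi t := (s * partial i v (x + t *: (s *: delta_mx ord0 i)))%R.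
  have dE (t : R) : is_derive t (1%R : R) phi (dphi t).
    have := C1_line x (s *: delta_mx ord0 i)%R t C1v.
    rewrite (bigD1 i)//= big1 ?addr0 => [|j ji]; rewrite !mxE.
      by rewrite !eqxx mulr1.
    by rewrite (negPf ji) mulr0 mul0r.
  have cd : continuous dphi.
    move=> t; apply: cvgM; first exact: cvg_cst.
    by apply: (@continuous_comp _ _ _ (fun t : R => x + t *: (s *: delta_mx ord0 i))%R (partial i v));
      [exact: continuous_line|exact: cp].
  have := value_from_layer h0 dE cd; rewrite {1}/phi scale0r addr0 => /le_trans; apply.
  have cphi := derive_continuous dE.
  apply: le_integral_but0.
  - move=> t; rewrite lee_fin; apply: addr_ge0.
      by apply: mulr_ge0 => //; apply: mulr_ge0; [rewrite indicE|exact: sqr_ge0].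
    by apply: mulr_ge0; [apply: mulr_ge0 => //; exact: sqr_ge0|exact: sqr_ge0].
  - apply/measurable_EFinP; apply: measurable_funD.
      apply: measurable_funM => //; apply: measurable_funM; first by apply: measurable_indic; exact: measurable_itv.
      by apply: measurable_funX; exact: continuous_measurable_fun.
    by apply: measurable_funM => //; apply: measurable_funX; exact: continuous_measurable_fun.
  - move=> t /andP[tp t2h]; rewrite lee_fin /f shift_coordE; apply: lerD.
      rewrite ler_pM2l// /phi; apply: ler_wpM2r; first exact: sqr_ge0.
      rewrite !indicE; case: (boolP (t \in _)) => // ht.
      rewrite mem_set// -shift_coordE; apply: SU => //.
      by move: ht; rewrite inE/= in_itv.
    rewrite /dphi exprMn -(real_normK (num_real s)) s1 expr1n mul1r.
    rewrite indicE mem_set ?mul1r// -shift_coordE; apply: SOm => //.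
    by rewrite tp.
  - by move=> t; exact: f0E.
have upper : \int[leb]_x (f x)%:E = 2%:E * \int[leb]_(x in U) (v x ^+ 2)%:E +
    (4 * h ^+ 2)%:E * \int[leb]_(x in Omega) (partial i v x ^+ 2)%:E.
  rewrite (@integral_addf _ _ _ leb _ _ _ measurableT f10 (borel_fun_lebesgue mf1) f20 (borel_fun_lebesgue mf2)).
  have part (A : set 'rV[R]_n) (c : R) (w : 'rV[R]_n -> R) : (0 <= c)%R ->
      measurable (A : set Bo) -> continuous w ->
      \int[leb]_x (c * (\1_A x * w x ^+ 2))%:E = c%:E * \int[leb]_(x in A) (w x ^+ 2)%:E.
    move=> c0 mA cw; have mAL := borel_lebesgue mA.
    rewrite -(integral_scale _ measurableT c0); last 2 first.
    - by move=> x; apply: mulr_ge0 => //; exact: sqr_ge0.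
    - apply: borel_fun_lebesgue; apply: measurable_funM; first exact: measurable_indic.
      exact: continuous_sqr_borel.
    congr (_ * _); rewrite [RHS]integral_mkcond; apply: eq_integral => x _.
    by rewrite patchE indicE; case: ifP => _; rewrite ?mul1r// mul0r.
  by rewrite !part// mulr_ge0// sqr_ge0.
rewrite upper in lower.
by apply: (layer_arithmetic h0 M0 _ _ lower); exact: integral_sqr_ge0.
Qed.

End layer.

(** * Poincare's inequality on cubes *)

Section cube.
Context {R : realType} {n : nat}.
Local Open Scope ereal_scope.
Local Notation Bo := (borel_rV R n).
Local Notation CL := (caratheodory_type (@lebesgue_outer R n)).
Local Notation leb := (@lebesgue_rV R n).

Lemma integral_mrestr d (T : measurableType d) (m : {measure set T -> \bar R})
    (E : set T) (mE : measurable E) (f : T -> \bar R) : (forall x, 0 <= f x) ->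
  measurable_fun setT f -> \int[mrestr m mE]_x f x = \int[m]_(x in E) f x.
Proof.
move=> f0 mf; apply/eqP; rewrite eq_le le_integral_mrestr// andbT.
rewrite (@ge0_negligible_integral _ _ _ (mrestr m mE) setT (~` E))//; last 2 first.
- exact: measurableC.
- by rewrite /mrestr; change (m (~` E `&` E) = 0); rewrite setICl measure0.
rewrite setTD setCK integral_mkcond [leRHS]integral_mkcond.
apply: le_measure_integral => [A mA|x]; last by rewrite patchE; case: ifP.
by rewrite /mrestr; apply: le_measure; rewrite ?inE//; exact: measurableI.
Qed.

Lemma measurable_coord_lebesgue i :
  measurable_fun setT (fun x : CL => (x : 'rV[R]_n) ord0 i).
Proof.
exact: (borel_fun_lebesgue (f := fun x : 'rV[R]_n => x ord0 i) (measurable_coord i)).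
Qed.

Definition toward (z x : 'rV[R]_n) (s : R) : 'rV[R]_n := (x + s *: (z - x))%R.

Lemma toward_coord z x s j :
  toward z x s ord0 j = (x ord0 j + s * (z ord0 j - x ord0 j))%R.
Proof. by rewrite /toward !mxE. Qed.

Lemma obox_toward p q z x s : obox p q z -> obox p q x -> (0 <= s <= 1)%R ->
  obox p q (toward z x s).
Proof.
move=> zQ xQ /andP[s0 s1] j; rewrite toward_coord.
have /andP[z1 z2] := zQ j; have /andP[x1 x2] := xQ j; apply/andP; split.
  have [s1'|s1'] := ltP s 1%R; last by rewrite (_ : s = 1%R) ?mul1r; lra.
  have h1 : (0 < (1 - s) * (x ord0 j - p ord0 j))%R by rewrite mulr_gt0 ?subr_gt0.
  have h2 : (0 <= s * (z ord0 j - p ord0 j))%R by rewrite mulr_ge0// subr_ge0 ltW.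
  lra.
have h1 : (0 <= (1 - s) * (q ord0 j - x ord0 j))%R by rewrite mulr_ge0 ?subr_ge0.
have h2 : (0 <= s * (q ord0 j - z ord0 j))%R by rewrite mulr_ge0 ?subr_ge0.
lra.
Qed.

Lemma preimage_toward (z : 'rV[R]_n) s (a b x : 'rV[R]_n) : (s <= 2^-1)%R ->
  obox a b (toward z x s) ->
  obox (\row_j ((a ord0 j - s * z ord0 j) / (1 - s))%R)
       (\row_j ((b ord0 j - s * z ord0 j) / (1 - s))%R) x.
Proof.
move=> s2 h j; have := h j; rewrite toward_coord !mxE.
have s10 : (0 < 1 - s)%R by lra.
by rewrite ltr_pdivrMr// ler_pdivlMr// => /andP[h1 h2]; apply/andP; split; lra.
Qed.

Lemma volume_toward (z : 'rV[R]_n) s (a b : 'rV[R]_n) : (s <= 2^-1)%R ->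
  (forall j, a ord0 j < b ord0 j)%R ->
  (volume (\row_j ((a ord0 j - s * z ord0 j) / (1 - s))%R)
       (\row_j ((b ord0 j - s * z ord0 j) / (1 - s))%R) <= 2 ^+ n * volume a b)%R.
Proof.
move=> s2 ab; have s10 : (0 < 1 - s)%R by lra.
rewrite /volume; have -> : (2 ^+ n = \prod_(j < n) 2 :> R)%R by rewrite prodr_const card_ord.
rewrite -big_split/=; apply: ler_prod => j _; rewrite !mxE -mulrBl opprB addrA subrK.
have d0 : (0 < b ord0 j - a ord0 j)%R by rewrite subr_gt0.
rewrite divr_ge0 ?(ltW d0) ?(ltW s10)//= ler_pdivrMr//; nra.
Qed.

(** Moving the points of a box at most half of the way toward one of its points
    concentrates volumes by a factor at most 2 ^ n. *)
Lemma toward_transport (p q z : 'rV[R]_n) (f : Bo -> \bar R) :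
  (forall j, p ord0 j < q ord0 j)%R -> obox p q z ->
  measurable_fun setT f -> (forall x, 0 <= f x) ->
  \int[leb]_(x in obox p q) \int[lebesgue_measure]_(s in `[0%R, 2^-1%R]) f (toward z x s)
    <= (2 ^+ n)%:E * \int[leb]_(x in obox p q) f x.
Proof.
move=> pq Qz mf f0; pose Q : set CL := obox p q.
have mQ : measurable Q by apply: borel_lebesgue; exact: measurable_obox.
have Qoo : leb Q < +oo by apply: le_lt_trans (le_lebesgue_obox pq) _; exact: ltry.
pose m2 : {finite_measure set CL -> \bar R} := mfrestr mQ Qoo.
pose phi (w : R * CL) : Bo := toward z w.2 w.1.
have mphi : measurable_fun setT phi.
  apply: measurable_rV_fun => j.
  rewrite (_ : (fun w => _) = (fun w : R * CL => (w.2 : 'rV[R]_n) ord0 j +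
      w.1 * (z ord0 j - (w.2 : 'rV[R]_n) ord0 j))%R); last first.
    by apply/funext => w; rewrite /phi toward_coord.
  have m2j : measurable_fun setT (fun w : R * CL => (w.2 : 'rV[R]_n) ord0 j).
    exact: (measurableT_comp (measurable_coord_lebesgue j) measurable_snd).
  apply: measurable_funD => //; apply: measurable_funM; first exact: measurable_fst.
  exact: measurable_funB.
pose I2 : set R := `[0%R, 2^-1%R]%classic.
pose E : set (R * CL) := I2 `*` Q.
have mI2 : measurable I2 by exact: measurable_itv.
have mE : measurable E by exact: measurableX.
pose g := (f \o phi) \_ E.
have g0 w : 0 <= g w by rewrite /g patchE; case: ifP => _; [exact: f0|exact: lexx].
have mg : measurable_fun setT g.
  by apply/(measurable_restrictT _ mE); apply: measurable_funTS; exact: (measurableT_comp mf mphi).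
have -> : \int[leb]_(x in obox p q) \int[lebesgue_measure]_(s in `[0%R, 2^-1%R]) f (toward z x s) =
    \int[leb]_(x in Q) fubini_G (@lebesgue_measure R) g x.
  apply: eq_integral => x Qx; rewrite /fubini_G [LHS]integral_mkcond.
  apply: eq_integral => t _.
  by rewrite /g !patchE /E in_setX /= Qx andbT.
have G0 x : 0 <= fubini_G (@lebesgue_measure R) g x by exact: integral_ge0.
apply: (le_trans (le_integral_mrestr _ mQ G0)).
pose m12 := ((@lebesgue_measure R) \x m2 : {measure set _ -> \bar R})%E.
have := fubini_tonelli2 (m1 := @lebesgue_measure R) (m2 := m2) _ mg g0.
move=> e; rewrite -[leLHS]e /g -integral_mkcond.
apply: (@transport_integral _ _ _ _ m12 phi E Q (2 ^+ n)%R f) => //.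
- exact: measurable_obox.
- move=> a b ab; pose A : set (R * CL) := phi @^-1` (obox a b : set Bo) `&` E.
  have mA : measurable A.
    apply: measurableI => //; rewrite -[X in measurable X]setTI.
    by apply: mphi => //; exact: measurable_obox.
  have v0 : (0 <= 2 ^+ n * volume a b)%R.
    rewrite mulr_ge0 ?exprn_ge0//; apply: prodr_ge0 => j _; by rewrite subr_ge0 ltW.
  change (\int[@lebesgue_measure R]_s m2 (xsection A s) <= (2 ^+ n * volume a b)%:E).
  apply: (@le_trans _ _ (\int[@lebesgue_measure R]_(s in I2) (2 ^+ n * volume a b)%:E)); last first.
    rewrite integral_cst//= lebesgue_measure_itv/= lte_fin invr_gt0 ltr0n /=.
    rewrite -EFinB subr0 -EFinM lee_fin ler_piMr//; lra.
  rewrite [leRHS]integral_mkcond; apply: ge0_le_integral.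
  + exact: measurableT.
  + by move=> x _; exact: measure_ge0.
  + exact: measurable_fun_xsection.
  + by apply/(measurable_restrictT _ mI2); exact: measurable_cst.
  move=> s _ /=; rewrite patchE; case: ifPn => [|nIs]; last first.
    suff -> : xsection A s = set0 by change (m2 set0 <= 0); rewrite measure0.
    rewrite -subset0 => t; rewrite /xsection/= inE => -[/= _ [Is _]].
    by move/negP: nIs; apply; rewrite inE.
  rewrite inE /I2 /= in_itv/= => /andP[s0 s2].
  pose a' : 'rV[R]_n := \row_j ((a ord0 j - s * z ord0 j) / (1 - s))%R.
  pose b' : 'rV[R]_n := \row_j ((b ord0 j - s * z ord0 j) / (1 - s))%R.
  have a'b' j : (a' ord0 j < b' ord0 j)%R.
    have s10 : (0 < 1 - s)%R by lra.
    by rewrite !mxE ltr_pM2r ?invr_gt0// ltrD2r.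
  apply: (@le_trans _ _ (leb (obox a' b' : set CL))).
    rewrite /m2 /= /mfrestr /mrestr; apply: (@le_outer_measure _ _ (@lebesgue_outer R n)).
    move=> x [xA _]; move: xA; rewrite /xsection /= inE => -[h _].
    exact: preimage_toward h.
  apply: le_trans (le_lebesgue_obox a'b') _; rewrite lee_fin.
  exact: volume_toward.
- move=> [s x] [/= Is Qx]; move: Is; rewrite /I2 /= in_itv/= => /andP[s0 s2].
  by apply: obox_toward => //; rewrite s0 /=; lra.
Qed.

End cube.

Section poincare.
Context {R : realType} {n : nat}.
Local Open Scope ereal_scope.
Local Notation Bo := (borel_rV R n).
Local Notation leb := (@lebesgue_rV R n).

Lemma sqr_sum_le (k : nat) (f : 'I_k -> R) :
  ((\sum_i f i) ^+ 2 <= k%:R * \sum_i f i ^+ 2)%R.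
Proof.
elim: k f => [|k IH] f; first by rewrite !big_ord0 mulr0 expr0n.
have [k0|k0] := posnP k.
  by rewrite k0 in f *; rewrite !big_ord1 mul1r.
rewrite !big_ord_recr/=.
have h := IH (fun i => f (widen_ord (leqnSn k) i)).
move: h; set A := (\sum_(i < k) f (widen_ord (leqnSn k) i))%R.
set T := (\sum_(i < k) f (widen_ord (leqnSn k) i) ^+ 2)%R; set y := f ord_max.
move=> h; rewrite -natr1.
have kp : (0 < k%:R :> R)%R by rewrite ltr0n.
have c : (2 * A * y <= T + k%:R * y ^+ 2)%R.
  rewrite -(ler_pM2l kp); have := sqr_ge0 (A - k%:R * y)%R.
  by rewrite sqrrB => hh; nra.
nra.
Qed.

Definition grad2 (v : 'rV[R]_n -> R) (x : 'rV[R]_n) : R := (\sum_i partial i v x ^+ 2)%R.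

Lemma grad2_ge0 v x : (0 <= grad2 v x)%R.
Proof. by apply: sumr_ge0 => i _; exact: sqr_ge0. Qed.

Lemma continuous_sqr (v : 'rV[R]_n -> R) : continuous v -> continuous (fun x => v x ^+ 2)%R.
Proof.
move=> cv x; apply: (@continuous_comp _ _ _ v (fun t => t ^+ 2)%R); [exact: cv|exact: exprn_continuous].
Qed.

Lemma continuous_grad2 v : Ck 1 v -> continuous (grad2 v).
Proof.
move=> C1v; apply: continuous_sum_fun => i; apply: continuous_sqr.
exact: Ck1_partial.
Qed.

Definition cbox (M : R) : set 'rV[R]_n := [set x | forall i, (`|x ord0 i| <= M)%R].

Lemma bounded_cbox (D : set 'rV[R]_n) : bounded_set D -> exists2 M : R, (0 < M)%R & D `<=` cbox M.
Proof.
move=> [M [_ hM]]; exists (`|M| + 1)%R; first by rewrite ltr_wpDl.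
move=> x Dx i; have xM : (`|x| <= `|M| + 1)%R.
  by apply: (hM (`|M| + 1)%R) => //; rewrite ltr_pwDr// ler_norm.
apply: le_trans xM.
by rewrite [leRHS]mx_normrE; apply: (le_bigmax _ _ (ord0, i)).
Qed.

Lemma compact_cbox (M : R) : compact (cbox M).
Proof.
have := @rV_compact _ n (fun=> `[(- M)%R, M]%classic) (fun=> @segment_compact _ _ _).
congr compact; apply/seteqP; split => x h i; have := h i; rewrite /= in_itv/= ler_norml//.
Qed.

Lemma closed_cbox (M : R) : closed (cbox M).
Proof.
apply: compact_closed; last exact: compact_cbox.
exact: norm_hausdorff.
Qed.

Lemma lebesgue_bounded_lty (D : set 'rV[R]_n) : bounded_set D -> lebesgue_outer D < +oo.
Proof.
move=> /bounded_cbox[M M0 DM]; pose K := (M + 1)%R.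
pose a : 'rV[R]_n := (\row_i (- K))%R; pose b : 'rV[R]_n := (\row_i K)%R.
have ab j : (a ord0 j < b ord0 j)%R by rewrite !mxE /K; lra.
have Dab : lebesgue_outer D <= lebesgue_outer (obox a b); last first.
  by apply: le_lt_trans Dab _; apply: le_lt_trans (le_lebesgue_obox ab) _; exact: ltry.
apply: (@le_outer_measure _ _ (@lebesgue_outer R n)) => x /DM xM j; rewrite !mxE.
have := xM j; rewrite ler_norml /K => /andP[h1 h2]; apply/andP; split; lra.
Qed.

Lemma continuous_bounded_on (D : set 'rV[R]_n) (f : 'rV[R]_n -> R) :
  bounded_set D -> continuous f -> exists M : R, forall x, D x -> (`|f x| <= M)%R.
Proof.
move=> /bounded_cbox[K _ DK] cf.
have := @continuous_compact _ _ f (cbox K) (continuous_subspaceT cf) (@compact_cbox K).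
move=> /compact_bounded[M [_ hM]].
exists (M + 1)%R => x Dx; apply: (hM (M + 1)%R); first by rewrite ltrDl.
by exists x => //; exact: DK.
Qed.

Lemma continuous_integrable (D : set 'rV[R]_n) (f : 'rV[R]_n -> R) :
  measurable (D : set Bo) -> bounded_set D -> continuous f -> leb.-integrable D (EFin \o f).
Proof.
move=> mD bD cf; apply: measurable_bounded_integrable.
- exact: borel_lebesgue.
- exact: lebesgue_bounded_lty.
- by apply: measurable_funTS; apply: borel_fun_lebesgue; exact: continuous_borel.
have [M hM] := continuous_bounded_on bD cf.
exists M; split; first exact: num_real.
by move=> N MN x Dx; apply: le_trans (hM x Dx) _; exact: ltW.
Qed.

End poincare.

Section poincare_cube.
Context {R : realType} {n : nat}.
Local Open Scope ereal_scope.
Local Notation Bo := (borel_rV R n).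
Local Notation CL := (caratheodory_type (@lebesgue_outer R n)).
Local Notation leb := (@lebesgue_rV R n).

Lemma bounded_obox (a b : 'rV[R]_n) : bounded_set (obox a b).
Proof.
exists (`|a| + `|b|)%R; split; first exact: num_real.
move=> M hM x xab; apply: le_trans (ltW hM).
rewrite [leLHS]mx_normrE; apply/bigmax_leP; split; first by rewrite addr_ge0.
move=> [i j] _ /=; rewrite (ord1 i); have /andP[h1 h2] := xab j.
have ha : (`|a ord0 j| <= `|a|)%R by rewrite [leRHS]mx_normrE; apply: (le_bigmax _ _ (ord0, j)).
have hb : (`|b ord0 j| <= `|b|)%R by rewrite [leRHS]mx_normrE; apply: (le_bigmax _ _ (ord0, j)).
move: ha hb; rewrite !ler_norml => /andP[ha1 ha2] /andP[hb1 hb2]; apply/andP; split; lra.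
Qed.

Section one_cube.
Variables (p q : 'rV[R]_n) (l : R) (v : 'rV[R]_n -> R).
Hypotheses (pq : forall j, (p ord0 j < q ord0 j)%R)
  (pql : forall j, (q ord0 j - p ord0 j <= l)%R) (C1v : Ck 1 v).
Let Q : set 'rV[R]_n := obox p q.
Let D (x z : 'rV[R]_n) : R := ((v x - v (toward z x 2^-1)) ^+ 2)%R.
Let I : R := \int[leb]_(x in Q) v x.
Let J : R := \int[leb]_(x in Q) (v x ^+ 2)%R.
Let G : R := \int[leb]_(x in Q) grad2 v x.
Let m : R := fine (leb Q).

Lemma path_derivative (x z : 'rV[R]_n) (s : R) :
  is_derive s (1%R : R) (fun t => v (toward z x t))
    (\sum_k (z - x) ord0 k * partial k v (toward z x s))%R.
Proof. exact: C1_line. Qed.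

Lemma continuous_path_derivative (x z : 'rV[R]_n) :
  continuous (fun s : R => \sum_k (z - x) ord0 k * partial k v (toward z x s))%R.
Proof.
move=> s; rewrite (_ : (fun _ => _) = (fun y => \sum_k (z - x) ord0 k * partial k v y)%R \o
    (fun s : R => x + s *: (z - x))%R)//.
apply: continuous_comp; first exact: continuous_line.
apply: continuous_sum_fun => k y.
have c : continuous (partial k v) by exact: Ck1_partial.
by apply: continuousM; [exact: cst_continuous|exact: c].
Qed.

Lemma path_derivative_le (x z : 'rV[R]_n) (s : R) : Q x -> Q z ->
  ((\sum_k (z - x) ord0 k * partial k v (toward z x s)) ^+ 2 <=
   n%:R * l ^+ 2 * grad2 v (toward z x s))%R.
Proof.
move=> Qx Qz; apply: le_trans (sqr_sum_le _) _.
rewrite -mulrA ler_wpM2l ?ler0n// mulr_sumr; apply: ler_sum => k _.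
rewrite exprMn ler_wpM2r ?sqr_ge0// !mxE.
have /andP[z1 z2] := Qz k; have /andP[x1 x2] := Qx k; have h := pql k.
rewrite -[leLHS]real_normK ?num_real// ler_sqr ?nnegrE//; last by have := pq k; lra.
rewrite ler_norml; apply/andP; split; lra.
Qed.

Lemma midpoint_increment (x z : 'rV[R]_n) : Q x -> Q z ->
  (D x z)%:E <= \int[lebesgue_measure]_(s in `[0%R, 2^-1%R])
    (2^-1 * (n%:R * l ^+ 2 * grad2 v (toward z x s)))%:E.
Proof.
move=> Qx Qz.
have h2 : (0 <= 2^-1 :> R)%R by [].
have := sqr_increment h2 (@path_derivative x z) (@continuous_path_derivative x z).
have -> : toward z x 0 = x by rewrite /toward scale0r addr0.
have -> : ((v (toward z x 2^-1) - v x) ^+ 2 = D x z)%R by rewrite /D -sqrrN opprB.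
have msq : measurable_fun (`[0%R, 2^-1%R]%classic : set R)
    (fun s => (\sum_k (z - x) ord0 k * partial k v (toward z x s)) ^+ 2)%R.
  apply: measurable_funTS; apply: measurable_funX; apply: continuous_measurable_fun.
  exact: continuous_path_derivative.
rewrite integral_scale// => [|s]; last exact: sqr_ge0.
move=> /le_trans; apply; apply: le_integral_nonneg => s _.
  by rewrite lee_fin; apply: mulr_ge0 => //; exact: sqr_ge0.
by rewrite lee_fin; apply: ler_wpM2l => //; exact: path_derivative_le.
Qed.

Let mQB : measurable (Q : set Bo). Proof. exact: measurable_obox. Qed.
Let mQ : measurable (Q : set CL). Proof. exact: borel_lebesgue. Qed.
Let bQ : bounded_set Q. Proof. exact: bounded_obox. Qed.
Let Qoo : leb Q < +oo. Proof. exact: lebesgue_bounded_lty. Qed.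
Let Qfin : leb Q = m%:E.
Proof. by rewrite /m fineK// ge0_fin_numE. Qed.

Let c : R := (2^-1 * (n%:R * l ^+ 2) * (2 ^+ n * G))%R.

Lemma integral_midpoint (z : 'rV[R]_n) : Q z -> \int[leb]_(x in Q) (D x z)%:E <= c%:E.
Proof.
move=> Qz; pose g x := (2^-1 * (n%:R * l ^+ 2 * grad2 v x))%R.
have e0 : (0 <= 2^-1 * (n%:R * l ^+ 2) :> R)%R by apply: mulr_ge0 => //; apply: mulr_ge0 => //; exact: sqr_ge0.
have g0 x : (0 <= g x)%R.
  by rewrite /g mulrA; apply: mulr_ge0 => //; exact: grad2_ge0.
have mgrad : measurable_fun setT (grad2 v : Bo -> R).
  by apply: continuous_borel; exact: continuous_grad2.
have mgE : measurable_fun setT ((fun x => (g x)%:E) : Bo -> \bar R).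
  apply/measurable_EFinP; rewrite /g; under eq_fun do rewrite mulrA.
  exact: measurable_funM.
have g0E x : 0 <= (g x)%:E by rewrite lee_fin.
have := @toward_transport R n p q z (fun x => (g x)%:E) pq Qz mgE g0E.
have -> : \int[leb]_(x in obox p q) (g x)%:E = (2^-1 * (n%:R * l ^+ 2) * G)%:E.
  rewrite /g; under eq_integral do rewrite mulrA.
  rewrite -integral_scale//; last 2 first.
  - by move=> x; exact: grad2_ge0.
  - by apply: measurable_funTS; exact: borel_fun_lebesgue.
  rewrite [RHS]EFinM; congr (_ * _)%E; rewrite /G /Rintegral fineK//; apply: integrable_fin_num => //.
  apply: continuous_integrable => //; exact: continuous_grad2.
rewrite -EFinM (_ : 2 ^+ n * _ = c)%R; last by rewrite /c mulrCA.
apply: le_trans; apply: le_integral_nonneg => x Qx; first by rewrite lee_fin sqr_ge0.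
exact: midpoint_increment.
Qed.

Let D0 x z : (0 <= D x z)%R. Proof. exact: sqr_ge0. Qed.

Lemma measurable_midpoint :
  measurable_fun setT (fun w : CL * CL => v (toward w.2 w.1 2^-1)).
Proof.
apply: (measurableT_comp (f := (v : Bo -> R)) (g := fun w : CL * CL => (toward w.2 w.1 2^-1 : Bo))).
  by apply: continuous_borel; exact: Ck1_continuous.
apply: measurable_rV_fun => j.
rewrite (_ : (fun w => _) = (fun w : CL * CL => (w.1 : 'rV[R]_n) ord0 j +
    2^-1 * ((w.2 : 'rV[R]_n) ord0 j - (w.1 : 'rV[R]_n) ord0 j))%R); last first.
  by apply/funext => w; rewrite toward_coord.
have m1 : measurable_fun setT (fun w : CL * CL => (w.1 : 'rV[R]_n) ord0 j).
  exact: (measurableT_comp (measurable_coord_lebesgue j) measurable_fst).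
have m2 : measurable_fun setT (fun w : CL * CL => (w.2 : 'rV[R]_n) ord0 j).
  exact: (measurableT_comp (measurable_coord_lebesgue j) measurable_snd).
by apply: measurable_funD => //; apply: measurable_funM => //; exact: measurable_funB.
Qed.

Let mv : measurable_fun setT (v : CL -> R).
Proof. by apply: borel_fun_lebesgue; apply: continuous_borel; exact: Ck1_continuous. Qed.

Let mD : measurable_fun setT (fun w : CL * CL => D w.1 w.2).
Proof.
apply: measurable_funX; apply: measurable_funB; last exact: measurable_midpoint.
exact: (measurableT_comp mv measurable_fst).
Qed.

Lemma measurable_integral_midpoint :
  measurable_fun setT (fun x : CL => \int[leb]_(z in Q) (D x z)%:E).
Proof.
pose m1 : {finite_measure set CL -> \bar R} := mfrestr mQ Qoo.
pose F (w : CL * CL) := (D w.1 w.2)%:E.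
have mF : measurable_fun setT F by exact/measurable_EFinP.
have F0 w : 0 <= F w by rewrite lee_fin.
have sec1 x : \int[leb]_(z in Q) (D x z)%:E = \int[m1]_z F (x, z).
  rewrite -(integral_mrestr _ mQ).
  - by [].
  - by move=> z; rewrite lee_fin.
  - exact: (measurableT_comp (f := F) (g := fun z : CL => (x : CL, z)) mF (measurable_pair1 (x : CL))).
under eq_fun do rewrite sec1.
exact: (@measurable_fun_fubini_tonelli_F _ _ _ _ _ m1 F).
Qed.

Lemma swap_midpoint :
  \int[leb]_(x in Q) \int[leb]_(z in Q) (D x z)%:E <= (m * c)%:E.
Proof.
pose m1 : {finite_measure set CL -> \bar R} := mfrestr mQ Qoo.
pose F (w : CL * CL) := (D w.1 w.2)%:E.
have mF : measurable_fun setT F by exact/measurable_EFinP.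
have F0 w : 0 <= F w by rewrite lee_fin.
have sec1 x : \int[leb]_(z in Q) (D x z)%:E = \int[m1]_z F (x, z).
  rewrite -(integral_mrestr _ mQ).
  - by [].
  - by move=> z; rewrite lee_fin.
  - exact: (measurableT_comp (f := F) (g := fun z : CL => (x : CL, z)) mF (measurable_pair1 (x : CL))).
have sec2 z : \int[leb]_(x in Q) (D x z)%:E = \int[m1]_x F (x, z).
  rewrite -(integral_mrestr _ mQ).
  - by [].
  - by move=> x; rewrite lee_fin.
  - exact: (measurableT_comp (f := F) (g := fun x : CL => (x, z : CL)) mF (measurable_pair2 (z : CL))).
under eq_integral do rewrite sec1.
apply: (le_trans (le_integral_mrestr _ mQ _)).
  by move=> x; apply: integral_ge0.
have e := fubini_tonelli (m1 := m1) (m2 := m1) _ mF F0.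
rewrite [leLHS]e; under eq_integral do rewrite -sec2.
rewrite integral_mrestr; last 2 first.
- by move=> z; apply: integral_ge0 => x _; rewrite lee_fin.
- under eq_fun do rewrite sec2; exact: (@measurable_fun_fubini_tonelli_G _ _ _ _ _ m1 F).
apply: (@le_trans _ _ (\int[leb]_(z in Q) c%:E)).
  apply: le_integral_nonneg => z Qz; last exact: integral_midpoint.
  by apply: integral_ge0 => x _; rewrite lee_fin.
by rewrite (integral_cst_fin c mQ Qfin) mulrC.
Qed.

Let cv : continuous v. Proof. exact: Ck1_continuous. Qed.

Let iv : leb.-integrable Q (EFin \o v). Proof. exact: continuous_integrable. Qed.

Let iv2 : leb.-integrable Q (EFin \o (fun x => v x ^+ 2)%R).
Proof. apply: continuous_integrable => //; exact: continuous_sqr. Qed.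

Let icst (r : R) : leb.-integrable Q (EFin \o cst r).
Proof. apply: continuous_integrable => //; exact: cst_continuous. Qed.

Lemma integral_difference (x : 'rV[R]_n) :
  \int[leb]_(z in Q) ((v x - v z) ^+ 2)%:E = (m * v x ^+ 2 + (- (2 * I)) * v x + J)%:E.
Proof.
have cdiff : continuous (fun z => v x - v z)%R.
  by move=> z; apply: continuousB; [exact: cst_continuous|exact: cv].
have ci : leb.-integrable Q (EFin \o (fun z => (v x - v z) ^+ 2)%R).
  by apply: continuous_integrable => //; exact: continuous_sqr.
rewrite -[LHS]fineK; last exact: (integrable_fin_num mQ ci).
congr (_%:E); rewrite -[LHS]/(\int[leb]_(z in Q) ((v x - v z) ^+ 2))%R.
transitivity (\int[leb]_(z in Q) (v x ^+ 2 + ((- 2 * v x) * v z + v z ^+ 2)))%R.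
  by apply: eq_Rintegral => z _; ring.
have clin : continuous (fun z => (- 2 * v x) * v z)%R.
  exact: continuous_scalef.
have ilin := continuous_integrable mQB bQ clin.
have csum : continuous (fun z => (- 2 * v x) * v z + v z ^+ 2)%R.
  by apply: continuous_addf => //; exact: continuous_sqr.
rewrite [LHS](RintegralD mQ (icst _) (continuous_integrable mQB bQ csum)).
rewrite (RintegralD mQ ilin iv2) (RintegralZl _ mQ iv).
transitivity (v x ^+ 2 * m + (- 2 * v x * I + J))%R; last by ring.
by congr (_ + _)%R; exact: (Rintegral_cst leb mQ).
Qed.

(** Both v x and v z are compared with the value of v at the midpoint of x and z.
    Along the half of the segment that starts at x, the derivative is a gradient at
    a point moved toward z, whose square integral toward_transport controls; the
    other half is symmetric.  The left-hand side and the square of I come from the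
    expansion of the double integral of (v x - v z) ^ 2. *)
Lemma poincare_product : (m * J <= I ^+ 2 + 2 * m * c)%R.
Proof.
have cq : continuous (fun x => m * v x ^+ 2 + (- (2 * I)) * v x + J)%R.
  apply: continuous_shiftf; apply: continuous_addf; apply: continuous_scalef => //.
  exact: continuous_sqr.
have iq := continuous_integrable mQB bQ cq.
have qE : \int[leb]_(x in Q) (m * v x ^+ 2 + (- (2 * I)) * v x + J)%:E =
    (2 * m * J - 2 * I ^+ 2)%:E.
  rewrite -[LHS]fineK; last exact: (integrable_fin_num mQ iq).
  congr (_%:E); rewrite -[LHS]/(\int[leb]_(x in Q) (m * v x ^+ 2 + (- (2 * I)) * v x + J))%R.
  transitivity (\int[leb]_(x in Q) (J + ((- 2 * I) * v x + m * v x ^+ 2)))%R.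
    by apply: eq_Rintegral => z _; rewrite mulNr; ring.
  have c1 : continuous (fun z => (- 2 * I) * v z)%R.
    exact: continuous_scalef.
  have c2 : continuous (fun z => m * v z ^+ 2)%R.
    by apply: continuous_scalef; exact: continuous_sqr.
  have c12 : continuous (fun z => (- 2 * I) * v z + m * v z ^+ 2)%R.
    exact: continuous_addf.
  rewrite [LHS](RintegralD mQ (icst _) (continuous_integrable mQB bQ c12)).
  rewrite (RintegralD mQ (continuous_integrable mQB bQ c1) (continuous_integrable mQB bQ c2)).
  rewrite (RintegralZl _ mQ iv) (RintegralZl _ mQ iv2).
  transitivity (J * m + (- 2 * I * I + m * J))%R; last by ring.
  by congr (_ + _)%R; exact: (Rintegral_cst leb mQ).
have split_le : \int[leb]_(x in Q) (m * v x ^+ 2 + (- (2 * I)) * v x + J)%:E <=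
    \int[leb]_(x in Q) (2%:E * \int[leb]_(z in Q) (D x z)%:E + (2 * c)%:E).
  apply: le_integral_nonneg => x Qx; rewrite -integral_difference.
    by apply: integral_ge0 => z _; rewrite lee_fin sqr_ge0.
  have mz : forall y : 'rV[R]_n -> 'rV[R]_n -> R,
      measurable_fun setT (fun w : CL * CL => y w.1 w.2) -> measurable_fun (Q : set CL) (fun z : CL => y x z).
    move=> y my; apply: measurable_funTS.
    exact: (measurableT_comp (f := fun w : CL * CL => y w.1 w.2) (g := fun z : CL => (x : CL, z)) my (measurable_pair1 (x : CL))).
  have mz' : forall y : 'rV[R]_n -> 'rV[R]_n -> R,
      measurable_fun setT (fun w : CL * CL => y w.1 w.2) -> measurable_fun (Q : set CL) (fun z : CL => y z x).
    move=> y my; apply: measurable_funTS.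
    exact: (measurableT_comp (f := fun w : CL * CL => y w.1 w.2) (g := fun z : CL => (z, x : CL)) my (measurable_pair2 (x : CL))).
  have two0 y z : (0 <= 2 * D y z)%R by apply: mulr_ge0.
  apply: (@le_trans _ _ (\int[leb]_(z in Q) (2 * D x z + 2 * D z x)%:E)).
    apply: le_integral_nonneg => z _; first by rewrite lee_fin sqr_ge0.
    rewrite lee_fin /D; have -> : toward x z 2^-1 = toward z x 2^-1 :> 'rV[R]_n.
      by apply/rowP => j; rewrite !toward_coord; field.
    have := sqr_ge0 (v x - v (toward z x 2^-1) + (v z - v (toward z x 2^-1)))%R; nra.
  have m2D : measurable_fun (Q : set CL) (fun z => 2 * D x z)%R by exact: (measurable_funM (measurable_cst _) (mz D mD)).
  have m2D' : measurable_fun (Q : set CL) (fun z => 2 * D z x)%R by exact: (measurable_funM (measurable_cst _) (mz' D mD)).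
  rewrite (@integral_addf _ _ _ leb Q _ _ mQ (fun z => two0 x z) m2D (fun z => two0 z x) m2D').
  rewrite -(@integral_scale _ _ _ leb Q 2 _ mQ _ (fun z => D0 x z) (mz D mD))//.
  apply: leeD => //.
  rewrite -(@integral_scale _ _ _ leb Q 2 _ mQ _ (fun z => D0 z x) (mz' D mD))//.
  by rewrite EFinM; apply: lee_wpmul2l; [rewrite lee_fin|exact: integral_midpoint].
have A0 x : 0 <= \int[leb]_(z in Q) (D x z)%:E by apply: integral_ge0 => z _; rewrite lee_fin.
have G0 : (0 <= G)%R by apply: Rintegral_ge0 => x _; exact: grad2_ge0.
have c0 : (0 <= c)%R.
  by apply: mulr_ge0; apply: mulr_ge0 => //; apply: mulr_ge0 => //; exact: sqr_ge0.
have : ((2 * m * J - 2 * I ^+ 2)%:E <= (2 * (m * c) + 2 * c * m)%:E).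
  rewrite -qE; apply: le_trans split_le _.
  rewrite (integral_affine mQ A0 measurable_integral_midpoint _ _ Qfin)//; last by rewrite mulr_ge0.
  rewrite [leRHS]EFinD; apply: leeD => //.
  by rewrite EFinM; apply: lee_wpmul2l => //; exact: swap_midpoint.
rewrite lee_fin; lra.
Qed.

(** When the box is negligible both integrals of squares vanish, and m^-1 is the
    junk value 0. *)
Lemma poincare_cube : \int[leb]_(x in Q) (v x ^+ 2)%:E <=
  (2 ^+ n * (n%:R * l ^+ 2))%:E * \int[leb]_(x in Q) (grad2 v x)%:E +
  (m^-1 * (\int[leb]_(x in Q) v x)%R ^+ 2)%:E.
Proof.
have G0 : (0 <= G)%R by apply: Rintegral_ge0 => x _; exact: grad2_ge0.
have GE : \int[leb]_(x in Q) (grad2 v x)%:E = G%:E.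
  rewrite /G /Rintegral fineK//; apply: integrable_fin_num => //.
  apply: continuous_integrable => //; exact: continuous_grad2.
have JE : \int[leb]_(x in Q) (v x ^+ 2)%:E = J%:E.
  by rewrite /J /Rintegral fineK//; exact: (integrable_fin_num mQ iv2).
have [m0|m0] := eqVneq m 0%R.
  rewrite (_ : \int[leb]_(x in Q) (v x ^+ 2)%:E = 0).
    by rewrite GE -EFinM -EFinD lee_fin m0 invr0 mul0r addr0; do 3 apply: mulr_ge0 => //; exact: sqr_ge0.
  apply: null_set_integral => //; last by rewrite Qfin m0.
  by apply/measurable_EFinP; apply: measurable_funTS; apply: measurable_funX.
rewrite GE JE -EFinM -EFinD lee_fin -/I.
have mp : (0 < m)%R by rewrite lt_neqAle eq_sym m0 fine_ge0.
rewrite -(ler_pM2l mp) mulrDr mulrA mulVKf//.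
apply: le_trans poincare_product _; rewrite /c; lra.
Qed.

End one_cube.
End poincare_cube.

Section interior.
Context {R : realType} {n : nat}.
Local Open Scope ereal_scope.
Local Notation Bo := (borel_rV R n).
Local Notation CL := (caratheodory_type (@lebesgue_outer R n)).
Local Notation leb := (@lebesgue_rV R n).

Lemma compact_margin (Omega U : set 'rV[R]_n) : open Omega -> compact U -> U `<=` Omega ->
  exists2 rho : R, (0 < rho)%R &
    forall x y : 'rV[R]_n, U x -> (forall j, `|x ord0 j - y ord0 j| < rho)%R -> Omega y.
Proof.
move=> oO cU UO.
have := (compact_near_coveringP U).1 cU R (0%R^'+)
  (fun rho x => forall y : 'rV[R]_n, (forall j, `|x ord0 j - y ord0 j| < rho)%R -> Omega y).
case.
- move=> x Ux; have /nbhs_rV[r r0 hr] : nbhs x Omega by apply: open_nbhs_nbhs; split => //; exact: UO.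
  exists ([set x' : 'rV[R]_n | forall j, `|x ord0 j - x' ord0 j| < r / 2]%R, [set t : R | t < r / 2]%R) => /=.
    split; last by apply: nbhs_right_lt; rewrite divr_gt0.
    have r2 : (0 < r / 2)%R by rewrite divr_gt0.
    apply: (@filter_forall _ _ (fun j => [set x' : 'rV[R]_n | `|x ord0 j - x' ord0 j| < r / 2]%R) (nbhs x) _) => j.
    have := @continuous_coord R n j x => /cvgrPdist_lt/(_ _ r2); exact.
  move=> [x' t] [/= h1 h2] y h3; apply: hr => j.
  rewrite (splitr r) -(subrK (x' ord0 j) (x ord0 j)) -addrA.
  by apply: le_lt_trans (ler_normD _ _) _; apply: ltrD => //; apply: lt_trans h2.
- move=> r r0 hr; exists (r / 2)%R; first by rewrite divr_gt0.
  move=> x y Ux xy; apply: (hr (r / 2)%R _ _ x Ux y xy) => //=.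
    by rewrite sub0r normrN gtr0_norm ?divr_gt0// gtr_pMr// invf_lt1// ltr1n.
  by rewrite divr_gt0.
Qed.

Lemma sum_le_affine (I : Type) (s : seq I) (A G : I -> \bar R) (c : R) (b : I -> R) :
  (0 <= c)%R -> (forall z, 0 <= G z) -> (forall z, A z <= c%:E * G z + (b z)%:E) ->
  \sum_(z <- s) A z <= c%:E * \sum_(z <- s) G z + (\sum_(z <- s) b z)%R%:E.
Proof.
move=> c0 G0 AG; elim: s => [|z s IH]; first by rewrite !big_nil mule0 adde0.
rewrite !big_cons ge0_muleDr//; last exact: sume_ge0.
rewrite EFinD addeACA; exact: leeD.
Qed.

(** Poincare's inequality on the cubes of a fine grid that meet the compact set; the
    cubes are disjoint and contained in Omega, so that their energies add up. *)
Lemma interior_estimate (Omega U : set 'rV[R]_n) (eta : R) :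
  open Omega -> compact U -> U `<=` Omega -> (0 < eta)%R ->
  exists (s : seq ('rV[R]_n * 'rV[R]_n)) (M : R), [/\ (0 <= M)%R,
    forall c, c \in s -> obox c.1 c.2 `<=` Omega &
    forall v, Ck 1 v -> \int[leb]_(x in U) (v x ^+ 2)%:E <=
      eta%:E * \int[leb]_(x in Omega) (grad2 v x)%:E +
      (M * \sum_(c <- s) (\int[leb]_(x in obox c.1 c.2) v x)%R ^+ 2)%:E].
Proof.
move=> oO cU UO eta0.
have [rho rho0 hrho] := compact_margin oO cU UO.
have [M M0 UM] := bounded_cbox (compact_bounded cU).
pose K : R := (2 ^+ n * n%:R)%R.
have K0 : (0 <= K)%R by rewrite mulr_ge0// exprn_ge0.
(* Cubes of side l that meet U stay in Omega, and their constant K l ^ 2 is at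
   most eta. *)
pose l : R := Num.min rho (Num.min 1%R (eta / (K + 1)))%R.
have K1 : (0 < K + 1)%R by rewrite ltr_wpDl.
have l0 : (0 < l)%R by rewrite !lt_min rho0 ltr01 divr_gt0.
have lrho : (l <= rho)%R by rewrite ge_min lexx.
have l1 : (l <= 1)%R by rewrite !ge_min lexx !orbT.
have leta : (l * (K + 1) <= eta)%R by rewrite -ler_pdivlMr// !ge_min lexx !orbT.
have Kl : (2 ^+ n * (n%:R * l ^+ 2) <= eta)%R.
  rewrite mulrA -/K expr2; nra.
have [N NE] : exists N, N = (Num.truncn ((2 * M + 1) / l)).+1 by eexists.
have S1 k : (k.+1%:R = k%:R + 1 :> R)%R by rewrite natr1.
pose T := {ffun 'I_n -> 'I_N}.
pose p (z : T) : 'rV[R]_n := (\row_j (M + 1 - (z j).+1%:R * l))%R.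
pose q (z : T) : 'rV[R]_n := (\row_j (M + 1 - (z j)%:R * l))%R.
pose C z := obox (p z) (q z).
have pq z j : (p z ord0 j < q z ord0 j)%R by rewrite !mxE S1; lra.
have pql z j : (q z ord0 j - p z ord0 j <= l)%R by rewrite !mxE S1; lra.
have CE z x j : C z x -> ((z j : nat) = Num.truncn ((M + 1 - x ord0 j) / l))%N.
  move=> /(_ j); rewrite !mxE => /andP[h1 h2]; apply/esym/truncn_def.
  by rewrite ler_pdivlMr// ltr_pdivrMr//; apply/andP; split; lra.
have Ccover x : U x -> exists z, C z x.
  move=> /UM xM; have xb j : (0 <= (M + 1 - x ord0 j) / l <= (2 * M + 1) / l)%R.
    have := xM j; rewrite ler_norml => /andP[h1 h2].
    by rewrite divr_ge0 ?(ltW l0)//= ?ler_pM2r ?invr_gt0//; lra.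
  have tb j : (Num.truncn ((M + 1 - x ord0 j) / l) < N)%N.
    by rewrite NE ltnS; apply: le_truncn; have /andP[] := xb j.
  exists [ffun j => Ordinal (tb j)] => j; rewrite !mxE !ffunE /=.
  have /andP[t0 _] := xb j; have /andP[h1 h2] := truncn_itv t0.
  by move: h1 h2; rewrite ler_pdivlMr// ltr_pdivrMr// => h1 h2; apply/andP; split; lra.
(* The cubes of the grid that meet U. *)
pose sel := [seq z <- enum T | `[< C z `&` U !=set0 >]].
have selO z : z \in sel -> C z `<=` Omega.
  rewrite mem_filter => /andP[/asboolP[x [Cx Ux]] _] y Cy.
  apply: (hrho x y Ux) => j; apply: lt_le_trans lrho.
  have /andP[x1 x2] := Cx j; have /andP[y1 y2] := Cy j; have := pql z j => h.
  rewrite ltr_norml; apply/andP; split; lra.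
have mCB z : measurable (C z : set Bo) by exact: measurable_obox.
have mC z : measurable (C z : set CL) by exact: borel_lebesgue.
have mOm : measurable (Omega : set CL) by apply: borel_lebesgue; exact: open_borel.
have mU : measurable (U : set CL).
  by apply: borel_lebesgue; apply: closed_borel; apply: compact_closed => //; exact: norm_hausdorff.
have triv : trivIset [set` sel] (C : T -> set CL).
  move=> z z' _ _ [x [Cx C'x]]; apply/ffunP => j; apply: val_inj.
  by rewrite /= (CE _ _ j Cx) (CE _ _ j C'x).
have usel : uniq sel by rewrite filter_uniq// enum_uniq.
pose m z := fine (leb (C z)).
exists [seq (p z, q z) | z <- sel], (\sum_(z <- sel) (m z)^-1)%R; split.
- by apply: sumr_ge0 => z _; rewrite invr_ge0 fine_ge0.
- by move=> _ /mapP[z zs ->] /=; exact: selO.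
move=> v C1v; have cv := Ck1_continuous C1v.
have mv2 : measurable_fun setT ((fun x => v x ^+ 2)%R : CL -> R).
  by apply: borel_fun_lebesgue; exact: continuous_sqr_borel.
have mg : measurable_fun setT (grad2 v : CL -> R).
  by apply: borel_fun_lebesgue; apply: continuous_borel; exact: continuous_grad2.
have split_sum (f : CL -> R) : (forall x, (0 <= f x)%R) -> measurable_fun setT f ->
    \int[leb]_(x in \big[setU/set0]_(z <- sel) (C z : set CL)) (f x)%:E =
    \sum_(z <- sel) \int[leb]_(x in C z) (f x)%:E.
  move=> f0 mf; apply: (@ge0_integral_bigsetU _ _ _ leb _ (C : T -> set CL)); first exact: mC.
    exact: usel. exact: triv.
    by apply/measurable_EFinP; exact: measurable_funTS.
  by move=> x _; rewrite lee_fin.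
have mE : measurable (\big[setU/set0]_(z <- sel) (C z : set CL)) by exact: bigsetU_measurable.
apply: (@le_trans _ _ (\int[leb]_(x in \big[setU/set0]_(z <- sel) (C z : set CL)) (v x ^+ 2)%:E)).
  apply: (ge0_subset_integral _ mU mE).
  - by apply/measurable_EFinP; exact: measurable_funTS.
  - by move=> x _; rewrite lee_fin sqr_ge0.
  move=> x Ux; have [z Cz] := Ccover x Ux; rewrite -bigcup_seq; exists z => //=.
  by rewrite mem_filter mem_enum andbT; apply/asboolP; exists x.
rewrite split_sum//; last by move=> x; exact: sqr_ge0.
pose G z := \int[leb]_(x in C z) (grad2 v x)%:E.
have G0 z : 0 <= G z by apply: integral_ge0 => x _; rewrite lee_fin grad2_ge0.
pose b z := ((m z)^-1 * (\int[leb]_(x in C z) v x)%R ^+ 2)%R.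
have cell z : \int[leb]_(x in C z) (v x ^+ 2)%:E <= eta%:E * G z + (b z)%:E.
  apply: le_trans (poincare_cube (pq z) (pql z) C1v) _.
  apply: leeD; last exact: lexx.
  have KlE : ((2 ^+ n * (n%:R * l ^+ 2))%R)%:E <= eta%:E by rewrite lee_fin.
  exact: (lee_wpmul2r (G0 z) KlE).
apply: le_trans (sum_le_affine sel (ltW eta0) G0 cell) _; apply: leeD.
  apply: lee_wpmul2l; first by rewrite lee_fin ltW.
  rewrite -split_sum//; last exact: grad2_ge0.
  apply: (ge0_subset_integral _ mE mOm).
  - by apply/measurable_EFinP; exact: measurable_funTS.
  - by move=> x _; rewrite lee_fin grad2_ge0.
  by rewrite -bigcup_seq => x [z /= zs]; exact: selO.
rewrite lee_fin big_map/= mulr_suml.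
rewrite big_seq [leRHS]big_seq; apply: ler_sum => z zs; apply: ler_wpM2l.
  by rewrite invr_ge0 fine_ge0.
by rewrite (big_rem z zs)/= lerDl; apply: sumr_ge0 => z' _; exact: sqr_ge0.
Qed.

End interior.

(** * Compactness of the trace of smooth functions *)

Lemma le_integral_setU {R : realType} d (T : measurableType d)
    (mu : {measure set T -> \bar R}) (E F : set T) (f : T -> \bar R) :
  measurable E -> measurable F -> measurable_fun setT f -> (forall x, (0 <= f x)%E) ->
  (\int[mu]_(x in E `|` F) f x <= \int[mu]_(x in E) f x + \int[mu]_(x in F) f x)%E.
Proof.
move=> mE mF mf f0; have mFE : measurable (F `\` E) by exact: measurableD.
have -> : E `|` F = E `|` (F `\` E) by rewrite setDE setUIr setUv setIT.
rewrite ge0_integral_setU//; last 2 first.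
- exact: measurable_funTS.
- by apply/disj_setPS => x [Ex []].
apply: leeD => //; apply: (ge0_subset_integral _ mFE mF) => [|//|x []//].
exact: measurable_funTS.
Qed.

Lemma continuous_subf {R : realType} {n : nat} (f g : 'rV[R]_n -> R) :
  continuous f -> continuous g -> continuous (fun x => f x - g x).
Proof. by move=> cf cg x; apply: continuousB; [exact: cf|exact: cg]. Qed.

Section patch.
Context {R : realType} {n : nat}.
Local Open Scope ereal_scope.
Local Notation Bo := (borel_rV R n).
Local Notation leb := (@lebesgue_rV R n).
Local Notation CH := (caratheodory_type (@hausdorff_outer R n n.-1)).
Implicit Types (Omega E F : set 'rV[R]_n).

(** The form in which compactness of the restriction to E enters: up to an
    arbitrarily small multiple of the energy, finitely many linear functionals
    control the norm in L^2(E). *)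
Definition trace_compact Omega E : Prop :=
  [/\ measurable (E : set Bo), hausdorff_outer n.-1 E < +oo &
  forall delta : R, (0 < delta)%R ->
  exists (s : seq ('rV[R]_n * 'rV[R]_n)) (M : R), [/\ (0 <= M)%R,
    forall c, c \in s -> obox c.1 c.2 `<=` Omega &
    forall v, Ck 1 v -> \int[surface_measure]_(x in E) (v x ^+ 2)%:E <=
      delta%:E * \int[leb]_(x in Omega) (grad2 v x)%:E +
      (M * \sum_(c <- s) (\int[leb]_(x in obox c.1 c.2) v x)%R ^+ 2)%:E]].

Lemma trace_compact0 Omega : trace_compact Omega set0.
Proof.
split; [exact: measurable0|by rewrite hausdorff_outer0 ltry|].
move=> delta d0; exists [::], 0%R; split => // v C1v.
rewrite integral_set0 mul0r adde0; apply: mule_ge0; first by rewrite lee_fin ltW.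
by apply: integral_ge0 => x _; rewrite lee_fin grad2_ge0.
Qed.

Lemma trace_compactU Omega E F : trace_compact Omega E -> trace_compact Omega F ->
  trace_compact Omega (E `|` F).
Proof.
move=> [mE Eoo HE] [mF Foo HF]; split; first exact: measurableU.
  apply: le_lt_trans (outer_measureU2 (@hausdorff_outer R n n.-1) E F) _.
  exact: lte_add_pinfty.
move=> delta d0; have d2 : (0 < delta / 2)%R by rewrite divr_gt0.
have [s [M [M0 sO hM]]] := HE _ d2; have [t [N [N0 tO hN]]] := HF _ d2.
exists (s ++ t), (M + N)%R; split; first by rewrite addr_ge0.
  by move=> c; rewrite mem_cat => /orP[/sO|/tO].
move=> v C1v; have mv : measurable_fun setT ((fun x => (v x ^+ 2)%:E) : CH -> \bar R).
  apply/measurable_EFinP; apply: borel_fun_hausdorff; apply: continuous_sqr_borel; exact: Ck1_continuous.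
have mEH : measurable (E : set CH) by exact: borel_hausdorff.
have mFH : measurable (F : set CH) by exact: borel_hausdorff.
have v0 (x : CH) : 0 <= (v x ^+ 2)%:E by rewrite lee_fin sqr_ge0.
pose D := \int[leb]_(x in Omega) (grad2 v x)%:E.
have D0 : 0 <= D by apply: integral_ge0 => x _; rewrite lee_fin grad2_ge0.
pose bs := (\sum_(c <- s) (\int[leb]_(x in obox c.1 c.2) v x) ^+ 2)%R.
pose bt := (\sum_(c <- t) (\int[leb]_(x in obox c.1 c.2) v x) ^+ 2)%R.
have bs0 : (0 <= bs)%R by apply: sumr_ge0 => c _; exact: sqr_ge0.
have bt0 : (0 <= bt)%R by apply: sumr_ge0 => c _; exact: sqr_ge0.
apply: (@le_trans _ _ (((delta / 2)%:E * D + (M * bs)%:E) + ((delta / 2)%:E * D + (N * bt)%:E))).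
  apply: le_trans (le_integral_setU surface_measure mEH mFH mv v0) _.
  by apply: leeD; [exact: hM|exact: hN].
rewrite addeACA -ge0_muleDl ?lee_fin ?(ltW d2)// -EFinD -splitr; apply: leeD => //.
rewrite -EFinD lee_fin big_cat/= -/bs -/bt; nra.
Qed.

Lemma trace_compact_cover Omega (A : set 'rV[R]_n) : compact A ->
  (forall x, A x -> exists2 rho : R, (0 < rho)%R &
    trace_compact Omega (A `&` [set y : 'rV[R]_n | forall j, (`|y ord0 j - x ord0 j| <= rho)%R])) ->
  trace_compact Omega A.
Proof.
rewrite compact_cover => cA loc.
pose N (x : 'rV[R]_n) (r : R) : set 'rV[R]_n := [set y | forall j, (`|y ord0 j - x ord0 j| <= r)%R].
have loc' (x : 'rV[R]_n) : exists rho : R, A x -> (0 < rho)%R /\ trace_compact Omega (A `&` N x rho).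
  have [Ax|nAx] := pselect (A x); last by exists 1%R.
  by have [rho r0 hr] := loc x Ax; exists rho.
have [rho rhoP] := choice loc'.
pose f (x : 'rV[R]_n) : set 'rV[R]_n := interior (N x (rho x)).
have [] := cA _ A f (fun x _ => @open_interior _ _).
  move=> x Ax; exists x => //; rewrite /f /interior.
  have [r0 _] := rhoP x Ax; rewrite /N.
  apply: (@filter_forall _ _ (fun j => [set y : 'rV[R]_n | `|y ord0 j - x ord0 j| <= rho x]%R) (nbhs x) _) => j.
  have := @continuous_coord R n j x => /cvgrPdist_le/(_ _ r0).
  by apply: filterS => y; rewrite /= distrC.
move=> D DA AD; have -> : A = \bigcup_(x in [set` finmap.enum_fset D]) (A `&` N x (rho x)).
  apply/seteqP; split => y; last by move=> [x _ []].
  by move=> Ay; have [x Dx /interior_subset] := AD y Ay; exists x.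
rewrite bigcup_seq; have : forall x, x \in finmap.enum_fset D -> A x by move=> x xD; have := DA x xD; rewrite inE.
elim: (finmap.enum_fset D) => [|x l IH] hl; first by rewrite big_nil; exact: trace_compact0.
rewrite big_cons; apply: trace_compactU; last by apply: IH => y yl; apply: hl; rewrite in_cons yl orbT.
by apply: (rhoP x _).2; apply: hl; exact: mem_head.
Qed.

Lemma boundary_open Omega : open Omega -> boundary Omega = closure Omega `\` Omega.
Proof. by move=> oO; rewrite /boundary; move/interior_id : oO => ->. Qed.

Lemma closed_boundary Omega : closed (boundary Omega).
Proof.
rewrite /boundary setDE; apply: closedI; first exact: closed_closure.
by apply: open_closedC; exact: open_interior.
Qed.

Lemma closure_cbox Omega (M : R) : Omega `<=` cbox M -> closure Omega `<=` cbox M.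
Proof.
by move=> OM; have /closure_id -> := @closed_cbox R n M; exact: closureS.
Qed.

Lemma compact_closure_bounded Omega : bounded_set Omega -> compact (closure Omega).
Proof.
move=> /bounded_cbox[M _ OM]; apply: (subclosed_compact _ (@compact_cbox R n M)).
  exact: closed_closure.
exact: closure_cbox.
Qed.

Lemma compact_boundary Omega : bounded_set Omega -> compact (boundary Omega).
Proof.
move=> bO; apply: (subclosed_compact _ (compact_closure_bounded bO)).
  exact: closed_boundary.
by move=> x [].
Qed.

Lemma continuous_col' (i : 'I_n) (g : 'rV[R]_n.-1 -> R) : continuous g ->
  continuous (fun x : 'rV[R]_n => g (col' i x)).
Proof.
move=> cg x; apply/(@cvgrPdist_le _ _ _ (nbhs x) _) => e e0.
have /nbhs_rV[r r0 hr] : nbhs (col' i x) [set z | `|g (col' i x) - g z| <= e]%R.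
  by have /cvgrPdist_le := cg (col' i x); apply.
have : nbhs x [set y : 'rV[R]_n | forall j, `|x ord0 j - y ord0 j| < r]%R.
  apply: (@filter_forall _ _ (fun j => [set y : 'rV[R]_n | `|x ord0 j - y ord0 j| < r]%R) (nbhs x) _) => j.
  by have := @continuous_coord R n j x => /cvgrPdist_lt/(_ _ r0).
by apply: filterS => y h; apply: hr => k; rewrite !mxE; exact: h.
Qed.

End patch.

Section boundary_patch.
Context {R : realType} {n : nat}.
Local Open Scope ereal_scope.
Local Notation Bo := (borel_rV R n).
Local Notation leb := (@lebesgue_rV R n).

Lemma le_grad2 (i : 'I_n) (v : 'rV[R]_n -> R) x : (partial i v x ^+ 2 <= grad2 v x)%R.
Proof.
by rewrite /grad2 (bigD1 i)//= lerDl; apply: sumr_ge0 => j _; exact: sqr_ge0.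
Qed.

(** The factor 3 leaves room for the intermediate points of C1_increment, which are
    off y by at most the distance of x and y in each coordinate. *)
Lemma C1_lipschitz_bounded (k : nat) (g : 'rV[R]_k -> R) (K : R) : Ck 1 g -> (0 <= K)%R ->
  exists L : R, (0 <= L)%R /\ forall x y rho, cbox K x -> cbox K y ->
    (forall j, `|x ord0 j - y ord0 j| <= rho)%R -> (`|g x - g y| <= L * rho)%R.
Proof.
move=> C1g K0.
have bK : bounded_set (cbox (3 * K)%R : set 'rV[R]_k).
  by apply: compact_bounded; exact: compact_cbox.
have bound (j : 'I_k) : exists M : R, forall x, cbox (3 * K)%R x -> (`|partial j g x| <= M)%R.
  by apply: continuous_bounded_on => //; exact: Ck1_partial.
have [M hM] := choice bound.
exists (\sum_j `|M j|)%R; split; first by apply: sumr_ge0.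
move=> x y rho xK yK xy.
have [xi xiP E] := C1_increment y (x - y)%R C1g.
have -> : (g x - g y = g (y + (x - y)) - g y)%R by rewrite [(y + _)%R]addrC subrK.
rewrite E mulr_suml; apply: le_trans (ler_norm_sum _ _ _) _; apply: ler_sum => j _.
rewrite normrM mulrC; apply: ler_pM => //; last by rewrite !mxE; exact: xy.
apply: (@le_trans _ _ (M j)); last exact: ler_norm.
apply: hM => l; have := yK l; rewrite ler_norml => /andP[a1 a2].
have := xK l; rewrite ler_norml => /andP[b1 b2]; have := xiP j l; rewrite !mxE => h.
have {}h : (`|xi j ord0 l - y ord0 l| <= 2 * K)%R.
  apply: le_trans h _; rewrite ler_norml; apply/andP; split; lra.
by move: h; rewrite !ler_norml => /andP[h1 h2]; apply/andP; split; lra.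
Qed.

Lemma closed_nearby (x0 : 'rV[R]_n) (rho : R) :
  closed [set y : 'rV[R]_n | forall j, (`|y ord0 j - x0 ord0 j| <= rho)%R].
Proof.
rewrite (_ : [set _ | _] = \bigcap_(j in [set: 'I_n])
   ((fun y : 'rV[R]_n => `|y ord0 j - x0 ord0 j|) @^-1` [set t | t <= rho]))%R; last first.
  by apply/seteqP; split => y h j; [move=> _; exact: h|exact: h].
apply: closed_bigI => j _.
have c : continuous (fun y : 'rV[R]_n => y ord0 j - x0 ord0 j)%R.
  by apply: continuous_subf; [exact: continuous_coord|exact: cst_continuous].
apply: preimage_closed => [y _|]; last exact: closed_le.
apply: (@continuous_comp _ _ _ (fun y : 'rV[R]_n => y ord0 j - x0 ord0 j)%R Num.norm); last exact: norm_continuous.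
exact: c.
Qed.

(** Near x0 the boundary is the graph of g, by continuity of g.  The part U
    of the patch at height at least h above the graph is a compact subset of Omega:
    layer_inequality bounds the trace by the values on U, and interior_estimate
    bounds these. *)
Lemma boundary_patch (Omega : set 'rV[R]_n) (x0 : 'rV[R]_n) :
  open Omega -> C11_boundary Omega -> boundary Omega x0 ->
  exists2 rho : R, (0 < rho)%R &
    trace_compact Omega (boundary Omega `&`
      [set y : 'rV[R]_n | forall j, (`|y ord0 j - x0 ord0 j| <= rho)%R]).
Proof.
move=> oO C11O /[dup] bx0 /C11O[r [i [s [g [r0 [C1g _] hg]]]]].
pose sg : R := ((-1) ^+ s)%R.
have sg1 : `|sg|%R = 1%R by rewrite normr_sign.
have sgsg : (sg * sg = 1)%R by rewrite -expr2 sqrr_sign.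
have cg := Ck1_continuous C1g; have cgc := @continuous_col' R n i g cg.
have csg : continuous (fun x : 'rV[R]_n => sg * x ord0 i)%R.
  by apply: continuous_scalef; exact: continuous_coord.
pose near_x0 (rho : R) (y : 'rV[R]_n) := forall j, (`|y ord0 j - x0 ord0 j| <= rho)%R.
have n1 : (0 < n.+1%:R :> R)%R by [].
(* Points within 3 rho of x0 in each coordinate are in the patch. *)
pose rho : R := (r / (4 * n.+1%:R))%R.
have rho0 : (0 < rho)%R by rewrite divr_gt0// mulr_gt0.
have nearE y : near_x0 (3 * rho)%R y -> (enorm (y - x0) < r)%R.
  move=> h; apply: le_lt_trans (enorm_le_sum _) _.
  apply: (@le_lt_trans _ _ (\sum_(j < n) 3 * rho)%R).
    by apply: ler_sum => j _; rewrite !mxE; exact: h.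
  rewrite sumr_const card_ord -mulr_natr.
  have nn : (n%:R < n.+1%:R :> R)%R by rewrite ltr_nat.
  have -> : (r = 4 * n.+1%:R * rho)%R by rewrite /rho; field; rewrite gt_eqF.
  nra.
have near_mono (a b : R) y : (a <= b)%R -> near_x0 a y -> near_x0 b y.
  by move=> ab h j; apply: le_trans (h j) ab.
exists rho => //; set S := _ `&` _.
have graphE x : S x -> (g (col' i x) = sg * x ord0 i)%R.
  move=> [bx nx]; have xr : (enorm (x - x0) < r)%R by apply: nearE; apply: (near_mono rho) => //; lra.
  move: bx; rewrite boundary_open// => -[clx nOx].
  apply/eqP; rewrite eq_le; apply/andP; split; last first.
    by rewrite leNgt; apply/negP => /(hg x xr).2.
  rewrite leNgt; apply/negP => lt1.
  have : nbhs x [set y : 'rV[R]_n | (enorm (y - x0) < r)%R /\ (sg * y ord0 i < g (col' i y))%R].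
    apply: filterI.
      have := @continuous_enorm_sub R n x0 x => /cvgr_lt; apply; exact: xr.
    have cd : continuous (fun y : 'rV[R]_n => g (col' i y) - sg * y ord0 i)%R.
      exact: continuous_subf.
    have := cd x => /cvgr_gt/(_ 0%R); rewrite subr_gt0 => /(_ lt1).
    by apply: filterS => y; rewrite /= subr_gt0.
  by move=> /clx[y [Oy [yr]]]; rewrite ltNge => /negP; apply; apply/ltW/(hg y yr).1.
have cS : closed S.
  apply: closedI; first exact: closed_boundary.
  exact: closed_nearby.
have mS : measurable (S : set Bo) by exact: closed_borel.
pose K : R := (\sum_j `|x0 ord0 j| + 3 * rho)%R.
have K0 : (0 <= K)%R by apply: addr_ge0; [exact: sumr_ge0|rewrite mulr_ge0// ltW].
have nearK y j : near_x0 (3 * rho)%R y -> (`|y ord0 j| <= K)%R.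
  move=> h; rewrite -(subrK (x0 ord0 j) (y ord0 j)); apply: le_trans (ler_normD _ _) _.
  rewrite /K addrC; apply: lerD => //.
  by rewrite (bigD1 j)//= lerDl; apply: sumr_ge0.
have [L [L0 hL]] := C1_lipschitz_bounded C1g K0.
have lipS : lipschitz_over i L S.
  move=> x y d Sx Sy xy.
  have nS z : S z -> near_x0 (3 * rho)%R z by move=> [_ h]; apply: (near_mono rho) => //; lra.
  have -> : (`|x ord0 i - y ord0 i| = `|g (col' i x) - g (col' i y)|)%R.
    by rewrite (graphE x Sx) (graphE y Sy) -mulrBr normrM sg1 mul1r.
  apply: hL => [k|k|k]; rewrite !mxE; [exact/nearK/nS|exact/nearK/nS|].
  by apply: xy; rewrite eq_sym neq_lift.
have [M M0 HM] := hausdorff_graph lipS L0.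
have Soo : hausdorff_outer n.-1 S < +oo.
  pose a : 'rV[R]_n := (\row_j (x0 ord0 j - 2 * rho))%R.
  pose b : 'rV[R]_n := (\row_j (x0 ord0 j + 2 * rho))%R.
  have ab j : j != i -> (a ord0 j < b ord0 j)%R by rewrite !mxE => _; lra.
  have := HM a b ab; rewrite (_ : S `&` cylinder i a b = S); last first.
    apply/seteqP; split => [x []//|x Sx]; split => // j _; rewrite !mxE.
    by have [_ /(_ j)] := Sx; rewrite ler_norml => /andP[h1 h2]; apply/andP; split; lra.
  by move=> /le_lt_trans; apply; exact: ltry.
split => // delta d0.
(* With 2 h <= 2 rho the segments stay in the patch; the other bound makes the
   coefficient 4 M h of the energy at most delta / 2. *)
pose h : R := Num.min rho (delta / (8 * M))%R.
have h0 : (0 < h)%R by rewrite lt_min rho0 divr_gt0// mulr_gt0.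
have hrho : (h <= rho)%R by rewrite ge_min lexx.
have hM : (4 * M * h <= delta / 2)%R.
  have : (h <= delta / (8 * M))%R by rewrite ge_min lexx orbT.
  by rewrite ler_pdivlMr ?mulr_gt0//; lra.
pose U : set 'rV[R]_n := [set y | near_x0 (3 * rho)%R y /\ (g (col' i y) + h <= sg * y ord0 i)%R].
have UO : U `<=` Omega by move=> y [/nearE yr yg]; apply/(hg y yr).2; rewrite -/sg; lra.
have cU : closed U.
  have -> : U = near_x0 (3 * rho)%R `&`
     (fun y : 'rV[R]_n => g (col' i y) - sg * y ord0 i)%R @^-1` [set t | t <= - h]%R.
    apply/seteqP; split => y [h1 h2]; split => //=; first lra.
    by move: h2 => /=; lra.
  apply: closedI; first exact: closed_nearby.
  apply: preimage_closed => [y _|]; last exact: closed_le.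
  have c := continuous_subf cgc csg; exact: c.
have kU : compact U.
  apply: (subclosed_compact cU (@compact_cbox R n K)) => y [h1 _] j; exact: nearK.
have shift_near x t j : S x -> (0 < t <= 2 * h)%R ->
    (`|shift_coord i x (sg * t) ord0 j - x0 ord0 j| <= 3 * rho)%R.
  move=> [_ nx] /andP[t0 t2]; have [->|ji] := eqVneq j i; last first.
    by rewrite shift_coord_neq//; apply: le_trans (nx j) _; lra.
  rewrite shift_coord_eq addrAC; apply: le_trans (ler_normD _ _) _.
  rewrite normrM sg1 mul1r gtr0_norm//; have := nx i; lra.
have col_shift x t : col' i (shift_coord i x t) = col' i x.
  by apply/rowP => k; rewrite [LHS]mxE [RHS]mxE shift_coord_neq// eq_sym neq_lift.
have gap x t : S x -> (sg * shift_coord i x (sg * t) ord0 i =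
    g (col' i (shift_coord i x (sg * t))) + t)%R.
  by move=> Sx; rewrite col_shift (graphE x Sx) shift_coord_eq mulrDr mulrA sgsg mul1r.
have SO x t : S x -> (0 < t <= 2 * h)%R -> Omega (shift_coord i x (sg * t)).
  move=> Sx tt; have /nearE yr : near_x0 (3 * rho)%R (shift_coord i x (sg * t)).
    by move=> j; exact: shift_near.
  by apply/(hg _ yr).2; rewrite -/sg gap// ltrDl; case/andP: tt.
have SU x t : S x -> (h <= t <= 2 * h)%R -> U (shift_coord i x (sg * t)).
  move=> Sx /andP[t1 t2]; have t0 : (0 < t)%R by apply: lt_le_trans t1.
  split; first by move=> j; apply: shift_near => //; rewrite t0.
  by rewrite gap// lerD2l.
have SO0 : S `&` Omega = set0.
  by apply/seteqP; split => // x [[+ _] Ox]; rewrite boundary_open// => -[].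
have Mh0 : (0 < 2 * M / h)%R by rewrite divr_gt0// mulr_gt0.
have eta0 : (0 < (delta / 2) / (2 * M / h))%R by rewrite divr_gt0// divr_gt0.
have [l [M' [M'0 lO hint]]] := interior_estimate oO kU UO eta0.
exists l, ((2 * M / h) * M')%R; split => //; first by rewrite mulr_ge0// ltW.
move=> v C1v.
have mU : measurable (U : set Bo) by exact: closed_borel.
have mOm : measurable (Omega : set Bo) by exact: open_borel.
have := layer_inequality sg1 M0 h0 HM Soo mS mU mOm SO SU UO SO0 C1v.
move=> /le_trans; apply.
have mOL : measurable (Omega : set (caratheodory_type (@lebesgue_outer R n))) by exact: borel_lebesgue.
pose D := \int[leb]_(x in Omega) (grad2 v x)%:E.
have D0 : 0 <= D by apply: integral_ge0 => x _; rewrite lee_fin grad2_ge0.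
pose b := (\sum_(c <- l) (\int[leb]_(x in obox c.1 c.2) v x) ^+ 2)%R.
have le1 : \int[leb]_(x in Omega) (partial i v x ^+ 2)%:E <= D.
  apply: le_integral_nonneg => x _; rewrite lee_fin; [exact: sqr_ge0|exact: le_grad2].
apply: (@le_trans _ _ ((2 * M / h)%:E * ((delta / 2 / (2 * M / h))%:E * D + (M' * b)%:E) + (delta / 2)%:E * D)).
  apply: leeD; first by apply: lee_wpmul2l; [rewrite lee_fin ltW|exact: hint].
  have hME : (4 * M * h)%:E <= (delta / 2)%:E by rewrite lee_fin.
  apply: (@le_trans _ _ ((4 * M * h)%:E * D)).
    by apply: lee_wpmul2l => //; rewrite lee_fin !mulr_ge0// ltW.
  exact: (lee_wpmul2r D0 hME).
have b0 : (0 <= b)%R by apply: sumr_ge0 => c _; exact: sqr_ge0.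
rewrite ge0_muleDr; last 2 first.
- by apply: mule_ge0 => //; rewrite lee_fin ltW.
- by rewrite lee_fin mulr_ge0.
rewrite muleA -!EFinM; have -> : (2 * M / h * (delta / 2 / (2 * M / h)) = delta / 2)%R.
  by field; rewrite !gt_eqF.
rewrite addeAC -ge0_muleDl ?lee_fin ?divr_ge0 ?(ltW d0)// -EFinD -splitr mulrA.
exact: lexx.
Qed.

Lemma trace_compact_boundary (Omega : set 'rV[R]_n) :
  open Omega -> bounded_set Omega -> C11_boundary Omega -> trace_compact Omega (boundary Omega).
Proof.
move=> oO bO C11O; apply: trace_compact_cover; first exact: compact_boundary.
by move=> x; exact: boundary_patch.
Qed.

End boundary_patch.

(** * Smooth cutoff functions of boxes *)

Section smooth_line.
Context {R : realType}.

(** The one-variable counterpart of Ck, with the derivative existentially quantified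
    so that closure under sums and products is immediate. *)
Fixpoint smooth (k : nat) (f : R -> R) : Prop :=
  continuous f /\
  match k with
  | 0 => True
  | k'.+1 => exists2 f' : R -> R, forall t : R, is_derive t (1 : R) f (f' t) & smooth k' f'
  end.

Lemma smooth_continuous k f : smooth k f -> continuous f. Proof. by case: k => [|k] []. Qed.

Lemma smoothW k f : smooth k.+1 f -> smooth k f.
Proof.
elim: k f => [f []//|k IH f [cf [f' df sf']]]; split => //.
by exists f' => //; exact: IH.
Qed.

Lemma smoothD k f g : smooth k f -> smooth k g -> smooth k (fun t => f t + g t).
Proof.
elim: k f g => [|k IH] f g [cf sf] [cg sg]; split => //.
- by move=> t; apply: continuousD; [exact: cf|exact: cg].
- by move=> t; apply: continuousD; [exact: cf|exact: cg].
have [f' df sf'] := sf; have [g' dg sg'] := sg.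
by exists (fun t => f' t + g' t) => [t|]; [exact: is_deriveD|exact: IH].
Qed.

Lemma smooth_cst k (c : R) : smooth k (fun=> c).
Proof.
elim: k c => [|k IH] c; split=> //; try exact: cst_continuous.
by exists (fun=> 0) => // t; exact: is_derive_cst.
Qed.

Lemma smoothM k f g : smooth k f -> smooth k g -> smooth k (fun t => f t * g t).
Proof.
elim: k f g => [|k IH] f g sf sg.
  by split => // t; apply: continuousM; [exact: (smooth_continuous sf)|exact: (smooth_continuous sg)].
split; first by move=> t; apply: continuousM; [exact: (smooth_continuous sf)|exact: (smooth_continuous sg)].
have sf0 := smoothW sf; have sg0 := smoothW sg.
have [_ [f' df sf']] := sf; have [_ [g' dg sg']] := sg.
exists (fun t => f t * g' t + g t * f' t) => [t|].
  by apply: is_deriveM.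
by apply: smoothD; exact: IH.
Qed.

Lemma smooth_affine k f (c d : R) : smooth k f -> smooth k (fun t => f (c * t + d)).
Proof.
have ca : continuous (fun t : R => c * t + d).
  move=> t; apply: continuousD; last exact: cst_continuous.
  by apply: continuousM; [exact: cst_continuous|exact: cvg_id].
elim: k f => [|k IH] f sf.
  by split => // t; apply: (@continuous_comp _ _ _ (fun t : R => c * t + d) f); [exact: ca|exact: (smooth_continuous sf)].
split; first by move=> t; apply: (@continuous_comp _ _ _ (fun t : R => c * t + d) f); [exact: ca|exact: (smooth_continuous sf)].
have [_ [f' df sf']] := sf.
exists (fun t => c * f' (c * t + d)) => [t|].
  have da : is_derive t (1 : R) (fun t : R => c * t + d) c.
    have := is_deriveD (is_deriveZ c (is_derive_id t (1 : R))) (is_derive_cst d t (1 : R)).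
    by move=> h; apply: is_derive_eq h _; rewrite addr0 /GRing.scale/= mulr1.
  have := @is_derive1_comp R f (fun t : R => c * t + d) t (f' (c * t + d)) c (df _) da.
  by rewrite mulrC.
by apply: smoothM; [exact: smooth_cst|exact: IH].
Qed.

(** The functions t^-m exp(-1/t), extended by 0 to the nonpositive numbers; their
    derivatives are combinations of functions of the same family. *)
Definition flat (m : nat) (t : R) : R := if 0 < t then t^-1 ^+ m * expR (- t^-1) else 0.

Lemma pow_le_exp (m : nat) (y : R) : 0 <= y -> y ^+ m <= m%:R ^+ m * expR y.
Proof.
move=> y0; case: m => [|m]; first by rewrite !expr0 mul1r -expR0 ler_expR.
have m0 : (0 < m.+1%:R :> R) by [].
have -> : expR y = expR (y / m.+1%:R) ^+ m.+1 by rewrite -expRM_natl mulrC divfK ?gt_eqF.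
rewrite -exprMn; apply: lerXn2r; rewrite ?nnegrE//.
have := expR_ge1Dx (y / m.+1%:R) => h.
have : y / m.+1%:R <= expR (y / m.+1%:R) by apply: le_trans h; rewrite lerDr.
by rewrite ler_pdivrMr// mulrC.
Qed.

Lemma flat_ge0 m t : 0 <= flat m t.
Proof.
by rewrite /flat; case: ifP => // t0; rewrite mulr_ge0 ?expR_ge0// exprn_ge0// invr_ge0 ltW.
Qed.

Lemma flat_le_sqr m (t : R) : flat m t <= m.+2%:R ^+ m.+2 * t ^+ 2.
Proof.
rewrite /flat; case: ifPn => [t0|_]; last by rewrite mulr_ge0 ?sqr_ge0 ?exprn_ge0.
have y0 : 0 <= t^-1 by rewrite invr_ge0 ltW.
have := pow_le_exp m.+2 y0; rewrite expRN.
rewrite -[X in X ^+ m.+2 <= _]mul1r => h.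
rewrite ler_pdivrMr ?expR_gt0// mulrAC; move: h; rewrite mul1r -addn2 exprD.
have t2 : 0 < t ^+ 2 by rewrite exprn_gt0.
by rewrite [t^-1 ^+ 2]exprVn ler_pdivrMr.
Qed.

Lemma invX_derive m (t : R) : t != 0 ->
  is_derive t (1 : R) (fun s : R => s^-1 ^+ m) (- m%:R * t^-1 ^+ m.+1).
Proof.
move=> t0; elim: m => [|m IH].
  by rewrite oppr0 mul0r; exact: is_derive_cst.
have dV : is_derive t (1 : R) (fun s : R => s^-1) (- t ^- 2).
  by have := is_deriveV t0 (is_derive_id t (1 : R)) => h; apply: is_derive_eq h _; rewrite /GRing.scale/= mulr1.
have := is_deriveM dV IH => h; rewrite (_ : (fun s : R => s^-1 ^+ m.+1) = (fun s : R => s^-1) * (fun s : R => s^-1 ^+ m)); last first.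
  by apply/funext => s; rewrite exprS.
apply: is_derive_eq h _; rewrite /GRing.scale/= -exprVn -natr1 !exprS expr0; ring.
Qed.

Lemma flat_derive m (t : R) :
  is_derive t (1 : R) (flat m) (- m%:R * flat m.+1 t + flat m.+2 t).
Proof.
have [t0|t0|->] := ltgtP t 0.
- apply: (@near_eq_is_derive _ _ _ (fun=> 0)).
    near=> s; rewrite /flat ifF//; apply/negbTE; rewrite -leNgt ltW//.
    by near: s; exact: lt_nbhsl.
  rewrite /flat !ifF ?mulr0 ?addr0; try by apply/negbTE; rewrite -leNgt ltW.
  exact: is_derive_cst.
- have tn0 : t != 0 by rewrite gt_eqF.
  apply: (@near_eq_is_derive _ _ _ ((fun s : R => s^-1 ^+ m) * (fun s : R => expR (- s^-1)))).
    near=> s; rewrite /flat ifT//; near: s; exact: lt_nbhsr.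
  have dV : is_derive t (1 : R) (fun s : R => - s^-1) (t ^- 2).
    have := is_deriveN (is_deriveV tn0 (is_derive_id t (1 : R))) => h.
    by apply: is_derive_eq h _; rewrite /GRing.scale/= mulr1 opprK.
  have dE := @is_derive1_comp R expR (fun s : R => - s^-1) t _ _ (is_derive_expR _) dV.
  have := is_deriveM (invX_derive m tn0) dE => h.
  apply: is_derive_eq h _; rewrite /flat t0 /GRing.scale/= -exprVn !exprS expr0; ring.
- rewrite /flat ltxx mulr0 addr0.
  have q0 : h^-1 *: (flat m (h *: 1 + 0) - flat m 0) @[h --> 0^'] --> (0 : R).
    apply/cvgrPdist_le => e e0; pose C : R := m.+2%:R ^+ m.+2.
    have C0 : 0 < C by rewrite exprn_gt0.
    near=> h; have h0 : h != 0 by near: h; exact: nbhs_dnbhs_neq.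
    have hC : `|h| < e / C by near: h; apply: dnbhs0_lt; rewrite divr_gt0.
    rewrite sub0r normrN {2}/flat ltxx subr0 addr0 [h *: 1]mulr1 normrM normfV.
    rewrite (ger0_norm (flat_ge0 m h)) mulrC ler_pdivrMr ?normr_gt0//.
    apply: le_trans (flat_le_sqr m h) _; rewrite -/C -(real_normK (num_real h)) expr2 mulrA.
    rewrite ler_wpM2r// mulrC -ler_pdivlMr// ltW//.
  split; first by apply/cvg_ex; exists (0 : R).
  by apply: cvg_lim q0.
Unshelve. all: by end_near. Qed.

Lemma smooth_flat k m : smooth k (flat m).
Proof.
have cf l : continuous (flat l) := derive_continuous (@flat_derive l).
elim: k m => [|k IH] m; split => //.
exists (fun t => - m%:R * flat m.+1 t + flat m.+2 t); first exact: flat_derive.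
by apply: smoothD => //; apply: smoothM => //; exact: smooth_cst.
Qed.

End smooth_line.

Section cutoff.
Context {R : realType} {n : nat}.
Implicit Types (f : 'I_n -> R -> R) (x a b : 'rV[R]_n).

Definition tensor f x : R := \prod_j f j (x ord0 j).

Lemma continuous_tensor f : (forall j, continuous (f j)) -> continuous (tensor f).
Proof.
move=> cf; rewrite /tensor.
have c j : continuous (fun x : 'rV[R]_n => f j (x ord0 j)).
  by move=> x; apply: (@continuous_comp _ _ _ (fun x : 'rV[R]_n => x ord0 j) (f j)); [exact: continuous_coord|exact: cf].
elim: (index_enum _) => [|j s IH].
  by under eq_fun do rewrite big_nil; exact: cst_continuous.
by under eq_fun do rewrite big_cons; exact: continuous_mulf.
Qed.

Lemma tensor_derive f x (i : 'I_n) (d : R) :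
  is_derive (x ord0 i) (1 : R) (f i) d ->
  is_derive x (delta_mx ord0 i) (tensor f) (d * \prod_(j < n | j != i) f j (x ord0 j)).
Proof.
move=> [df dE]; set P := \prod_(j < n | j != i) _.
have step (h : R) : h^-1 *: (tensor f (h *: delta_mx ord0 i + x) - tensor f x) =
    h^-1 *: (f i (h *: 1 + x ord0 i) - f i (x ord0 i)) * P.
  rewrite /tensor (bigD1 i)//= [X in _ - X](bigD1 i)//= -/P.
  rewrite (eq_bigr (fun j => f j (x ord0 j))) => [|j ji]; last first.
    by rewrite !mxE (negPf ji) andbF mulr0 add0r.
  by rewrite -/P !mxE !eqxx -mulrBl scalerAl.
have lim : h^-1 *: (tensor f (h *: delta_mx ord0 i + x) - tensor f x) @[h --> 0^'] --> d * P.
  under eq_fun do rewrite step; apply: cvgM; last exact: cvg_cst.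
  by rewrite -dE; exact: df.
split; first by apply/cvg_ex; exists (d * P).
by apply: cvg_lim lim.
Qed.

Lemma Ck_tensor k f : (forall j, smooth k (f j)) -> Ck k (tensor f).
Proof.
elim: k f => [|k IH] f sf.
  by split => //; apply: continuous_tensor => j; exact: smooth_continuous (sf j).
split; first by apply: continuous_tensor => j; exact: smooth_continuous (sf j).
move=> i; have [_ [f' df sf']] := sf i.
have dT x := @tensor_derive f x i _ (df (x ord0 i)).
split; first by move=> x; have [] := dT x.
have -> : partial i (tensor f) = tensor (fun j => if j == i then f' else f j).
  apply/funext => x; rewrite /partial; have [_ ->] := dT x.
  rewrite /tensor [RHS](bigD1 i)//= eqxx; congr (_ * _).
  by apply: eq_bigr => j ji; rewrite (negPf ji).
by apply: IH => j; case: ifP => // _; exact: smoothW.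
Qed.

(** A smooth approximation of the indicator function of the open box with corners a
    and b, supported in the closed box and converging to it as k grows. *)
Definition cutoff (k : nat) a b : 'rV[R]_n -> R :=
  tensor (fun j t => flat 0 (k.+1%:R * t + - (k.+1%:R * a ord0 j)) *
                     flat 0 (- k.+1%:R * t + k.+1%:R * b ord0 j)).

Lemma cutoffE k a b x : cutoff k a b x =
  \prod_j (flat 0 (k.+1%:R * (x ord0 j - a ord0 j)) * flat 0 (k.+1%:R * (b ord0 j - x ord0 j))).
Proof.
apply: eq_bigr => j _; congr (flat 0 _ * flat 0 _); first by rewrite mulrBr.
by rewrite mulNr addrC -mulrBr.
Qed.

Lemma Ck_cutoff l k a b : Ck l (cutoff k a b).
Proof. by apply: Ck_tensor => j; apply: smoothM; apply: smooth_affine; exact: smooth_flat. Qed.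

Lemma continuous_cutoff k a b : continuous (cutoff k a b).
Proof. by case: (Ck_cutoff 0 k a b). Qed.

Lemma flat0_le1 (t : R) : flat 0 t <= 1.
Proof.
rewrite /flat; case: ifPn => // t0; rewrite expr0 mul1r -expR0 ler_expR oppr_le0 invr_ge0.
exact: ltW.
Qed.

Lemma cutoff_ge0 k a b x : 0 <= cutoff k a b x.
Proof. by apply: prodr_ge0 => j _; rewrite mulr_ge0// flat_ge0. Qed.

Lemma cutoff_le1 k a b x : `|cutoff k a b x| <= 1.
Proof.
rewrite ger0_norm ?cutoff_ge0//; apply: numdomain.Num.Theory.prodr_ile1 => j _.
by rewrite mulr_ge0 ?flat_ge0//= mulr_ile1 ?flat_ge0 ?flat0_le1.
Qed.

Lemma cutoff_out k a b x : ~ rect a b x -> cutoff k a b x = 0.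
Proof.
move=> nx; have [j hj] : exists j, ~ (a ord0 j < x ord0 j < b ord0 j).
  by apply/existsNP => h; apply: nx => j; exact: h.
rewrite cutoffE (bigD1 j)//=; suff -> : flat 0 (k.+1%:R * (x ord0 j - a ord0 j)) *
  flat 0 (k.+1%:R * (b ord0 j - x ord0 j)) = 0 by rewrite mul0r.
have [ax|ax] := ltP (a ord0 j) (x ord0 j); last first.
  by rewrite /flat ifF ?mul0r//; apply/negbTE; rewrite -leNgt pmulr_rle0// subr_le0.
have [bx|bx] := ltP (x ord0 j) (b ord0 j); first by case: hj; rewrite ax bx.
by rewrite mulrC /flat ifF ?mul0r//; apply/negbTE; rewrite -leNgt pmulr_rle0// subr_le0.
Qed.

Lemma cvg_flat (u : R) : 0 < u -> flat 0 (k.+1%:R * u) @[k --> \oo] --> (1 : R).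
Proof.
move=> u0; rewrite (_ : (fun k => _) = (fun k => expR (- (u^-1 * k.+1%:R^-1)))); last first.
  by apply/funext => k; rewrite /flat mulr_gt0// expr0 mul1r invfM mulrC.
have lim0 : - (u^-1 * k.+1%:R^-1) @[k --> \oo] --> (0 : R).
  rewrite -oppr0; apply: cvgN; rewrite -(mulr0 u^-1); apply: cvgM; first exact: cvg_cst.
  exact: cvg_harmonic.
have ce : {for (0 : R), continuous expR} by exact: continuous_expR.
have h := cvg_comp _ _ lim0 ce; rewrite expR0 in h; exact: h.
Qed.

Lemma cvg_cutoff a b x : cutoff k a b x @[k --> \oo] --> (\1_(rect a b) x : R).
Proof.
have [rx|nrx] := pselect (rect a b x); last first.
  rewrite indicE memNset//= (_ : (fun k => _) = fun=> 0); first exact: cvg_cst.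
  by apply/funext => k; exact: cutoff_out.
rewrite indicE mem_set//=.
under eq_fun do rewrite cutoffE.
elim: (index_enum _) => [|j s IH].
  by under eq_fun do rewrite big_nil; exact: cvg_cst.
under eq_fun do rewrite big_cons.
have /andP[h1 h2] := rx j.
have c2 (u w : nat -> R) : u k @[k --> \oo] --> (1 : R) -> w k @[k --> \oo] --> (1 : R) ->
    u k * w k @[k --> \oo] --> (1 : R).
  by move=> cu cw; have h := cvgM cu cw; rewrite mulr1 in h; exact: h.
by apply: (c2 _ _ _ IH); apply: (c2); apply: cvg_flat; rewrite subr_gt0.
Qed.

Definition closed_rect a b : set 'rV[R]_n :=
  [set x : 'rV[R]_n | forall j, a ord0 j <= x ord0 j <= b ord0 j].

Lemma compact_closed_rect a b : compact (closed_rect a b).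
Proof.
have := @rV_compact _ n (fun j => `[a ord0 j, b ord0 j]%classic) (fun j => @segment_compact _ _ _).
by congr compact; apply/seteqP; split => x h i; have := h i; rewrite /= in_itv/=.
Qed.

Lemma test_cutoff (Omega : set 'rV[R]_n) k a b : closed_rect a b `<=` Omega ->
  test_function Omega (cutoff k a b).
Proof.
move=> abO.
have cl : closure [set x | cutoff k a b x != 0] `<=` closed_rect a b.
  have ccl : closed (closed_rect a b).
    by apply: compact_closed; [exact: norm_hausdorff|exact: compact_closed_rect].
  have /closure_id -> := ccl; apply: closureS => x /eqP bx j.
  by have /contrapT/(_ j)/andP[h1 h2] := contra_not (@cutoff_out k a b x) bx; rewrite !ltW.
split; first by move=> l; exact: Ck_cutoff.
- apply: (subclosed_compact _ (@compact_closed_rect a b) cl); exact: closed_closure.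
- exact: subset_trans cl abO.
Qed.

End cutoff.

(** * Functions orthogonal to all cutoffs *)

Section vanishing.
Context {R : realType} {n : nat}.
Local Open Scope ereal_scope.
Local Notation Bo := (borel_rV R n).

Section density.
Context d (T : measurableType d) (m : {measure set T -> \bar R}).
Variable g : T -> \bar R.
Hypotheses (mg : measurable_fun setT g) (g0 : forall x, 0 <= g x).

Definition density (A : set T) : \bar R := \int[m]_(x in A) g x.

Let density0 : density set0 = 0. Proof. exact: integral_set0. Qed.
Let density_ge0 A : 0 <= density A. Proof. by apply: integral_ge0 => x _. Qed.
Let density_sigma : semi_sigma_additive density.
Proof. exact: semi_sigma_additive_nng_induced. Qed.

HB.instance Definition _ := isMeasure.Build d T R density density0 density_ge0 density_sigma.

Definition density_measure : {measure set T -> \bar R} := density.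
End density.

Local Notation rat_rects := [set A : set 'rV[R]_n | exists pq, A = rat_rect pq].

Lemma borel_rat_rects (B : set 'rV[R]_n) : measurable (B : set Bo) -> <<s rat_rects>> B.
Proof.
move=> mB; apply: (smallest_sub _ _ mB); first exact: smallest_sigma_algebra.
move=> _ [i [c ->]].
have cl : closed (halfspace i c : set 'rV[R]_n).
  rewrite (_ : halfspace i c = (fun x : 'rV[R]_n => x ord0 i) @^-1` [set t | t <= c]%R)//.
  apply: preimage_closed => [y _|]; last exact: closed_le.
  exact: continuous_coord.
pose T' := g_sigma_algebraType rat_rects.
rewrite -[halfspace i c]setCK; apply: (@measurableC _ T').
have oU : open (~` halfspace i c) by exact: closed_openC.
rewrite (open_rat_rect oU) bigcup_mkcond.
apply: (@countable_bigcupT_measurable _ T') => [|pq]; first exact: countableP.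
case: ifP => _; last exact: (@measurable0 _ T').
by apply: sub_sigma_algebra; exists pq.
Qed.

Definition meet_rect (pq pq' : 'rV[rat]_n * 'rV[rat]_n) : 'rV[rat]_n * 'rV[rat]_n :=
  (\row_j Order.max (pq.1 ord0 j) (pq'.1 ord0 j), \row_j Order.min (pq.2 ord0 j) (pq'.2 ord0 j))%R.

Lemma closed_meet_rect pq pq' :
  closed_rect (map_mx ratr (meet_rect pq pq').1) (map_mx ratr (meet_rect pq pq').2) `<=`
  (closed_rect (map_mx ratr pq.1) (map_mx ratr pq.2) : set 'rV[R]_n).
Proof.
move=> x h j; have := h j; rewrite !mxE => /andP[h1 h2]; apply/andP; split.
  by apply: le_trans h1; rewrite ler_rat le_max lexx.
by apply: le_trans h2 _; rewrite ler_rat ge_min lexx.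
Qed.

Lemma setI_rat_rect (pq pq' : 'rV[rat]_n * 'rV[rat]_n) :
  rat_rect pq `&` rat_rect pq' = rat_rect (meet_rect pq pq') :> set 'rV[R]_n.
Proof.
have ratr_max (x y : rat) (t : R) : (ratr (Order.max x y) < t)%R = (ratr x < t)%R && (ratr y < t)%R.
  rewrite maxEge; case: ifP => xy.
    have : (ratr y <= ratr x :> R)%R by rewrite ler_rat.
    by move=> h; apply/idP/andP => [h1|[]//]; split => //; exact: le_lt_trans h1.
  have : (ratr x <= ratr y :> R)%R by rewrite ler_rat ltW// ltNge xy.
  by move=> h; apply/idP/andP => [h1|[]//]; split => //; exact: le_lt_trans h1.
have ratr_min (x y : rat) (t : R) : (t < ratr (Order.min x y))%R = (t < ratr x)%R && (t < ratr y)%R.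
  rewrite minEle; case: ifP => xy.
    have : (ratr x <= ratr y :> R)%R by rewrite ler_rat.
    by move=> h; apply/idP/andP => [h1|[]//]; split => //; exact: lt_le_trans h.
  have : (ratr y <= ratr x :> R)%R by rewrite ler_rat ltW// ltNge xy.
  by move=> h; apply/idP/andP => [h1|[]//]; split => //; exact: lt_le_trans h.
apply/seteqP; split => x /=.
  move=> [h1 h2] j; have := h1 j; have := h2 j; rewrite !mxE ratr_max ratr_min.
  by move=> /andP[-> ->] /andP[-> ->].
by move=> h; split => j; have := h j; rewrite !mxE ratr_max ratr_min => /andP[/andP[a b] /andP[c e]]; apply/andP.
Qed.

Section regular_measure.
Variables (nu : {outer_measure set 'rV[R]_n -> \bar R}).
Local Notation T := (caratheodory_type nu).
Variable m : {measure set T -> \bar R}.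
Hypotheses (mE : forall A, m A = nu A)
  (borelT : forall A : set 'rV[R]_n, measurable (A : set Bo) -> measurable (A : set T))
  (regular : forall X, exists B : set 'rV[R]_n,
    [/\ measurable (B : set Bo), X `<=` B & nu B <= nu X]).

Lemma cover_rat_rect : exists g : nat -> 'rV[rat]_n * 'rV[rat]_n,
  \bigcup_k (rat_rect (g k) : set 'rV[R]_n) = setT.
Proof.
exists (fun k => (\row_j - k%:R, \row_j k%:R)%R).
apply/seteqP; split => // x _.
pose M : R := (\sum_j `|x ord0 j|)%R.
exists (Num.truncn M).+1 => // j; rewrite !mxE rmorphN/= ratr_nat -ltr_norml.
apply: le_lt_trans (truncnS_gt M).
by rewrite /M (bigD1 j)//= lerDl; apply: sumr_ge0.
Qed.

(** The positive and negative parts of F are densities of two measures that agree on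
    the rational boxes, which are stable under intersection. *)
Lemma integral_borel0 (F : T -> \bar R) : m.-integrable setT F ->
  (forall pq, \int[m]_(x in (rat_rect pq : set T)) F x = 0) ->
  forall B : set 'rV[R]_n, measurable (B : set Bo) -> \int[m]_(x in (B : set T)) F x = 0.
Proof.
move=> iF F0 B mB; have mF : measurable_fun setT F by exact: measurable_int iF.
have mBT : measurable (B : set T) by exact: borelT.
have p0 x : 0 <= F^\+ x by exact: funepos_ge0.
have n0 x : 0 <= F^\- x by exact: funeneg_ge0.
pose m1 := density_measure m (measurable_funepos mF) p0.
pose m2 := density_measure m (measurable_funeneg mF) n0.
have fin1 (A : set T) : measurable A -> m1 A < +oo.
  move=> mA; apply: integrable_lty => //; apply: integrable_funepos => //.
  by apply: integrableS iF.
have fin2 (A : set T) : measurable A -> m2 A < +oo.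
  move=> mA; apply: integrable_lty => //; apply: integrable_funeneg => //.
  by apply: integrableS iF.
have mr pq : measurable (rat_rect pq : set T) by apply: borelT; exact: measurable_rect.
have [g gT] := cover_rat_rect.
have E : m1 B = m2 B.
  apply: (@g_sigma_algebra_measure_unique _ _ T rat_rects _ (fun k => rat_rect (g k))).
  - by move=> _ [pq ->]; exact: mr.
  - by move=> k; exists (g k).
  - exact: gT.
  - move=> _ _ [pq ->] [pq' ->]; by exists (meet_rect pq pq'); exact: setI_rat_rect.
  - move=> _ [pq ->]; have := F0 pq; rewrite integralE => /eqP; rewrite sube_eq.
    + by rewrite add0e => /eqP.
    + by rewrite -[X in X \is a fin_num]/(m1 (rat_rect pq)) ge0_fin_numE//; exact: fin1.
    + rewrite -[X in _ +? X]/(m2 (rat_rect pq)); apply: fin_num_adde_defl.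
      by rewrite ge0_fin_numE//; exact: fin2.
  - by move=> k; exact: fin1.
  - exact: borel_rat_rects.
rewrite integralE -[X in X - _]/(m1 B) -[X in _ - X]/(m2 B) E subee//.
by rewrite ge0_fin_numE//; exact: fin2.
Qed.

(** Regularity replaces the measurable set on which F would have a sign by a Borel
    set of the same measure. *)
Lemma ae_zero_of_rects (D : set T) (F : T -> \bar R) : measurable D -> nu D < +oo ->
  m.-integrable setT F -> (forall pq, \int[m]_(x in (rat_rect pq : set T)) F x = 0) ->
  {ae m, forall x, D x -> F x = 0}.
Proof.
move=> mD Doo iF F0.
have iFD : m.-integrable D F by apply: integrableS iF.
apply: (integral_ae_eq mD iFD (g := cst 0)) => // E ED mE'.
rewrite integral0; have [B [mB EB Bnu]] := regular E.
have mBT : measurable (B : set T) by exact: borelT.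
have mBE : measurable (B `\` E : set T) by exact: measurableD.
have null : m (B `\` E) = 0.
  have Eoo : m E < +oo.
    by apply: le_lt_trans (_ : m D < +oo); [apply: le_measure; rewrite ?inE|rewrite mE].
  have Boo : m B < +oo by rewrite mE; apply: le_lt_trans Bnu _; rewrite -mE.
  rewrite measureD//.
  have BE : m B = m E.
    apply/eqP; rewrite eq_le; apply/andP; split; last by apply: le_measure; rewrite ?inE.
    by have := Bnu; rewrite -(mE B) -(mE E).
  rewrite (setIidr EB); transitivity (m B - m B); first by congr (_ - _).
  by rewrite subee// ge0_fin_numE.
have := integral_borel0 iF F0 mB.
have iFB : m.-integrable (B : set T) F by apply: integrableS iF.
rewrite (negligible_integral mBE mBT iFB null).
by rewrite setDD (setIidr EB).
Qed.

(** Dominated convergence turns cutoffs into indicator functions of boxes.  Boxes with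
    rational corners suffice, and there are countably many of them. *)
Lemma ae_zero_of_cutoffs (D : set T) (G : set 'rV[R]_n) (f : 'rV[R]_n -> R) :
  measurable D -> nu D < +oo -> open G -> m.-integrable D (EFin \o f) ->
  (forall k (pq : 'rV[rat]_n * 'rV[rat]_n),
    closed_rect (map_mx ratr pq.1) (map_mx ratr pq.2) `<=` G ->
    (\int[m]_(x in D) (f x * cutoff k (map_mx ratr pq.1) (map_mx ratr pq.2) x) = 0)%R) ->
  {ae m, forall x, D x -> G x -> f x = 0%R}.
Proof.
move=> mD Doo oG If f0.
pose good (pq : 'rV[rat]_n * 'rV[rat]_n) :=
  closed_rect (map_mx ratr pq.1) (map_mx ratr pq.2) `<=` G.
have mr pq : measurable (rat_rect pq : set T) by apply: borelT; exact: measurable_rect.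
have mf : measurable_fun D f by apply/measurable_EFinP; exact: measurable_int If.
have rect0 pq : good pq -> \int[m]_(x in D `&` (rat_rect pq : set T)) (f x)%:E = 0.
  move=> gpq; pose a : 'rV[R]_n := map_mx ratr pq.1; pose b : 'rV[R]_n := map_mx ratr pq.2.
  pose F k (x : T) := (f x * cutoff k a b x)%:E.
  have mF k : measurable_fun D (F k).
    apply/measurable_EFinP; apply: measurable_funM => //; apply: measurable_funTS.
    move=> _ A mA; rewrite setTI; apply: borelT; rewrite -[X in measurable X]setTI.
    by apply: continuous_borel => //; exact: continuous_cutoff.
  have iabs : m.-integrable D (EFin \o (fun x => `|f x|)%R).
    by apply: integrable_norm.
  have mlim : measurable_fun D (fun x => (f x * \1_(rat_rect pq) x)%:E).
    have mi : measurable_fun setT (\1_(rat_rect pq : set T) : T -> R) by exact: measurable_indic.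
    by apply/measurable_EFinP; apply: measurable_funM => //; exact: measurable_funTS.
  have [] := dominated_convergence mD mF mlim _ iabs _.
  - apply: aeW => x Dx; apply: cvg_EFin; first by near=> k.
    by apply: cvgM; [exact: cvg_cst|exact: cvg_cutoff].
  - apply: aeW => x k Dx; rewrite /F /= lee_fin normrM ler_piMr//; exact: cutoff_le1.
  move=> _ _; rewrite (_ : (fun k => _) = cst 0); last first.
    apply/funext => k; rewrite -[LHS]fineK; first by congr (_%:E); exact: f0.
    apply: integrable_fin_num => //; apply: (le_integrable mD (mF k) _ iabs) => x Dx.
    by rewrite /F /= lee_fin normrM normr_id ler_piMr//; exact: cutoff_le1.
  move=> h; have {}h := cvg_unique _ h (cvg_cst _).
  rewrite (_ : \int[m]_(x in D `&` (rat_rect pq : set T)) (f x)%:E =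
     \int[m]_(x in D) (f x * \1_(rat_rect pq) x)%:E); first exact: h.
  rewrite integral_mkcondr; apply: eq_integral => x _; rewrite patchE indicE.
  by case: ifP => _; rewrite ?mulr1 ?mulr0.
have local (pq : 'rV[rat]_n * 'rV[rat]_n) : good pq ->
    {ae m, forall x, (D `&` rat_rect pq) x -> (f x)%:E = 0}.
  move=> gpq; pose E : set T := D `&` rat_rect pq.
  have mE' : measurable E by exact: measurableI.
  pose F : T -> \bar R := (EFin \o f) \_ E.
  have iF : m.-integrable setT F.
    apply/(integrable_mkcond _ mE'); apply: (integrableS mD mE' _ If).
    by move=> x [].
  have : {ae m, forall x, E x -> F x = 0}.
    apply: (ae_zero_of_rects mE' _ iF).
      by apply: le_lt_trans Doo; apply: le_outer_measure => x [].
    move=> pq'; rewrite -integral_mkcondr setIC -setIA setI_rat_rect; apply: rect0.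
    exact: subset_trans (@closed_meet_rect pq pq') gpq.
  apply: filterS => x h Ex; have := h Ex; rewrite /F patchE mem_set//.
pose P (i : nat) (x : T) := if unpickle i is Some pq then
  `[< good pq >] -> (D `&` rat_rect pq) x -> (f x)%:E = 0 else True.
have : {ae m, forall x i, P i x}.
  apply: ae_foralln => i; rewrite /P; case: (unpickle i) => [pq|]; last exact: aeW.
  have [g|ng] := pselect (good pq); last by apply: aeW => x /asboolP.
  by apply: filterS (local pq g) => x h _.
apply: filterS => x h Dx Gx.
have [e e0 eG] := nbhs_rV (open_nbhs_nbhs (conj oG Gx)).
have lt1 i : (x ord0 i - e < x ord0 i)%R by rewrite ltrBlDr ltrDl.
have lt2 i : (x ord0 i < x ord0 i + e)%R by rewrite ltrDl.
have [p Hp] := choice (fun i => rat_in_itvoo (lt1 i)).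
have [q Hq] := choice (fun i => rat_in_itvoo (lt2 i)).
pose pq : 'rV[rat]_n * 'rV[rat]_n := (\row_i p i, \row_i q i)%R.
have := h (pickle pq); rewrite /P pickleK => hx.
suff : (f x)%:E = 0 by case.
apply: hx.
  apply/asboolP => y yr; apply: eG => i; have := yr i; rewrite !mxE.
  have := Hp i; have := Hq i; rewrite !in_itv/= => /andP[? ?] /andP[? ?] /andP[? ?].
  by rewrite ltr_distl; apply/andP; split; lra.
split => // i; rewrite !mxE; have := Hp i; have := Hq i.
by rewrite !in_itv/= => /andP[-> _] /andP[_ ->].
Unshelve. all: by end_near. Qed.

End regular_measure.
End vanishing.

(** * Functions with vanishing weak gradient *)

Section boxes.
Context {R : realType} {n : nat}.
Local Open Scope ereal_scope.
Local Notation leb := (@lebesgue_rV R n).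
Implicit Types (a b p q x : 'rV[R]_n).

Definition translate (s : 'rV[R]_n) (A : set 'rV[R]_n) : set 'rV[R]_n := [set x | A (x - s)%R].

Lemma translate_obox (s : 'rV[R]_n) a b : translate s (obox a b) = obox (a + s) (b + s).
Proof.
by apply/seteqP; split => x h j; have := h j; rewrite !mxE => /andP[h1 h2]; apply/andP; split; lra.
Qed.

Lemma lebesgue_translate_le (s : 'rV[R]_n) (A : set 'rV[R]_n) :
  lebesgue_outer (translate s A) <= lebesgue_outer A.
Proof.
have gauge (B : set 'rV[R]_n) : box_gauge (translate s B) <= box_gauge B.
  rewrite /box_gauge; case: (asboolP (B = set0)) => [->|B0].
    by case: asboolP => // -[]; apply/seteqP; split.
  case: asboolP => [h|_].
    by exfalso; apply: B0; apply/seteqP; split => // x Bx; have : translate s B (x + s)%R;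
      [rewrite /translate /= addrK|rewrite h].
  apply: le_ereal_inf_tmp => _ [a [b [ab BE ->]]]; apply: ereal_inf_lbound.
  exists (a + s)%R, (b + s)%R; split.
  - by move=> i; rewrite !mxE ltrD2r.
  - by rewrite BE -[X in translate s X]/(obox a b) translate_obox.
  - by congr EFin; apply: eq_bigr => i _; rewrite !mxE; ring.
apply: le_ereal_inf_tmp => _ [F AF <-].
apply: (@le_trans _ _ (\sum_(k <oo) box_gauge (translate s (F k)))); last first.
  apply: lee_nneseries => [k _ _|k _]; [exact: box_gauge_ge0|exact: gauge].
apply: ereal_inf_lbound; exists (fun k => translate s (F k)) => //.
by move=> x /AF[k _ Fk]; exists k.
Qed.

Lemma lebesgue_translate (s : 'rV[R]_n) (A : set 'rV[R]_n) :
  lebesgue_outer (translate s A) = lebesgue_outer A.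
Proof.
apply/eqP; rewrite eq_le lebesgue_translate_le/=.
rewrite [X in lebesgue_outer X <= _](_ : A = translate (- s) (translate s A)).
  exact: lebesgue_translate_le.
by apply/seteqP; split => x; rewrite /translate /= opprK addrK.
Qed.

(** Hyperplanes are null: inside a box they are covered by arbitrarily thin boxes. *)
Lemma null_face a b (j : 'I_n) (c : R) : leb [set x | obox a b x /\ x ord0 j = c] = 0.
Proof.
have [ab|nab] := pselect (forall i, (a ord0 i < b ord0 i)%R); last first.
  rewrite (_ : [set x | _] = set0) ?measure0//; apply/seteqP; split => // x [xab _].
  by apply: nab => i; have /andP[h1 h2] := xab i; exact: lt_le_trans h2.
apply/eqP; rewrite eq_le measure_ge0 andbT; apply/lee_addgt0Pr => eps e0; rewrite add0e.
pose P := (\prod_(i < n | i != j) (b ord0 i - a ord0 i))%R.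
have P0 : (0 <= P)%R by apply: prodr_ge0 => i _; rewrite subr_ge0 ltW.
pose d : R := (eps / (P + 1))%R.
have d0 : (0 < d)%R by rewrite divr_gt0// ltr_wpDl.
pose a' := set_coord a j (c - d); pose b' := set_coord b j c.
have ab' i : (a' ord0 i < b' ord0 i)%R.
  have [->|ij] := eqVneq i j; first by rewrite !set_coord_eq; lra.
  by rewrite !set_coord_neq.
apply: (@le_trans _ _ (lebesgue_outer (obox a' b'))).
  apply: (@le_outer_measure _ _ (@lebesgue_outer R n)) => x [xab xc] i.
  have [->|ij] := eqVneq i j; first by rewrite !set_coord_eq xc; apply/andP; split; lra.
  by rewrite !set_coord_neq.
apply: le_trans (le_lebesgue_obox ab') _; rewrite lee_fin /volume (bigD1 j)//=.
rewrite !set_coord_eq (_ : c - (c - d) = d)%R; last by ring.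
rewrite (eq_bigr (fun i => b ord0 i - a ord0 i)%R) => [|i ij]; last by rewrite !set_coord_neq.
by rewrite -/P /d mulrAC ler_pdivrMr ?ltr_wpDl// mulrDr mulr1 lerDl ltW.
Qed.

(** The deviation g from linearity is additive and vanishes at T, so that it is
    additive modulo T; its multiples N g t are therefore values of g as well, and
    they are bounded. *)
Lemma additive_bounded_linear (h : R -> R) (T K : R) : (0 < T)%R ->
  (forall s t, 0 <= s -> 0 <= t -> s + t <= T -> h (s + t) = h s + h t)%R ->
  (forall t, 0 <= t <= T -> `|h t| <= K)%R ->
  forall t, (0 <= t <= T)%R -> (h t = t / T * h T)%R.
Proof.
move=> T0 hD hK t /andP[t0 tT]; pose g s := (h s - s / T * h T)%R.
have gD u w : (0 <= u -> 0 <= w -> u + w <= T -> g (u + w) = g u + g w)%R.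
  by move=> u0 w0 uw; rewrite /g hD//; ring.
have gT : g T = 0%R by rewrite /g divff ?mul1r ?subrr// gt_eqF.
(* Walk by steps of t modulo T. *)
have walk N : exists2 u, (0 <= u <= T)%R & (g u = N%:R * g t)%R.
  elim: N => [|N [u /andP[u0 uT] gu]].
    exists 0%R; first by rewrite lexx ltW.
    by have := gD 0%R 0%R (lexx _) (lexx _); rewrite addr0 => /(_ (ltW T0)); lra.
  have [ut|ut] := leP (u + t)%R T.
    exists (u + t)%R; first by rewrite ut addr_ge0.
    by rewrite gD// gu -natr1; ring.
  exists (u + t - T)%R; first by apply/andP; split; lra.
  have e1 : g u = (g (u + t - T) + g (T - t))%R by rewrite -gD; [congr g; ring|lra|lra|lra].
  have e2 : g T = (g t + g (T - t))%R by rewrite -gD; [congr g; ring|lra|lra|lra].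
  by rewrite -natr1; lra.
have K0 : (0 <= K)%R by apply: le_trans (hK T _) => //; rewrite lexx ltW.
have gK u : (0 <= u <= T -> `|g u| <= 2 * K)%R.
  move=> /andP[u0 uT]; apply: le_trans (ler_normB _ _) _.
  have h1 : (`|h u| <= K)%R by apply: hK; rewrite u0.
  have h2 : (`|h T| <= K)%R by apply: hK; rewrite lexx ltW.
  have q1 : (0 <= u / T <= 1)%R by rewrite divr_ge0 ?(ltW T0)//= ler_pdivrMr// mul1r.
  rewrite normrM; have -> : (`|u / T| = u / T)%R by rewrite ger0_norm//; case/andP: q1.
  have := normr_ge0 (h T); case/andP: q1; nra.
suff : g t = 0%R by rewrite /g => /subr0_eq.
apply/eqP/contraT => gt0.
have gp : (0 < `|g t|)%R by rewrite normr_gt0.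
have [u uT gu] := walk (Num.truncn (2 * K / `|g t|)).+1.
have := gK u uT; rewrite gu normrM ger0_norm// => h1.
have := truncnS_gt (2 * K / `|g t|)%R; rewrite ltr_pdivrMr// => h2; lra.
Qed.

(** In each side separately, a bounded additive function of boxes that is invariant
    under translations is linear.  So its value on a box is a multiple of the value
    on the box with one side lengthened to that of the largest box; lengthening the
    sides one after the other ends at the largest box. *)
Lemma box_function_zero (G : 'rV[R]_n -> 'rV[R]_n -> R) p q (K : R) :
  (forall i, p ord0 i < q ord0 i)%R ->
  (forall a b, (forall i, p ord0 i <= a ord0 i /\ a ord0 i <= b ord0 i /\ b ord0 i <= q ord0 i)%R ->
     (`|G a b| <= K)%R) ->
  (forall a b i (c : R), (forall j, p ord0 j <= a ord0 j /\ a ord0 j <= b ord0 j /\ b ord0 j <= q ord0 j)%R ->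
     (a ord0 i <= c <= b ord0 i)%R -> G a b = (G a (set_coord b i c) + G (set_coord a i c) b)%R) ->
  (forall a b i (t : R), (forall j, p ord0 j <= a ord0 j /\ a ord0 j <= b ord0 j /\ b ord0 j <= q ord0 j)%R ->
     (0 <= t)%R -> (b ord0 i + t <= q ord0 i)%R ->
     G a b = G (set_coord a i (a ord0 i + t)) (set_coord b i (b ord0 i + t))) ->
  G p q = 0%R ->
  forall a b, (forall j, p ord0 j <= a ord0 j /\ a ord0 j <= b ord0 j /\ b ord0 j <= q ord0 j)%R ->
    G a b = 0%R.
Proof.
move=> pq GK Gsplit Gtr G0.
pose inside a b := (forall j, p ord0 j <= a ord0 j /\ a ord0 j <= b ord0 j /\ b ord0 j <= q ord0 j)%R.
have sets a b i (c d : R) : inside a b -> (p ord0 i <= c)%R -> (c <= d)%R -> (d <= q ord0 i)%R ->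
    inside (set_coord a i c) (set_coord b i d).
  move=> ab pc cd dq j; have [->|ji] := eqVneq j i; first by rewrite !set_coord_eq.
  by rewrite !set_coord_neq//; exact: ab.
have setset a i (c d : R) : set_coord (set_coord a i c) i d = set_coord a i d.
  apply/rowP => j; have [->|ji] := eqVneq j i; first by rewrite !set_coord_eq.
  by rewrite !set_coord_neq.
have setid a i : set_coord a i (a ord0 i) = a.
  by apply/rowP => j; have [->|ji] := eqVneq j i; [rewrite set_coord_eq|rewrite set_coord_neq].
have step a b i : inside a b ->
    (G (set_coord a i (p ord0 i)) (set_coord b i (q ord0 i)) = 0 -> G a b = 0)%R.
  move=> ab Gfull; pose T := (q ord0 i - p ord0 i)%R.
  have T0 : (0 < T)%R by rewrite subr_gt0.
  pose h t := G (set_coord a i (p ord0 i)) (set_coord b i (p ord0 i + t)%R).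
  have hT : h T = 0%R by rewrite /h /T addrC subrK.
  have hlin := @additive_bounded_linear h T K T0.
  have [pa [abi bq]] := ab i.
  have := hlin _ _ (b ord0 i - a ord0 i)%R; rewrite hT mulr0 => <-.
  - have ins : inside (set_coord a i (p ord0 i)) (set_coord b i (p ord0 i + (b ord0 i - a ord0 i)))%R.
      by apply: sets => //; lra.
    rewrite /h (Gtr _ _ i (a ord0 i - p ord0 i)%R ins) ?set_coord_eq ?setset; [|lra|lra].
    rewrite (_ : p ord0 i + (a ord0 i - p ord0 i) = a ord0 i)%R; last by ring.
    rewrite (_ : p ord0 i + (b ord0 i - a ord0 i) + (a ord0 i - p ord0 i) = b ord0 i)%R; last by ring.
    by rewrite !setid.
  - move=> s t s0 t0 st; rewrite /h.
    have ins : inside (set_coord a i (p ord0 i)) (set_coord b i (p ord0 i + (s + t)))%R.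
      by apply: sets => //; rewrite /T in st; lra.
    rewrite (Gsplit _ _ i (p ord0 i + s)%R ins) ?set_coord_eq ?setset; last by apply/andP; split; lra.
    congr (_ + _)%R; apply/esym.
    have ins2 : inside (set_coord a i (p ord0 i)) (set_coord b i (p ord0 i + t))%R.
      by apply: sets => //; rewrite /T in st; lra.
    rewrite (Gtr _ _ i s ins2) ?set_coord_eq ?setset//; last by rewrite /T in st; lra.
    by congr (G _ (set_coord _ _ _)); ring.
  - move=> t /andP[t0 tT]; apply: GK; apply: sets => //; rewrite /T in tT; lra.
  - by apply/andP; split; rewrite /T; lra.
move=> a b ab.
pose ak (k : nat) : 'rV[R]_n := (\row_j (if (j < k)%N then p ord0 j else a ord0 j))%R.
pose bk (k : nat) : 'rV[R]_n := (\row_j (if (j < k)%N then q ord0 j else b ord0 j))%R.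
have insk k : inside (ak k) (bk k).
  move=> j; rewrite !mxE; case: ifP => _; last exact: ab.
  by rewrite !lexx; split => //; split => //; apply: ltW.
have a0 : ak 0%N = a by apply/rowP => j; rewrite mxE.
have b0 : bk 0%N = b by apply/rowP => j; rewrite mxE.
have an : ak n = p by apply/rowP => j; rewrite mxE ltn_ord.
have bn : bk n = q by apply/rowP => j; rewrite mxE ltn_ord.
(* The box with corners ak k and bk k has its first k sides already lengthened. *)
have next k (kn : (k < n)%N) : (G (ak k.+1) (bk k.+1) = 0 -> G (ak k) (bk k) = 0)%R.
  move=> h; apply: (step _ _ (Ordinal kn)) => //.
  have setk (u w : 'rV[R]_n) : set_coord (\row_j (if (j < k)%N then u ord0 j else w ord0 j))%R
     (Ordinal kn) (u ord0 (Ordinal kn)) = (\row_j (if (j < k.+1)%N then u ord0 j else w ord0 j))%R.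
    apply/rowP => j; have [->|ji] := eqVneq j (Ordinal kn).
      by rewrite set_coord_eq mxE /= ltnSn.
    have jk : (j == k :> nat) = false by apply/negbTE; rewrite -(inj_eq val_inj) in ji.
    by rewrite set_coord_neq// !mxE [in RHS]ltnS [in RHS]leq_eqVlt jk.
  by rewrite !setk.
have all k : (k <= n)%N -> (G (ak (n - k)%N) (bk (n - k)%N) = 0)%R.
  elim: k => [_|k IH kn]; first by rewrite subn0 an bn.
  have lt : (n - k.+1 < n)%N by rewrite ltn_subrL (leq_ltn_trans _ kn).
  apply: (next _ lt); rewrite subnSK//; apply: IH; exact: ltnW.
by have := all n (leqnn n); rewrite subnn a0 b0.
Qed.

End boxes.

Section translation_invariance.
Context {R : realType} {n : nat}.
Local Notation CL := (caratheodory_type (@lebesgue_outer R n)).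
Local Notation leb := (@lebesgue_rV R n).
Implicit Types (a b p q x : 'rV[R]_n).

Lemma partial_translate (i : 'I_n) (f : 'rV[R]_n -> R) (s : 'rV[R]_n) x :
  partial i (fun y => f (y + s)) x = partial i f (x + s).
Proof.
rewrite /partial /derive.
rewrite (_ : (fun h : R => h^-1 *: (f (h *: delta_mx ord0 i + x + s) - f (x + s))) =
  (fun h : R => h^-1 *: (f (h *: delta_mx ord0 i + (x + s)) - f (x + s))))//.
by apply/funext => h /=; rewrite addrA.
Qed.

Lemma second_order (f : 'rV[R]_n -> R) (i : 'I_n) (y : 'rV[R]_n) (h K : R) : Ck 2 f ->
  (forall t, `|t| <= `|h| -> `|partial i (partial i f) (y + t *: delta_mx ord0 i)| <= K) ->
  `|f (y + h *: delta_mx ord0 i) - f y - h * partial i f y| <= K * h ^+ 2.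
Proof.
move=> [cf C2] hK; set e := delta_mx ord0 i.
have [df [cpf C1p]] := C2 i; have [dpf _] := C1p i.
have K0 : 0 <= K by apply: le_trans (hK 0 _); rewrite ?normr0.
pose g (t : R) := f (y + t *: e) - t * partial i f y.
have dg (t : R) : is_derive t (1 : R) g (partial i f (y + t *: e) - partial i f y).
  have d1 := is_derive_line (df (y + t *: e)).
  have d2 : is_derive t (1 : R) (fun t : R => t * partial i f y) (partial i f y).
    have := is_deriveZ (partial i f y) (is_derive_id t (1 : R)) => d.
    rewrite (_ : (fun t : R => t * partial i f y) = partial i f y *: id); last first.
      by apply/funext => u; rewrite mulrC.
    by apply: is_derive_eq d _; rewrite /GRing.scale/= mulr1.
  exact: is_deriveB.
have [xi xih E] := MVT_signed h dg.
have d2 (t : R) : is_derive t (1 : R) (fun t : R => partial i f (y + t *: e))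
    (partial i (partial i f) (y + t *: e)) by exact: is_derive_line (dpf (y + t *: e)).
have [zeta zxi E2] := MVT_signed xi d2.
rewrite scale0r addr0 in E2.
have -> : f (y + h *: e) - f y - h * partial i f y = g h - g 0.
  by rewrite /g scale0r addr0 mul0r subr0; ring.
rewrite E E2 !normrM.
have -> : K * h ^+ 2 = `|h| * (`|h| * K) by rewrite -(real_normK (num_real h)); ring.
apply: ler_wpM2l => //; apply: ler_pM => //.
by apply: hK; exact: le_trans zxi xih.
Qed.

Lemma small_increments_constant (g : R -> R) (T K : R) : 0 <= T ->
  (forall t h, 0 <= t -> 0 <= h -> t + h <= T -> `|g (t + h) - g t| <= K * h ^+ 2) ->
  g T = g 0.
Proof.
move=> T0 gK; apply/eqP; rewrite -subr_eq0 -normr_le0; apply/ler_addgt0Pr => eps e0; rewrite add0r.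
have K0 : 0 <= K * T ^+ 2.
  by have := gK 0 T (lexx _) T0; rewrite add0r => /(_ (lexx _)); apply: le_trans.
pose N := (Num.truncn (K * T ^+ 2 / eps)).+1.
have N0 : (0 < N%:R :> R) by [].
have hN : K * T ^+ 2 <= eps * N%:R.
  rewrite [leRHS]mulrC -ler_pdivrMr//; exact: (ltW (truncnS_gt _)).
pose d : R := T / N%:R.
have d0 : 0 <= d by rewrite divr_ge0// ltW.
have tele k : (k <= N)%N -> `|g (k%:R * d) - g 0| <= k%:R * (K * d ^+ 2).
  elim: k => [_|k IH kN]; first by rewrite !mul0r subrr normr0.
  have kd : k%:R * d + d <= T.
    have -> : k%:R * d + d = k.+1%:R * d by rewrite -natr1 mulrDl mul1r.
    by rewrite /d mulrA ler_pdivrMr// mulrC ler_wpM2l// ler_nat.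
  have -> : k.+1%:R * d = k%:R * d + d by rewrite -natr1 mulrDl mul1r.
  have -> : g (k%:R * d + d) - g 0 = (g (k%:R * d + d) - g (k%:R * d)) + (g (k%:R * d) - g 0) by ring.
  apply: le_trans (ler_normD _ _) _; rewrite -natr1 mulrDl mul1r addrC; apply: lerD.
    by apply: IH; exact: ltnW.
  by apply: gK => //; rewrite mulr_ge0.
have := tele N (leqnn N); have -> : N%:R * d = T by rewrite /d mulrC divfK// gt_eqF.
move=> /le_trans; apply; rewrite /d.
have -> : N%:R * (K * (T / N%:R) ^+ 2) = K * T ^+ 2 / N%:R by field; rewrite gt_eqF.
by rewrite ler_pdivrMr.
Qed.

Definition weak_gradient_zero (Omega : set 'rV[R]_n) (e : 'rV[R]_n -> R) : Prop :=
  forall i phi, test_function Omega phi -> \int[leb]_(x in Omega) (e x * partial i phi x) = 0.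

Section zero_gradient.
Variables (Omega : set 'rV[R]_n) (e : 'rV[R]_n -> R).
Hypotheses (oO : open Omega) (bO : bounded_set Omega)
  (ie : leb.-integrable Omega (EFin \o e)) (e0 : weak_gradient_zero Omega e).

Let mO : measurable (Omega : set CL).
Proof. by apply: borel_lebesgue; exact: open_borel. Qed.

Lemma integrable_scale_abs (c : R) : leb.-integrable Omega (EFin \o (fun x => c * `|e x|)).
Proof.
have h := integrableZl mO c (integrable_norm ie).
by rewrite (_ : EFin \o _ = fun x => (c%:E * (EFin \o (fun y => `|e y|)%R) x)%E).
Qed.

Lemma integrable_mul_continuous (f : 'rV[R]_n -> R) : continuous f ->
  leb.-integrable Omega (EFin \o (fun x => e x * f x)).
Proof.
move=> cf; have [M hM] := continuous_bounded_on bO cf.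
have me : measurable_fun (Omega : set CL) e by apply/measurable_EFinP; exact: measurable_int ie.
have mf : measurable_fun (Omega : set CL) f.
  by apply: measurable_funTS; apply: borel_fun_lebesgue; exact: continuous_borel.
have iM : leb.-integrable Omega (EFin \o (fun x => `|M| * `|e x|)).
  exact: integrable_scale_abs.
apply: (le_integrable mO _ _ iM); first by apply/measurable_EFinP; exact: measurable_funM.
move=> x Ox; rewrite /= lee_fin normrM; apply: le_trans (ler_norm _); rewrite mulrC.
by rewrite ler_wpM2r//; apply: le_trans (hM x Ox) (ler_norm _).
Qed.

Lemma cutoff_translate k a b (s : 'rV[R]_n) x :
  cutoff k (a + s) (b + s) x = cutoff k a b (x - s).
Proof. by rewrite !cutoffE; apply: eq_bigr => j _; rewrite !mxE; congr (flat 0 (_ * _) * flat 0 (_ * _)); ring. Qed.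

(** The derivative in the direction of the translation is the integral of e against a
    partial derivative of a test function, which is zero.  Instead of differentiating
    under the integral sign, bound the increments by the square of the step. *)
Lemma cutoff_integral_translate k a b (i : 'I_n) (T : R) : 0 <= T ->
  (forall t, 0 <= t <= T ->
    closed_rect (a + t *: delta_mx ord0 i) (b + t *: delta_mx ord0 i) `<=` Omega) ->
  \int[leb]_(x in Omega) (e x * cutoff k (a + T *: delta_mx ord0 i) (b + T *: delta_mx ord0 i) x) =
  \int[leb]_(x in Omega) (e x * cutoff k a b x).
Proof.
move=> T0 inO; set d := delta_mx ord0 i; pose B := cutoff k a b.
pose g (t : R) := \int[leb]_(x in Omega) (e x * B (x - t *: d)).
have [M M0 OM] := bounded_cbox bO.
have C2 : Ck 2 B by exact: Ck_cutoff.
have cpp : continuous (partial i (partial i B)).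
  by have [_ /(_ i)[_ [_ /(_ i)[_ []]]]] := C2.
have bK : bounded_set (cbox (M + T) : set 'rV[R]_n).
  by apply: compact_bounded; exact: compact_cbox.
have [K hK] := continuous_bounded_on bK cpp.
pose E := \int[leb]_(x in Omega) `|e x|.
have ct (f : 'rV[R]_n -> R) (s : 'rV[R]_n) : continuous f -> continuous (fun x => f (x - s)).
  move=> cf x; apply: (@continuous_comp _ _ _ (fun x => x - s) f); last exact: cf.
  by apply: continuousB; [exact: cvg_id|exact: cst_continuous].
have cB : continuous B by exact: continuous_cutoff.
have cpB : continuous (partial i B) by have [_ /(_ i)[_ []]] := C2.
have gE t : g t = \int[leb]_(x in Omega) (e x * cutoff k (a + t *: d) (b + t *: d) x).
  by apply: eq_Rintegral => x _; rewrite cutoff_translate.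
have -> : \int[leb]_(x in Omega) (e x * cutoff k a b x) = g 0.
  by rewrite gE scale0r !addr0.
rewrite -gE; apply: (@small_increments_constant g T (E * K)) => // t h t0 h0 th.
have flux : \int[leb]_(x in Omega) (e x * partial i B (x - t *: d)) = 0.
  rewrite -(e0 i (phi := cutoff k (a + t *: d) (b + t *: d))); last first.
    by apply: test_cutoff; apply: inO; rewrite t0; lra.
  apply: eq_Rintegral => x _; congr (_ * _).
  rewrite -[LHS](partial_translate i B (- (t *: d))); congr (partial i _ x).
  by apply/funext => y; rewrite cutoff_translate.
pose r x := B (x - (t + h) *: d) - B (x - t *: d) + h * partial i B (x - t *: d).
have cr : continuous r.
  apply: continuous_addf; last by apply: continuous_scalef; exact: ct.
  by apply: continuous_subf; exact: ct.
have -> : g (t + h) - g t = \int[leb]_(x in Omega) (e x * r x).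
  have i1 := integrable_mul_continuous (ct _ ((t + h) *: d) cB).
  have i2 := integrable_mul_continuous (ct _ (t *: d) cB).
  have i3 := integrable_mul_continuous (@continuous_scalef _ _ h _ (ct _ (t *: d) cpB)).
  have i12 := integrable_mul_continuous (continuous_subf (ct _ ((t + h) *: d) cB) (ct _ (t *: d) cB)).
  transitivity (\int[leb]_(x in Omega) (e x * (B (x - (t + h) *: d) - B (x - t *: d)) +
      e x * (h * partial i B (x - t *: d)))); last by apply: eq_Rintegral => x _; rewrite -mulrDr.
  rewrite (RintegralD mO i12 i3).
  have -> : \int[leb]_(x in Omega) (e x * (h * partial i B (x - t *: d))) = 0.
    transitivity (\int[leb]_(x in Omega) (h * (e x * partial i B (x - t *: d)))).
      by apply: eq_Rintegral => x _; ring.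
    by rewrite RintegralZl ?flux ?mulr0//; exact: (integrable_mul_continuous (ct _ (t *: d) cpB)).
  rewrite addr0 /g -RintegralB//; apply: eq_Rintegral => x _; ring.
have rK x : Omega x -> `|r x| <= K * h ^+ 2.
  move=> Ox; have := @second_order B i (x - t *: d) (- h) K C2.
  rewrite sqrrN (_ : x - t *: d + - h *: delta_mx ord0 i = x - (t + h) *: d); last first.
    by rewrite scalerDl opprD addrA scaleNr.
  rewrite mulNr opprK -/(r x); apply => u; rewrite normrN (ger0_norm h0) => uh.
  apply: hK => j; rewrite !mxE; have := OM x Ox j; move: uh; rewrite !ler_norml eqxx /=.
  case: (j == i); rewrite ?mulr1 ?mulr0 => /andP[u1 u2] /andP[x1 x2]; apply/andP; split; lra.
have ier := integrable_mul_continuous cr.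
apply: le_trans (le_normr_Rintegral mO ier) _.
have -> : E * K * h ^+ 2 = \int[leb]_(x in Omega) ((K * h ^+ 2) * `|e x|).
  by rewrite (RintegralZl _ mO (integrable_norm ie)) /E mulrC mulrA mulrC; ring.
apply: le_Rintegral => //.
- exact: (integrable_norm ier).
- exact: integrable_scale_abs.
by move=> x Ox; rewrite normrM mulrC ler_wpM2r//; exact: rK.
Qed.

End zero_gradient.
End translation_invariance.

Section locally_constant.
Context {R : realType} {n : nat}.
Local Notation CL := (caratheodory_type (@lebesgue_outer R n)).
Local Notation leb := (@lebesgue_rV R n).
Implicit Types (a b p q x : 'rV[R]_n).

Variables (Omega : set 'rV[R]_n) (e : 'rV[R]_n -> R).
Hypotheses (oO : open Omega) (bO : bounded_set Omega)
  (ie : leb.-integrable Omega (EFin \o e)) (e0 : weak_gradient_zero Omega e).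

Let mO : measurable (Omega : set CL).
Proof. by apply: borel_lebesgue; exact: open_borel. Qed.

Let mbox a b : measurable (obox a b : set CL).
Proof. by apply: borel_lebesgue; exact: measurable_obox. Qed.

Let mrect a b : measurable (rect a b : set CL).
Proof. by apply: borel_lebesgue; exact: measurable_rect. Qed.

Lemma null_obox_rect a b : leb (obox a b `\` rect a b : set CL) = 0%E.
Proof.
apply/eqP; rewrite eq_le measure_ge0 andbT.
apply: (@le_trans _ _ (\sum_(j < n) leb [set x | obox a b x /\ x ord0 j = b ord0 j])%E).
  apply: (@le_trans _ _ (lebesgue_outer (\big[setU/set0]_(j < n)
      [set x | obox a b x /\ x ord0 j = b ord0 j]))).
    apply: (@le_outer_measure _ _ (@lebesgue_outer R n)) => x [xab nx].
    rewrite -bigcup_seq; have [j hj] : exists j, ~ (a ord0 j < x ord0 j < b ord0 j).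
      by apply/existsNP => h; apply: nx => j; exact: h.
    exists j; first by rewrite /= mem_index_enum.
    split => //; apply/eqP; rewrite eq_le; have /andP[h1 h2] := xab j; rewrite h2 /= leNgt.
    by apply/negP => h3; apply: hj; rewrite h1.
  elim/big_rec2 : _ => [|j B A _ IH]; first by rewrite outer_measure0.
  apply: le_trans (outer_measureU2 (@lebesgue_outer R n) _ _) _; exact: leeD.
by rewrite big1// => j _; exact: null_face.
Qed.

(** Faces do not contribute to integrals over boxes. *)
Lemma integral_obox_between a b (E : set CL) (f : 'rV[R]_n -> R) :
  measurable E -> rect a b `<=` E -> E `<=` obox a b ->
  leb.-integrable (obox a b) (EFin \o f) ->
  \int[leb]_(x in E) f x = \int[leb]_(x in obox a b) f x.
Proof.
move=> mE rE Eo If.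
have null : leb (obox a b `\` E : set CL) = 0%E.
  apply/eqP; rewrite eq_le measure_ge0 andbT -(null_obox_rect a b).
  by apply: (@le_outer_measure _ _ (@lebesgue_outer R n)) => x [h1 h2]; split => // /rE.
have mN : measurable (obox a b `\` E : set CL) by exact: measurableD.
rewrite /Rintegral; congr fine; apply/esym.
by rewrite (negligible_integral mN (mbox a b) If null) setDD (setIidr Eo).
Qed.

Lemma cvg_cutoff_integral a b : rect a b `<=` Omega ->
  \int[leb]_(x in Omega) (e x * cutoff k a b x) @[k --> \oo] -->
  \int[leb]_(x in rect a b) e x.
Proof.
move=> abO; pose F k (x : CL) := (e x * cutoff k a b x)%:E.
have me : measurable_fun (Omega : set CL) e by apply/measurable_EFinP; exact: measurable_int ie.
have mF k : measurable_fun (Omega : set CL) (F k).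
  apply/measurable_EFinP; apply: measurable_funM => //; apply: measurable_funTS.
  by apply: borel_fun_lebesgue; apply: continuous_borel; exact: continuous_cutoff.
have mi : measurable_fun setT (\1_(rect a b : set CL) : CL -> R) by exact: measurable_indic.
have mlim : measurable_fun (Omega : set CL) (fun x => (e x * \1_(rect a b) x)%:E).
  by apply/measurable_EFinP; apply: measurable_funM => //; exact: measurable_funTS.
have iabs := integrable_norm ie.
have [] := dominated_convergence mO mF mlim _ iabs _.
- apply: aeW => x Ox; apply: cvg_EFin; first by near=> k.
  by apply: cvgM; [exact: cvg_cst|exact: cvg_cutoff].
- apply: aeW => x k Ox; rewrite /F /= lee_fin normrM ler_piMr//; exact: cutoff_le1.
move=> ilim _ h; have -> : \int[leb]_(x in rect a b) e x = \int[leb]_(x in Omega) (e x * \1_(rect a b) x).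
  rewrite /Rintegral; congr fine; rewrite -{1}(setIidr abO) integral_mkcondr.
  by apply: eq_integral => x _; rewrite patchE indicE; case: ifP => _; rewrite ?mulr1 ?mulr0.
apply: (cvg_comp _ _ h); apply: fine_cvg; rewrite fineK//; exact: (integrable_fin_num mO ilim).
Unshelve. all: by end_near. Qed.

Lemma closed_rect_sub a b : rect a b `<=` closed_rect a b.
Proof. by move=> x h j; have /andP[h1 h2] := h j; rewrite !ltW. Qed.

Lemma rect_integral_translate a b (i : 'I_n) (T : R) : 0 <= T ->
  (forall t, 0 <= t <= T ->
    closed_rect (a + t *: delta_mx ord0 i) (b + t *: delta_mx ord0 i) `<=` Omega) ->
  \int[leb]_(x in rect (a + T *: delta_mx ord0 i) (b + T *: delta_mx ord0 i)) e x =
  \int[leb]_(x in rect a b) e x.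
Proof.
move=> T0 inO.
have subT : rect (a + T *: delta_mx ord0 i) (b + T *: delta_mx ord0 i) `<=` Omega.
  by apply: subset_trans (@closed_rect_sub _ _) _; apply: inO; rewrite T0 lexx.
have sub0 : rect a b `<=` Omega.
  have := inO 0; rewrite lexx T0 scale0r !addr0 => /(_ isT).
  by apply: subset_trans; exact: closed_rect_sub.
have hT := cvg_cutoff_integral subT; have h0 := cvg_cutoff_integral sub0.
rewrite (_ : (fun k => _) = (fun k => \int[leb]_(x in Omega) (e x * cutoff k a b x))) in hT.
  exact: (cvg_unique _ hT h0).
by apply/funext => k; exact: (cutoff_integral_translate oO bO ie e0).
Qed.

(** The integrals of e over boxes are invariant under translations, as are their
    volumes; with c the mean of e over the largest box, box_function_zero applies to
    the integrals of e - c. *)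
Lemma constant_in_box p q : (forall i, p ord0 i < q ord0 i) -> closed_rect p q `<=` Omega ->
  exists c : R, {ae leb, forall x, obox p q x -> e x = c}.
Proof.
move=> pq pqO.
have boxO a b : (forall j, p ord0 j <= a ord0 j /\ a ord0 j <= b ord0 j /\ b ord0 j <= q ord0 j) ->
    closed_rect a b `<=` Omega.
  move=> ab x h; apply: pqO => j; have [h1 [_ h2]] := ab j; have /andP[h3 h4] := h j.
  by rewrite (le_trans h1 h3) (le_trans h4 h2).
have oboxO a b : (forall j, p ord0 j <= a ord0 j /\ a ord0 j <= b ord0 j /\ b ord0 j <= q ord0 j) ->
    obox a b `<=` Omega.
  by move=> ab x h; apply: (boxO a b ab) => j; have /andP[h3 h4] := h j; rewrite (ltW h3).
have pqin : forall j, p ord0 j <= p ord0 j /\ p ord0 j <= q ord0 j /\ q ord0 j <= q ord0 j.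
  by move=> j; rewrite !lexx; split => //; split => //; exact: ltW.
pose m := fine (leb (obox p q)).
have boxfin a b : leb (obox a b) \is a fin_num.
  by rewrite ge0_fin_numE//; apply: lebesgue_bounded_lty; exact: bounded_obox.
have [m0|m0] := eqVneq m 0.
  exists 0; exists (obox p q); split; first exact: mbox.
    by rewrite -(fineK (boxfin p q)) -/m m0.
  by move=> x /= /not_implyP[].
pose c := m^-1 * \int[leb]_(x in obox p q) e x; exists c.
pose f x := e x - c.
have icst : leb.-integrable Omega (EFin \o cst c).
  apply: continuous_integrable => //; [exact: open_borel|exact: cst_continuous].
have If : leb.-integrable Omega (EFin \o f).
  by have := integrableB mO ie icst; apply: eq_integrable => // x _; rewrite /f /= EFinB.
have Ibox (g : 'rV[R]_n -> R) a b : leb.-integrable Omega (EFin \o g) ->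
    (forall j, p ord0 j <= a ord0 j /\ a ord0 j <= b ord0 j /\ b ord0 j <= q ord0 j) ->
    leb.-integrable (obox a b) (EFin \o g).
  by move=> Ig ab; apply: (integrableS mO (mbox a b) _ Ig); exact: oboxO.
pose G a b := \int[leb]_(x in obox a b) f x.
have GE a b : (forall j, p ord0 j <= a ord0 j /\ a ord0 j <= b ord0 j /\ b ord0 j <= q ord0 j) ->
    G a b = \int[leb]_(x in obox a b) e x - c * fine (leb (obox a b)).
  move=> ab; rewrite /G /f RintegralB//; [|exact: Ibox|exact: (Ibox (cst c))].
  by congr (_ - _); rewrite -(Rintegral_cst leb (mbox a b) c).
have G0 a b : (forall j, p ord0 j <= a ord0 j /\ a ord0 j <= b ord0 j /\ b ord0 j <= q ord0 j) -> G a b = 0.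
  apply: (@box_function_zero _ _ G p q (\int[leb]_(x in Omega) `|f x|) pq).
  - move=> a' b' ab; apply: le_trans (le_normr_Rintegral (mbox a' b') (Ibox _ _ _ If ab)) _.
    rewrite /Rintegral; apply: fine_le.
    + by apply: integrable_fin_num => //; apply: integrable_norm; exact: Ibox.
    + by apply: integrable_fin_num => //; apply: integrable_norm.
    + apply: (ge0_subset_integral _ (mbox a' b') mO) => //; last exact: oboxO.
      by apply: measurable_int; exact: (integrable_norm If).
  - move=> a' b' i t ab /andP[at1 tb].
    have sub1 : obox a' (set_coord b' i t) `<=` obox a' b'.
      move=> x h j; have := h j; have [->|ji] := eqVneq j i; last by rewrite set_coord_neq.
      by rewrite set_coord_eq => /andP[-> /le_trans ->].
    have sub2 : obox (set_coord a' i t) b' `<=` obox a' b'.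
      move=> x h j; have := h j; have [->|ji] := eqVneq j i; last by rewrite set_coord_neq.
      by rewrite set_coord_eq => /andP[h1 ->]; rewrite andbT; exact: le_lt_trans h1.
    have EU : obox a' b' = obox a' (set_coord b' i t) `|` obox (set_coord a' i t) b'.
      apply/seteqP; split => [x h|x [/sub1|/sub2]//].
      have /andP[h1 h2] := h i.
      have [xt|xt] := leP (x ord0 i) t; [left|right] => j;
        have [->|ji] := eqVneq j i; rewrite ?set_coord_eq ?set_coord_neq//; last first.
      + by rewrite xt h2.
      + by rewrite h1 xt.
    rewrite /G EU Rintegral_setU//; last first.
    + apply/disj_setPS => x [h1 h2]; have := h1 i; have := h2 i; rewrite !set_coord_eq.
      by move=> /andP[h3 _] /andP[_ h4]; move: h3; rewrite ltNge h4.
    + by rewrite -EU; exact: Ibox.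
  - move=> a' b' i t ab t0 tq.
    have shiftE (u : 'rV[R]_n) : set_coord u i (u ord0 i + t) = u + t *: delta_mx ord0 i.
      apply/rowP => j; rewrite !mxE eqxx /=; have [->|ji] := eqVneq j i.
        by rewrite mulr1.
      by rewrite mulr0 addr0.
    rewrite !shiftE.
    have ins t' : 0 <= t' <= t -> forall j, p ord0 j <= (a' + t' *: delta_mx ord0 i) ord0 j /\
       (a' + t' *: delta_mx ord0 i) ord0 j <= (b' + t' *: delta_mx ord0 i) ord0 j /\
       (b' + t' *: delta_mx ord0 i) ord0 j <= q ord0 j.
      move=> /andP[t'0 t't] j; rewrite !mxE eqxx /=; have [h1 [h2 h3]] := ab j.
      by have [->|ji] := eqVneq j i; rewrite ?mulr1 ?mulr0 ?addr0//; have [? [? ?]] := ab i; split; [|split]; lra.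
    have inst := ins t; rewrite t0 lexx in inst; have {}inst := inst isT.
    rewrite GE// GE// -translate_obox; congr (_ - _ * fine _); last exact/esym/lebesgue_translate.
    rewrite translate_obox.
    have r_in (u w : 'rV[R]_n) : rect u w `<=` obox u w by move=> x h j; have /andP[-> /ltW ->] := h j.
    rewrite -(integral_obox_between (mrect a' b') (@subset_refl _ _) (r_in _ _) (Ibox _ _ _ ie ab)).
    rewrite -(integral_obox_between (mrect _ _) (@subset_refl _ _) (r_in _ _) (Ibox _ _ _ ie inst)).
    apply/esym/rect_integral_translate => // t' tt'; apply: boxO; exact: ins.
  - by rewrite GE// /c mulrAC mulVf// mul1r subrr.
pose F : CL -> \bar R := (EFin \o f) \_ (obox p q).
have iF : leb.-integrable setT F by apply/(integrable_mkcond _ (mbox p q)); exact: Ibox.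
have Qoo : (lebesgue_outer (obox p q) < +oo)%E.
  by apply: lebesgue_bounded_lty; exact: bounded_obox.
have rects pq' : (\int[leb]_(x in (rat_rect pq' : set CL)) F x = 0)%E.
  rewrite -integral_mkcondr setIC; set E := _ `&` _.
  have mE : measurable E by apply: measurableI => //; exact: mrect.
  have IE : leb.-integrable E (EFin \o f).
    by apply: (integrableS (mbox p q) mE _ (Ibox _ _ _ If pqin)) => x [].
  rewrite -[LHS]fineK; last exact: (integrable_fin_num mE IE).
  congr EFin; rewrite -[LHS]/(\int[leb]_(x in E) f x).
  pose p' : 'rV[R]_n := map_mx ratr pq'.1; pose q' : 'rV[R]_n := map_mx ratr pq'.2.
  pose a : 'rV[R]_n := \row_j Order.max (p ord0 j) (p' ord0 j).
  pose b : 'rV[R]_n := \row_j Order.min (q ord0 j) (q' ord0 j).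
  have [ab|nab] := pselect (forall j, a ord0 j <= b ord0 j); last first.
    rewrite (_ : E = set0) ?Rintegral_set0//; apply/seteqP; split => // x [h1 h2].
    apply: nab => j; have /andP[u1 u2] := h1 j; have /andP[w1 w2] := h2 j.
    move: w1 w2; rewrite !mxE => w1 w2; apply: (@le_trans _ _ (x ord0 j)).
      by rewrite ge_max (ltW u1) (ltW w1).
    by rewrite le_min u2 (ltW w2).
  have abin : forall j, p ord0 j <= a ord0 j /\ a ord0 j <= b ord0 j /\ b ord0 j <= q ord0 j.
    by move=> j; split; [|split; [exact: ab|]]; rewrite mxE ?le_max ?ge_min lexx.
  rewrite (@integral_obox_between a b E f mE)//; [exact: G0| | |exact: Ibox].
    move=> x h; split => j; have /andP[h1 h2] := h j; move: h1 h2; rewrite !mxE lt_min gt_max.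
      by move=> /andP[-> _] /andP[/ltW-> _].
    by move=> /andP[_ ->] /andP[_ ->].
  move=> x [h1 h2] j; have /andP[u1 u2] := h1 j; have /andP[w1 w2] := h2 j.
  by move: w1 w2; rewrite !mxE gt_max le_min u1 u2 /= => -> /ltW ->.
have h := @ae_zero_of_rects _ _ (@lebesgue_outer R n) leb (fun=> erefl) (@borel_lebesgue R n)
  (@lebesgue_regular R n) (obox p q) F (mbox p q) Qoo iF rects.
apply: filterS h => x h Ex; have := h Ex; rewrite /F patchE mem_set// => -[].
by move/eqP; rewrite subr_eq0 => /eqP.
Qed.

End locally_constant.

Lemma ae_and {R : realType} d (T : measurableType d) (mu : {measure set T -> \bar R})
    (P Q : T -> Prop) : {ae mu, forall x, P x} -> {ae mu, forall x, Q x} ->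
  {ae mu, forall x, P x /\ Q x}.
Proof.
move=> hP hQ; have : {ae mu, forall x (i : nat), if i is 0%N then P x else Q x}.
  by apply: ae_foralln => -[|i].
by apply: filterS => x h; split; [exact: (h 0%N)|exact: (h 1%N)].
Qed.

Section constant.
Context {R : realType} {n : nat}.
Local Notation CL := (caratheodory_type (@lebesgue_outer R n)).
Local Notation leb := (@lebesgue_rV R n).

Lemma open_rect (p q : 'rV[R]_n) : open (rect p q).
Proof.
rewrite openE => y hy; rewrite /interior.
apply: (@filter_forall _ _ (fun j => [set z : 'rV[R]_n | p ord0 j < z ord0 j < q ord0 j]) (nbhs y) _) => j.
have /andP[h1 h2] := hy j; have cj := @continuous_coord R n j y.
have f1 : nbhs y [set z : 'rV[R]_n | p ord0 j < z ord0 j] by exact: (cvgr_gt _ cj _ h1).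
have f2 : nbhs y [set z : 'rV[R]_n | z ord0 j < q ord0 j] by exact: (cvgr_lt _ cj _ h2).
by apply: filterS (filterI f1 f2) => z [/= u1 u2]; apply/andP.
Qed.

(** On a connected open set the locally constant value does not change, since
    overlapping boxes have an intersection of positive measure.  Indeed, if one box
    were null, then every set would be, being covered by translates of that box. *)
Lemma zero_gradient_constant (Omega : set 'rV[R]_n) (e : 'rV[R]_n -> R) :
  open Omega -> connected Omega -> bounded_set Omega ->
  leb.-integrable Omega (EFin \o e) -> weak_gradient_zero Omega e ->
  exists c : R, {ae leb, forall x, Omega x -> e x = c}.
Proof.
move=> oO cO bO ie e0.
have [Onull|Onn] := eqVneq (leb (Omega : set CL)) 0%E.
  exists 0; exists Omega; split; [by apply: borel_lebesgue; exact: open_borel|exact: Onull|].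
  by move=> x /= /not_implyP[].
have boxnn (a b : 'rV[R]_n) : (forall i, a ord0 i < b ord0 i) -> leb (obox a b) <> 0%E.
  move=> ab ab0.
  (* The translates of the box by multiples of its sides cover the space. *)
  have translates (k : {ffun 'I_n -> int}) : leb (translate (\row_j ((b ord0 j - a ord0 j) * (k j)%:~R)) (obox a b)) = 0%E.
    by rewrite -ab0; exact: lebesgue_translate.
  suff Oz : leb (Omega : set CL) = 0%E by rewrite Oz eqxx in Onn.
  apply/eqP; rewrite eq_le measure_ge0 andbT.
  pose F (i : nat) : set 'rV[R]_n := if unpickle i is Some k then
     translate (\row_j ((b ord0 j - a ord0 j) * ((k : {ffun 'I_n -> int}) j)%:~R)) (obox a b) else set0.
  apply: (@le_trans _ _ (\sum_(i <oo) lebesgue_outer (F i))%E).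
    apply: (@le_trans _ _ (lebesgue_outer (\bigcup_i F i))); last exact: outer_measure_sigma_subadditive.
    apply: le_outer_measure => x _.
    pose k : {ffun 'I_n -> int} := [ffun j => Num.ceil ((x ord0 j - a ord0 j) / (b ord0 j - a ord0 j)) - 1].
    exists (pickle k) => //; rewrite /F pickleK => j; rewrite !mxE ffunE.
    have d0 : 0 < b ord0 j - a ord0 j by rewrite subr_gt0.
    set t := _ / _; have xE : x ord0 j = a ord0 j + (b ord0 j - a ord0 j) * t.
      by rewrite /t mulrC divfK ?gt_eqF// addrC subrK.
    have /andP[h1 h2] := ceil_itv t.
    move: h1 h2; rewrite !rmorphB/= => h1 h2; rewrite {1 2}xE; apply/andP; split; nra.
  rewrite eseries0// => i _ _; rewrite /F; case: (unpickle i) => [k|]; last exact: outer_measure0.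
  exact: translates.
(* These sets are open, disjoint for distinct c, and cover Omega. *)
pose near_const (c : R) : set 'rV[R]_n := [set x | exists p q : 'rV[R]_n,
  [/\ forall i, p ord0 i < q ord0 i, rect p q x, closed_rect p q `<=` Omega &
      {ae leb, forall y, obox p q y -> e y = c}]].
have cover x : Omega x -> exists c, near_const c x.
  move=> Ox; have [r r0 hr] := nbhs_rV (open_nbhs_nbhs (conj oO Ox)).
  pose p : 'rV[R]_n := \row_j (x ord0 j - r / 2); pose q : 'rV[R]_n := \row_j (x ord0 j + r / 2).
  have pq i : p ord0 i < q ord0 i by rewrite !mxE; lra.
  have pqO : closed_rect p q `<=` Omega.
    move=> y h; apply: hr => j; have := h j; rewrite !mxE ltr_distl => /andP[h1 h2]; apply/andP; split; lra.
  have [c hc] := constant_in_box oO bO ie e0 pq pqO.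
  by exists c, p, q; split => // j; rewrite !mxE; apply/andP; split; lra.
have onear c : open (near_const c).
  rewrite openE => x [p [q [pq xpq pqO hc]]].
  have := @open_rect p q.
  move=> orect; have := open_nbhs_nbhs (conj orect xpq).
  by apply: filterS => y hy; exists p, q.
have disj c c' x : near_const c x -> near_const c' x -> c = c'.
  move=> [p [q [pq xpq _ hc]]] [p' [q' [pq' xpq' _ hc']]].
  pose a : 'rV[R]_n := \row_j Order.max (p ord0 j) (p' ord0 j).
  pose b : 'rV[R]_n := \row_j Order.min (q ord0 j) (q' ord0 j).
  have ab j : a ord0 j < b ord0 j.
    rewrite !mxE; have /andP[h1 h2] := xpq j; have /andP[h3 h4] := xpq' j.
    by apply: (@lt_trans _ _ (x ord0 j)); rewrite ?gt_max ?lt_min ?h1 ?h2 ?h3 ?h4.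
  apply/eqP/contraT => /eqP ncc'; case: (boxnn a b ab).
  have : {ae leb, forall y, ~ obox a b y}.
    apply: filterS (ae_and hc hc') => y [h1 h2] hy; apply: ncc'.
    rewrite -(h1 _) ?(h2 _)// => j; have := hy j; rewrite !mxE gt_max le_min => /andP[/andP[u1 u2] /andP[u3 u4]].
      by rewrite u2 u4.
    by rewrite u1 u3.
  move=> [N [mN N0 hN]]; apply/eqP; rewrite eq_le measure_ge0 andbT -N0.
  apply: (@le_outer_measure _ _ (@lebesgue_outer R n)) => y hy; apply: hN => /=; exact.
have [x0 Ox0] : Omega !=set0.
  by apply/set0P/eqP => O0; move: Onn; rewrite O0 measure0 eqxx.
have [c hc0] := cover x0 Ox0; exists c.
have BO : Omega `&` near_const c = Omega.
  apply: cO; first by exists x0.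
    by exists (near_const c).
  exists (~` \bigcup_(c' in [set c' | c' <> c]) near_const c').
    by apply: open_closedC; apply: bigcup_open => c' _; exact: onear.
  apply/seteqP; split => [x [Ox hx]|x [Ox hx]]; split => //.
    by move=> [c' /= ncc' hx']; apply: ncc'; exact: disj hx' hx.
  have [c' hx'] := cover x Ox; have [<-//|ncc'] := pselect (c' = c).
  by exfalso; apply: hx; exists c'.
pose P (i : nat) (x : CL) := if unpickle i is Some pq then
  `[< {ae leb, forall y, rat_rect pq y -> e y = c} >] -> rat_rect (pq : 'rV[rat]_n * 'rV[rat]_n) x -> e x = c else True.
have : {ae leb, forall x i, P i x}.
  apply: ae_foralln => i; rewrite /P; case: (unpickle i) => [pq|]; last exact: aeW.
  have [g|ng] := pselect ({ae leb, forall y, rat_rect pq y -> e y = c}); last by apply: aeW => x /asboolP.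
  by apply: filterS (ae_and g g) => x [h _] _.
apply: filterS => x h Ox; have : near_const c x by rewrite -BO in Ox; case: Ox.
move=> [p [q [pq xpq pqO hc]]].
have orect : open (rect p q : set 'rV[R]_n) by exact: open_rect.
have := xpq; rewrite (open_rat_rect orect) => -[r rpq xr].
have := h (pickle r); rewrite /P pickleK; apply => //; apply/asboolP.
apply: filterS (ae_and hc hc) => y [hy _] yr; apply: hy => j.
by have /andP[-> /ltW ->] := rpq y yr j.
Qed.
End constant.

(** * Square-integrable functions and weak derivatives *)

Lemma ae_imp {R : realType} d (T : measurableType d) (mu : {measure set T -> \bar R})
    (P Q : T -> Prop) : {ae mu, forall x, P x} -> (forall x, P x -> Q x) ->
  {ae mu, forall x, Q x}.
Proof. by move=> hP PQ; apply: filterS hP. Qed.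

Section square_integrable.
Context {R : realType} d (T : measurableType d) (mu : {measure set T -> \bar R}) (D : set T).
Hypothesis mD : measurable D.
Implicit Types (f g h : T -> R).

Definition L2 f := measurable_fun D f /\ mu.-integrable D (EFin \o (fun x => f x ^+ 2)).

Lemma L2P f : Lp_on mu D 2 f <-> L2 f.
Proof.
have finE : measurable_fun D f ->
    finite_norm mu 2%:E (f \_ D) = (\int[mu]_(x in D) (f x ^+ 2)%:E < +oo)%E.
  move=> mf; rewrite /finite_norm.
  have E : (\int[mu]_x `|(EFin \o f \_ D) x| `^ 2 = \int[mu]_(x in D) (f x ^+ 2)%:E)%E.
    rewrite [RHS]integral_mkcond; apply: eq_integral => x _; rewrite /= !patchE.
    rewrite powR_mulrn// real_normK ?num_real//; case: ifP => // _.
    by change (((0 : R) ^+ 2)%:E = 0%E); rewrite expr0n.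
  rewrite -E -poweR_Lnorm//; apply/idP/idP; first exact: poweR_lty.
  by apply: lty_poweRy.
split=> -[mf fi]; split => //; last first.
  by rewrite finE//; have /integrableP[_] := fi; under eq_integral do rewrite /= ger0_norm ?sqr_ge0//.
rewrite finE// in fi; apply/integrableP; split.
  by apply/measurable_EFinP; exact: measurable_funX.
by under eq_integral do rewrite /= ger0_norm ?sqr_ge0//.
Qed.

Lemma L2_measurable f : L2 f -> measurable_fun D f. Proof. by case. Qed.

Lemma L2_mul f g : L2 f -> L2 g -> mu.-integrable D (EFin \o (fun x => f x * g x)).
Proof.
move=> [mf jf] [mg jg]; have jfg := integrableD mD jf jg.
apply: (le_integrable mD _ _ jfg); first by apply/measurable_EFinP; exact: measurable_funM.
move=> x _; rewrite /= lee_fin [leRHS]ger0_norm ?addr_ge0 ?sqr_ge0// normrM.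
rewrite -(real_normK (num_real (f x))) -(real_normK (num_real (g x))).
have := sqr_ge0 (`|f x| - `|g x|); have := sqr_ge0 (`|f x| + `|g x|); nra.
Qed.

Lemma L2_comb (c : R) f g : L2 f -> L2 g -> L2 (fun x => c * f x + g x).
Proof.
move=> /[dup] lf [mf jf] /[dup] lg [mg jg]; split.
  by apply: measurable_funD => //; exact: measurable_funM.
have j1 := integrableZl mD (c ^+ 2) jf.
have j2 := integrableZl mD (2 * c) (L2_mul lf lg).
have := integrableD mD (integrableD mD j1 j2) jg; apply: eq_integrable => // x _.
by rewrite /= -!EFinM -!EFinD; congr EFin; ring.
Qed.

Lemma L2_0 : L2 (fun=> 0).
Proof.
split; first exact: measurable_cst.
by rewrite (_ : EFin \o _ = cst 0%E); [exact: integrable0|apply/funext => x; rewrite /= expr0n].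
Qed.

Lemma L2_integrable f : (mu D < +oo)%E -> L2 f -> mu.-integrable D (EFin \o f).
Proof.
move=> Doo [mf jf]; have j1 : mu.-integrable D (EFin \o cst (1 : R)).
  apply: measurable_bounded_integrable => //; exists 1; split => // M M1 x _.
  by rewrite /= normr1 ltW.
apply: (le_integrable mD _ _ (integrableD mD jf j1)); first exact/measurable_EFinP.
move=> x _; rewrite /= lee_fin [leRHS]ger0_norm ?addr_ge0 ?sqr_ge0//.
rewrite -(real_normK (num_real (f x))); have := sqr_ge0 (`|f x| - 1); have := normr_ge0 (f x); nra.
Qed.

Lemma integral_sqr_fin f : L2 f ->
  (\int[mu]_(x in D) (f x ^+ 2)%:E = (\int[mu]_(x in D) (f x ^+ 2))%:E)%E.
Proof. by move=> [_ jf]; rewrite /Rintegral fineK//; exact: (integrable_fin_num mD jf). Qed.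

Lemma sqr_triangle (c : R) f g : measurable_fun D f -> measurable_fun D g ->
  (\int[mu]_(x in D) ((c * f x + g x) ^+ 2)%:E <=
   (2 * c ^+ 2)%:E * \int[mu]_(x in D) (f x ^+ 2)%:E + 2%:E * \int[mu]_(x in D) (g x ^+ 2)%:E)%E.
Proof.
move=> mf mg; have c0 : 0 <= 2 * c ^+ 2 by rewrite mulr_ge0// sqr_ge0.
have mf2 : measurable_fun D (fun x => f x ^+ 2) by exact: measurable_funX.
have mg2 : measurable_fun D (fun x => g x ^+ 2) by exact: measurable_funX.
rewrite (integral_scale _ mD c0 (fun x => sqr_ge0 (f x)) mf2).
rewrite (integral_scale _ mD (ler0n _ 2) (fun x => sqr_ge0 (g x)) mg2).
rewrite -integral_addf//; last 4 first.
- by move=> x; rewrite mulr_ge0// sqr_ge0.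
- exact: measurable_funM.
- by move=> x; rewrite mulr_ge0// sqr_ge0.
- exact: measurable_funM.
apply: le_integral_nonneg => x _; rewrite lee_fin ?sqr_ge0//.
have := sqr_ge0 (c * f x - g x); nra.
Qed.

Lemma L2_cvg_near (v : nat -> T -> R) f : L2_cvg mu D v f ->
  forall eps : R, 0 < eps -> \forall k \near \oo, (\int[mu]_(x in D) ((v k x - f x) ^+ 2)%:E <= eps%:E)%E.
Proof.
move=> /fine_cvgP[fin /cvgrPdist_le cv] eps e0.
apply: filterS2 fin (cv _ e0) => k fk; rewrite sub0r normrN => h.
rewrite -(fineK fk) lee_fin; apply: le_trans h; exact: ler_norm.
Qed.

Lemma L2_cvg_comb (c : R) (v w : nat -> T -> R) f g :
  (forall k, measurable_fun D (v k)) -> (forall k, measurable_fun D (w k)) ->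
  measurable_fun D f -> measurable_fun D g -> L2_cvg mu D v f -> L2_cvg mu D w g ->
  L2_cvg mu D (fun k x => c * v k x + w k x) (fun x => c * f x + g x).
Proof.
move=> mv mw mf mg cv cw.
pose a k := (\int[mu]_(x in D) ((v k x - f x) ^+ 2)%:E)%E.
pose b k := (\int[mu]_(x in D) ((w k x - g x) ^+ 2)%:E)%E.
have ub k : (\int[mu]_(x in D) ((c * v k x + w k x - (c * f x + g x)) ^+ 2)%:E <=
    (2 * c ^+ 2)%:E * a k + 2%:E * b k)%E.
  have := @sqr_triangle c (fun x => v k x - f x) (fun x => w k x - g x)
    (measurable_funB (mv k) mf) (measurable_funB (mw k) mg).
  by apply: le_trans; apply: le_integral_nonneg => x _; rewrite lee_fin ?sqr_ge0//;
    rewrite le_eqVlt; apply/orP; left; apply/eqP; ring.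
have lim : ((2 * c ^+ 2)%:E * a k + 2%:E * b k)%E @[k --> \oo] --> 0%E.
  rewrite -(adde0 0%E); apply: cvgeD => //.
    by rewrite -[X in _ --> X](mule0 (2 * c ^+ 2)%:E); apply: cvgeZl.
  by rewrite -[X in _ --> X](mule0 2%:E); apply: cvgeZl.
apply: (squeeze_cvge _ (cvg_cst 0%E) lim); apply: nearW => k.
by rewrite ub andbT; exact: integral_sqr_ge0.
Qed.

Lemma ae_eq_L2 f g : mu.-negligible `<=` measurable ->
  {ae mu, forall x, D x -> f x = g x} -> L2 f -> L2 g.
Proof.
move=> cmp fg [mf jf].
have fgE : ae_eq mu D (EFin \o f) (EFin \o g) by apply: filterS fg => x h Dx; rewrite /= h.
have mg : measurable_fun D g.
  apply/measurable_EFinP; apply: (ae_measurable_fun cmp fgE); exact/measurable_EFinP.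
split => //; apply/integrableP; split; first by apply/measurable_EFinP; exact: measurable_funX.
have /integrableP[_] := jf; rewrite (@ae_eq_integral _ _ _ mu D (fun x => `|(EFin \o (fun x => f x ^+ 2)%R) x|%E)
   (fun x => `|(EFin \o (fun x => g x ^+ 2)%R) x|%E))//.
- by apply: measurableT_comp => //; apply/measurable_EFinP; exact: measurable_funX.
- by apply: measurableT_comp => //; apply/measurable_EFinP; exact: measurable_funX.
by apply: filterS fg => x h Dx; rewrite /= h.
Qed.

Lemma ae_eq_Rintegral f g : mu.-negligible `<=` measurable ->
  {ae mu, forall x, D x -> f x = g x} -> measurable_fun D f ->
  \int[mu]_(x in D) f x = \int[mu]_(x in D) g x.
Proof.
move=> cmp fg mf.
have fgE : ae_eq mu D (EFin \o f) (EFin \o g) by apply: filterS fg => x h Dx; rewrite /= h.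
have mfE : measurable_fun D (EFin \o f) by exact/measurable_EFinP.
rewrite /Rintegral; congr fine; apply: (ae_eq_integral (EFin \o g) (EFin \o f) mD mfE _ fgE).
exact: (ae_measurable_fun cmp fgE).
Qed.

Lemma integral_sqr_eq0 f : measurable_fun D f ->
  (\int[mu]_(x in D) (f x ^+ 2)%:E = 0)%E -> {ae mu, forall x, D x -> f x = 0}.
Proof.
move=> mf f0; have mf2 : measurable_fun D (EFin \o (fun x => f x ^+ 2)).
  by apply/measurable_EFinP; exact: measurable_funX.
have := (ae_eq_integral_abs mu mD mf2).1.
under eq_integral do rewrite /= ger0_norm ?sqr_ge0//.
move=> /(_ f0); apply: filterS => x h Dx; have := h Dx => /= -[] /eqP.
by rewrite sqrf_eq0 => /eqP.
Qed.

Lemma L2_cvg_congr (v : nat -> T -> R) f g : (forall k, measurable_fun D (v k)) ->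
  measurable_fun D f -> measurable_fun D g -> {ae mu, forall x, D x -> f x = g x} ->
  L2_cvg mu D v f -> L2_cvg mu D v g.
Proof.
move=> mv mf mg fg; rewrite /L2_cvg; set S1 := (fun k : nat => _).
set S2 := (X in _ -> X @ _ --> _); suff -> : S2 = S1 by [].
have mE h k : measurable_fun D h -> measurable_fun D (fun x => ((v k x - h x) ^+ 2)%:E).
  by move=> mh; apply/measurable_EFinP; apply: measurable_funX; exact: measurable_funB.
apply/funext => k; rewrite /S1 /S2; apply: (ae_eq_integral _ _ mD (mE _ k mg) (mE _ k mf) _).
by apply: (ae_imp fg) => x e Dx; rewrite e.
Qed.

Lemma L2_cvg_cst f : L2_cvg mu D (fun=> f) f.
Proof.
rewrite /L2_cvg; have -> : (fun k : nat => (\int[mu]_(x in D) ((f x - f x) ^+ 2)%:E)%E) = cst 0%E.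
  by apply/funext => k; apply: integral0_eq => x _; rewrite subrr expr0n.
exact: cvg_cst.
Qed.

End square_integrable.

Lemma caratheodory_complete {R : realType} (T : pointedType) (nu : {outer_measure set T -> \bar R})
   (m : {measure set (caratheodory_type nu) -> \bar R}) : (forall A, m A = nu A) ->
  m.-negligible `<=` measurable.
Proof.
move=> mE A [N [mN N0 AN]]; apply: le_caratheodory_measurable => X.
rewrite (_ : nu (X `&` A) = 0)%E ?add0e; first by apply: le_outer_measure => x [].
apply/eqP; rewrite eq_le outer_measure_ge0 andbT -N0 mE.
by apply: le_outer_measure => x [_ /AN].
Qed.

Section sobolev_algebra.
Context {R : realType} {n : nat}.
Local Notation CL := (caratheodory_type (@lebesgue_outer R n)).
Local Notation leb := (@lebesgue_rV R n).
Variable Omega : set 'rV[R]_n.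
Hypotheses (oO : open Omega) (bO : bounded_set Omega).
Implicit Types (u v w g h phi : 'rV[R]_n -> R).

Lemma lebesgue_complete : leb.-negligible `<=` measurable.
Proof. exact: (@caratheodory_complete R _ (@lebesgue_outer R n) leb (fun=> erefl)). Qed.

Let mO : measurable (Omega : set CL).
Proof. by apply: borel_lebesgue; exact: open_borel. Qed.

Let Ooo : (leb (Omega : set CL) < +oo)%E. Proof. exact: lebesgue_bounded_lty. Qed.

Lemma test_continuous phi : test_function Omega phi -> continuous phi.
Proof. by move=> [/(_ 0%N)[]]. Qed.

Lemma test_partial_continuous phi i : test_function Omega phi -> continuous (partial i phi).
Proof. by move=> [/(_ 1%N)[_ /(_ i)[_ []]]]. Qed.

Lemma integrable_mul_test u phi : L2 leb Omega u -> continuous phi ->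
  leb.-integrable Omega (EFin \o (fun x => u x * phi x)).
Proof.
by move=> lu cphi; apply: integrable_mul_continuous => //; exact: L2_integrable.
Qed.

Lemma weak_partial_unique i u g h : weak_partial Omega i u g -> weak_partial Omega i u h ->
  {ae leb, forall x, Omega x -> g x = h x}.
Proof.
move=> [/(L2P leb Omega _) lg eg] [/(L2P leb Omega _) lh eh].
have lgh : L2 leb Omega (fun x => (-1) * h x + g x) by exact: L2_comb.
have : {ae leb, forall x, Omega x -> Omega x -> (-1) * h x + g x = 0}.
  apply: (@ae_zero_of_cutoffs _ _ (@lebesgue_outer R n) leb (fun=> erefl) (@borel_lebesgue R n)
    (@lebesgue_regular R n) Omega Omega _ mO Ooo oO); first exact: L2_integrable.
  move=> k pq pqO; have tphi := test_cutoff k pqO; set phi := cutoff _ _ _ in tphi *.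
  have cphi := test_continuous tphi.
  transitivity (\int[leb]_(x in Omega) (g x * phi x - h x * phi x)).
    by apply: eq_Rintegral => x _; ring.
  rewrite RintegralB//; [|exact: integrable_mul_test|exact: integrable_mul_test].
  by apply/eqP; rewrite subr_eq0; apply/eqP/oppr_inj; rewrite -eg// eh.
by move=> /ae_imp; apply => x e Ox; have := e Ox Ox; lra.
Qed.

Lemma weak_partial_comb (c : R) i u v g h : L2 leb Omega u -> L2 leb Omega v ->
  weak_partial Omega i u g -> weak_partial Omega i v h ->
  weak_partial Omega i (fun x => c * u x + v x) (fun x => c * g x + h x).
Proof.
move=> lu lv [/(L2P leb Omega _) lg eg] [/(L2P leb Omega _) lh eh]; split.
  by apply/(L2P leb Omega _); exact: L2_comb.
move=> phi tphi; have cphi := test_continuous tphi; have cp := @test_partial_continuous phi i tphi.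
have iu := integrable_mul_test lu cp; have iv := integrable_mul_test lv cp.
have ig := integrable_mul_test lg cphi; have ih := integrable_mul_test lh cphi.
have scale f psi : leb.-integrable Omega (EFin \o (fun x => f x * psi x)) ->
    leb.-integrable Omega (EFin \o (fun x => c * (f x * psi x))).
  by move=> j; have := integrableZl mO c j; apply: eq_integrable => // x _; rewrite /= EFinM.
transitivity (\int[leb]_(x in Omega) (c * (u x * partial i phi x) + v x * partial i phi x)).
  by apply: eq_Rintegral => x _; ring.
rewrite (RintegralD mO (scale _ _ iu) iv) (RintegralZl _ mO iu) eg// eh//.
transitivity (- \int[leb]_(x in Omega) (c * (g x * phi x) + h x * phi x)); last first.
  by congr (- _); apply: eq_Rintegral => x _; ring.
by rewrite (RintegralD mO (scale _ _ ig) ih) (RintegralZl _ mO ig); ring.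
Qed.

Lemma H1_L2 u : H1 Omega u -> L2 leb Omega u. Proof. by move=> [/(L2P leb Omega _)]. Qed.

Lemma wpartialP i u : H1 Omega u -> weak_partial Omega i u (wpartial Omega i u).
Proof. by move=> [_ /(_ i) hg]; exact: xgetPex. Qed.

Lemma wpartial_L2 i u : H1 Omega u -> L2 leb Omega (wpartial Omega i u).
Proof. by move=> /(wpartialP i)[/(L2P leb Omega _)]. Qed.

Lemma H1_comb (c : R) u v : H1 Omega u -> H1 Omega v -> H1 Omega (fun x => c * u x + v x).
Proof.
move=> hu hv; split; first by apply/(L2P leb Omega _); apply: L2_comb => //; exact: H1_L2.
move=> i; exists (fun x => c * wpartial Omega i u x + wpartial Omega i v x).
by apply: weak_partial_comb; [exact: H1_L2|exact: H1_L2|exact: wpartialP|exact: wpartialP].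
Qed.

Lemma wpartial_comb (c : R) i u v : H1 Omega u -> H1 Omega v ->
  {ae leb, forall x, Omega x -> wpartial Omega i (fun x => c * u x + v x) x =
    c * wpartial Omega i u x + wpartial Omega i v x}.
Proof.
move=> hu hv; apply: weak_partial_unique; first exact/wpartialP/H1_comb.
by apply: weak_partial_comb; [exact: H1_L2|exact: H1_L2|exact: wpartialP|exact: wpartialP].
Qed.

Lemma weak_partial_null i u : {ae leb, forall x, Omega x -> u x = 0} ->
  weak_partial Omega i u (fun=> 0).
Proof.
move=> u0; split; first by apply/(L2P leb Omega _); exact: L2_0.
move=> phi tphi; transitivity (\int[leb]_(x in Omega) (0 : R)).
  apply/esym; apply: (ae_eq_Rintegral mO lebesgue_complete) => //.
  by apply: (ae_imp u0) => x h Ox; rewrite h// mul0r.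
rewrite (_ : \int[leb]_(x in Omega) (0 * phi x) = \int[leb]_(x in Omega) (0 : R)).
  by rewrite Rintegral_cst// mul0r oppr0.
by apply: eq_Rintegral => x _; rewrite mul0r.
Qed.

Lemma H1_null u : {ae leb, forall x, Omega x -> u x = 0} -> H1 Omega u.
Proof.
move=> u0; split; last by move=> i; exists (fun=> 0); exact: weak_partial_null.
apply/(L2P leb Omega _); apply: (ae_eq_L2 mO lebesgue_complete _ (L2_0 leb Omega)).
by apply: (ae_imp u0) => x h Ox; rewrite h.
Qed.

Lemma wpartial_null i u : {ae leb, forall x, Omega x -> u x = 0} ->
  {ae leb, forall x, Omega x -> wpartial Omega i u x = 0}.
Proof.
move=> u0; exact: (weak_partial_unique (wpartialP i (H1_null u0)) (weak_partial_null i u0)).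
Qed.

Lemma integrable_sum_fun (I : Type) (s : seq I) (f : I -> 'rV[R]_n -> R) :
  (forall i, leb.-integrable Omega (EFin \o f i)) ->
  leb.-integrable Omega (EFin \o (fun x => \sum_(i <- s) f i x)) /\
  \int[leb]_(x in Omega) (\sum_(i <- s) f i x) = \sum_(i <- s) \int[leb]_(x in Omega) f i x.
Proof.
move=> jf; elim: s => [|i s [IH1 IH2]].
  rewrite big_nil; split.
    by rewrite (_ : EFin \o _ = cst 0%E); [exact: integrable0|apply/funext => x; rewrite /= big_nil].
  transitivity (\int[leb]_(x in Omega) (0 : R)); last by rewrite Rintegral_cst// mul0r.
  by apply: eq_Rintegral => x _; rewrite big_nil.
split.
  have := integrableD mO (jf i) IH1; apply: eq_integrable => // x _.
  by rewrite /= big_cons EFinD.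
rewrite big_cons -IH2 -(RintegralD mO (jf i) IH1).
by apply: eq_Rintegral => x _; rewrite big_cons.
Qed.

Lemma dirichletE u v : H1 Omega u -> H1 Omega v -> dirichlet_form Omega u v =
  \sum_(i < n) \int[leb]_(x in Omega) (wpartial Omega i u x * wpartial Omega i v x).
Proof.
move=> hu hv; apply: (integrable_sum_fun _ _).2 => i.
by apply: L2_mul => //; exact: wpartial_L2.
Qed.

Lemma dirichletC u v : dirichlet_form Omega u v = dirichlet_form Omega v u.
Proof.
by apply: eq_Rintegral => x _; apply: eq_bigr => i _; rewrite mulrC.
Qed.

Lemma dirichlet_comb (c : R) u v w : H1 Omega u -> H1 Omega v -> H1 Omega w ->
  dirichlet_form Omega (fun x => c * u x + v x) w =
  c * dirichlet_form Omega u w + dirichlet_form Omega v w.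
Proof.
move=> hu hv hw; rewrite (dirichletE (H1_comb c hu hv) hw) (dirichletE hu hw) (dirichletE hv hw).
rewrite mulr_sumr -big_split/=; apply: eq_bigr => i _.
have lu := wpartial_L2 i hu; have lv := wpartial_L2 i hv; have lw := wpartial_L2 i hw.
have iu := L2_mul mO lu lw; have iv := L2_mul mO lv lw.
have icu : leb.-integrable Omega (EFin \o (fun x => c * (wpartial Omega i u x * wpartial Omega i w x))).
  by have := integrableZl mO c iu; apply: eq_integrable => // x _; rewrite /= EFinM.
rewrite -(RintegralZl _ mO iu) -(RintegralD mO icu iv).
apply: (ae_eq_Rintegral mO lebesgue_complete).
  apply: (ae_imp (wpartial_comb c i hu hv)) => x h Ox; rewrite h//; ring.
apply: measurable_funM; last exact: L2_measurable lw.
exact: L2_measurable (wpartial_L2 i (H1_comb c hu hv)).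
Qed.

Lemma dirichlet_ge0 u : 0 <= dirichlet_form Omega u u.
Proof. by apply: Rintegral_ge0 => x _; apply: sumr_ge0 => i _; rewrite -expr2 sqr_ge0. Qed.

Lemma dirichlet_eq0 u i : H1 Omega u -> dirichlet_form Omega u u = 0 ->
  {ae leb, forall x, Omega x -> wpartial Omega i u x = 0}.
Proof.
move=> hu D0; have lw := wpartial_L2 i hu.
have sqrE j : \int[leb]_(x in Omega) (wpartial Omega j u x * wpartial Omega j u x) =
    \int[leb]_(x in Omega) (wpartial Omega j u x ^+ 2).
  by apply: eq_Rintegral => x _; rewrite expr2.
have pos j : 0 <= \int[leb]_(x in Omega) (wpartial Omega j u x * wpartial Omega j u x).
  by rewrite sqrE; apply: Rintegral_ge0 => x _; exact: sqr_ge0.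
apply: (integral_sqr_eq0 mO (L2_measurable lw)); rewrite (integral_sqr_fin mO lw) -sqrE.
have := dirichletE hu hu; rewrite D0 => /esym/(psumr_eq0P (fun j _ => pos j)) h.
by rewrite h.
Qed.

Lemma dirichlet_eq0_constant u : connected Omega -> H1 Omega u -> dirichlet_form Omega u u = 0 ->
  exists c : R, {ae leb, forall x, Omega x -> u x = c}.
Proof.
move=> cO hu D0; apply: zero_gradient_constant => //.
  by apply: L2_integrable => //; exact: H1_L2.
move=> i phi tphi; have [_ ->//] := wpartialP i hu.
apply/eqP; rewrite oppr_eq0; apply/eqP.
transitivity (\int[leb]_(x in Omega) (0 : R)); last by rewrite Rintegral_cst// mul0r.
apply: (ae_eq_Rintegral mO lebesgue_complete).
  by apply: (ae_imp (dirichlet_eq0 i hu D0)) => x h Ox; rewrite h// mul0r.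
apply: measurable_funM; first exact: L2_measurable (wpartial_L2 i hu).
by apply: measurable_funTS; apply: borel_fun_lebesgue; apply: continuous_borel; exact: test_continuous.
Qed.

End sobolev_algebra.

(** * The trace operator *)

Section trace_operator.
Context {R : realType} {n : nat}.
Local Notation CL := (caratheodory_type (@lebesgue_outer R n)).
Local Notation CH := (caratheodory_type (@hausdorff_outer R n n.-1)).
Local Notation leb := (@lebesgue_rV R n).
Local Notation surf := (@surface_measure R n).
Variable Omega : set 'rV[R]_n.
Hypotheses (oO : open Omega) (bO : bounded_set Omega) (C11O : C11_boundary Omega).
Implicit Types (u v w g h phi : 'rV[R]_n -> R).
Local Notation Gamma := (boundary Omega).

Lemma surface_complete : surf.-negligible `<=` measurable.
Proof. exact: (@caratheodory_complete R _ (@hausdorff_outer R n n.-1) surf (fun=> erefl)). Qed.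

Let mO : measurable (Omega : set CL).
Proof. by apply: borel_lebesgue; exact: open_borel. Qed.

Let mG : measurable (Gamma : set CH).
Proof. by apply: borel_hausdorff; apply: closed_borel; exact: closed_boundary. Qed.

Lemma surface_lty : (surf (Gamma : set CH) < +oo)%E.
Proof. by have [] := trace_compact_boundary oO bO C11O. Qed.

Lemma is_derive_comb (c : R) i v w x : Ck 1 v -> Ck 1 w ->
  is_derive x (delta_mx ord0 i) (fun x => c * v x + w x) (c * partial i v x + partial i w x).
Proof.
move=> Cv Cw; have dv := @Ck1_derivable _ _ v i x Cv; have dw := @Ck1_derivable _ _ w i x Cw.
exact: (is_deriveD (is_deriveZ c (DeriveDef dv erefl)) (DeriveDef dw erefl)).
Qed.

Lemma partial_comb (c : R) i v w : Ck 1 v -> Ck 1 w ->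
  partial i (fun x => c * v x + w x) = (fun x => c * partial i v x + partial i w x).
Proof.
by move=> Cv Cw; apply/funext => x; have [_ h] := is_derive_comb c i x Cv Cw; exact: h.
Qed.

Lemma Ck1_comb (c : R) v w : Ck 1 v -> Ck 1 w -> Ck 1 (fun x => c * v x + w x).
Proof.
move=> Cv Cw; split.
  by apply: continuous_addf; [apply: continuous_scalef|]; exact: Ck1_continuous.
move=> i; split; first by move=> x; have [h _] := is_derive_comb c i x Cv Cw; exact: h.
rewrite partial_comb//; split => //.
have cv : continuous (partial i v) by exact: Ck1_partial.
have cw : continuous (partial i w) by exact: Ck1_partial.
by apply: continuous_addf => //; exact: continuous_scalef.
Qed.

Let mcont v : continuous v -> measurable_fun (Omega : set CL) v.
Proof. by move=> cv; apply: measurable_funTS; apply: borel_fun_lebesgue; exact: continuous_borel. Qed.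

Let mcontG v : continuous v -> measurable_fun (Gamma : set CH) v.
Proof. by move=> cv; apply: measurable_funTS; apply: borel_fun_hausdorff; exact: continuous_borel. Qed.

Let mpart v i : Ck 1 v -> measurable_fun (Omega : set CL) (partial i v).
Proof. by move=> Cv; apply: mcont; exact: Ck1_partial. Qed.

Lemma is_trace_L2 u g : is_trace Omega u g -> L2 surf Gamma g.
Proof. by move=> [/(L2P surf Gamma _)]. Qed.

Lemma is_trace_comb (c : R) u v g h : H1 Omega u -> H1 Omega v ->
  is_trace Omega u g -> is_trace Omega v h ->
  is_trace Omega (fun x => c * u x + v x) (fun x => c * g x + h x).
Proof.
move=> hu hv tu tv; have lg := is_trace_L2 tu; have lh := is_trace_L2 tv.
have [_ [v_ [Cv v1 v2 v3]]] := tu; have [_ [w_ [Cw w1 w2 w3]]] := tv.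
split; first by apply/(L2P surf Gamma _); exact: L2_comb.
have mv k := mcont (Ck1_continuous (Cv k)); have mw k := mcont (Ck1_continuous (Cw k)).
exists (fun k x => c * v_ k x + w_ k x); split.
- by move=> k; exact: Ck1_comb.
- apply: L2_cvg_comb => //; [exact: (L2_measurable (H1_L2 hu))|exact: (L2_measurable (H1_L2 hv))].
- move=> i; have lu := wpartial_L2 i hu; have lv := wpartial_L2 i hv.
  have mpc k : measurable_fun (Omega : set CL) (partial i (fun x => c * v_ k x + w_ k x)).
    by apply: mpart; exact: Ck1_comb.
  have H := L2_cvg_comb mO c (fun k => mpart i (Cv k)) (fun k => mpart i (Cw k))
    (L2_measurable lu) (L2_measurable lv) (v2 i) (w2 i).
  have E : (fun k => partial i (fun x => c * v_ k x + w_ k x)) =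
      (fun k x => c * partial i (v_ k) x + partial i (w_ k) x).
    by apply/funext => k; rewrite partial_comb.
  rewrite -E in H; apply: (L2_cvg_congr mO mpc _ _ _ H).
  + exact: L2_measurable (L2_comb mO c lu lv).
  + exact: L2_measurable (wpartial_L2 i (H1_comb oO bO c hu hv)).
  + by apply: (ae_imp (wpartial_comb oO bO c i hu hv)) => x e Ox; rewrite e.
- apply: L2_cvg_comb => //.
  + by move=> k; exact: mcontG (Ck1_continuous (Cv k)).
  + by move=> k; exact: mcontG (Ck1_continuous (Cw k)).
  + exact: L2_measurable lg.
  + exact: L2_measurable lh.
Qed.

Lemma trace_approximation u g (eps : R) : is_trace Omega u g -> 0 < eps ->
  exists v, [/\ Ck 1 v, (\int[leb]_(x in Omega) ((v x - u x) ^+ 2)%:E <= eps%:E)%E,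
    forall i, (\int[leb]_(x in Omega) ((partial i v x - wpartial Omega i u x) ^+ 2)%:E <= eps%:E)%E &
    (\int[surf]_(x in Gamma) ((v x - g x) ^+ 2)%:E <= eps%:E)%E].
Proof.
move=> [_ [v [Cv v1 v2 v3]]] e0.
have n1 := L2_cvg_near v1 e0; have n3 := L2_cvg_near v3 e0.
have n2 : \forall k \near \oo, forall i,
    (\int[leb]_(x in Omega) ((partial i (v k) x - wpartial Omega i u x) ^+ 2)%:E <= eps%:E)%E.
  by apply: filter_forall => i; exact: L2_cvg_near (v2 i) _ e0.
near \oo => k; exists (v k); split => //.
- by near: k.
- by near: k.
- by near: k.
Unshelve. all: by end_near. Qed.

(** The Cauchy-Schwarz inequality against the constant 1, from the square of
    m u - I with m the measure of the box and I the integral of u. *)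
Lemma sqr_Rintegral_le (a b : 'rV[R]_n) u : obox a b `<=` Omega -> L2 leb Omega u ->
  (((\int[leb]_(x in obox a b) u x) ^+ 2)%:E <=
   leb (obox a b) * \int[leb]_(x in Omega) (u x ^+ 2)%:E)%E.
Proof.
move=> QO lu; set Q := obox a b.
have mQ : measurable (Q : set CL) by apply: borel_lebesgue; exact: measurable_obox.
have Qoo : (leb (Q : set CL) < +oo)%E by apply: lebesgue_bounded_lty; exact: bounded_obox.
have luQ : L2 leb Q u.
  have [mu ju] := lu; split; first exact: (measurable_funS mO QO mu).
  exact: (integrableS mO mQ QO ju).
have Qfin : leb (Q : set CL) = (fine (leb (Q : set CL)))%:E by rewrite fineK// ge0_fin_numE.
set m := fine _ in Qfin; have m0 : 0 <= m by rewrite fine_ge0.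
have le1 : (\int[leb]_(x in Q) (u x ^+ 2)%:E <= \int[leb]_(x in Omega) (u x ^+ 2)%:E)%E.
  apply: (ge0_subset_integral _ mQ mO) => //.
    by apply/measurable_EFinP; apply: measurable_funX; exact: L2_measurable lu.
  by move=> x _; rewrite lee_fin sqr_ge0.
apply: (@le_trans _ _ (leb (Q : set CL) * \int[leb]_(x in Q) (u x ^+ 2)%:E)%E); last first.
  by apply: lee_wpmul2l => //; exact: measure_ge0.
rewrite Qfin (integral_sqr_fin mQ luQ) -EFinM lee_fin.
set I := \int[leb]_(x in Q) u x; set J := \int[leb]_(x in Q) (u x ^+ 2).
have iu := L2_integrable mQ Qoo luQ; have [_ iu2] := luQ.
have [mz|mnz] := eqVneq m 0.
  rewrite /I /Rintegral (_ : (\int[leb]_(x in Q) (u x)%:E)%E = 0%E); first by rewrite /= expr0n mz mul0r.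
  have h := null_set_integral; apply: h => //; last by rewrite Qfin mz.
  by apply/measurable_EFinP; exact: L2_measurable luQ.
have mp : 0 < m by rewrite lt_neqAle eq_sym mnz.
have exp : 0 <= \int[leb]_(x in Q) ((m * u x - I) ^+ 2) by apply: Rintegral_ge0 => x _; exact: sqr_ge0.
have E : \int[leb]_(x in Q) ((m * u x - I) ^+ 2) = m ^+ 2 * J - m * I ^+ 2.
  have i1 : leb.-integrable Q (EFin \o (fun x => m ^+ 2 * u x ^+ 2)).
    by have := integrableZl mQ (m ^+ 2) iu2; apply: eq_integrable => // x _; rewrite /= EFinM.
  have i2 : leb.-integrable Q (EFin \o (fun x => (- 2 * m * I) * u x)).
    by have := integrableZl mQ (- 2 * m * I) iu; apply: eq_integrable => // x _; rewrite /= EFinM.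
  have i3 : leb.-integrable Q (EFin \o cst (I ^+ 2)).
    by apply: continuous_integrable; [exact: measurable_obox|exact: bounded_obox|exact: cst_continuous].
  have i12 : leb.-integrable Q (EFin \o (fun x => m ^+ 2 * u x ^+ 2 + (- 2 * m * I) * u x)).
    by have := integrableD mQ i1 i2; apply: eq_integrable => // x _; rewrite /= EFinD.
  transitivity (\int[leb]_(x in Q) ((m ^+ 2 * u x ^+ 2 + (- 2 * m * I) * u x) + I ^+ 2)).
    by apply: eq_Rintegral => x _; ring.
  rewrite (RintegralD mQ i12 i3) (RintegralD mQ i1 i2) (RintegralZl _ mQ iu2) (RintegralZl _ mQ iu).
  transitivity (m ^+ 2 * J + (- 2 * m * I) * I + I ^+ 2 * m); last by ring.
  by congr (_ + _); exact: (Rintegral_cst leb mQ).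
rewrite E in exp; rewrite -(ler_pM2l mp); nra.
Qed.

Lemma continuous_L2 v : continuous v -> L2 leb Omega v.
Proof.
move=> cv; split; first exact: mcont.
by apply: continuous_integrable => //; [exact: open_borel|exact: continuous_sqr].
Qed.

Lemma continuous_boundary_L2 v : continuous v -> L2 surf Gamma v.
Proof.
move=> cv; split; first exact: mcontG.
have [M hM] := continuous_bounded_on (compact_bounded (compact_boundary bO)) (continuous_sqr cv).
have m2 : measurable_fun (Gamma : set CH) (fun x => v x ^+ 2) by apply: measurable_funX; exact: mcontG.
apply: (measurable_bounded_integrable mG surface_lty m2); exists M; split; first exact: num_real.
by move=> N MN x Dx; apply: le_trans (hM x Dx) _; exact: ltW.
Qed.

Lemma integral_grad2 v : Ck 1 v -> (\int[leb]_(x in Omega) (grad2 v x)%:E =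
  \sum_(i < n) \int[leb]_(x in Omega) (partial i v x ^+ 2)%:E)%E.
Proof.
move=> Cv; rewrite /grad2; under eq_integral do rewrite -sumEFin.
apply: (ge0_integral_sum _ mO) => [i|i x _]; last by rewrite lee_fin sqr_ge0.
by apply/measurable_EFinP; apply: measurable_funX; exact: mpart.
Qed.

(** The inequality of trace_compact_boundary passes to the limit along the smooth
    functions that define the trace; the factor 4 pays for replacing a square by
    twice two squares on both sides. *)
Lemma trace_inequality (delta : R) : 0 < delta ->
  exists (s : seq ('rV[R]_n * 'rV[R]_n)) (M : R), [/\ 0 <= M,
    forall c, c \in s -> obox c.1 c.2 `<=` Omega &
    forall u g, H1 Omega u -> is_trace Omega u g ->
      \int[surf]_(x in Gamma) (g x ^+ 2) <= delta * dirichlet_form Omega u u +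
        M * \sum_(c <- s) (\int[leb]_(x in obox c.1 c.2) u x) ^+ 2].
Proof.
move=> d0; have [_ _ comp] := trace_compact_boundary oO bO C11O.
have d4 : 0 < delta / 4 by rewrite divr_gt0.
have [s [M [M0 sO hs]]] := comp _ d4.
exists s, (4 * M); split => //; first by rewrite mulr_ge0.
move=> u g hu tu; have lg := is_trace_L2 tu; have lu := H1_L2 hu.
pose m (c : 'rV[R]_n * 'rV[R]_n) := fine (leb (obox c.1 c.2)).
have m0 c : 0 <= m c by rewrite fine_ge0.
(* An approximation error h in each square integral costs at most K h in total. *)
pose K := 2 + delta * n%:R + 4 * M * \sum_(c <- s) m c.
have sm0 : 0 <= \sum_(c <- s) m c by apply: sumr_ge0.
have a1 : 0 <= delta * n%:R by rewrite mulr_ge0// ltW.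
have a2 : 0 <= 4 * M * \sum_(c <- s) m c by rewrite mulr_ge0// mulr_ge0.
have K0 : 0 < K by rewrite /K; lra.
apply/ler_addgt0Pr => eps e0; have h0 : 0 < eps / K by rewrite divr_gt0.
have [v [Cv v1 v2 v3]] := trace_approximation tu h0.
have cv := Ck1_continuous Cv; have lv := continuous_L2 cv; have lvG := continuous_boundary_L2 cv.
have lvu : L2 leb Omega (fun x => v x - u x).
  by have := L2_comb mO (-1) lu lv; congr (L2 leb Omega _); apply/funext => x; ring.
have lvg : L2 surf Gamma (fun x => v x - g x).
  by have := L2_comb mG (-1) lg lvG; congr (L2 surf Gamma _); apply/funext => x; ring.
have A : \int[surf]_(x in Gamma) (g x ^+ 2) <= 2 * (eps / K) + 2 * \int[surf]_(x in Gamma) (v x ^+ 2).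
  have := sqr_triangle surf mG (-1) (L2_measurable lvg) (L2_measurable lvG).
  rewrite (_ : (fun x => ((-1 * (v x - g x) + v x) ^+ 2)%:E) = (fun x => (g x ^+ 2)%:E)); last first.
    by apply/funext => x; congr EFin; ring.
  move: v3; rewrite (integral_sqr_fin mG lvg) (integral_sqr_fin mG lg) (integral_sqr_fin mG lvG).
  rewrite -!EFinM -!EFinD !lee_fin; nra.
have P i : \int[leb]_(x in Omega) (partial i v x ^+ 2) <=
    2 * (eps / K) + 2 * \int[leb]_(x in Omega) (wpartial Omega i u x ^+ 2).
  have lw := wpartial_L2 i hu; have cp : continuous (partial i v) by exact: Ck1_partial.
  have lp := continuous_L2 cp.
  have lpw : L2 leb Omega (fun x => partial i v x - wpartial Omega i u x).
    by have := L2_comb mO (-1) lw lp; congr (L2 leb Omega _); apply/funext => x; ring.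
  have := sqr_triangle leb mO 1 (L2_measurable lpw) (L2_measurable lw).
  rewrite (_ : (fun x => ((1 * (partial i v x - wpartial Omega i u x) + wpartial Omega i u x) ^+ 2)%:E) =
     (fun x => (partial i v x ^+ 2)%:E)); last by apply/funext => x; congr EFin; ring.
  move: (v2 i); rewrite (integral_sqr_fin mO lpw) (integral_sqr_fin mO lp) (integral_sqr_fin mO lw).
  rewrite -!EFinM -!EFinD !lee_fin; nra.
have C c : c \in s -> (\int[leb]_(x in obox c.1 c.2) v x) ^+ 2 <=
    2 * (m c * (eps / K)) + 2 * (\int[leb]_(x in obox c.1 c.2) u x) ^+ 2.
  move=> cs; have cO := sO c cs.
  have mQ : measurable (obox c.1 c.2 : set CL) by apply: borel_lebesgue; exact: measurable_obox.
  have Qoo : (leb (obox c.1 c.2 : set CL) < +oo)%E by apply: lebesgue_bounded_lty; exact: bounded_obox.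
  have Ooo : (leb (Omega : set CL) < +oo)%E by exact: lebesgue_bounded_lty.
  have restr f : L2 leb Omega f -> leb.-integrable (obox c.1 c.2) (EFin \o f).
    by move=> lf; apply: (integrableS mO mQ cO); exact: L2_integrable.
  have := sqr_Rintegral_le cO lvu; rewrite (integral_sqr_fin mO lvu).
  have -> : leb (obox c.1 c.2) = (m c)%:E by rewrite /m fineK// ge0_fin_numE.
  rewrite -EFinM lee_fin (RintegralB mQ (restr _ lv) (restr _ lu)).
  move: v1; rewrite (integral_sqr_fin mO lvu) lee_fin => w1.
  have := m0 c; set J := \int[leb]_(x in Omega) _ in w1 *; move=> mc hJ.
  have : m c * J <= m c * (eps / K) by rewrite ler_wpM2l.
  set a := \int[leb]_(t in _) v t in hJ *; set b := \int[leb]_(t in _) u t in hJ *; move: hJ.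
  by have := sqr_ge0 (a - 2 * b); nra.
have B := hs v Cv; rewrite (integral_sqr_fin mG lvG) (integral_grad2 Cv) in B.
have E : (\sum_(i < n) \int[leb]_(x in Omega) (partial i v x ^+ 2)%:E)%E =
    (\sum_(i < n) \int[leb]_(x in Omega) (partial i v x ^+ 2))%:E.
  rewrite -sumEFin; apply: eq_bigr => i _; apply: (integral_sqr_fin mO); apply: continuous_L2.
  exact: Ck1_partial.
rewrite E -EFinM -EFinD lee_fin in B.
have SP : \sum_(i < n) \int[leb]_(x in Omega) (partial i v x ^+ 2) <=
    2 * n%:R * (eps / K) + 2 * dirichlet_form Omega u u.
  apply: le_trans (ler_sum _ (fun i _ => P i)) _.
  rewrite big_split/= sumr_const card_ord -mulr_sumr -[X in X + _]mulr_natr.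
  have -> : dirichlet_form Omega u u = \sum_(i < n) \int[leb]_(x in Omega) (wpartial Omega i u x ^+ 2).
    by rewrite dirichletE//; apply: eq_bigr => i _; apply: eq_Rintegral => x _; rewrite expr2.
  by rewrite le_eqVlt; apply/orP; left; apply/eqP; ring.
have SC : \sum_(c <- s) (\int[leb]_(x in obox c.1 c.2) v x) ^+ 2 <=
    2 * (eps / K) * \sum_(c <- s) m c + 2 * \sum_(c <- s) (\int[leb]_(x in obox c.1 c.2) u x) ^+ 2.
  rewrite !mulr_sumr -big_split/= big_seq [leRHS]big_seq; apply: ler_sum => c cs.
  by apply: le_trans (C c cs) _; rewrite le_eqVlt; apply/orP; left; apply/eqP; ring.
have KE : eps = K * (eps / K) by rewrite mulrCA divff ?mulr1// gt_eqF.
rewrite [X in _ <= _ + X]KE /K.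
move: A B SP SC; set G := \int[surf]_(x in Gamma) (g x ^+ 2); set V := \int[surf]_(x in Gamma) (v x ^+ 2).
set D := dirichlet_form _ _ _; set Sp := \sum_(i < n) _; set Sv := \sum_(c <- s) (_ ^+ 2).
set Su := \sum_(c <- s) (_ ^+ 2); set Sm := \sum_(c <- s) m c; set h := eps / _.
move=> A B SP SC; have B1 : delta / 4 * Sp <= delta / 4 * (2 * n%:R * h + 2 * D) by rewrite ler_wpM2l// ltW.
have B2 : M * Sv <= M * (2 * h * Sm + 2 * Su) by rewrite ler_wpM2l.
have -> : delta * D + 4 * M * Su + (2 + delta * n%:R + 4 * M * Sm) * h =
  2 * h + 2 * (delta / 4 * (2 * n%:R * h + 2 * D) + M * (2 * h * Sm + 2 * Su)) by field.
by lra.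
Qed.

(** A trace of the null function is null: both terms on the right of
    trace_inequality vanish. *)
Lemma is_trace_unique u g h : H1 Omega u -> is_trace Omega u g -> is_trace Omega u h ->
  {ae surf, forall x, Gamma x -> g x = h x}.
Proof.
move=> hu tg th; have t0 := is_trace_comb (-1) hu hu th tg.
set w := (fun x => -1 * u x + u x) in t0.
have w0 : {ae leb, forall x, Omega x -> w x = 0} by apply: aeW => x _; rewrite /w mulN1r addNr.
have hw : H1 Omega w by exact: H1_comb.
have [s [M [M0 sO hs]]] := trace_inequality ltr01.
have := hs w _ hw t0.
have -> : dirichlet_form Omega w w = 0.
  rewrite dirichletE// big1// => i _.
  transitivity (\int[leb]_(x in Omega) (0 : R)); last by rewrite Rintegral_cst// mul0r.
  apply: (ae_eq_Rintegral mO lebesgue_complete).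
    by apply: (ae_imp (wpartial_null oO bO i w0)) => x e Ox; rewrite e// mul0r.
  by apply: measurable_funM; exact: (L2_measurable (wpartial_L2 i hw)).
rewrite mulr0 add0r big1_seq => [|c cs]; last first.
  rewrite (_ : \int[leb]_(x in obox c.1 c.2) w x = 0) ?expr0n//.
  transitivity (\int[leb]_(x in obox c.1 c.2) (0 : R)).
    by apply: eq_Rintegral => x _; rewrite /w mulN1r addNr.
  by rewrite Rintegral_cst ?mul0r//; apply: borel_lebesgue; exact: measurable_obox.
rewrite mulr0 => le0; have lt := is_trace_L2 t0.
have I0 : (\int[surf]_(x in Gamma) ((-1 * h x + g x) ^+ 2)%:E = 0)%E.
  rewrite (integral_sqr_fin mG lt); congr EFin; apply/eqP; rewrite eq_le le0 /=.
  by apply: Rintegral_ge0 => x _; exact: sqr_ge0.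
apply: (ae_imp (integral_sqr_eq0 mG (L2_measurable lt) I0)) => x e Gx.
by have := e Gx; rewrite mulN1r addrC => /subr0_eq.
Qed.

(** The functions whose trace is a genuine limit; the trace of any other function
    has the junk value 0, which would spoil linearity. *)
Definition traceable : set ('rV[R]_n -> R) :=
  [set u | H1 Omega u /\ exists g, is_trace Omega u g].

Lemma traceP u : traceable u -> is_trace Omega u (trace Omega u).
Proof. by move=> [_ h]; exact: xgetPex. Qed.

Lemma traceable_comb (c : R) u v : traceable u -> traceable v ->
  traceable (fun x => c * u x + v x).
Proof.
move=> tu tv; have [hu _] := tu; have [hv _] := tv; split; first exact: H1_comb.
by exists (fun x => c * trace Omega u x + trace Omega v x); apply: is_trace_comb => //; exact: traceP.
Qed.

Lemma trace_comb (c : R) u v : traceable u -> traceable v ->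
  {ae surf, forall x, Gamma x -> trace Omega (fun x => c * u x + v x) x =
    c * trace Omega u x + trace Omega v x}.
Proof.
move=> tu tv; have [hu _] := tu; have [hv _] := tv.
apply: (is_trace_unique (H1_comb oO bO c hu hv)); first exact/traceP/traceable_comb.
by apply: is_trace_comb => //; exact: traceP.
Qed.

Lemma trace_L2 u : traceable u -> L2 surf Gamma (trace Omega u).
Proof. by move=> /traceP; exact: is_trace_L2. Qed.

Lemma no_trace u : H1 Omega u -> ~ traceable u -> trace Omega u = cst 0.
Proof.
move=> hu ntu; apply: xgetPN => g tg; apply: ntu; split => //; by exists g.
Qed.

(** The constant functions are an approximating sequence. *)
Lemma is_trace_constant u (c : R) : H1 Omega u -> dirichlet_form Omega u u = 0 ->
  {ae leb, forall x, Omega x -> u x = c} -> is_trace Omega u (cst c).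
Proof.
move=> hu D0 uc; have cc : continuous (cst c : 'rV[R]_n -> R) by exact: cst_continuous.
split; first by apply/(L2P surf Gamma _); exact: continuous_boundary_L2.
have p0 i : partial i (cst c : 'rV[R]_n -> R) = cst 0.
  by apply/funext => x; rewrite /partial derive_cst.
have C1c : Ck 1 (cst c : 'rV[R]_n -> R).
  by split => // i; split; [move=> x; exact: derivable_cst|rewrite p0; split => //; exact: cst_continuous].
have mc0 : measurable_fun (Omega : set CL) (cst c : 'rV[R]_n -> R) by exact: measurable_cst.
have mz0 : measurable_fun (Omega : set CL) (cst 0 : 'rV[R]_n -> R) by exact: measurable_cst.
exists (fun=> cst c); split.
- by move=> _.
- apply: (L2_cvg_congr mO (fun=> mc0) mc0 (L2_measurable (H1_L2 hu)) _ (L2_cvg_cst leb Omega _)).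
  by apply: (ae_imp uc) => x e Ox; rewrite e.
- move=> i; rewrite p0.
  apply: (L2_cvg_congr mO (fun=> mz0) mz0 (L2_measurable (wpartial_L2 i hu)) _ (L2_cvg_cst leb Omega _)).
  have w0 := dirichlet_eq0 oO i hu D0.
  by apply: (ae_imp w0) => x e Ox; have := e Ox => ->.
- exact: L2_cvg_cst.
Qed.

End trace_operator.

(** * Weighted forms *)

Section weighted_integrals.
Context {R : realType} d (T : measurableType d) (mu : {measure set T -> \bar R}) (D : set T).
Hypotheses (mD : measurable D) (complete : mu.-negligible `<=` measurable).
Implicit Types (f g w : T -> R).

Lemma ae_eq_integrable f g : {ae mu, forall x, D x -> f x = g x} ->
  mu.-integrable D (EFin \o f) -> mu.-integrable D (EFin \o g).
Proof.
move=> fg jf; have fgE : ae_eq mu D (EFin \o f) (EFin \o g).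
  by apply: (ae_imp fg) => x h Dx; rewrite /= h.
have mg := ae_measurable_fun complete fgE (measurable_int _ jf).
apply/integrableP; split => //; have /integrableP[mf] := jf.
rewrite (ae_eq_integral _ _ mD _ _ (ae_eq_abse fgE))//; exact: measurableT_comp.
Qed.

Lemma integrable_scale (c : R) f : mu.-integrable D (EFin \o f) ->
  mu.-integrable D (EFin \o (fun x => c * f x)).
Proof. by move=> j; have := integrableZl mD c j; apply: eq_integrable => // x _; rewrite /= EFinM. Qed.

Lemma integrable_add f g : mu.-integrable D (EFin \o f) -> mu.-integrable D (EFin \o g) ->
  mu.-integrable D (EFin \o (fun x => f x + g x)).
Proof. by move=> jf jg; have := integrableD mD jf jg; apply: eq_integrable => // x _; rewrite /= EFinD. Qed.

Lemma Rintegral_comb (c : R) f g : mu.-integrable D (EFin \o f) -> mu.-integrable D (EFin \o g) ->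
  \int[mu]_(x in D) (c * f x + g x) = c * \int[mu]_(x in D) f x + \int[mu]_(x in D) g x.
Proof.
by move=> jf jg; rewrite (RintegralD mD (integrable_scale c jf) jg) (RintegralZl _ mD jf).
Qed.

Lemma Rintegral_le f g : mu.-integrable D (EFin \o f) -> mu.-integrable D (EFin \o g) ->
  (forall x, D x -> f x <= g x) -> \int[mu]_(x in D) f x <= \int[mu]_(x in D) g x.
Proof.
move=> jf jg fg; have E := Rintegral_comb (-1) jf jg.
have : 0 <= \int[mu]_(x in D) (-1 * f x + g x).
  by apply: Rintegral_ge0 => x Dx; have := fg x Dx; lra.
rewrite E; lra.
Qed.

Lemma Rintegral_ae0 f : {ae mu, forall x, D x -> f x = 0} -> \int[mu]_(x in D) f x = 0.
Proof.
move=> f0; transitivity (\int[mu]_(x in D) (0 : R)); last by rewrite Rintegral_cst// mul0r.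
apply/esym; apply: (ae_eq_Rintegral mD complete) => //.
by apply: (ae_imp f0) => x h Dx; rewrite h.
Qed.

Lemma Rintegral_ae_ge0 f : measurable_fun D f -> {ae mu, forall x, D x -> 0 <= f x} ->
  0 <= \int[mu]_(x in D) f x.
Proof.
move=> mf f0; rewrite (ae_eq_Rintegral mD complete (g := fun x => `|f x|))//.
  by apply: Rintegral_ge0.
by apply: (ae_imp f0) => x h Dx; rewrite ger0_norm// h.
Qed.

Lemma integrable_weight_mul w f g : measurable_fun D w -> measurable_fun D f -> measurable_fun D g ->
  mu.-integrable D (EFin \o (fun x => w x * f x * f x)) ->
  mu.-integrable D (EFin \o (fun x => w x * g x * g x)) ->
  mu.-integrable D (EFin \o (fun x => w x * f x * g x)).
Proof.
move=> mw mf mg jf jg.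
have jfa := integrable_abse jf; have jga := integrable_abse jg.
have jfg := integrableD mD jfa jga.
apply: (le_integrable mD _ _ jfg).
  by apply/measurable_EFinP; apply: measurable_funM => //; exact: measurable_funM.
move=> x _; rewrite /= lee_fin [leRHS]ger0_norm ?addr_ge0// !normrM.
have := sqr_ge0 (`|f x| - `|g x|); have := sqr_ge0 (`|f x| + `|g x|); have := normr_ge0 (w x).
move: `|w x| `|f x| `|g x| => W F G W0 h1 h2.
have : 0 <= W * ((F + G) ^+ 2 + (F - G) ^+ 2) by rewrite mulr_ge0// addr_ge0.
have : 0 <= W * (F - G) ^+ 2 by rewrite mulr_ge0.
have : 0 <= W * (F + G) ^+ 2 by rewrite mulr_ge0.
by nra.
Qed.

Lemma integrable_bounded_mul (M : R) w f g : measurable_fun D w -> (forall x, D x -> `|w x| <= M) ->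
  L2 mu D f -> L2 mu D g -> mu.-integrable D (EFin \o (fun x => w x * f x * g x)).
Proof.
move=> mw wM lf lg; have j := integrable_scale M (L2_mul mD lf lg).
apply: (le_integrable mD _ _ j).
  apply/measurable_EFinP; apply: measurable_funM; last exact: L2_measurable lg.
  by apply: measurable_funM => //; exact: L2_measurable lf.
move=> x Dx; rewrite /= lee_fin -mulrA !normrM.
have M0 : 0 <= M by exact: le_trans (wM x Dx).
by rewrite (ger0_norm M0) ler_wpM2r ?mulr_ge0// wM.
Qed.

Section weighted_form.
Context {V : lmodType R}.
Variables (X : set V) (tau : V -> T -> R).
Hypothesis hX : linear_subspace X.
Hypothesis tau_comb : forall (c : R) u v, X u -> X v ->
  {ae mu, forall x, D x -> tau (c *: u + v) x = c * tau u x + tau v x}.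

Definition weighted w u v : R := \int[mu]_(x in D) (w x * tau u x * tau v x).

Definition weight_integrable w := forall u v, X u -> X v ->
  mu.-integrable D (EFin \o (fun x => w x * tau u x * tau v x)).

(** The operator tau is linear only almost everywhere; completeness of the measure
    transfers measurability and integrals between the two sides. *)
Lemma weighted_form w : weight_integrable w -> form_on X (weighted w).
Proof.
move=> jw; split.
  by move=> u v Xu Xv; apply: eq_Rintegral => x _; rewrite -!mulrA (mulrC (tau u x)).
move=> v Xv c u u' Xu Xu'; have Xc : X (c *: u + u') by case: hX => _; exact.
rewrite /weighted -(Rintegral_comb c (jw u v Xu Xv) (jw u' v Xu' Xv)).
have mi : measurable_fun D (fun x => w x * tau (c *: u + u') x * tau v x).
  by apply/measurable_EFinP; exact: measurable_int (jw _ _ Xc Xv).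
apply: (ae_eq_Rintegral mD complete _ mi).
by apply: (ae_imp (tau_comb c Xu Xu')) => x h Dx; rewrite h//; ring.
Qed.

Lemma weighted_perturb w w' (t : R) u v : weight_integrable w -> weight_integrable w' -> X u -> X v ->
  weighted (fun x => w x + t * w' x) u v = weighted w u v + t * weighted w' u v.
Proof.
move=> jw jw' Xu Xv; rewrite [RHS]addrC /weighted -Rintegral_comb; [|exact: jw'|exact: jw].
by apply: eq_Rintegral => x _; ring.
Qed.

End weighted_form.
End weighted_integrals.

(** * Simple eigenvalues for a generic potential *)

Section generic_potential.
Context {R : realType} {n : nat}.
Local Notation CL := (caratheodory_type (@lebesgue_outer R n)).
Local Notation CH := (caratheodory_type (@hausdorff_outer R n n.-1)).
Local Notation leb := (@lebesgue_rV R n).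
Local Notation surf := (@surface_measure R n).
Local Notation V := ('rV[R]_n -> R^o).
Variables (Omega S : set 'rV[R]_n).
Hypotheses (oO : open Omega) (bO : bounded_set Omega) (C11O : C11_boundary Omega).
Hypothesis cO : connected Omega.
Variables (nu : {outer_measure set 'rV[R]_n -> \bar R})
  (m : {measure set (caratheodory_type nu) -> \bar R}) (E : set 'rV[R]_n).
Hypothesis mE : forall A, m A = nu A.
Hypothesis borelT : forall A : set 'rV[R]_n, measurable (A : set (borel_rV R n)) ->
  measurable (A : set (caratheodory_type nu)).
Hypothesis regular : forall X : set 'rV[R]_n, exists B : set 'rV[R]_n,
  [/\ measurable (B : set (borel_rV R n)), X `<=` B & (nu B <= nu X)%E].
Hypotheses (mEE : measurable (E : set (caratheodory_type nu))) (Eoo : (nu E < +oo)%E).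
Variable tau : ('rV[R]_n -> R) -> 'rV[R]_n -> R.
Hypothesis tau_comb : forall (c : R) u v, traceable Omega u -> traceable Omega v ->
  {ae m, forall x, E x -> tau (fun x => c * u x + v x) x = c * tau u x + tau v x}.
Hypothesis tau_L2 : forall u, H1 Omega u -> L2 m E (tau u).
Hypothesis tau_zero : forall u, traceable Omega u -> {ae m, forall x, E x -> tau u x = 0} ->
  {ae surf, forall x, boundary Omega x -> trace Omega u x = 0}.
Variable a : 'rV[R]_n -> R.
Hypotheses (ma : measurable_fun (E : set (caratheodory_type nu)) a).
Hypothesis apos : {ae m, forall x, E x -> 0 < a x}.
Implicit Types (u v e b phi : 'rV[R]_n -> R).
Local Notation Gamma := (boundary Omega).
Local Notation D := (dirichlet_form Omega).

Let complete : m.-negligible `<=` measurable.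
Proof. exact: (caratheodory_complete mE). Qed.

Let mG : measurable (Gamma : set CH).
Proof. by apply: borel_hausdorff; apply: closed_borel; exact: closed_boundary. Qed.

Let mcont b : continuous b -> measurable_fun (E : set (caratheodory_type nu)) b.
Proof.
move=> cb; apply: measurable_funTS => _ Y mY; rewrite setTI; apply: borelT.
by have := continuous_borel cb measurableT mY; rewrite setTI.
Qed.

Definition steklov u v : R := \int[surf]_(x in Gamma) (\1_S x * trace Omega u x * trace Omega v x).

Definition potential b u v : R := \int[m]_(x in E) (b x * tau u x * tau v x).

(** The form domain.  As S need not be measurable, integrability of the boundary term
    against another function does not follow from the diagonal; for the measurable
    weight a it does. *)
Definition admissible : set V := [set u | [/\ traceable Omega u,
  m.-integrable E (EFin \o (fun x => a x * tau u x * tau u x)) &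
  forall phi, H1 Omega phi ->
    surf.-integrable Gamma (EFin \o (fun x => \1_S x * trace Omega u x * trace Omega phi x))]].

Local Notation X := admissible.

(** This is the eigenspace of the Robin problem when tau is the trace and m the
    surface measure, and of the other problem when tau is the identity and m the
    Lebesgue measure. *)
Definition eigenfunctions b (lambda : R) : set ('rV[R]_n -> R) :=
  [set e | H1 Omega e /\ forall phi, H1 Omega phi ->
    let q x := (a x + b x) * tau e x * tau phi x in
    let r x := \1_S x * trace Omega e x * trace Omega phi x in
    [/\ m.-integrable E (EFin \o q), surf.-integrable Gamma (EFin \o r) &
        D e phi + \int[m]_(x in E) q x = lambda * \int[surf]_(x in Gamma) r x]].

Let X_traceable u : X u -> traceable Omega u. Proof. by case. Qed.
Let traceable_H1 u : traceable Omega u -> H1 Omega u. Proof. by case. Qed.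
Let X_H1 u : X u -> H1 Omega u. Proof. by case=> -[]. Qed.

Lemma flat_null u : {ae leb, forall x, Omega x -> u x = 0} -> D u u = 0.
Proof.
move=> u0; have hu := H1_null oO u0; rewrite dirichletE// big1// => i _.
apply: (Rintegral_ae0 _ lebesgue_complete).
  by apply: borel_lebesgue; exact: open_borel.
by apply: (ae_imp (wpartial_null oO bO i u0)) => x h Ox; rewrite h// mul0r.
Qed.

Lemma flat_constant u : H1 Omega u -> D u u = 0 ->
  exists c : R, {ae leb, forall x, Omega x -> u x = c} /\
    is_trace Omega u (cst c).
Proof.
move=> hu D0; have [c uc] := dirichlet_eq0_constant oO bO cO hu D0.
by exists c; split => //; exact: is_trace_constant.
Qed.

Lemma null_traceable u : {ae leb, forall x, Omega x -> u x = 0} -> is_trace Omega u (cst 0).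
Proof. by move=> u0; apply: is_trace_constant => //; [exact: H1_null|exact: flat_null]. Qed.

Lemma flat_traceable u : H1 Omega u -> D u u = 0 -> traceable Omega u.
Proof. by move=> hu D0; split => //; have [c [_ tc]] := flat_constant hu D0; exists (cst c). Qed.

Lemma steklov_null u v : {ae surf, forall x, Gamma x -> trace Omega u x = 0} -> steklov u v = 0.
Proof.
move=> u0; apply: (Rintegral_ae0 mG surface_complete).
by apply: (ae_imp u0) => x h Gx; rewrite h// mulr0 mul0r.
Qed.

Lemma trace_null u : {ae leb, forall x, Omega x -> u x = 0} ->
  {ae surf, forall x, Gamma x -> trace Omega u x = 0}.
Proof.
move=> u0; have hu := H1_null oO u0; have tu := null_traceable u0.
by apply: (is_trace_unique oO bO C11O hu _ tu); apply: traceP; split => //; exists (cst 0).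
Qed.

(** A constant function w whose image under tau vanishes has trace zero; if the
    constant is not zero, then the boundary is negligible. *)
Lemma flat_determined e w : steklov e e != 0 -> traceable Omega w -> D w w = 0 ->
  {ae m, forall x, E x -> tau w x = 0} -> {ae leb, forall x, Omega x -> w x = 0}.
Proof.
move=> re tw D0 t0; have [hw _] := tw; have [c [wc tc]] := flat_constant hw D0.
have [c0|c0] := eqVneq c 0; first by rewrite c0 in wc.
case/eqP: re; apply: (Rintegral_ae0 mG surface_complete).
have h1 := tau_zero tw t0; have h2 := is_trace_unique oO bO C11O hw (traceP tw) tc.
apply: (ae_imp (ae_and h1 h2)) => x [e1 e2] Gx; have := e2 Gx; rewrite e1// => /esym/eqP.
by rewrite /= (negbTE c0).
Qed.

Lemma flat_proportional e u : H1 Omega e -> D e e = 0 -> H1 Omega u -> D u u = 0 ->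
  ~ eq_on Omega e (cst 0) -> exists c : R, eq_on Omega u (fun x => c * e x).
Proof.
move=> he De hu Du ne; have [c1 [e1 _]] := flat_constant he De.
have [c2 [u2 _]] := flat_constant hu Du.
have c10 : c1 != 0 by apply/eqP => c10; apply: ne; rewrite /eq_on; rewrite c10 in e1.
exists (c2 / c1); apply: (ae_imp (ae_and e1 u2)) => x [h1 h2] Ox.
by rewrite h1// h2// divfK.
Qed.

Lemma zero_function : is_trace Omega (cst 0) (cst 0).
Proof. by apply: null_traceable; apply: aeW. Qed.

Let traceable0 : traceable Omega (cst 0).
Proof. by split; [apply: H1_null => //; apply: aeW|exists (cst 0); exact: zero_function]. Qed.

Let tau0 : {ae m, forall x, E x -> tau (cst 0) x = 0}.
Proof.
have := tau_comb (-1) traceable0 traceable0.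
have -> : (fun x : 'rV[R]_n => -1 * cst 0 x + cst 0 x) = cst 0 :> ('rV[R]_n -> R).
  by apply/funext => x; rewrite /= mulr0 addr0.
by move=> h; apply: (ae_imp h) => x hx Ex; rewrite hx//; ring.
Qed.

Lemma admissible_subspace : linear_subspace X.
Proof.
split.
  split; first exact: traceable0.
  - apply: (ae_eq_integrable mEE complete (f := cst 0)); last first.
      by rewrite (_ : EFin \o _ = cst 0%E)//; exact: integrable0.
    by apply: (ae_imp tau0) => x h Ex; rewrite h// mulr0.
  - move=> phi _; apply: (ae_eq_integrable mG surface_complete (f := cst 0)); last first.
      by rewrite (_ : EFin \o _ = cst 0%E)//; exact: integrable0.
    have t0 : {ae surf, forall x, Gamma x -> trace Omega (cst 0) x = 0}.
      by apply: trace_null; apply: aeW.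
    by apply: (ae_imp t0) => x h Ex; rewrite h// mulr0 mul0r.
move=> c u v [tu au su] [tv av sv]; have tc := traceable_comb oO bO c tu tv.
split; first exact: tc.
- have mu := L2_measurable (tau_L2 (traceable_H1 tu)).
  have mv := L2_measurable (tau_L2 (traceable_H1 tv)).
  have auv := integrable_weight_mul mEE ma mu mv au av.
  have j := integrable_add mEE (integrable_add mEE (integrable_scale mEE (c ^+ 2) au)
    (integrable_scale mEE (2 * c) auv)) av.
  apply: (ae_eq_integrable mEE complete _ j).
  by apply: (ae_imp (tau_comb c tu tv)) => x h Ex; rewrite [in RHS]h//; ring.
- move=> phi hphi; have j := integrable_add mG (integrable_scale mG c (su _ hphi)) (sv _ hphi).
  apply: (ae_eq_integrable mG surface_complete _ j).
  apply: (ae_imp (trace_comb oO bO C11O c tu tv)) => x h Gx.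
  have hx : trace Omega (c *: (u : V) + v) x = c * trace Omega u x + trace Omega v x := h Gx.
  change (c * (\1_S x * trace Omega u x * trace Omega phi x) + \1_S x * trace Omega v x * trace Omega phi x =
    \1_S x * trace Omega (c *: (u : V) + v) x * trace Omega phi x).
  rewrite hx; move: (\1_S x) (trace Omega u x) (trace Omega v x) (trace Omega phi x) => i1 i2 i3 i4.
  by ring.
Qed.

Lemma steklov_form : form_on X (steklov : V -> V -> R).
Proof.
apply: (weighted_form mG surface_complete admissible_subspace).
  by move=> c u v [tu _ _] [tv _ _]; exact: trace_comb.
by move=> u v [_ _ su] [[hv _] _ _]; exact: su.
Qed.

Let tau_combX (c : R) (u v : V) : X u -> X v ->
  {ae m, forall x, E x -> tau (c *: u + v) x = c * tau u x + tau v x}.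
Proof. by move=> [tu _ _] [tv _ _]; exact: tau_comb. Qed.

Let weight_a : weight_integrable m E X tau a.
Proof.
move=> u v [[hu _] au _] [[hv _] av _].
exact: (integrable_weight_mul mEE ma (L2_measurable (tau_L2 hu)) (L2_measurable (tau_L2 hv)) au av).
Qed.

Let weight_b b : continuous b -> (exists M : R, forall x, `|b x| <= M) -> weight_integrable m E X tau b.
Proof.
move=> cb [M bM] u v Xu Xv.
exact: (integrable_bounded_mul mEE (mcont cb) (fun x _ => bM x) (tau_L2 (X_H1 Xu)) (tau_L2 (X_H1 Xv))).
Qed.

Lemma potential_form b : weight_integrable m E X tau b -> form_on X (potential b : V -> V -> R).
Proof. exact: (weighted_form mEE complete admissible_subspace tau_combX). Qed.

Lemma dirichlet_form_on : form_on X (D : V -> V -> R).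
Proof.
split; first by move=> u v _ _; exact: dirichletC.
by move=> w Xw c u v Xu Xv; exact: (dirichlet_comb oO bO c (X_H1 Xu) (X_H1 Xv) (X_H1 Xw)).
Qed.

Lemma steklov_ge0 u : 0 <= steklov u u.
Proof.
apply: Rintegral_ge0 => x _; rewrite -mulrA mulr_ge0//.
by rewrite -expr2 sqr_ge0.
Qed.

Lemma coercive (c0 : R) b f : 0 <= c0 -> L2 m E f -> (forall x, c0 <= b x) ->
  m.-integrable E (EFin \o (fun x => (a x + b x) * f x * f x)) ->
  c0 * \int[m]_(x in E) (f x ^+ 2) <= \int[m]_(x in E) ((a x + b x) * f x * f x).
Proof.
move=> c00 lf cb jq; have [_ j2] := lf.
have jqc := Rintegral_comb mEE (- c0) j2 jq.
suff : 0 <= \int[m]_(x in E) (- c0 * f x ^+ 2 + (a x + b x) * f x * f x) by rewrite jqc; lra.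
apply: (Rintegral_ae_ge0 mEE complete).
  apply/measurable_EFinP.
  exact: measurable_int (integrable_add mEE (integrable_scale mEE (- c0) j2) jq).
apply: (ae_imp apos) => x h Ex; have := h Ex; have := cb x => h1 h2.
have -> : - c0 * f x ^+ 2 + (a x + b x) * f x * f x = (a x + (b x - c0)) * f x ^+ 2 by ring.
by rewrite mulr_ge0 ?sqr_ge0// addr_ge0// ?subr_ge0// ltW.
Qed.

Lemma no_energy (c0 : R) b e : 0 < c0 -> H1 Omega e -> (forall x, c0 <= b x) ->
  m.-integrable E (EFin \o (fun x => (a x + b x) * tau e x * tau e x)) ->
  D e e + \int[m]_(x in E) ((a x + b x) * tau e x * tau e x) = 0 ->
  D e e = 0 /\ {ae m, forall x, E x -> tau e x = 0}.
Proof.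
move=> c00 he cb jq E0; have lt := tau_L2 he.
have D0 := dirichlet_ge0 Omega e.
have P0 : 0 <= \int[m]_(x in E) (tau e x ^+ 2) by apply: Rintegral_ge0 => x _; exact: sqr_ge0.
have C := coercive (ltW c00) lt cb jq.
have P1 : c0 * \int[m]_(x in E) (tau e x ^+ 2) <= 0 by lra.
have P2 : \int[m]_(x in E) (tau e x ^+ 2) = 0.
  by apply/eqP; rewrite eq_le P0 andbT; rewrite pmulr_rle0 in P1.
split; first by rewrite P2 mulr0 in C; lra.
by apply: (integral_sqr_eq0 mEE (L2_measurable lt)); rewrite (integral_sqr_fin mEE lt) P2.
Qed.

Definition test_cutoffs (j : nat) : 'rV[R]_n -> R :=
  if unpickle j is Some (k, (p, q)) then cutoff k (map_mx ratr p : 'rV[R]_n) (map_mx ratr q : 'rV[R]_n)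
  else cst 0.

Lemma continuous_test_cutoffs j : continuous (test_cutoffs j).
Proof.
rewrite /test_cutoffs; case: unpickle => [[k [p q]]|]; first exact: continuous_cutoff.
exact: cst_continuous.
Qed.

Lemma test_cutoffs_le1 j x : `|test_cutoffs j x| <= 1.
Proof.
rewrite /test_cutoffs; case: unpickle => [[k [p q]]|]; first exact: cutoff_le1.
by rewrite /= normr0.
Qed.

Lemma test_cutoffs_separate f : m.-integrable E (EFin \o f) ->
  (forall j, \int[m]_(x in E) (f x * test_cutoffs j x) = 0) -> {ae m, forall x, E x -> f x = 0}.
Proof.
move=> jf f0; have := @ae_zero_of_cutoffs R n nu m mE borelT regular E setT f mEE Eoo openT jf.
move=> H; have {}H : {ae m, forall x, E x -> setT x -> f x = 0}.
  apply: H => k [p q] _; have := f0 (pickle (k, (p, q))).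
  by rewrite /test_cutoffs pickleK.
by apply: (ae_imp H) => x h Ex; exact: h.
Qed.

(** On the common kernel of the integrals over the boxes of trace_inequality, the
    boundary term is bounded by a small multiple of the energy. *)
Lemma steklov_compact (delta : R) : 0 < delta ->
  exists k, exists2 l : 'I_k -> V -> R, forall j, linear_on X (l j) &
    forall u, X u -> (forall j, l j u = 0) -> steklov u u <= delta * (D u u + potential a u u).
Proof.
move=> d0; have [s [M [M0 sO hs]]] := trace_inequality oO bO C11O d0.
(* The default box is never reached, as indices are below the size of s. *)
pose c j := nth (0, 0) s j : 'rV[R]_n * 'rV[R]_n.
have cs (j : 'I_(size s)) : obox (c j).1 (c j).2 `<=` Omega by apply: sO; exact: mem_nth.
have mQ (p : 'rV[R]_n * 'rV[R]_n) : measurable (obox p.1 p.2 : set CL).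
  by apply: borel_lebesgue; exact: measurable_obox.
have mO : measurable (Omega : set CL) by apply: borel_lebesgue; exact: open_borel.
have Ooo : (leb (Omega : set CL) < +oo)%E by exact: lebesgue_bounded_lty.
exists (size s), (fun j u => \int[leb]_(x in obox (c j).1 (c j).2) u x).
  move=> j b u v Xu Xv.
  have restr f : H1 Omega f -> leb.-integrable (obox (c j).1 (c j).2) (EFin \o f).
    move=> hf; apply: (integrableS mO (mQ (c j)) (cs j)).
    exact: (L2_integrable mO Ooo (H1_L2 hf)).
  exact: (Rintegral_comb (mQ (c j)) b (restr _ (X_H1 Xu)) (restr _ (X_H1 Xv))).
move=> u Xu l0; have [tu au su] := Xu; have [hu _] := tu.
have ltr := trace_L2 tu; have [_ jt2] := ltr.
have h1 : steklov u u <= \int[surf]_(x in Gamma) (trace Omega u x ^+ 2).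
  apply: (Rintegral_le mG (su _ hu) jt2) => x _.
  by rewrite -mulrA -expr2 ler_piMl ?sqr_ge0.
apply: le_trans h1 _; apply: le_trans (hs _ _ hu (traceP tu)) _.
rewrite [X in _ + M * X]big1_seq => [|p /andP[_ ps]]; last first.
  have ip : (index p s < size s)%N by rewrite index_mem.
  by have := l0 (Ordinal ip); rewrite /c /= nth_index// => ->; rewrite expr0n.
rewrite mulr0 addr0 ler_pM2l// lerDl; apply: (Rintegral_ae_ge0 mEE complete).
  by apply/measurable_EFinP; exact: measurable_int au.
apply: (ae_imp apos) => x h Ex; rewrite -mulrA mulr_ge0 ?(ltW (h Ex))//.
by rewrite -expr2 sqr_ge0.
Qed.

(** The potential of generic_splitting for kappa = eps / 4, so that b lies within
    eps / 8 of eps / 2.  Test cutoffs annihilate (tau e)^2 - (tau u)^2 and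
    (tau e)(tau u), which therefore vanish. *)
Theorem separating_potential (eps : R) : 0 < eps -> exists b, [/\ continuous b,
  forall x, 3 / 8 * eps <= b x <= 5 / 8 * eps &
  forall (lambda : R) e u, X e -> X u ->
    (forall v, X v -> D e v + potential (fun x => a x + b x) e v = lambda * steklov e v) ->
    (forall v, X v -> D u v + potential (fun x => a x + b x) u v = lambda * steklov u v) ->
    steklov e e = 1 -> steklov u u = 1 -> steklov e u = 0 -> False].
Proof.
move=> e0; have k0 : 0 < eps / 4 by rewrite divr_gt0.
have hA : form_on X ((fun u v => D u v + potential a u v) : V -> V -> R).
  have := form_on_comb 1 dirichlet_form_on (potential_form weight_a); congr (form_on X _).
  by apply/funext => u; apply/funext => v; rewrite mul1r.
have wt b : tame b -> weight_integrable m E X tau b by move=> [cb bM]; exact: weight_b.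
have A0 : nonneg_on X ((fun u v => D u v + potential a u v) : V -> V -> R).
  move=> u Xu; rewrite addr_ge0 ?dirichlet_ge0//; apply: (Rintegral_ae_ge0 mEE complete).
    by apply/measurable_EFinP; exact: measurable_int (weight_a Xu Xu).
  by apply: (ae_imp apos) => x h Ex; rewrite -mulrA mulr_ge0 ?(ltW (h Ex))// -expr2 sqr_ge0.
have tame_cst (c : R) : tame (cst c : 'rV[R]_n -> R).
  by split; [exact: cst_continuous|exists `|c| => x].
have BN b (rho : R) u : tame b -> (forall x, `|b x| <= rho) -> X u ->
    `|potential b u u| <= rho * \int[m]_(x in E) (tau u x ^+ 2).
  move=> tb brho Xu; have [_ jt] := tau_L2 (X_H1 Xu).
  have jb := wt b tb u u Xu Xu; have t0 := fun x => sqr_ge0 (tau u x).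
  have bx x : - rho <= b x /\ b x <= rho by have := brho x; rewrite ler_norml => /andP.
  rewrite -(RintegralZl _ mEE jt) ler_norml; apply/andP; split.
    rewrite -mulN1r -(RintegralZl _ mEE (integrable_scale mEE rho jt)).
    apply: (Rintegral_le mEE (integrable_scale mEE (-1) (integrable_scale mEE rho jt)) jb) => x _.
    by have := t0 x; have [] := bx x; rewrite -mulrA -expr2; nra.
  apply: (Rintegral_le mEE jb (integrable_scale mEE rho jt)) => x _.
  by rewrite -mulrA -expr2 ler_wpM2r//; have [] := bx x.
have Bcst (c : R) u : X u -> potential (cst c) u u = c * \int[m]_(x in E) (tau u x ^+ 2).
  move=> Xu; have [_ jt] := tau_L2 (X_H1 Xu); rewrite -(RintegralZl _ mEE jt).
  by apply: eq_Rintegral => x _; rewrite -mulrA expr2.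
have zero u : X u -> {ae m, forall x, E x -> tau u x = 0} -> steklov u u = 0.
  by move=> Xu t0; apply: steklov_null; exact: tau_zero (X_traceable Xu) t0.
have N0 u : X u -> 0 <= \int[m]_(x in E) (tau u x ^+ 2).
  by move=> _; apply: Rintegral_ge0 => x _; exact: sqr_ge0.
have BD b b' (t : R) u v : tame b -> tame b' -> X u -> X v ->
    potential (perturb b t b') u v = potential b u v + t * potential b' u v.
  by move=> tb tb' Xu Xv; exact: (weighted_perturb mEE t (wt b tb) (wt b' tb') Xu Xv).
have definite u : X u -> D u u + potential a u u = 0 -> \int[m]_(x in E) (tau u x ^+ 2) = 0 ->
    steklov u u = 0.
  move=> Xu _ Nu; apply: zero => //; have lt := tau_L2 (X_H1 Xu).
  by apply: (integral_sqr_eq0 mEE (L2_measurable lt)); rewrite (integral_sqr_fin mEE lt) Nu.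
have [b [cb bc sep]] := @generic_splitting R V 'rV[R]_n X steklov
   (fun u v => D u v + potential a u v) potential (fun u => \int[m]_(x in E) (tau u x ^+ 2)) test_cutoffs
   (eps / 4) 0 admissible_subspace steklov_form hA A0
   (fun b tb => potential_form (wt b tb)) BD N0 BN Bcst definite steklov_compact
   continuous_test_cutoffs test_cutoffs_le1 k0.
exists b; split; first exact: cb.
  move=> x; have := bc x; rewrite /= ler_norml => /andP[h1 h2]; apply/andP; split; lra.
have bM x : `|b x| <= eps.
  by have := bc x; rewrite /= !ler_norml => /andP[h1 h2]; apply/andP; split; lra.
have tb : tame b by split => //; exists eps.
move=> lambda e u Xe Xu ev uv ree ruu reu.
have eqa w v : X w -> X v -> potential (fun x => a x + b x) w v = potential a w v + potential b w v.
  move=> Xw Xv; rewrite -[X in _ = _ + X]mul1r -(weighted_perturb mEE 1 weight_a (wt b tb) Xw Xv).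
  by apply: eq_Rintegral => x _; rewrite mul1r.
have eigen w : X w -> (forall v, X v -> D w v + potential (fun x => a x + b x) w v = lambda * steklov w v) ->
    @eigenvector R V 'rV[R]_n X steklov (fun u v => D u v + potential a u v) potential b lambda w.
  move=> Xw wv; split; [exact: Xw|move=> v Xv].
  by have := wv v Xv; rewrite (eqa w v Xw Xv) addrA => ->.
have {}sep := sep lambda e u (eigen e Xe ev) (eigen u Xu uv) ree ruu reu.
have le := tau_L2 (X_H1 Xe); have lu := tau_L2 (X_H1 Xu).
have jeu := L2_mul mEE le lu; have [me je] := le; have [mu ju] := lu.
have eu0 : {ae m, forall x, E x -> tau e x * tau u x = 0}.
  apply: (test_cutoffs_separate jeu) => j; have [_ <-] := sep j.
  by apply: eq_Rintegral => x _; ring.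
have jd := integrable_add mEE (integrable_scale mEE (-1) ju) je.
have d0 : {ae m, forall x, E x -> -1 * tau u x ^+ 2 + tau e x ^+ 2 = 0}.
  apply: (test_cutoffs_separate jd) => j; have [h _] := sep j.
  have tj : tame (test_cutoffs j).
    by split; [exact: continuous_test_cutoffs|exists 1 => x; exact: test_cutoffs_le1].
  transitivity (-1 * potential (test_cutoffs j) u u + potential (test_cutoffs j) e e); last first.
    by rewrite h; ring.
  rewrite -(Rintegral_comb mEE (-1) (wt _ tj u u Xu Xu) (wt _ tj e e Xe Xe)).
  by apply: eq_Rintegral => x _; ring.
suff e00 : {ae m, forall x, E x -> tau e x = 0}.
  by have := zero e Xe e00; rewrite ree => /eqP; rewrite oner_eq0.
apply: (ae_imp (ae_and eu0 d0)) => x [h1 h2] Ex; have {}h1 := h1 Ex; have {}h2 := h2 Ex.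
apply/eqP; move/eqP: h1; rewrite mulf_eq0 => /orP[//|/eqP u0].
by move: h2; rewrite u0 expr0n mulr0 add0r => /eqP; rewrite sqrf_eq0.
Qed.

Section simplicity.
Variables (b : 'rV[R]_n -> R) (c0 M : R).
Hypotheses (cb : continuous b) (c00 : 0 < c0) (bc : forall x, c0 <= b x) (bM : forall x, b x <= M).

Let weight_bb : weight_integrable m E X tau b.
Proof.
by apply: weight_b => //; exists M => x; rewrite ger0_norm// (le_trans (ltW c00)).
Qed.

Let weight_ab : weight_integrable m E X tau (fun x => a x + b x).
Proof.
move=> u v Xu Xv; have := integrable_add mEE (weight_a Xu Xv) (weight_bb Xu Xv).
by apply: eq_integrable => // x _; rewrite /= !mulrDl.
Qed.

Definition energy u v := D u v + potential (fun x => a x + b x) u v.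

Lemma energy_form : form_on X (energy : V -> V -> R).
Proof.
have := form_on_comb 1 dirichlet_form_on (potential_form weight_ab); congr (form_on X _).
by apply/funext => u; apply/funext => v; rewrite mul1r.
Qed.

(** An eigenfunction without a trace would see only the energy on the left-hand side
    of its equation, since its trace has the junk value 0; then its gradient would
    vanish, and constants have traces. *)
Lemma eigenfunctions_admissible (lambda : R) e : eigenfunctions b lambda e -> X e.
Proof.
move=> [he eq]; have te : traceable Omega e.
  have [//|nt] := pselect (traceable Omega e).
  have [jq _ E0] := eq e he; apply: (flat_traceable he).
  suff [//] : D e e = 0 /\ {ae m, forall x, E x -> tau e x = 0}.
  apply: (no_energy c00 he bc jq); rewrite E0 (no_trace he nt).
  have r0 : \int[surf]_(x in Gamma) (\1_S x * cst 0 x * cst 0 x) = 0 :> R.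
    by apply: (Rintegral_ae0 mG surface_complete); apply: aeW => x _; rewrite /= mulr0.
  by rewrite r0 mulr0.
split; first exact: te.
  have [jq _ _] := eq e he; have le := tau_L2 he.
  have bM' x : E x -> `|b x| <= M by move=> _; rewrite ger0_norm// (le_trans (ltW c00)).
  have jb := integrable_bounded_mul mEE (mcont cb) bM' le le.
  have := integrable_add mEE (integrable_scale mEE (-1) jb) jq.
  by apply: eq_integrable => // x _; congr EFin; rewrite /=; ring.
by move=> phi hphi; have [] := eq phi hphi.
Qed.

Lemma eigenfunctions_energy (lambda : R) e v : eigenfunctions b lambda e -> X v ->
  energy e v = lambda * steklov e v.
Proof. by move=> [_ eq] Xv; have [_ _] := eq v (X_H1 Xv). Qed.

Lemma eigenfunctions_flat (lambda : R) e : X e -> energy e e = lambda * steklov e e ->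
  steklov e e = 0 -> D e e = 0 /\ {ae m, forall x, E x -> tau e x = 0}.
Proof.
move=> Xe ev re; apply: (no_energy c00 (X_H1 Xe) bc (weight_ab Xe Xe)).
by move: ev; rewrite re mulr0.
Qed.

(** Either some eigenfunction e has steklov e e > 0, and subtracting from another one
    its r-projection on e leaves an eigenfunction without energy; or no
    eigenfunction of this eigenvalue has energy, and all of them are constants. *)
Lemma eigenvalue_simple (lambda : R) :
  (forall e u, X e -> X u ->
    (forall v, X v -> energy e v = lambda * steklov e v) ->
    (forall v, X v -> energy u v = lambda * steklov u v) ->
    steklov e e = 1 -> steklov u u = 1 -> steklov e u = 0 -> False) ->
  is_eigenvalue Omega (eigenfunctions b) lambda ->
  is_simple_eigenvalue Omega (eigenfunctions b) lambda.
Proof.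
move=> sep [e0 Ve0 ne0]; have hX := admissible_subspace; have hs := steklov_form.
have hE := energy_form.
have unit_scale (x : R) : 0 < x -> (Num.sqrt x)^-1 * ((Num.sqrt x)^-1 * x) = 1.
  move=> x0; rewrite mulrA -expr2 exprVn sqr_sqrtr; last exact: ltW.
  by rewrite mulVf// gt_eqF.
have scale_comb (k E1 E2 s1 s2 : R) : E1 = lambda * s1 -> E2 = lambda * s2 ->
    k * E1 + E2 = lambda * (k * s1 + s2).
  by move=> -> ->; ring.
have solve_shift (k x y : R) : - k * x + y = 0 -> y = k * x by lra.
(* The generic b separates normalized pairs; without e there is nothing to normalize. *)
have [[e Ve re]|none] := pselect (exists2 e, eigenfunctions b lambda e & steklov e e != 0); last first.
  have flat e : eigenfunctions b lambda e -> D e e = 0.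
    move=> Ve; have Xe := eigenfunctions_admissible Ve.
    apply: (eigenfunctions_flat Xe (eigenfunctions_energy Ve Xe) _).1.
    by apply/eqP; apply/negP => /negP re; apply: none; exists e.
  exists e0; split => // u Vu; have [he0 _] := Ve0; have [hu _] := Vu.
  exact: (flat_proportional he0 (flat _ Ve0) hu (flat _ Vu) ne0).
have Xe := eigenfunctions_admissible Ve.
have normalize w : X w -> 0 < steklov w w ->
    steklov ((Num.sqrt (steklov w w))^-1 *: (w : V)) ((Num.sqrt (steklov w w))^-1 *: (w : V)) = 1.
  move=> Xw w0; have Xsw := subspace_scale (Num.sqrt (steklov w w))^-1 hX Xw.
  rewrite (form_scalel hX hs _ Xw Xsw) (form_scaler hX hs _ Xw Xw).
  by apply: unit_scale.
have scaled (s : R) w v : X w -> (forall v, X v -> energy w v = lambda * steklov w v) -> X v ->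
    energy (s *: (w : V)) v = lambda * steklov (s *: (w : V)) v.
  by move=> Xw wv Xv; rewrite (form_scalel hX hE _ Xw Xv) (form_scalel hX hs _ Xw Xv) wv//; ring.
have re0 : 0 < steklov e e by rewrite lt_neqAle eq_sym re steklov_ge0.
exists e; split => //.
  move=> e00; case/eqP: re; apply: steklov_null; exact: trace_null.
move=> u Vu; have Xu := eigenfunctions_admissible Vu.
pose c := steklov u e / steklov e e; pose w : V := (- c) *: (e : V) + u.
have [_ Xcomb] := hX; have Xw : X w := Xcomb (- c) _ _ Xe Xu.
have wv v : X v -> energy w v = lambda * steklov w v.
  move=> Xv; rewrite (form_combll hE _ Xe Xu Xv) (form_combll hs _ Xe Xu Xv).
  have h := scale_comb (- c) _ _ _ _ (eigenfunctions_energy Ve Xv) (eigenfunctions_energy Vu Xv).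
  exact h.
have we : steklov w e = 0.
  by rewrite (form_combll hs _ Xe Xu Xe) /c mulNr divfK// addNr.
have wE x : w x = - c * e x + u x by [].
clearbody w c.
have ortho (s t : R) : steklov (s *: (e : V)) (t *: w) = 0.
  rewrite (form_scalel hX hs _ Xe (subspace_scale t hX Xw)) (form_scaler hX hs _ Xw Xe).
  by rewrite (form_sym hs Xe Xw) we !mulr0.
have rw : steklov w w = 0.
  apply/eqP; apply/negP => /negP rw.
  have rw0 : 0 < steklov w w by rewrite lt_neqAle eq_sym rw steklov_ge0.
  pose s := (Num.sqrt (steklov e e))^-1; pose t := (Num.sqrt (steklov w w))^-1.
  have Xse := subspace_scale s hX Xe; have Xtw := subspace_scale t hX Xw.
  apply: (sep (s *: (e : V)) (t *: w) Xse Xtw _ _ (normalize _ Xe re0) (normalize _ Xw rw0)).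
  - by move=> v Xv; refine (scaled s e v Xe (fun v' Xv' => eigenfunctions_energy Ve Xv') Xv).
  - by move=> v Xv; refine (scaled t w v Xw wv Xv).
  - exact: ortho.
have [Dw tw] := eigenfunctions_flat Xw (wv _ Xw) rw.
have w0 := flat_determined re (X_traceable Xw) Dw tw.
exists c; apply: (ae_imp w0) => x h Ox; have {}h := h Ox.
by move: h; rewrite wE; exact: solve_shift.
Qed.

End simplicity.

Theorem simple_eigenvalues (eps : R) : 0 < eps -> exists b, [/\ continuous b,
  C0_norm Omega b < eps & forall lambda : R, is_eigenvalue Omega (eigenfunctions b) lambda ->
    is_simple_eigenvalue Omega (eigenfunctions b) lambda].
Proof.
move=> e0; have [b [cb bb sep]] := separating_potential e0.
have c00 : 0 < 3 / 8 * eps by rewrite mulr_gt0// divr_gt0.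
have bc x : 3 / 8 * eps <= b x by case/andP: (bb x).
have bM x : b x <= 5 / 8 * eps by case/andP: (bb x).
exists b; split; first exact: cb; last first.
  move=> lambda; apply: (eigenvalue_simple cb c00 bc bM) => e u Xe Xu ev uv.
  exact: (sep lambda e u Xe Xu ev uv).
apply: (@le_lt_trans _ _ (5 / 8 * eps)); last by lra.
rewrite /C0_norm; have [->|ne] := eqVneq [set `|b x| | x in closure Omega] set0.
  by rewrite sup0; lra.
apply: ge_sup; first exact/set0P.
by move=> _ [x _ <-]; rewrite ger0_norm// (le_trans (ltW c00)).
Qed.

End generic_potential.

Theorem theorem3 (R : realType) (n : nat) (Omega S W : set 'rV[R]_n)
  (Omega_open : open Omega)
  (Omega_connected : connected Omega)
  (Omega_bounded : bounded_set Omega)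
  (Omega_C11 : C11_boundary Omega)
  (boundary_split : boundary Omega = S `|` W)
  (S_connected : connected S)
  (W_connected : connected W)
  (S_interior : relint (boundary Omega) S !=set0)
  (W_interior : relint (boundary Omega) W !=set0)
  (SW_disjoint : relint (boundary Omega) S `&` relint (boundary Omega) W = set0) :
  (forall a : 'rV[R]_n -> R,
     Lp_on surface_measure (boundary Omega) (n%:R - 1) a ->
     {ae surface_measure, forall x, boundary Omega x -> 0 < a x} ->
     forall eps : R, 0 < eps ->
     exists b : 'rV[R]_n -> R,
       [/\ {within closure Omega, continuous b},
           C0_norm Omega b < eps &
           forall lambda : R,
             is_eigenvalue Omega (robin_eigenspace Omega S a b) lambda ->
             is_simple_eigenvalue Omega (robin_eigenspace Omega S a b) lambda])
  /\
  (forall a : 'rV[R]_n -> R,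
     Lp_on lebesgue_rV Omega (n%:R / 2) a ->
     {ae lebesgue_rV, forall x, Omega x -> 0 < a x} ->
     forall eps : R, 0 < eps ->
     exists b : 'rV[R]_n -> R,
       [/\ {within closure Omega, continuous b},
           C0_norm Omega b < eps &
           forall lambda : R,
             is_eigenvalue Omega (steklov_eigenspace Omega S a b) lambda ->
             is_simple_eigenvalue Omega (steklov_eigenspace Omega S a b) lambda]).
Proof.
have cw (b : 'rV[R]_n -> R) : continuous b -> {within closure Omega, continuous b}.
  exact: continuous_subspaceT.
split=> a [ma _] apos eps eps0.
- have mG : measurable (boundary Omega : set (caratheodory_type (@hausdorff_outer R n n.-1))).
    by apply: borel_hausdorff; apply: closed_borel; exact: closed_boundary.
  have tL2 u : H1 Omega u -> L2 surface_measure (boundary Omega) (trace Omega u).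
    move=> hu; have [tu|ntu] := pselect (traceable Omega u); first exact: trace_L2.
    by rewrite (no_trace hu ntu); exact: L2_0.
  have [b [cb b0 simple]] := simple_eigenvalues S Omega_open Omega_bounded Omega_C11
    Omega_connected (fun=> erefl) (@borel_hausdorff R n n.-1) (@hausdorff_regular R n n.-1)
    mG (surface_lty Omega_open Omega_bounded Omega_C11)
    (@trace_comb R n Omega Omega_open Omega_bounded Omega_C11) tL2 (fun _ _ h => h) ma apos eps0.
  by exists b; split; [exact: cw|exact: b0|exact: simple].
- have mO : measurable (Omega : set (caratheodory_type (@lebesgue_outer R n))).
    by apply: borel_lebesgue; exact: open_borel.
  have [b [cb b0 simple]] := @simple_eigenvalues R n Omega S Omega_open Omega_bounded Omega_C11
    Omega_connected _ lebesgue_rV Omega (fun=> erefl) (@borel_lebesgue R n) (@lebesgue_regular R n)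
    mO (lebesgue_bounded_lty Omega_bounded) id (fun c u v _ _ => aeW _ (fun x _ => erefl))
    (fun u hu => H1_L2 hu)
    (fun u _ u0 => trace_null Omega_open Omega_bounded Omega_C11 u0) a ma apos eps eps0.
  by exists b; split; [exact: cw|exact: b0|exact: simple].
Qed.
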